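(* Let $f:(\mathbb{R}^2,0)\to(\mathbb{R}^2,0)$ be a $C^\infty$ map-germ satisfying $\operatorname{rank} df_0=0$, and let $\lambda$ be an identifier of singularities of $f$. Suppose that $\lambda$ has a non-degenerate critical point at $0$, and let $\eta_1,\eta_2$ be (possibly complex) vector fields such that $\eta_1(0)$ and $\eta_2(0)$ are linearly independent solutions of the Hesse quadric of $\lambda$ at $0$. Then $f$ is a sharksfin (respectively, a deltoid) at $0$ if and only if $\det\operatorname{Hess}(\lambda)(0)<0$ (respectively, $\det\operatorname{Hess}(\lambda)(0)>0$) and $$\det(\eta_1^2f,\eta_1^3f)(0)\neq 0\quad\text{and}\quad \det(\eta_2^2f,\eta_2^3f)(0)\neq 0.$$
   Context: All maps and germs are $C^\infty$. Two map-germs $f_1,f_2:(\mathbb{R}^2,0)\to(\mathbb{R}^2,0)$ are $\mathcal{A}$-equivalent if there exist diffeomorphism-germs $\phi$ of the source and $\Phi$ of the target, both $(\mathbb{R}^2,0)\to(\mathbb{R}^2,0)$, with $\Phi\circ f_1=f_2\circ\phi$. A map-germ $f:(\mathbb{R}^2,0)\to(\mathbb{R}^2,0)$ is a sharksfin (respectively, a deltoid) if it is $\mathcal{A}$-equivalent to the germ at the origin of $(u,v)\mapsto(uv,u^2+v^2+u^3)$ (respectively, $(u,v)\mapsto(uv,-u^2+v^2+u^3)$). For a map-germ $f$ with $\operatorname{rank} df_0=0$, an identifier of singularities of $f$ is a function-germ $\lambda$ that is a non-zero functional multiple of the Jacobian determinant of $f$ (i.e. $\lambda=g\cdot\det J_f$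 with $g$ a smooth nowhere vanishing function-germ). Such $\lambda$ has a critical point at $0$. $\operatorname{Hess}(h)(0)$ denotes the Hesse matrix of $h$ at $0$ in coordinates $(u,v)$. For a function-germ $h:(\mathbb{R}^2,0)\to(\mathbb{R},0)$ with a non-degenerate critical point at $0$, a solution of the Hesse quadric of $h$ at $0$ is a non-zero vector $(x,y)$ with $h_{uu}(0)x^2+2h_{uv}(0)xy+h_{vv}(0)y^2=0$. If $\det\operatorname{Hess}(h)(0)<0$ there are two $\mathbb{R}$-linearly independent real solutions; if $\det\operatorname{Hess}(h)(0)>0$ the solutions are taken to be complex vectors, and there are two $\mathbb{C}$-linearly independent ones. In the latter case $\eta_1,\eta_2$ are vector fields with complex-valued smooth coefficients, and the determinants may be complex numbers. For a vector field $\eta=\xi_1\partial_u+\xi_2\partial_v$, $\eta f$ denotes the directional derivative of $f$ by $\eta$ (componentwise), and $\eta^i f=\eta(\eta^{i-1}f)$. *)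

(* Defs.v *)
From Stdlib Require Export Reals List.
From Coquelicot Require Export Coquelicot.
Export ListNotations.
Open Scope R_scope.

(* Germs at the origin are represented by total functions, of which only the
   restriction to some neighbourhood of the origin matters. *)

Definition origin : R * R := (0, 0).

Definition near0 (P : R * R -> Prop) : Prop := locally origin P.

(* One neighbourhood must work for all orders of differentiability. *)
Definition smooth (h : R * R -> R) : Prop :=
  near0 (fun p => forall n, ex_diff_n (fun u v => h (u, v)) n (fst p) (snd p)).

Definition map_germ (f : R * R -> R * R) : Prop :=
  smooth (fun p => fst (f p)) /\ smooth (fun p => snd (f p)) /\
  f origin = origin.

Definition diffeo_germ (phi : R * R -> R * R) : Prop :=
  map_germ phi /\
  exists psi, map_germ psi /\
    near0 (fun p => psi (phi p) = p) /\ near0 (fun p => phi (psi p) = p).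

Definition A_equivalent (f1 f2 : R * R -> R * R) : Prop :=
  exists phi Phi, diffeo_germ phi /\ diffeo_germ Phi /\
    near0 (fun p => Phi (f1 p) = f2 (phi p)).

Definition sharksfin (f : R * R -> R * R) : Prop :=
  A_equivalent f (fun p => let (u, v) := p in (u * v, u ^ 2 + v ^ 2 + u ^ 3)).

Definition deltoid (f : R * R -> R * R) : Prop :=
  A_equivalent f (fun p => let (u, v) := p in (u * v, - (u ^ 2) + v ^ 2 + u ^ 3)).

Definition du (h : R * R -> R) (p : R * R) : R :=
  Derive (fun u => h (u, snd p)) (fst p).

Definition dv (h : R * R -> R) (p : R * R) : R :=
  Derive (fun v => h (fst p, v)) (snd p).

(* The linear map given by the Jacobian matrix of f at p. *)
Definition differential (f : R * R -> R * R) (p w : R * R) : R * R :=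
  let f1 q := fst (f q) in
  let f2 q := snd (f q) in
  (du f1 p * fst w + dv f1 p * snd w, du f2 p * fst w + dv f2 p * snd w).

Definition det_jac (f : R * R -> R * R) (p : R * R) : R :=
  let f1 q := fst (f q) in
  let f2 q := snd (f q) in
  du f1 p * dv f2 p - dv f1 p * du f2 p.

Definition lin_comb {K : Ring} {V : ModuleSpace K} (c : list K) (b : list V) : V :=
  fold_right plus zero (map (fun cw => scal (fst cw) (snd cw)) (combine c b)).

Definition lin_indep {K : Ring} {V : ModuleSpace K} (b : list V) : Prop :=
  forall c : list K, length c = length b -> lin_comb c b = zero ->
    List.Forall (fun a => a = zero) c.

(* r is the dimension of the image of L; b is a basis of that image. *)
Definition has_rank (L : R * R -> R * R) (r : nat) : Prop :=
  exists b : list (R * R), length b = r /\ lin_indep (K := R_Ring) b /\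
    forall w, (exists x, L x = w) <->
      exists c : list R, length c = r /\ lin_comb (K := R_Ring) c b = w.

Definition identifier (f : R * R -> R * R) (lambda : R * R -> R) : Prop :=
  exists g : R * R -> R, smooth g /\ near0 (fun p => g p <> 0) /\
    near0 (fun p => lambda p = g p * det_jac f p).

Definition h_uu (h : R * R -> R) : R := du (du h) origin.
Definition h_uv (h : R * R -> R) : R := dv (du h) origin.
Definition h_vv (h : R * R -> R) : R := dv (dv h) origin.

Definition det_hess (h : R * R -> R) : R := h_uu h * h_vv h - h_uv h ^ 2.

Definition nondegenerate_critical (h : R * R -> R) : Prop :=
  du h origin = 0 /\ dv h origin = 0 /\ det_hess h <> 0.

Definition hesse_solution (h : R * R -> R) (w : C * C) : Prop :=
  let (x, y) := w in
  w <> (RtoC 0, RtoC 0) /\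
  (h_uu h * x * x + 2 * h_uv h * x * y + h_vv h * y * y = 0)%C.

Definition csmooth (h : R * R -> C) : Prop :=
  smooth (fun p => Re (h p)) /\ smooth (fun p => Im (h p)).

(* Partial derivatives with respect to the real variables u, v. *)
Definition cdu (h : R * R -> C) (p : R * R) : C :=
  (du (fun q => Re (h q)) p, du (fun q => Im (h q)) p).

Definition cdv (h : R * R -> C) (p : R * R) : C :=
  (dv (fun q => Re (h q)) p, dv (fun q => Im (h q)) p).

(* A vector field xi1 d/du + xi2 d/dv is given by its coefficients (xi1, xi2). *)
Definition vector_field (eta : R * R -> C * C) : Prop :=
  csmooth (fun p => fst (eta p)) /\ csmooth (fun p => snd (eta p)).

Definition real_vector_field (eta : R * R -> C * C) : Prop :=
  vector_field eta /\
  near0 (fun p => Im (fst (eta p)) = 0 /\ Im (snd (eta p)) = 0).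

Definition dir_deriv (eta : R * R -> C * C) (F : R * R -> C * C) (p : R * R) : C * C :=
  let d (h : R * R -> C) := (fst (eta p) * cdu h p + snd (eta p) * cdv h p)%C in
  (d (fun q => fst (F q)), d (fun q => snd (F q))).

Definition iter_deriv (eta : R * R -> C * C) (i : nat) (f : R * R -> R * R)
    : R * R -> C * C :=
  Nat.iter i (dir_deriv eta) (fun p => (RtoC (fst (f p)), RtoC (snd (f p)))).

Definition cdet (a b : C * C) : C := (fst a * snd b - snd a * fst b)%C.

(* The fields are real where the Hesse quadric has real solutions and complex
   otherwise; for real vectors, independence over C is independence over R. *)
Definition hesse_fields (lambda : R * R -> R) (eta1 eta2 : R * R -> C * C) : Prop :=
  (det_hess lambda < 0 -> real_vector_field eta1 /\ real_vector_field eta2) /\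
  (det_hess lambda > 0 -> vector_field eta1 /\ vector_field eta2) /\
  hesse_solution lambda (eta1 origin) /\
  hesse_solution lambda (eta2 origin) /\
  lin_indep (K := C_Ring) [eta1 origin; eta2 origin].

Definition det23 (f : R * R -> R * R) (eta : R * R -> C * C) : C :=
  cdet (iter_deriv eta 2 f origin) (iter_deriv eta 3 f origin).

(* Main.v *)
(* Let e = 1 for the sharksfin and e = -1 for the deltoid, and write the plane as the algebra
   R[j] with j^2 = e, z = u + j v, zbar = u - j v, N = z zbar = u^2 - e v^2. Both conditions only
   concern the 3-jet (Q, K) of f: the Hesse form of lambda is a multiple of the Jacobian form of
   the quadratic part Q, and det(eta^2 f, eta^3 f)(0) = 12 det(Q(w), K(w)) for a solution w of it.
   Comparing 3-jets in Phi f = g phi shows that they are invariant, which gives necessity.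

   Conversely, linear changes bring f to the form z^2 - zbar^3 + z r + O(4) with r in m^2, the
   conditions being that the coefficient of zbar^3 is invertible. Such an f is equivalent to
   G = z^2 + z^3 - zbar^3. By the Morse lemma the Jacobian determinant of f becomes a multiple of
   N. Modulo zbar one computes with series in z: source changes normalize f + fbar and -fbar to
   z^2 and z^3 up to order 4, and since by Whitney's theorem on even functions every h(0) + z^2 h'
   is a function of G modulo zbar, a target change Psi of G produces f modulo zbar and modulo z.
   Hence Psi^-1 f = G + N k, and since its Jacobian determinant is still a multiple of N, k is
   absorbed by a source change id + N s. *)

Require Import Defs.
From Stdlib Require Import Factorial Lra Lia Psatz FunctionalExtensionality ClassicalEpsilon.

(** * Smooth functions on normed spaces *)

(** Modulo zbar the germ G and its conjugate become z^2 + z^3 and -z^3, so functions of G only see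
    the ring of the cusp (z^2, z^3), in which the monomial z is missing. This gap shapes the
    reduction. One real target change has to match f and its conjugate at the same time; the
    corrections have order z^4 and are divided by the unit 1 + 2 z that such a change produces, and
    the quotients must have no linear term. A source change arranges this beforehand. N = z zbar
    cuts out the two branches of the critical set, real for e = 1 and conjugate for e = -1.
    Congruences modulo zbar for a map and for its conjugate together record it along both branches,
    and coprimality of z and zbar turns them into a congruence modulo N. Whitney's theorem, obtained
    with a parameter from Borel's theorem, takes the place of a preparation theorem, because modulo
    zbar functions of u^2 and v^2 are functions of the real part of z^2. The notion of smoothness is
    chosen to be stable under products, parameters and integrals, so that Hadamard's lemma and the
    implicit function theorem hold with parameters in any normed module. *)

Notation NM := (NormedModule R_AbsRing).

Lemma plus_minus_cancel {G : AbelianGroup} (x y : G) : plus x (minus y x) = y.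
Proof. unfold minus. rewrite (plus_comm y), plus_assoc, plus_opp_r. apply plus_zero_l. Qed.

Lemma minus_plus_cancel {G : AbelianGroup} (x d : G) : minus (plus x d) x = d.
Proof. apply (plus_reg_l x). apply plus_minus_cancel. Qed.

Definition dir_der {V W : NM} (F : V -> W) (x h : V) (l : W) : Prop :=
  is_derive (fun s : R => F (plus x (scal s h))) 0 l.

(* Differentiability in Bastiani's sense: the directional derivative is jointly C^(k-1) on V * V,
   so no space of linear maps is needed. *)
Fixpoint Ck (k : nat) {V W : NM} (U : V -> Prop) (F : V -> W) : Prop :=
  (forall x, U x -> continuous F x) /\
  match k with
  | O => True
  | S k' => exists dF : V * V -> W,
      (forall x h, U x -> dir_der F x h (dF (x, h))) /\
      @Ck k' (prod_NormedModule _ V V) W (fun p => U (fst p)) dF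
  end.

Lemma Ck_cont k {V W : NM} (U : V -> Prop) (F : V -> W) x :
  Ck k U F -> U x -> continuous F x.
Proof. destruct k; simpl; intros [H _]; apply H. Qed.

Lemma Ck_S k : forall {V W : NM} (U : V -> Prop) (F : V -> W),
  Ck (S k) U F -> Ck k U F.
Proof.
  induction k as [|k IH]; intros V W U F [H0 [dF [H1 H2]]]; split; auto.
  exists dF; split; auto.
Qed.

Lemma Ck_sub k : forall {V W : NM} (U U' : V -> Prop) (F : V -> W),
  (forall x, U' x -> U x) -> Ck k U F -> Ck k U' F.
Proof.
  induction k as [|k IH]; intros V W U U' F HU; simpl.
  - intros [H _]; split; auto.
  - intros [H [dF [H1 H2]]]; split; auto. exists dF; split; auto.
    apply IH with (2 := H2); auto.
Qed.

Lemma open_fst {V V' : NM} (U : V -> Prop) :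
  open U -> open (fun p : V * V' => U (fst p)).
Proof. intros HU [x y] Hx. apply (continuous_fst x y). apply HU, Hx. Qed.

Lemma plus_scal_0 {V : NM} (x h : V) : plus x (scal 0 h) = x.
Proof.
  transitivity (plus x zero); [|apply plus_zero_r].
  f_equal. exact (scal_zero_l h).
Qed.

Lemma is_derive_line {V : NM} (x h : V) (s : R) :
  is_derive (fun s : R => plus x (scal s h)) s h.
Proof.
  apply (is_derive_ext (fun s : R => plus x (scal (s:R) h))); [reflexivity|].
  cut (is_derive (fun s : R => plus x (scal s h)) s (plus zero h)).
  { rewrite plus_zero_l; auto. }
  apply (is_derive_plus (fun _ : R => x) (fun s : R => scal s h) s zero h).
  - apply is_derive_const.
  - apply filterdiff_linear, is_linear_scal_l.
Qed.

Lemma continuous_line {V : NM} (x h : V) (s : R) :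
  continuous (fun s : R => plus x (scal s h)) s.
Proof. apply (ex_derive_continuous (fun s : R => plus x (scal s h))). eexists; apply is_derive_line. Qed.

Lemma near_line {V : NM} (U : V -> Prop) (x h : V) :
  open U -> U x -> locally (0:R) (fun s : R => U (plus x (scal s h))).
Proof.
  intros HU Hx. apply (continuous_line x h 0).
  rewrite plus_scal_0. apply HU, Hx.
Qed.

Lemma dir_der_ext_open {V W : NM} (U : V -> Prop) (F G : V -> W) x h l :
  open U -> U x -> (forall y, U y -> F y = G y) -> dir_der F x h l -> dir_der G x h l.
Proof.
  intros HU Hx E H. unfold dir_der.
  apply (is_derive_ext_loc (fun s : R => F (plus x (scal s h)))); auto.
  generalize (near_line U x h HU Hx). apply filter_imp. intros s Hs; apply E, Hs.
Qed.

Lemma Ck_ext k : forall {V W : NM} (U : V -> Prop) (F G : V -> W),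
  open U -> (forall x, U x -> F x = G x) -> Ck k U F -> Ck k U G.
Proof.
  assert (C : forall {V W : NM} (U : V -> Prop) (F G : V -> W), open U ->
     (forall x, U x -> F x = G x) -> (forall x, U x -> continuous F x) ->
     forall x, U x -> continuous G x).
  { intros V W U F G HU E H x Hx. apply (continuous_ext_loc G F x); auto.
    generalize (HU x Hx). apply filter_imp; auto. }
  induction k as [|k IH]; intros V W U F G HU E; simpl.
  - intros [H _]; split; eauto.
  - intros [H [dF [H1 H2]]]; split; eauto. exists dF; split; auto.
    intros x h Hx. eapply dir_der_ext_open; eauto.
Qed.

Lemma Ck_const k : forall {V W : NM} (U : V -> Prop) (c : W), Ck k U (fun _ : V => c).
Proof.
  induction k as [|k IH]; intros V W U c; simpl; split; auto;
    try (intros; apply continuous_const).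
  exists (fun _ => zero). split; [|apply IH].
  intros x h _. apply (is_derive_const (K := R_AbsRing) c).
Qed.

Lemma is_linear_continuous {V W : NM} (L : V -> W) x : is_linear L -> continuous L x.
Proof. intros H; apply filterdiff_continuous. eexists; apply filterdiff_linear, H. Qed.

Lemma is_derive_linear_comp {V W : NM} (L : V -> W) (g : R -> V) (s : R) l :
  is_linear L -> is_derive g s l -> is_derive (fun t => L (g t)) s (L l).
Proof.
  intros HL Hg. unfold is_derive.
  eapply filterdiff_ext_lin.
  - apply (filterdiff_comp' g L s (fun y => scal y l) L); auto.
    apply filterdiff_linear, HL.
  - intros y; simpl. apply (linear_scal L HL).
Qed.

Lemma Ck_linear k : forall {V W : NM} (U : V -> Prop) (L : V -> W),
  is_linear L -> Ck k U L.
Proof.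
  induction k as [|k IH]; intros V W U L HL; simpl; split; auto;
    try (intros; apply is_linear_continuous, HL).
  exists (fun p => L (snd p)). split.
  - intros x h _. simpl. apply (is_derive_linear_comp L); auto. apply is_derive_line.
  - apply IH. apply (is_linear_comp (fun p : V * V => snd p) L); auto. apply is_linear_snd.
Qed.

Lemma Ck_comp_linear k : forall {V V' W : NM} (U : V' -> Prop) (L : V -> V') (F : V' -> W),
  is_linear L -> Ck k U F -> Ck k (fun x => U (L x)) (fun x => F (L x)).
Proof.
  induction k as [|k IH]; intros V V' W U L F HL; simpl.
  - intros [H _]; split; auto. intros x Hx. apply continuous_comp; auto.
    apply is_linear_continuous, HL.
  - intros [H [dF [H1 H2]]]; split.
    { intros x Hx. apply continuous_comp; auto. apply is_linear_continuous, HL. }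
    exists (fun p => dF (L (fst p), L (snd p))). split.
    + intros x h Hx. simpl. unfold dir_der.
      apply (is_derive_ext (fun s : R => F (plus (L x) (scal s (L h))))).
      { intros t. rewrite (linear_plus L HL), (linear_scal L HL). reflexivity. }
      apply H1, Hx.
    + refine (IH (prod_NormedModule _ V V) (prod_NormedModule _ V' V') W _ (fun p : V * V => (L (fst p), L (snd p))) dF _ H2).
      apply (is_linear_prod (fun p : V * V => L (fst p)) (fun p : V * V => L (snd p))).
      * apply (is_linear_comp (fun p : V * V => fst p) L); auto. apply is_linear_fst.
      * apply (is_linear_comp (fun p : V * V => snd p) L); auto. apply is_linear_snd.
Qed.

Lemma is_derive_pair {W Z : NM} (f : R -> W) (g : R -> Z) (s : R) lf lg :
  is_derive f s lf -> is_derive g s lg ->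
  is_derive (V := prod_NormedModule _ W Z) (fun t => (f t, g t)) s (lf, lg).
Proof.
  intros Hf Hg. unfold is_derive.
  refine (filterdiff_ext_lin _ (fun y : R => (scal y lf, scal y lg)) _ _ _);
    [|reflexivity].
  refine (filterdiff_comp_2 (W := prod_NormedModule _ W Z) f g (fun a b => (a, b)) _ _ (fun a b => (a, b)) Hf Hg _).
  apply (filterdiff_ext (fun t => t)); [intros [? ?]; reflexivity|].
  eapply filterdiff_ext_lin; [apply filterdiff_id|]. intros [? ?]; reflexivity.
Qed.

Lemma continuous_pair {V W Z : UniformSpace} (F : V -> W) (G : V -> Z) x :
  continuous F x -> continuous G x -> continuous (fun y => (F y, G y)) x.
Proof.
  intros HF HG. intros P [d HP].
  specialize (HF _ (locally_ball (F x) d)). specialize (HG _ (locally_ball (G x) d)).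
  unfold filtermap in *. generalize (filter_and _ _ HF HG). apply filter_imp.
  intros y [A B]. apply HP. split; auto.
Qed.

Lemma Ck_pair k : forall {V W Z : NM} (U : V -> Prop) (F : V -> W) (G : V -> Z),
  Ck k U F -> Ck k U G ->
  Ck (W := prod_NormedModule _ W Z) k U (fun x => (F x, G x)).
Proof.
  induction k as [|k IH]; intros V W Z U F G; simpl.
  - intros [H _] [H' _]; split; auto. intros; apply continuous_pair; auto.
  - intros [H [dF [H1 H2]]] [H' [dG [H1' H2']]]; split.
    { intros; apply continuous_pair; auto. }
    exists (fun p => (dF p, dG p)). split.
    + intros x h Hx. apply (is_derive_pair (fun s : R => F (plus x (scal s h))) (fun s : R => G (plus x (scal s h)))); [apply H1|apply H1']; auto.
    + apply IH; auto.
Qed.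

Notation RN := R_NormedModule.

(** Reparametrizing the line by the factor s. This homogeneity turns the mean value theorem along an
    increment s k into a statement about the difference quotient k. *)
Lemma dir_der_scal {V : NM} (F : V -> RN) (dF : V * V -> RN) x :
  (forall h, dir_der F x h (dF (x, h))) -> forall (s : R) h, dF (x, scal s h) = s * dF (x, h).
Proof.
  intros H s h.
  assert (H1 : is_derive (fun t : R => F (plus x (scal t (scal s h)))) 0 (s * dF (x, h))).
  { apply (is_derive_ext (fun t : R => F (plus x (scal (t * s) h)))).
    { intros t. f_equal. f_equal. symmetry. exact (scal_assoc (t : R_AbsRing) s h). }
    apply (is_derive_comp (fun t : R => F (plus x (scal t h))) (fun t : R => t * s)).
    - replace (0 * s) with 0 by ring. apply H.
    - auto_derive; auto. ring. }
  apply is_derive_unique in H1. specialize (H (scal s h)). apply is_derive_unique in H.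
  exact (eq_trans (eq_sym H) H1).
Qed.

Lemma norm_scal_le {V : NM} (s : R) (h : V) : norm (scal s h) <= Rabs s * norm h.
Proof. exact (norm_scal (s : R_AbsRing) h). Qed.

(** As F is real valued, the mean value theorem applies along the segment from g 0 to g s: the
    increment of F is [dF] at a point of the segment in the direction g s - g 0. Dividing by s, by
    homogeneity, leaves the difference quotient of g as direction, and joint continuity of [dF]
    gives the limit. *)
Lemma chain_dir {W : NM} (F : W -> RN) (dF : W * W -> RN) (UW : W -> Prop) (g : R -> W) (g' : W) :
  open UW -> UW (g 0) ->
  (forall x h, UW x -> dir_der F x h (dF (x, h))) ->
  continuous dF (g 0, g') -> is_derive g 0 g' ->
  is_derive (fun s => F (g s)) 0 (dF (g 0, g')).
Proof.
  intros HU H0 HF Hc Hg. apply is_derive_Reals. intros eps Heps.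
  destruct (HU _ H0) as [d1 Hd1].
  destruct (Hc _ (locally_ball (dF (g 0, g')) (mkposreal eps Heps))) as [d2 Hd2].
  (* Precision for the difference quotient of g: at most 1, to bound its norm by norm g' + 1, and
     below d2, within which [dF] varies by less than eps. *)
  set (e := mkposreal _ (Rmin_stable_in_posreal (mkposreal 1 Rlt_0_1) (pos_div_2 d2))).
  destruct Hg as [_ Hg]. specialize (Hg 0 (fun P HP => HP) e).
  destruct Hg as [d3 Hd3].
  assert (p1 := cond_pos d1). assert (p2 := cond_pos d2). assert (p3 := cond_pos d3).
  assert (Ng := norm_ge_0 g').
  assert (M0 : 0 < norm g' + 2) by lra.
  (* For s below m in absolute value the increment of g is shorter than d1 and d2, so the whole
     segment stays in [UW] and within d2 of g 0. *)
  set (m := Rmin d1 d2 / (norm g' + 2)).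
  assert (Hm : 0 < m) by (apply Rdiv_lt_0_compat; auto; apply Rmin_pos; auto).
  assert (Hd : 0 < Rmin d3 m) by (apply Rmin_pos; auto).
  exists (mkposreal _ Hd). intros s Hs0 Hs. simpl in Hs.
  assert (Hs3 : Rabs s < d3) by (eapply Rlt_le_trans; [exact Hs|apply Rmin_l]).
  assert (Hsm : Rabs s < m) by (eapply Rlt_le_trans; [exact Hs|apply Rmin_r]).
  assert (As := Rabs_pos_lt s Hs0).
  rewrite Rplus_0_l.
  set (del := minus (g s) (g 0) : W). set (k := scal (/ s) del).
  assert (Ek : del = scal s k).
  { unfold k. transitivity (scal (s * / s) del).
    - rewrite Rinv_r by auto. symmetry. exact (scal_one del).
    - symmetry; exact (scal_assoc (s : R_AbsRing) (/ s) del). }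
  assert (Nk : norm (minus k g') <= e).
  { assert (Hb : ball 0 d3 s).
    { apply (norm_compat1 (V := R_NormedModule)).
      change (Rabs (s + - 0) < d3). rewrite Ropp_0, Rplus_0_r. exact Hs3. }
    specialize (Hd3 s Hb).
    change (norm (minus del (scal (s + - 0) g')) <= e * Rabs (s + - 0)) in Hd3.
    rewrite Ropp_0, Rplus_0_r in Hd3.
    assert (E : minus k g' = scal (/ s) (minus del (scal s g'))).
    { unfold minus. transitivity (plus (scal (/ s) del) (scal (/s) (opp (scal s g')))).
      2:{ symmetry. exact (scal_distr_l (/ s : R_AbsRing) _ _). }
      fold k. f_equal. transitivity (opp (scal (/ s) (scal s g'))).
      2:{ symmetry. exact (scal_opp_r (/ s : R_AbsRing) _). }
      f_equal. transitivity (scal (/ s * s) g').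
      - rewrite Rinv_l by auto. symmetry; exact (scal_one g').
      - symmetry; exact (scal_assoc (/ s : R_AbsRing) s g'). }
    rewrite E. eapply Rle_trans; [apply norm_scal_le|].
    rewrite Rabs_inv.
    apply Rmult_le_reg_l with (Rabs s); auto. field_simplify; [|lra].
    rewrite Rmult_comm. exact Hd3. }
  assert (He1 : e <= 1) by apply Rmin_l.
  assert (He2 : e < d2).
  { eapply Rle_lt_trans; [apply Rmin_r|]. simpl. lra. }
  assert (Nk2 : norm k <= norm g' + 1).
  { replace k with (plus (minus k g') g').
    2:{ unfold minus. rewrite <- plus_assoc, plus_opp_l, plus_zero_r. reflexivity. }
    eapply Rle_trans; [exact (norm_triangle (minus k g') g')|]. lra. }
  assert (Nd : norm del < Rmin d1 d2).
  { rewrite Ek. eapply Rle_lt_trans; [apply norm_scal_le|].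
    apply Rle_lt_trans with (Rabs s * (norm g' + 2)).
    - apply Rmult_le_compat_l; lra.
    - unfold m in Hsm. apply (Rmult_lt_compat_r (norm g' + 2)) in Hsm; auto.
      unfold Rdiv in Hsm. rewrite Rmult_assoc, Rinv_l, Rmult_1_r in Hsm; lra. }
  assert (Nd1 : norm del < d1) by (eapply Rlt_le_trans; [exact Nd|apply Rmin_l]).
  assert (Nd2 : norm del < d2) by (eapply Rlt_le_trans; [exact Nd|apply Rmin_r]).
  assert (NT : forall t, 0 <= t <= 1 -> norm (minus (plus (g 0) (scal t del)) (g 0)) <= norm del).
  { intros t Ht.
    replace (minus (plus (g 0) (scal t del)) (g 0)) with (scal t del).
    2:{ symmetry. exact (minus_plus_cancel (g 0) (scal t del)). }
    eapply Rle_trans; [apply norm_scal_le|]. rewrite Rabs_pos_eq by lra.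
    rewrite <- (Rmult_1_l (norm del)) at 2. apply Rmult_le_compat_r; [apply norm_ge_0|lra]. }
  assert (UT : forall t, 0 <= t <= 1 -> UW (plus (g 0) (scal t del))).
  { intros t Ht. apply Hd1, norm_compat1. eapply Rle_lt_trans; [apply NT; auto|auto]. }
  assert (DT : forall t, 0 <= t <= 1 ->
     is_derive (fun t : R => F (plus (g 0) (scal t del))) t (dF (plus (g 0) (scal t del), del))).
  { intros t Ht.
    apply (is_derive_ext (fun t' : R => F (plus (plus (g 0) (scal t del)) (scal (t' - t) del)))).
    { intros t'. f_equal. rewrite <- plus_assoc. f_equal.
      transitivity (scal (plus t (t' - t)) del).
      - symmetry. exact (scal_distr_r (t : R_AbsRing) (t' - t) del).
      - f_equal. unfold plus; simpl; ring. }
    evar_last.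
    - apply (is_derive_comp (fun s : R => F (plus (plus (g 0) (scal t del)) (scal s del))) (fun t' => t' - t)).
      + replace (t - t) with 0 by ring. apply HF; auto.
      + auto_derive; auto.
    - exact (scal_one _). }
  destruct (MVT_gen (fun t : R => F (plus (g 0) (scal t del))) 0 1 (fun t => dF (plus (g 0) (scal t del), del))) as [c [Hc1 Hc2]].
  - intros t Ht. rewrite Rmin_left, Rmax_right in Ht by lra. apply DT; lra.
  - intros t Ht. rewrite Rmin_left, Rmax_right in Ht by lra.
    apply continuity_pt_filterlim. apply (ex_derive_continuous (fun t : R => F (plus (g 0) (scal t del)))).
    eexists; apply DT; lra.
  - rewrite Rmin_left, Rmax_right in Hc1 by lra. cbv beta in Hc2.
    assert (E0 : plus (g 0) (scal 0 del) = g 0) by apply plus_scal_0.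
    assert (E1 : plus (g 0) (scal 1 del) = g s).
    { transitivity (plus (g 0) del).
      - f_equal. exact (scal_one del).
      - exact (plus_minus_cancel (g 0) (g s)). }
    rewrite E0, E1 in Hc2.
    replace ((F (g s) - F (g 0)) / s) with (dF (plus (g 0) (scal c del), k)).
    + specialize (Hd2 (plus (g 0) (scal c del), k)).
      apply (fun H => Hd2 H). split; simpl.
      * apply norm_compat1. eapply Rle_lt_trans; [apply NT; auto|auto].
      * apply norm_compat1. eapply Rle_lt_trans; [apply Nk|auto].
    + rewrite Hc2. rewrite Ek at 3.
      rewrite (dir_der_scal F dF) by (intros; apply HF; auto).
      assert (Q : forall q : R, q = s * q * (1 - 0) / s) by (intros; field; auto). apply Q.
Qed.

(** The derivative of the composite is [dF] after the map (x, h) -> (G x, dG (x, h)), again a real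
    function after a map of class k between products. Hence the induction ranges over all normed
    modules, and only the outer function has to be real. *)
Lemma Ck_comp k : forall {V W : NM} (U : V -> Prop) (UW : W -> Prop) (F : W -> RN) (G : V -> W),
  open U -> open UW -> (forall x, U x -> UW (G x)) ->
  Ck k UW F -> Ck k U G -> Ck k U (fun x => F (G x)).
Proof.
  assert (C : forall {V W : NM} (U : V -> Prop) (UW : W -> Prop) (F : W -> RN) (G : V -> W),
    (forall x, U x -> UW (G x)) -> (forall x, U x -> continuous G x) ->
    (forall x, UW x -> continuous F x) -> forall x, U x -> continuous (fun x => F (G x)) x).
  { intros V W U UW F G H HG HF x Hx. apply continuous_comp; auto. }
  induction k as [|k IH]; intros V W U UW F G HU HUW H HF HG.
  - split; auto. apply (C V W U UW); auto; [apply HG|apply HF].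
  - split. { apply (C V W U UW); auto; [apply HG|apply HF]. }
    assert (HG0 := Ck_S _ _ _ HG).
    destruct HF as [_ [dF [HF1 HF2]]]. destruct HG as [HGc [dG [HG1 HG2]]].
    exists (fun p => dF (G (fst p), dG p)). split.
    + intros x h Hx. simpl. unfold dir_der.
      assert (E : G (plus x (scal 0 h)) = G x) by (rewrite plus_scal_0; auto).
      assert (A := chain_dir F dF UW (fun s : R => G (plus x (scal s h))) (dG (x, h)) HUW).
      cbv beta in A. rewrite E in A. apply A; auto.
      * apply (Ck_cont _ _ _ (G x, dG (x, h)) HF2). simpl; auto.
      * apply HG1; auto.
    + apply (IH (prod_NormedModule _ V V) (prod_NormedModule _ W W) (fun p => U (fst p)) (fun p => UW (fst p)) dF (fun p => (G (fst p), dG p))); auto.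
      * apply open_fst; auto.
      * apply open_fst; auto.
      * intros [x h] Hx; simpl in *; auto.
      * apply Ck_pair; auto.
        apply (Ck_comp_linear k (V := prod_NormedModule _ V V) U (fun p => fst p) G); auto.
        apply is_linear_fst.
Qed.

Notation RR := (prod_NormedModule R_AbsRing RN RN).

Lemma is_linear_add {V : NM} (L M : V -> RN) :
  is_linear L -> is_linear M -> is_linear (fun x => L x + M x : RN).
Proof.
  intros HL HM.
  apply (is_linear_comp (fun x => (L x, M x)) (fun p : RN * RN => plus (fst p) (snd p))).
  - apply is_linear_prod; auto.
  - apply (is_linear_plus (V := RN)).
Qed.

Lemma Ck_add k {V : NM} (U : V -> Prop) (F G : V -> R) :
  open U -> Ck (W := RN) k U F -> Ck (W := RN) k U G ->
  Ck (W := RN) k U (fun x => F x + G x).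
Proof.
  intros HU HF HG.
  apply (Ck_comp k U (fun _ : RR => True) (fun p : RR => fst p + snd p) (fun x => (F x, G x))); auto.
  - apply open_true.
  - apply Ck_linear. apply (is_linear_add (V := RR)); [apply is_linear_fst|apply is_linear_snd].
  - apply Ck_pair; auto.
Qed.

(** The derivative of a product is a sum of two products after linear substitutions, so the
    induction closes on itself. *)
Lemma Ck_mult_pair k : Ck (V := RR) (W := RN) k (fun _ => True) (fun p => fst p * snd p).
Proof.
  assert (C : forall x : RR, True -> continuous (fun p : RR => fst p * snd p : RN) x).
  { intros [a b] _. apply (continuous_mult (K := R_AbsRing) (U := RR) fst snd);
      [apply continuous_fst|apply continuous_snd]. }
  induction k as [|k IH]; split; auto.
  exists (fun q => fst (fst q) * snd (snd q) + fst (snd q) * snd (fst q)). split.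
  - intros [a b] [h l] _. unfold dir_der. simpl.
    assert (E1 : forall a b h l : R, is_derive (fun s : R => (a + s * h) * (b + s * l)) 0 (a * l + h * b))
      by (intros; auto_derive; auto; ring).
    apply E1.
  - apply (Ck_add k (V := prod_NormedModule _ RR RR)); [apply open_true| |].
    + apply (Ck_comp_linear k (V := prod_NormedModule _ RR RR) (V' := RR) (fun _ => True)
        (fun q => (fst (fst q), snd (snd q))) (fun p => fst p * snd p)); auto.
      apply (is_linear_prod (T := prod_NormedModule _ RR RR) (U := RN) (V := RN)).
      * apply (is_linear_comp (U := prod_NormedModule _ RR RR) (V := RR) (W := RN) fst fst); apply is_linear_fst.
      * apply (is_linear_comp (U := prod_NormedModule _ RR RR) (V := RR) (W := RN) snd snd); apply is_linear_snd.
    + apply (Ck_comp_linear k (V := prod_NormedModule _ RR RR) (V' := RR) (fun _ => True)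
        (fun q => (fst (snd q), snd (fst q))) (fun p => fst p * snd p)); auto.
      apply (is_linear_prod (T := prod_NormedModule _ RR RR) (U := RN) (V := RN)).
      * apply (is_linear_comp (U := prod_NormedModule _ RR RR) (V := RR) (W := RN) snd fst); [apply is_linear_snd|apply is_linear_fst].
      * apply (is_linear_comp (U := prod_NormedModule _ RR RR) (V := RR) (W := RN) fst snd); [apply is_linear_fst|apply is_linear_snd].
Qed.

Lemma Ck_mul k {V : NM} (U : V -> Prop) (F G : V -> R) :
  open U -> Ck (W := RN) k U F -> Ck (W := RN) k U G ->
  Ck (W := RN) k U (fun x => F x * G x).
Proof.
  intros HU HF HG.
  apply (Ck_comp k U (fun _ : RR => True) (fun p : RR => fst p * snd p) (fun x => (F x, G x))); auto.
  - apply open_true.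
  - apply Ck_mult_pair.
  - apply Ck_pair; auto.
Qed.

Lemma Ck_real_step k (U : R -> Prop) (f f' : R -> R) : open U ->
  (forall x, U x -> is_derive f x (f' x)) -> Ck (V := RN) (W := RN) k U f' ->
  Ck (V := RN) (W := RN) (S k) U f.
Proof.
  intros HU Hf Hf'. split.
  - intros x Hx. apply (ex_derive_continuous f). eexists; apply Hf, Hx.
  - exists (fun p => snd p * f' (fst p)). split.
    + intros x h Hx. simpl. unfold dir_der.
      assert (E0 : forall a b : R, a + 0 * b = a) by (intros; ring).
      assert (E1 : forall a b : R, is_derive (fun s : R => a + s * b) 0 b) by (intros; auto_derive; auto; ring).
      apply (is_derive_comp f (fun s : R => x + s * h)).
      * rewrite E0. apply Hf, Hx.
      * apply E1.
    + apply (Ck_mul k (V := RR)); [apply (open_fst (V := RN)), HU| |].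
      * apply Ck_linear, is_linear_snd.
      * apply (Ck_comp_linear k (V := RR) (V' := RN) U fst f'); auto. apply is_linear_fst.
Qed.

Lemma open_neq0 : open (fun x : R => x <> 0).
Proof. intros x Hx. apply (locally_open (fun x : R => x <> 0)); auto. apply open_neq. Qed.

Lemma Ck_inv k : Ck (V := RN) (W := RN) k (fun x => x <> 0) Rinv.
Proof.
  induction k as [|k IH].
  - split; auto. intros x Hx. apply (ex_derive_continuous Rinv). auto_derive; auto.
  - apply (Ck_real_step k _ _ (fun x => (-1) * (/ x * / x))).
    + exact open_neq0.
    + intros x Hx. auto_derive; auto. field; auto.
    + apply (Ck_mul k (V := RN)); [exact open_neq0|apply (Ck_const k (W := RN))|].
      apply (Ck_mul k (V := RN)); auto. exact open_neq0.
Qed.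

Lemma Ck_sqrt k : Ck (V := RN) (W := RN) k (fun x => 0 < x) sqrt.
Proof.
  assert (O : open (fun x : R => 0 < x)) by apply open_gt.
  induction k as [|k IH].
  - split; auto. intros x Hx. apply (ex_derive_continuous sqrt). auto_derive; auto.
  - apply (Ck_real_step k _ _ (fun x => /2 * / sqrt x)); auto.
    + intros x Hx. auto_derive; auto. field. intros E. apply sqrt_lt_R0 in Hx. lra.
    + apply (Ck_mul k (V := RN)); auto; [apply (Ck_const k (W := RN))|].
      apply (Ck_comp k (V := RN) (W := RN) _ (fun x => x <> 0) Rinv sqrt); auto.
      * exact open_neq0.
      * intros x Hx. apply sqrt_lt_R0 in Hx. lra.
      * apply Ck_inv.
Qed.

(* As in [smooth], one neighbourhood serves all orders. *)
Definition sm {V W : NM} (x0 : V) (F : V -> W) : Prop :=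
  exists U : V -> Prop, open U /\ U x0 /\ forall k, Ck k U F.

Lemma sm_cont {V W : NM} (x0 : V) (F : V -> W) : sm x0 F -> continuous F x0.
Proof. intros [U [HU [H0 H]]]. apply (Ck_cont 0 U F x0 (H 0%nat) H0). Qed.

Lemma sm_const {V W : NM} (x0 : V) (c : W) : sm x0 (fun _ => c).
Proof. exists (fun _ => True). repeat split; try apply open_true; auto. intros; apply Ck_const. Qed.

Lemma sm_linear {V W : NM} (x0 : V) (L : V -> W) : is_linear L -> sm x0 L.
Proof. exists (fun _ => True). repeat split; try apply open_true; auto. intros; apply Ck_linear, H. Qed.

Lemma sm_pair {V W Z : NM} (x0 : V) (F : V -> W) (G : V -> Z) :
  sm x0 F -> sm x0 G -> sm (W := prod_NormedModule _ W Z) x0 (fun x => (F x, G x)).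
Proof.
  intros [U [HU [H0 H]]] [U' [HU' [H0' H']]].
  exists (fun x => U x /\ U' x). repeat split; auto.
  - apply open_and; auto.
  - intros k. apply Ck_pair; [apply (Ck_sub k U)|apply (Ck_sub k U')]; tauto || auto.
Qed.

Lemma sm_comp {V W : NM} (x0 : V) (F : W -> RN) (G : V -> W) :
  sm (G x0) F -> sm x0 G -> sm x0 (fun x => F (G x)).
Proof.
  intros [UW [HU [H0 H]]] [U [HU' [H0' H']]].
  assert (O : open (fun x => U x /\ UW (G x))).
  { intros x [Hx Hx'].
    apply (filter_and _ _ (HU' x Hx)). apply (Ck_cont 0 U G x (H' 0%nat) Hx). apply HU, Hx'. }
  exists (fun x => U x /\ UW (G x)). repeat split; auto.
  intros k. apply (Ck_comp k _ UW F G); auto; [tauto|].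
  apply (Ck_sub k U); tauto || auto.
Qed.

Lemma sm_ext_loc {V W : NM} (x0 : V) (F G : V -> W) :
  locally x0 (fun x => F x = G x) -> sm x0 F -> sm x0 G.
Proof.
  intros HE [U [HU [H0 H]]].
  assert (O : open (fun x => U x /\ locally x (fun x => F x = G x))).
  { intros x [Hx Hx']. apply (filter_and _ _ (HU x Hx)). apply locally_locally, Hx'. }
  exists (fun x => U x /\ locally x (fun x => F x = G x)). repeat split; auto.
  intros k. apply (Ck_ext k _ F); auto.
  - intros x [_ Hx]. apply (locally_singleton _ _ Hx).
  - apply (Ck_sub k U); tauto || auto.
Qed.

Lemma sm_ext {V W : NM} (x0 : V) (F G : V -> W) :
  (forall x, F x = G x) -> sm x0 F -> sm x0 G.
Proof. intros E. apply sm_ext_loc. apply filter_forall. exact E. Qed.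

Lemma sm_2 {V : NM} (x0 : V) (F G : V -> R) (op : R -> R -> R) :
  (forall k, Ck (V := RR) (W := RN) k (fun _ => True) (fun p => op (fst p) (snd p))) ->
  sm (W := RN) x0 F -> sm (W := RN) x0 G -> sm (W := RN) x0 (fun x => op (F x) (G x)).
Proof.
  intros Hop HF HG.
  apply (sm_comp x0 (fun p : RR => op (fst p) (snd p)) (fun x => (F x, G x))).
  - exists (fun _ => True). repeat split; auto. apply open_true.
  - apply sm_pair; auto.
Qed.

Lemma sm_plus {V : NM} (x0 : V) (F G : V -> R) :
  sm (W := RN) x0 F -> sm (W := RN) x0 G -> sm (W := RN) x0 (fun x => F x + G x).
Proof.
  apply sm_2. intros k. apply Ck_linear. apply (is_linear_add (V := RR)); [apply is_linear_fst|apply is_linear_snd].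
Qed.

Lemma sm_mult {V : NM} (x0 : V) (F G : V -> R) :
  sm (W := RN) x0 F -> sm (W := RN) x0 G -> sm (W := RN) x0 (fun x => F x * G x).
Proof. apply sm_2. apply Ck_mult_pair. Qed.

Lemma sm_opp {V : NM} (x0 : V) (F : V -> R) :
  sm (W := RN) x0 F -> sm (W := RN) x0 (fun x => - F x).
Proof.
  intros H. apply (sm_ext x0 (fun x => (-1) * F x)).
  { intros x. assert (E : forall r : R, -1 * r = - r) by (intros; ring). exact (E (F x)). }
  apply sm_mult; auto. apply (sm_const (W := RN)).
Qed.

Lemma sm_minus {V : NM} (x0 : V) (F G : V -> R) :
  sm (W := RN) x0 F -> sm (W := RN) x0 G -> sm (W := RN) x0 (fun x => F x - G x).
Proof. intros; apply sm_plus; auto. apply sm_opp; auto. Qed.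

Lemma sm_pow {V : NM} (x0 : V) (F : V -> R) n :
  sm (W := RN) x0 F -> sm (W := RN) x0 (fun x => F x ^ n).
Proof.
  intros H. induction n; simpl; [apply (sm_const (W := RN))|apply sm_mult; auto].
Qed.

Lemma sm_inv {V : NM} (x0 : V) (F : V -> R) :
  F x0 <> 0 -> sm (W := RN) x0 F -> sm (W := RN) x0 (fun x => / F x).
Proof.
  intros H HF. apply (sm_comp (W := RN) x0 Rinv F); auto.
  exists (fun x => x <> 0). repeat split; auto. exact open_neq0. apply Ck_inv.
Qed.

Lemma sm_div {V : NM} (x0 : V) (F G : V -> R) : G x0 <> 0 ->
  sm (W := RN) x0 F -> sm (W := RN) x0 G -> sm (W := RN) x0 (fun x => F x / G x).
Proof. intros; apply sm_mult; auto. apply sm_inv; auto. Qed.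

Lemma sm_sqrt {V : NM} (x0 : V) (F : V -> R) :
  0 < F x0 -> sm (W := RN) x0 F -> sm (W := RN) x0 (fun x => sqrt (F x)).
Proof.
  intros H HF. apply (sm_comp (W := RN) x0 sqrt F); auto.
  exists (fun x => 0 < x). repeat split; auto. apply open_gt. apply Ck_sqrt.
Qed.

Lemma sm_fst {V W : NM} (x0 : V * W) : sm (V := prod_NormedModule _ V W) x0 fst.
Proof. apply sm_linear, is_linear_fst. Qed.

Lemma sm_snd {V W : NM} (x0 : V * W) : sm (V := prod_NormedModule _ V W) x0 snd.
Proof. apply sm_linear, is_linear_snd. Qed.

(** [Ck] supplies a derivative for each order separately. Uniqueness of derivatives identifies them
    all with the first one. *)
Lemma Ck_all_derivative {V : NM} (U : V -> Prop) (F : V -> RN) : open U ->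
  (forall k, Ck k U F) -> exists dF : V * V -> RN,
    (forall x h, U x -> dir_der F x h (dF (x, h))) /\
    (forall k, Ck (V := prod_NormedModule _ V V) k (fun p => U (fst p)) dF).
Proof.
  intros HU H. destruct (H 1%nat) as [_ [dF [H1 _]]].
  exists dF; split; auto.
  intros k. destruct (H (S k)) as [_ [dG [G1 G2]]].
  apply (Ck_ext k _ dG); auto.
  - apply open_fst, HU.
  - intros [x h] Hx. simpl in Hx. specialize (H1 x h Hx). specialize (G1 x h Hx).
    apply is_derive_unique in H1. apply is_derive_unique in G1. exact (eq_trans (eq_sym G1) H1).
Qed.

(** * Partial derivatives *)

Notation sm2 := (sm (V := RR) (W := RN)).

Lemma is_derive_u (h : R * R -> R) (p : R * R) l :
  dir_der (V := RR) (W := RN) h p (1, 0) l <-> is_derive (fun u : R => h (u, snd p)) (fst p) l.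
Proof.
  destruct p as [x y]. unfold dir_der. simpl. split; intros H.
  - assert (E : forall z : R, h (plus (x, y) (scal (z - x) (1, 0) : RR)) = h (z, y)).
    { intros z. f_equal. unfold plus, scal; simpl. unfold prod_plus, prod_scal; simpl.
      unfold plus, scal; simpl. unfold mult; simpl. f_equal; ring. }
    apply (is_derive_ext (fun z : R => h (plus (x, y) (scal (z - x) (1, 0) : RR)))); [exact E|].
    evar_last.
    + apply (is_derive_comp (fun s : R => h (plus (x, y) (scal s (1, 0) : RR)) : RN) (fun z : R => z - x)).
      * replace (x - x) with 0 by ring. exact H.
      * auto_derive; auto.
    + exact (scal_one _).
  - assert (E : forall s : R, h (x + s, y) = h (plus (x, y) (scal s (1, 0) : RR))).
    { intros z. f_equal. unfold plus, scal; simpl. unfold prod_plus, prod_scal; simpl.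
      unfold plus, scal; simpl. unfold mult; simpl. f_equal; ring. }
    apply (is_derive_ext (fun s : R => h (x + s, y))); [exact E|].
    evar_last.
    + apply (is_derive_comp (fun z : R => h (z, y) : RN) (fun s : R => x + s)).
      * replace (x + 0) with x by ring. exact H.
      * auto_derive; auto.
    + exact (scal_one _).
Qed.

Lemma is_derive_v (h : R * R -> R) (p : R * R) l :
  dir_der (V := RR) (W := RN) h p (0, 1) l <-> is_derive (fun v : R => h (fst p, v)) (snd p) l.
Proof.
  destruct p as [x y]. unfold dir_der. simpl. split; intros H.
  - assert (E : forall z : R, h (plus (x, y) (scal (z - y) (0, 1) : RR)) = h (x, z)).
    { intros z. f_equal. unfold plus, scal; simpl. unfold prod_plus, prod_scal; simpl.
      unfold plus, scal; simpl. unfold mult; simpl. f_equal; ring. }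
    apply (is_derive_ext (fun z : R => h (plus (x, y) (scal (z - y) (0, 1) : RR)))); [exact E|].
    evar_last.
    + apply (is_derive_comp (fun s : R => h (plus (x, y) (scal s (0, 1) : RR)) : RN) (fun z : R => z - y)).
      * replace (y - y) with 0 by ring. exact H.
      * auto_derive; auto.
    + exact (scal_one _).
  - assert (E : forall s : R, h (x, y + s) = h (plus (x, y) (scal s (0, 1) : RR))).
    { intros z. f_equal. unfold plus, scal; simpl. unfold prod_plus, prod_scal; simpl.
      unfold plus, scal; simpl. unfold mult; simpl. f_equal; ring. }
    apply (is_derive_ext (fun s : R => h (x, y + s))); [exact E|].
    evar_last.
    + apply (is_derive_comp (fun z : R => h (x, z) : RN) (fun s : R => y + s)).
      * replace (y + 0) with y by ring. exact H.
      * auto_derive; auto.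
    + exact (scal_one _).
Qed.

Lemma dir_der_partials (h hu hv : R * R -> R) (p : R * R) (a b : R) :
  locally p (fun q => is_derive (fun u : R => h (u, snd q)) (fst q) (hu q)) ->
  is_derive (fun v : R => h (fst p, v)) (snd p) (hv p) ->
  continuous (U := RN) hu p ->
  dir_der (V := RR) (W := RN) h p (a, b) (a * hu p + b * hv p).
Proof.
  intros H1 H2 H3. destruct p as [x y]. simpl in H2.
  assert (D : filterdiff (fun u : R * R => h (fst u, snd u)) (locally (x, y))
    (fun u : R * R => plus (scal (fst u) (hu (x, y))) (scal (snd u) (hv (x, y))))).
  { apply (is_derive_filterdiff (fun u v => h (u, v)) x y (fun u v => hu (u, v)) (hv (x, y))); auto.
    - generalize H1. apply filter_imp. intros [u v]; auto.
    - apply (continuous_ext (fun u : R * R => hu u)); auto. intros [u v]; auto. }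
  unfold dir_der, is_derive.
  apply (filterdiff_ext (fun s : R => h (fst (plus (x, y) (scal s (a, b) : RR)), snd (plus (x, y) (scal s (a, b) : RR))))).
  { intros s. f_equal. }
  eapply filterdiff_ext_lin.
  - apply (filterdiff_comp' (K := R_AbsRing) (V := RR) (W := RN) (fun s : R => plus (x, y) (scal s (a, b) : RR))
      (fun u : R * R => h (fst u, snd u)) 0 (fun s => scal s ((a, b) : RR))
      (fun u : R * R => plus (scal (fst u) (hu (x, y))) (scal (snd u) (hv (x, y))))).
    + apply (is_derive_line (V := RR) (x, y) (a, b) 0).
    + rewrite (plus_scal_0 (V := RR)). exact D.
  - intros s. unfold scal, plus; simpl. unfold mult; simpl.
    assert (E : forall s a b c d : R, s * a * c + s * b * d = s * (a * c + b * d)) by (intros; ring).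
    apply E.
Qed.

Lemma ex_diff_n_Ck k : forall (U : RR -> Prop) (h : R * R -> R), open U ->
  (forall p, U p -> forall n, ex_diff_n (fun u v => h (u, v)) n (fst p) (snd p)) ->
  Ck (V := RR) (W := RN) k U h.
Proof.
  assert (C : forall (h : R * R -> R) p n, ex_diff_n (fun u v => h (u, v)) n (fst p) (snd p) ->
    continuous (T := RR) (U := RN) h p).
  { intros h [x y] n Hn.
    assert (Hc : continuity_2d_pt (fun u v => h (u, v)) x y) by (destruct n; apply Hn).
    apply continuity_2d_pt_filterlim in Hc.
    apply (continuous_ext (T := RR) (U := RN) (fun u : R * R => h (fst u, snd u))); [intros [? ?]; reflexivity|].
    exact Hc. }
  induction k as [|k IH]; intros U h HU H.
  - split; auto. intros p Hp. apply (C h p 0%nat). auto.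
  - split. { intros p Hp. apply (C h p 0%nat). auto. }
    assert (Cu : Ck (V := RR) (W := RN) k U (du h)).
    { apply IH; auto. intros p Hp n. specialize (H p Hp (S n)). apply H. }
    assert (Cv : Ck (V := RR) (W := RN) k U (dv h)).
    { apply IH; auto. intros p Hp n. specialize (H p Hp (S n)). apply H. }
    exists (fun q => fst (snd q) * du h (fst q) + snd (snd q) * dv h (fst q)). split.
    + intros p [a b] Hp. apply dir_der_partials.
      * generalize (HU p Hp). apply filter_imp. intros q Hq.
        apply Derive_correct. apply (H q Hq 1%nat).
      * apply Derive_correct. apply (H p Hp 1%nat).
      * apply (Ck_cont k U); auto.
    + assert (O := open_fst (V := RR) (V' := RR) U HU).
      apply (Ck_add k (V := prod_NormedModule _ RR RR)); auto; apply (Ck_mul k (V := prod_NormedModule _ RR RR)); auto.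
      * apply Ck_linear.
        apply (is_linear_comp (U := prod_NormedModule _ RR RR) (V := RR) (W := RN) snd fst); [apply is_linear_snd|apply is_linear_fst].
      * apply (Ck_comp_linear k (V := prod_NormedModule _ RR RR) (V' := RR) U fst (du h)); auto. apply is_linear_fst.
      * apply Ck_linear.
        apply (is_linear_comp (U := prod_NormedModule _ RR RR) (V := RR) (W := RN) snd snd); apply is_linear_snd.
      * apply (Ck_comp_linear k (V := prod_NormedModule _ RR RR) (V' := RR) U fst (dv h)); auto. apply is_linear_fst.
Qed.

Lemma Ck_partials (U : RR -> Prop) (h : R * R -> R) : open U ->
  (forall k, Ck (V := RR) (W := RN) k U h) ->
  (forall k, Ck (V := RR) (W := RN) k U (du h)) /\ (forall k, Ck (V := RR) (W := RN) k U (dv h)) /\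
  (forall p, U p -> is_derive (fun u : R => h (u, snd p)) (fst p) (du h p)) /\
  (forall p, U p -> is_derive (fun v : R => h (fst p, v)) (snd p) (dv h p)).
Proof.
  intros HU H. destruct (Ck_all_derivative U h HU H) as [dF [H1 H2]].
  assert (A : forall e : RR, forall k, Ck (V := RR) (W := RN) k U (fun p => dF (p, e))).
  { intros e k. apply (Ck_comp k (V := RR) (W := prod_NormedModule _ RR RR) U (fun p => U (fst p)) dF (fun p => (p, e))); auto.
    - apply (open_fst (V := RR) (V' := RR) U HU).
    - apply (Ck_pair k (V := RR) (W := RR) (Z := RR)); [apply (Ck_linear k U (fun x : RR => x)), is_linear_id|apply Ck_const]. }
  assert (Du : forall p, U p -> is_derive (fun u : R => h (u, snd p)) (fst p) (dF (p, (1, 0)))).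
  { intros p Hp. apply is_derive_u, H1, Hp. }
  assert (Dv : forall p, U p -> is_derive (fun v : R => h (fst p, v)) (snd p) (dF (p, (0, 1)))).
  { intros p Hp. apply is_derive_v, H1, Hp. }
  assert (Eu : forall p, U p -> dF (p, (1, 0)) = du h p).
  { intros p Hp. symmetry. apply is_derive_unique, Du, Hp. }
  assert (Ev : forall p, U p -> dF (p, (0, 1)) = dv h p).
  { intros p Hp. symmetry. apply is_derive_unique, Dv, Hp. }
  split; [|split; [|split]].
  - intros k. apply (Ck_ext k _ _ _ HU Eu). apply A.
  - intros k. apply (Ck_ext k _ _ _ HU Ev). apply A.
  - intros p Hp. rewrite <- Eu; auto.
  - intros p Hp. rewrite <- Ev; auto.
Qed.

Lemma Ck_ex_diff_n n : forall (U : RR -> Prop) (h : R * R -> R), open U ->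
  (forall k, Ck (V := RR) (W := RN) k U h) ->
  forall p, U p -> ex_diff_n (fun u v => h (u, v)) n (fst p) (snd p).
Proof.
  assert (C : forall (U : RR -> Prop) (h : R * R -> R) p, (forall k, Ck (V := RR) (W := RN) k U h) -> U p ->
    continuity_2d_pt (fun u v => h (u, v)) (fst p) (snd p)).
  { intros U h [x y] H Hp. apply continuity_2d_pt_filterlim.
    apply (continuous_ext (T := RR) (U := RN) h (fun u : R * R => h (fst u, snd u)) (x, y)); [intros [? ?]; reflexivity|].
    apply (Ck_cont 0 U); auto. }
  induction n as [|n IH]; intros U h HU H p Hp.
  - split; auto. apply (C U); auto.
  - destruct (Ck_partials U h HU H) as [Cu [Cv [Du Dv]]].
    split; [apply (C U); auto|]. split; [|split; [|split]].
    + eexists; apply (Du p Hp).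
    + eexists; apply (Dv p Hp).
    + apply (IH U (du h)); auto.
    + apply (IH U (dv h)); auto.
Qed.

(** The bridge between iterated partial derivatives and directional ones: the partial derivatives
    are [dF] in the directions (1, 0) and (0, 1), and conversely [dF] is their linear
    combination. *)
Lemma smooth_sm (h : R * R -> R) : smooth h <-> sm2 origin h.
Proof.
  split.
  - intros H. unfold smooth, near0 in H.
    (* The interior of the set of good points, as the set itself need not be open. *)
    exists (fun p => locally p (fun p => forall n, ex_diff_n (fun u v => h (u, v)) n (fst p) (snd p))).
    assert (O : open (fun p : RR => locally p (fun p => forall n, ex_diff_n (fun u v => h (u, v)) n (fst p) (snd p)))).
    { intros p Hp. apply (locally_locally (T := RR) _ _ Hp). }
    repeat split; auto.
    intros k. apply ex_diff_n_Ck; auto.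
    intros p Hp. apply (locally_singleton (T := RR) _ _ Hp).
  - intros [U [HU [H0 H]]]. unfold smooth, near0.
    generalize (HU _ H0). apply filter_imp.
    intros p Hp n. apply (Ck_ex_diff_n n U); auto.
Qed.

Lemma sm_near {V W : NM} (x0 : V) (F : V -> W) : sm x0 F -> locally x0 (fun x => sm x F).
Proof.
  intros [U [HU [H0 H]]]. generalize (HU _ H0). apply filter_imp. intros x Hx. exists U; auto.
Qed.

Lemma sm_du p h : sm2 p h -> sm2 p (du h).
Proof. intros [U [HU [H0 H]]]. exists U; repeat split; auto. apply Ck_partials; auto. Qed.

Lemma sm_dv p h : sm2 p h -> sm2 p (dv h).
Proof. intros [U [HU [H0 H]]]. exists U; repeat split; auto. apply Ck_partials; auto. Qed.

Lemma du_correct p h : sm2 p h -> is_derive (fun u : R => h (u, snd p)) (fst p) (du h p).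
Proof. intros [U [HU [H0 H]]]. apply (Ck_partials U h); auto. Qed.

Lemma dv_correct p h : sm2 p h -> is_derive (fun v : R => h (fst p, v)) (snd p) (dv h p).
Proof. intros [U [HU [H0 H]]]. apply (Ck_partials U h); auto. Qed.

Lemma dir_der_sm p h a b : sm2 p h ->
  dir_der (V := RR) (W := RN) h p (a, b) (a * du h p + b * dv h p).
Proof.
  intros H. apply dir_der_partials.
  - generalize (sm_near _ _ H). apply filter_imp. intros q; apply du_correct.
  - apply dv_correct, H.
  - apply (sm_cont (V := RR) (W := RN)), sm_du, H.
Qed.

Lemma is_derive_curve (h : R * R -> R) (g1 g2 : R -> R) (t l1 l2 : R) :
  sm2 (g1 t, g2 t) h -> is_derive g1 t l1 -> is_derive g2 t l2 ->
  is_derive (fun s => h (g1 s, g2 s)) t (l1 * du h (g1 t, g2 t) + l2 * dv h (g1 t, g2 t)).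
Proof.
  intros H H1 H2.
  assert (H' := H). destruct H' as [U [HU [H0 Hk]]].
  assert (B : forall (g : R -> R) (l : R), is_derive g t l -> is_derive (fun s : R => g (t + s)) 0 l).
  { intros g l Hg. evar_last.
    - apply (is_derive_comp g (fun s => t + s)).
      + rewrite Rplus_0_r. exact Hg.
      + auto_derive; auto.
    - exact (scal_one _). }
  assert (A := chain_dir (W := RR) h (fun q => fst (snd q) * du h (fst q) + snd (snd q) * dv h (fst q)) U
    (fun s : R => (g1 (t + s), g2 (t + s))) (l1, l2) HU).
  cbv beta in A. rewrite !Rplus_0_r in A. simpl in A.
  assert (A' : is_derive (fun s : R => h (g1 (t + s), g2 (t + s))) 0 (l1 * du h (g1 t, g2 t) + l2 * dv h (g1 t, g2 t))).
  { apply A; auto.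
    - intros x [a b] Hx. apply dir_der_sm. exists U; auto.
    - apply (sm_cont (V := prod_NormedModule _ RR RR) (W := RN)).
      apply (sm_plus (V := prod_NormedModule _ RR RR)); apply (sm_mult (V := prod_NormedModule _ RR RR)).
      + apply (sm_comp (V := prod_NormedModule _ RR RR) (W := RR) _ fst snd); [apply (sm_fst (V := RN) (W := RN))|apply (sm_snd (V := RR) (W := RR))].
      + apply (sm_comp (V := prod_NormedModule _ RR RR) (W := RR) _ (du h) fst); [apply sm_du, H|apply (sm_fst (V := RR) (W := RR))].
      + apply (sm_comp (V := prod_NormedModule _ RR RR) (W := RR) _ snd snd); [apply (sm_snd (V := RN) (W := RN))|apply (sm_snd (V := RR) (W := RR))].
      + apply (sm_comp (V := prod_NormedModule _ RR RR) (W := RR) _ (dv h) fst); [apply sm_dv, H|apply (sm_fst (V := RR) (W := RR))].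
    - apply (is_derive_pair (W := RN) (Z := RN) (fun s => g1 (t + s)) (fun s => g2 (t + s))); apply B; auto. }
  apply (is_derive_ext (fun s : R => h (g1 (t + (s - t)), g2 (t + (s - t))))).
  { intros s. assert (E : forall a b : R, a + (b - a) = b) by (intros; ring). rewrite E. reflexivity. }
  evar_last.
  - apply (is_derive_comp (fun s : R => h (g1 (t + s), g2 (t + s)) : RN) (fun s => s - t)).
    + replace (t - t) with 0 by ring. exact A'.
    + auto_derive; auto.
  - exact (scal_one _).
Qed.

Lemma du_comp (h f1 f2 : R * R -> R) p : sm2 (f1 p, f2 p) h -> sm2 p f1 -> sm2 p f2 ->
  du (fun q => h (f1 q, f2 q)) p = du h (f1 p, f2 p) * du f1 p + dv h (f1 p, f2 p) * du f2 p.
Proof.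
  intros H H1 H2. apply is_derive_unique. evar_last.
  - apply (is_derive_curve h (fun u => f1 (u, snd p)) (fun u => f2 (u, snd p)) (fst p)).
    + rewrite <- surjective_pairing. exact H.
    + apply du_correct, H1.
    + apply du_correct, H2.
  - rewrite <- !surjective_pairing. ring.
Qed.

Lemma dv_comp (h f1 f2 : R * R -> R) p : sm2 (f1 p, f2 p) h -> sm2 p f1 -> sm2 p f2 ->
  dv (fun q => h (f1 q, f2 q)) p = du h (f1 p, f2 p) * dv f1 p + dv h (f1 p, f2 p) * dv f2 p.
Proof.
  intros H H1 H2. apply is_derive_unique. evar_last.
  - apply (is_derive_curve h (fun v => f1 (fst p, v)) (fun v => f2 (fst p, v)) (snd p)).
    + rewrite <- surjective_pairing. exact H.
    + apply dv_correct, H1.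
    + apply dv_correct, H2.
  - rewrite <- !surjective_pairing. ring.
Qed.

(** * Integrals with parameters and Hadamard's lemma *)

Notation VR V := (prod_NormedModule R_AbsRing V RN).

Lemma continuous_slice {V : NM} (H : V * R -> R) (x : V) (s : R) :
  continuous (T := VR V) (U := RN) H (x, s) -> continuous (U := RN) (fun s => H (x, s)) s.
Proof.
  intros C. apply (continuous_comp (U := R_UniformSpace) (V := VR V) (W := RN) (fun s => (x, s)) H); auto.
  apply (continuous_pair (V := R_UniformSpace) (W := V) (Z := RN)); [apply continuous_const|apply continuous_id].
Qed.

Lemma ex_RInt_slice {V : NM} (H : V * R -> R) (x : V) :
  (forall s, 0 <= s <= 1 -> continuous (T := VR V) (U := RN) H (x, s)) -> ex_RInt (fun s => H (x, s)) 0 1.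
Proof.
  intros C. apply (ex_RInt_continuous (V := R_CompleteNormedModule)).
  intros s Hs. rewrite Rmin_left, Rmax_right in Hs by lra. apply (continuous_slice (V := V)), C, Hs.
Qed.

(** Tube argument: the continuity bounds at the points (x0, s) become uniform in s because [0, 1] is
    compact. *)
Lemma continuous_RInt_param {V : NM} (H : V * R -> R) (x0 : V) :
  locally x0 (fun x => forall s, 0 <= s <= 1 -> continuous (T := VR V) (U := RN) H (x, s)) ->
  continuous (U := RN) (fun x => RInt (fun s => H (x, s)) 0 1) x0.
Proof.
  intros C. assert (C0 := locally_singleton _ _ C).
  apply filterlim_locally. intros eps.
  assert (D : forall s, exists d : posreal, 0 <= s <= 1 ->
     forall x s', ball x0 d x -> Rabs (s' - s) < d -> Rabs (H (x, s') - H (x0, s)) < eps / 4).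
  { intros s. destruct (classic (0 <= s <= 1)) as [Hs|Hs].
    2:{ exists (mkposreal 1 Rlt_0_1); tauto. }
    assert (He : 0 < eps / 4) by (destruct eps; simpl; lra).
    destruct (C0 s Hs _ (locally_ball (H (x0, s)) (mkposreal _ He))) as [d Hd].
    exists d. intros _ x s' Hx Hs'. apply (Hd (x, s')). split; auto. }
  apply (choice (fun s (d : posreal) => 0 <= s <= 1 ->
     forall x s', ball x0 d x -> Rabs (s' - s) < d -> Rabs (H (x, s') - H (x0, s)) < eps / 4)) in D.
  destruct D as [delta Hdelta].
  destruct (compactness_value_1d 0 1 delta) as [d Hd].
  assert (K : forall x, ball x0 d x -> forall s, 0 <= s <= 1 -> Rabs (H (x, s) - H (x0, s)) <= eps / 2).
  { intros x Hx s Hs. apply Rnot_lt_le. intros Hn. apply (Hd s Hs). intros [t [Ht [H1 H2]]].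
    assert (A := Hdelta t Ht x s (ball_le _ _ _ H2 _ Hx) H1).
    assert (B := Hdelta t Ht x0 s (ball_center x0 _) H1).
    assert (T : forall a b c e : R, Rabs (a - c) < e / 4 -> Rabs (b - c) < e / 4 -> e / 2 < Rabs (a - b) -> False).
    { intros a b c e. unfold Rabs; repeat destruct Rcase_abs; lra. }
    exact (T _ _ _ _ A B Hn). }
  generalize (filter_and _ _ C (locally_ball x0 d)). apply filter_imp. intros x [Cx Hx].
  change (Rabs (RInt (fun s => H (x, s)) 0 1 - RInt (fun s => H (x0, s)) 0 1) < eps).
  assert (E : RInt (fun s => H (x, s)) 0 1 - RInt (fun s => H (x0, s)) 0 1 =
              RInt (fun s => H (x, s) - H (x0, s)) 0 1).
  { symmetry. apply (RInt_minus (V := R_CompleteNormedModule) (fun s => H (x, s)) (fun s => H (x0, s)));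
      apply (ex_RInt_slice (V := V)); auto. }
  rewrite E.
  apply Rle_lt_trans with ((1 - 0) * (eps / 2)).
  - apply abs_RInt_le_const; [lra| |intros t Ht; apply K; auto].
    apply (ex_RInt_minus (V := R_NormedModule) (fun s => H (x, s)) (fun s => H (x0, s)));
      apply (ex_RInt_slice (V := V)); auto.
  - destruct eps; simpl; lra.
Qed.

(** Differentiation under the integral sign; the derivative in the direction (h, 0) is again an
    integrand of the same kind. The variable s runs over an open interval larger than [0, 1] to make
    the domain of [H] open. *)
Lemma Ck_RInt k : forall {V : NM} (U : V -> Prop) (H : V * R -> R), open U ->
  Ck (V := VR V) (W := RN) k (fun q => U (fst q) /\ -1 < snd q < 2) H ->
  Ck (W := RN) k U (fun x => RInt (fun s => H (x, s)) 0 1).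
Proof.
  assert (C0 : forall (V : NM) (U : V -> Prop) (H : V * R -> R), open U ->
    (forall q : VR V, U (fst q) /\ -1 < snd q < 2 -> continuous (T := VR V) (U := RN) H q) ->
    forall x, U x -> continuous (U := RN) (fun x => RInt (fun s => H (x, s)) 0 1) x).
  { intros V U H HU HC x Hx. apply (continuous_RInt_param (V := V)).
    generalize (HU x Hx). apply filter_imp. intros y Hy s Hs. apply HC; simpl; split; auto; lra. }
  induction k as [|k IH]; intros V U H HU HH.
  - split; auto. apply (C0 V U); auto. apply HH.
  - destruct HH as [HC [dH [H1 H2]]]. split; [apply (C0 V U); auto|].
    exists (fun p => RInt (fun s => dH ((fst p, s), (snd p, 0))) 0 1). split.
    + intros x h Hx. simpl. unfold dir_der.
      assert (DD : forall (u v : R), U (plus x (scal u h)) -> -1 < v < 2 ->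
         is_derive (fun z : R => H (plus x (scal z h), v)) u (dH ((plus x (scal u h), v), (h, 0)))).
      { intros u v Hu Hv.
        assert (E : forall z : R, H (plus (plus x (scal u h), v) (scal (z - u) ((h, 0) : VR V))) = H (plus x (scal z h), v)).
        { intros z. f_equal. unfold plus at 1, scal at 2; simpl. unfold prod_plus, prod_scal; simpl. f_equal.
          - rewrite <- plus_assoc. f_equal.
            transitivity (scal (plus u (z - u)) h).
            + symmetry. exact (scal_distr_r (u : R_AbsRing) (z - u) h).
            + f_equal. unfold plus; simpl; ring.
          - unfold plus, scal; simpl. unfold mult; simpl. ring. }
        apply (is_derive_ext _ _ _ _ E).
        evar_last.
        - apply (is_derive_comp (fun s : R => H (plus (plus x (scal u h), v) (scal s ((h, 0) : VR V))) : RN) (fun z : R => z - u)).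
          + replace (u - u) with 0 by ring. apply (H1 (plus x (scal u h), v) (h, 0)). simpl; auto.
          + auto_derive; auto.
        - exact (scal_one _). }
      assert (NL := near_line U x h HU Hx).
      evar_last.
      * apply (is_derive_RInt_param (fun (t s : R) => H (plus x (scal t h), s)) 0 1 0).
        -- generalize NL. apply filter_imp. intros u Hu t Ht.
           rewrite Rmin_left, Rmax_right in Ht by lra. eexists; apply DD; auto; lra.
        -- intros t Ht. rewrite Rmin_left, Rmax_right in Ht by lra.
           assert (L : locally (0, t) (fun z : R * R => U (plus x (scal (fst z) h)) /\ -1 < snd z < 2)).
           { apply filter_and.
             - destruct NL as [d Hd]. exists d. intros [u v] [Hu _]. apply Hd, Hu.
             - exists (mkposreal (1/2) ltac:(lra)). intros [u v] [_ Hv]. simpl in *.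
               change (Rabs (v - t) < 1/2) in Hv. apply Rabs_def2 in Hv. lra. }
           apply (continuity_2d_pt_ext_loc (fun u v => dH ((plus x (scal u h), v), (h, 0)))).
           { destruct L as [d Hd]. exists d. intros u v Hu Hv. symmetry.
             destruct (Hd (u, v)) as [A B]; [split; auto|]. simpl in *.
             apply is_derive_unique. apply DD; auto. }
           apply continuity_2d_pt_filterlim.
           apply (continuous_comp (U := RR) (V := prod_NormedModule _ (VR V) (VR V)) (W := RN)
              (fun z : R * R => ((plus x (scal (fst z) h), snd z), (h, 0))) dH).
           ++ apply (continuous_pair (V := RR) (W := VR V) (Z := VR V)); [|apply continuous_const].
              apply (continuous_pair (V := RR) (W := V) (Z := RN)); [|apply continuous_snd].
              apply (continuous_comp (U := RR) (V := RN) (W := V) fst (fun z => plus x (scal z h))).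
              ** apply continuous_fst.
              ** apply continuous_line.
           ++ apply (Ck_cont _ _ _ _ H2). simpl. rewrite (plus_scal_0 (V := V)). split; auto; lra.
        -- generalize NL. apply filter_imp. intros u Hu. apply (ex_RInt_slice (V := V)).
           intros s Hs. apply HC; simpl; split; auto; lra.
      * apply RInt_ext. intros t Ht. rewrite Rmin_left, Rmax_right in Ht by lra.
        apply is_derive_unique. assert (D0 := DD 0 t). rewrite (plus_scal_0 (V := V)) in D0. apply D0; auto; lra.
    + apply (IH (prod_NormedModule _ V V) (fun p => U (fst p)) (fun q => dH ((fst (fst q), snd q), (snd (fst q), 0)))).
      * apply open_fst, HU.
      * apply (Ck_comp_linear k (V := VR (prod_NormedModule _ V V)) (V' := prod_NormedModule _ (VR V) (VR V))
          (fun p => U (fst (fst p)) /\ -1 < snd (fst p) < 2)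
          (fun q => ((fst (fst q), snd q), (snd (fst q), 0))) dH); auto.
        apply (is_linear_prod (T := VR (prod_NormedModule _ V V)) (U := VR V) (V := VR V)).
        -- apply (is_linear_prod (T := VR (prod_NormedModule _ V V)) (U := V) (V := RN)).
           ++ apply (is_linear_comp (U := VR (prod_NormedModule _ V V)) (V := prod_NormedModule _ V V) fst fst); apply is_linear_fst.
           ++ apply is_linear_snd.
        -- apply (is_linear_prod (T := VR (prod_NormedModule _ V V)) (U := V) (V := RN)).
           ++ apply (is_linear_comp (U := VR (prod_NormedModule _ V V)) (V := prod_NormedModule _ V V) fst snd); [apply is_linear_fst|apply is_linear_snd].
           ++ exact (is_linear_zero (U := VR (prod_NormedModule _ V V)) (V := RN)).
Qed.

(** Balls of a uniform space need not be open, so the domain is described through the interior of a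
    ball. *)
Lemma sm_vr {V : NM} (x0 : V) (t0 : R) (F : V * R -> R) : sm (V := VR V) (W := RN) (x0, t0) F ->
  exists d : posreal, forall k, Ck (V := VR V) (W := RN) k
    (fun q => locally (fst q) (ball x0 d) /\ Rabs (snd q - t0) < d) F.
Proof.
  intros [U [HU [H0 H]]]. destruct (HU _ H0) as [d Hd]. exists d. intros k.
  apply (Ck_sub k U); auto. intros [x t] [Hx Ht]. apply Hd. split; [apply (locally_singleton _ _ Hx)|exact Ht].
Qed.

Lemma open_int_ball {V : NM} (x0 : V) (d : posreal) : open (fun x => locally x (ball x0 d)).
Proof. intros x Hx. apply locally_locally, Hx. Qed.

Lemma open_vr {V : NM} (U : V -> Prop) (I : R -> Prop) :
  open U -> open I -> open (fun q : VR V => U (fst q) /\ I (snd q)).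
Proof.
  intros HU HI. apply (open_and (T := VR V)).
  - apply (open_fst (V' := RN)), HU.
  - intros [x t] Ht. apply (continuous_snd x t). apply HI, Ht.
Qed.

Lemma open_abs (t0 d : R) : open (fun t : R => Rabs (t - t0) < d).
Proof.
  intros t Ht. exists (mkposreal (d - Rabs (t - t0)) ltac:(lra)). intros s Hs.
  change (Rabs (s - t) < d - Rabs (t - t0)) in Hs.
  replace (s - t0) with ((s - t) + (t - t0)) by ring.
  eapply Rle_lt_trans; [apply Rabs_triang|lra].
Qed.

Lemma open_interval (a b : R) : open (fun t : R => a < t < b).
Proof. apply open_and; [apply open_gt|apply open_lt]. Qed.

(** K (x, t) is the integral over s in [0, 1] of the t-derivative of F at (x, s t); the identity is
    the fundamental theorem of calculus for s -> F (x, s t). *)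
Lemma hadamard_param {V : NM} (x0 : V) (F : V * R -> R) :
  sm (V := VR V) (W := RN) (x0, 0) F -> locally x0 (fun x => F (x, 0) = 0) ->
  exists K : V * R -> R, sm (V := VR V) (W := RN) (x0, 0) K /\
    locally (T := VR V) (x0, 0) (fun q => F q = snd q * K q).
Proof.
  intros HF HZ. destruct (sm_vr _ _ _ HF) as [d Hd].
  set (U := fun q : VR V => locally (fst q) (ball x0 d) /\ Rabs (snd q - 0) < d) in *.
  assert (OU : open U) by (apply (open_vr (V := V) (fun x => locally x (ball x0 d)) (fun t => Rabs (t - 0) < d)); [apply open_int_ball|apply open_abs]).
  destruct (Ck_all_derivative U F OU Hd) as [dF [H1 H2]].
  assert (pd := cond_pos d).
  (* Half the radius in t, because the factor s of [Ck_RInt] ranges up to 2 in absolute value. *)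
  set (U' := fun q : VR V => locally (fst q) (ball x0 d) /\ Rabs (snd q - 0) < d / 2).
  assert (OU' : open U') by (apply (open_vr (V := V) (fun x => locally x (ball x0 d)) (fun t => Rabs (t - 0) < d / 2)); [apply open_int_ball|apply open_abs]).
  assert (U0 : U' (x0, 0)).
  { split; simpl; [apply locally_ball|]. rewrite Rminus_0_r, Rabs_R0. lra. }
  assert (US : forall x t s, U' (x, t) -> -1 < s < 2 -> U (x, s * t)).
  { intros x t s [A B] Hs. split; auto. simpl in *. rewrite Rminus_0_r in *. rewrite Rabs_mult.
    assert (Rabs s < 2) by (apply Rabs_def1; lra).
    assert (A0 := Rabs_pos t). assert (A1 := Rabs_pos s). nra. }
  exists (fun q => RInt (fun s => dF ((fst q, s * snd q), (zero, 1))) 0 1). split.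
  - exists U'. repeat split; auto; try apply U0.
    intros k. apply (Ck_RInt k (V := VR V) U' (fun p => dF ((fst (fst p), snd p * snd (fst p)), (zero, 1)))); auto.
    assert (O2 : open (fun q : VR (VR V) => U' (fst q) /\ -1 < snd q < 2)).
    { apply (open_vr (V := VR V) U' (fun s => -1 < s < 2)); auto. apply open_interval. }
    apply (Ck_comp k (V := VR (VR V)) (W := prod_NormedModule _ (VR V) (VR V)) _ (fun p => U (fst p)) dF
       (fun p => ((fst (fst p), snd p * snd (fst p)), (zero, 1)))); auto.
    + apply (open_fst (V := VR V) (V' := VR V)); auto.
    + intros [[x t] s] [A B]. simpl in *. apply US; auto.
    + apply (Ck_pair k (V := VR (VR V)) (W := VR V) (Z := VR V)); [|apply Ck_const].
      apply (Ck_pair k (V := VR (VR V)) (W := V) (Z := RN)).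
      * apply Ck_linear. apply (is_linear_comp (U := VR (VR V)) (V := VR V) fst fst); apply is_linear_fst.
      * apply (Ck_mul k (V := VR (VR V))); auto.
        -- apply Ck_linear. apply is_linear_snd.
        -- apply Ck_linear. apply (is_linear_comp (U := VR (VR V)) (V := VR V) fst snd); [apply is_linear_fst|apply is_linear_snd].
  - generalize (filter_and _ _ (OU' _ U0) (continuous_fst (U := V) (V := RN) x0 0 (fun x => F (x, 0) = 0) HZ)).
    apply filter_imp. intros [x t] [Hq HZ']. simpl in HZ'. cbn [fst snd].
    assert (DD : forall s, 0 <= s <= 1 -> is_derive (fun s : R => F (x, s * t)) s (t * dF ((x, s * t), (zero, 1)))).
    { intros s Hs.
      assert (E : forall z : R, F (plus (x, s * t) (scal (z - s) ((zero, t) : VR V))) = F (x, z * t)).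
      { intros z. f_equal. unfold plus at 1, scal at 1; simpl. unfold prod_plus, prod_scal; simpl. f_equal.
        - transitivity (plus x zero); [f_equal; exact (scal_zero_r (z - s : R_AbsRing))|apply plus_zero_r].
        - unfold plus, scal; simpl. unfold mult; simpl. ring. }
      apply (is_derive_ext _ _ _ _ E).
      assert (Q : U (x, s * t)) by (apply US; auto; lra).
      evar_last.
      - apply (is_derive_comp (fun z : R => F (plus (x, s * t) (scal z ((zero, t) : VR V))) : RN) (fun z : R => z - s)).
        + assert (E0 : forall r : R, r - r = 0) by (intros; ring). rewrite E0. apply (H1 (x, s * t) (zero, t)), Q.
        + auto_derive; auto.
      - transitivity (dF ((x, s * t), (zero, t))); [exact (scal_one _)|].
        rewrite <- (dir_der_scal (V := VR V) F dF (x, s * t)) by (intros h; apply H1, Q).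
        f_equal. f_equal. unfold scal; simpl. unfold prod_scal; simpl. f_equal.
        + symmetry. exact (scal_zero_r (t : R_AbsRing)).
        + unfold scal; simpl. unfold mult; simpl. symmetry; apply Rmult_1_r. }
    assert (CC : forall s, 0 <= s <= 1 -> continuous (U := RN) (fun s => dF ((x, s * t), (zero, 1))) s).
    { intros s Hs. apply (continuous_comp (U := R_UniformSpace) (V := prod_NormedModule _ (VR V) (VR V)) (W := RN)
        (fun s => ((x, s * t), (zero, 1))) dF).
      - apply (continuous_pair (V := R_UniformSpace) (W := VR V) (Z := VR V)); [|apply continuous_const].
        apply (continuous_pair (V := R_UniformSpace) (W := V) (Z := RN)); [apply continuous_const|].
        apply (ex_derive_continuous (fun s : R => s * t)). auto_derive; auto.
      - apply (Ck_cont 0 _ _ _ (H2 0%nat)). simpl. apply US; auto; lra. }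
    assert (I := is_RInt_derive (V := R_CompleteNormedModule) (fun s : R => F (x, s * t)) (fun s => t * dF ((x, s * t), (zero, 1))) 0 1).
    rewrite Rmin_left, Rmax_right in I by lra.
    specialize (I DD). lapply I.
    2:{ intros s Hs. apply (continuous_mult (K := R_AbsRing) (fun _ => t) (fun s => dF ((x, s * t), (zero, 1)))); [apply continuous_const|apply CC, Hs]. }
    clear I; intros I. apply is_RInt_unique in I.
    assert (EI : RInt (fun s => t * dF ((x, s * t), (zero, 1))) 0 1 = t * RInt (fun s => dF ((x, s * t), (zero, 1))) 0 1).
    { apply (RInt_scal (V := R_CompleteNormedModule) (fun s => dF ((x, s * t), (zero, 1)))).
      apply (ex_RInt_continuous (V := R_CompleteNormedModule)).
      intros s Hs. rewrite Rmin_left, Rmax_right in Hs by lra. apply CC, Hs. }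
    rewrite <- EI. etransitivity; [|symmetry; exact I].
    unfold minus, plus, opp; simpl.
    rewrite Rmult_1_l, Rmult_0_l, HZ'.
    assert (Q : forall r : R, r = r + - 0) by (intros; ring). apply Q.
Qed.

(** * The implicit function theorem *)

Lemma dir_der_second {V : NM} (H : V * R -> R) (x : V) (t l : R) :
  dir_der (V := VR V) (W := RN) H (x, t) (zero, 1) l <-> is_derive (fun t => H (x, t)) t l.
Proof.
  assert (X : forall z : R, plus x (scal z zero) = x).
  { intros z. transitivity (plus x zero); [f_equal; exact (scal_zero_r (z : R_AbsRing))|apply plus_zero_r]. }
  assert (E : forall z : R, H (plus (x, t) (scal z ((zero, 1) : VR V))) = H (x, t + z)).
  { intros z. f_equal. unfold plus at 1, scal at 1; simpl. unfold prod_plus, prod_scal; simpl.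
    rewrite X. f_equal. unfold plus, scal; simpl. unfold mult; simpl. f_equal. apply Rmult_1_r. }
  unfold dir_der. split; intros D.
  - apply (is_derive_ext (fun z : R => H (plus (x, t) (scal (z - t) ((zero, 1) : VR V))))).
    { intros z. assert (Q : forall a b : R, a + (b - a) = b) by (intros; ring). rewrite E, Q. reflexivity. }
    evar_last.
    + apply (is_derive_comp (fun z : R => H (plus (x, t) (scal z ((zero, 1) : VR V))) : RN) (fun z : R => z - t)).
      * assert (Q : forall a : R, a - a = 0) by (intros; ring). rewrite Q. exact D.
      * auto_derive; auto.
    + exact (scal_one _).
  - apply (is_derive_ext (fun z : R => H (x, t + z))); [intros z; symmetry; apply E|].
    evar_last.
    + apply (is_derive_comp (fun z : R => H (x, z) : RN) (fun z : R => t + z)).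
      * assert (Q : forall a : R, a + 0 = a) by (intros; ring). rewrite Q. exact D.
      * auto_derive; auto.
    + exact (scal_one _).
Qed.

Lemma dir_der_first {V : NM} (H : V * R -> R) (x h : V) (t l : R) :
  dir_der (V := VR V) (W := RN) H (x, t) (h, 0) l <-> dir_der (W := RN) (fun x => H (x, t)) x h l.
Proof.
  unfold dir_der.
  assert (E : forall z : R, H (plus (x, t) (scal z ((h, 0) : VR V))) = H (plus x (scal z h), t)).
  { intros z. f_equal. unfold plus at 1, scal at 1; simpl. unfold prod_plus, prod_scal; simpl.
    f_equal. unfold plus, scal; simpl. unfold mult; simpl. assert (Q : forall a b : R, a + b * 0 = a) by (intros; ring). apply Q. }
  split; intros D; (eapply is_derive_ext; [|exact D]); intros z; [apply E|symmetry; apply E].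
Qed.

(** A positive t-derivative makes H increasing in t: the zero exists by intermediate values, is
    unique, and is continuous because it is squeezed between points where H has opposite signs. Its
    derivative comes from the mean value theorem in each variable; as it is expressed through [tau]
    itself, every round gains one order of differentiability. *)
Lemma implicit_function_pos {V : NM} (x0 : V) (t0 a : R) (H : V * R -> R) :
  sm (V := VR V) (W := RN) (x0, t0) H -> H (x0, t0) = 0 ->
  is_derive (fun t => H (x0, t)) t0 a -> 0 < a ->
  exists tau : V -> R, sm (W := RN) x0 tau /\ tau x0 = t0 /\
    locally x0 (fun x => H (x, tau x) = 0) /\
    locally (T := VR V) (x0, t0) (fun q => H q = 0 -> snd q = tau (fst q)).
Proof.
  intros HF H0 Ha pa. destruct (sm_vr _ _ _ HF) as [d Hd].
  set (U := fun q : VR V => locally (fst q) (ball x0 d) /\ Rabs (snd q - t0) < d) in *.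
  assert (OU : open U) by (apply (open_vr (V := V) (fun x => locally x (ball x0 d)) (fun t => Rabs (t - t0) < d)); [apply open_int_ball|apply open_abs]).
  destruct (Ck_all_derivative U H OU Hd) as [dH [H1 H2]].
  assert (pd := cond_pos d).
  assert (U0 : U (x0, t0)).
  { split; simpl; [apply locally_ball|]. rewrite Rminus_diag, Rabs_R0. lra. }
  set (Ht := fun q : VR V => dH (q, (zero, 1))).
  assert (CHt : forall k, Ck (V := VR V) (W := RN) k U Ht).
  { intros k. apply (Ck_comp k (V := VR V) (W := prod_NormedModule _ (VR V) (VR V)) U (fun q => U (fst q)) dH (fun q => (q, (zero, 1)))); auto.
    - apply (open_fst (V := VR V) (V' := VR V)), OU.
    - apply (Ck_pair k (V := VR V) (W := VR V) (Z := VR V)); [apply (Ck_linear k U (fun q : VR V => q)), is_linear_id|apply Ck_const]. }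
  assert (DHt : forall x t, U (x, t) -> is_derive (fun t => H (x, t)) t (Ht (x, t))).
  { intros x t Hq. apply (dir_der_second (V := V)). apply H1, Hq. }
  assert (Ea : Ht (x0, t0) = a).
  { apply is_derive_unique in Ha. specialize (DHt x0 t0 U0). apply is_derive_unique in DHt.
    exact (eq_trans (eq_sym DHt) Ha). }
  assert (P0 : exists e : posreal, e < d /\ forall x t, locally x (ball x0 e) -> Rabs (t - t0) < e -> 0 < Ht (x, t)).
  { assert (Q := Ck_cont 0 U Ht (x0, t0) (CHt 0%nat) U0 (fun y => 0 < y)).
    lapply Q; [clear Q; intros [e He]|].
    - exists (mkposreal (Rmin e (d / 2)) ltac:(apply Rmin_pos; [apply cond_pos|lra])). simpl. split.
      + eapply Rle_lt_trans; [apply Rmin_r|lra].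
      + intros x t Hx Htt. apply (He (x, t)). split; simpl.
        * apply (ball_le x0 (Rmin e (d/2))); [apply Rmin_l|]. apply (locally_singleton _ _ Hx).
        * change (Rabs (t - t0) < e). eapply Rlt_le_trans; [exact Htt|apply Rmin_l].
    - rewrite Ea. apply (open_gt 0 a pa). }
  destruct P0 as [e [Hed Hpos]].
  assert (pe := cond_pos e).
  assert (UE : forall x t, locally x (ball x0 e) -> Rabs (t - t0) < e -> U (x, t)).
  { intros x t Hx Htt. split; simpl; [|lra]. generalize Hx. apply filter_imp. intros y. apply ball_le. lra. }
  assert (MON : forall x s t, locally x (ball x0 e) -> Rabs (s - t0) < e -> Rabs (t - t0) < e -> s < t -> H (x, s) < H (x, t)).
  { intros x s t Hx Hs Htt Hst.
    assert (B : forall r, s <= r <= t -> Rabs (r - t0) < e).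
    { intros r Hr. apply Rabs_def2 in Hs. apply Rabs_def2 in Htt. apply Rabs_def1; lra. }
    destruct (MVT_gen (fun t => H (x, t)) s t (fun t => Ht (x, t))) as [c [Hc1 Hc2]].
    - intros r Hr. rewrite Rmin_left, Rmax_right in Hr by lra. apply DHt, UE; auto. apply B; lra.
    - intros r Hr. rewrite Rmin_left, Rmax_right in Hr by lra. apply continuity_pt_filterlim.
      apply (ex_derive_continuous (fun t => H (x, t))). eexists. apply DHt, UE; auto.
    - rewrite Rmin_left, Rmax_right in Hc1 by lra.
      assert (A := Hpos x c Hx (B c Hc1)).
      assert (0 < Ht (x, c) * (t - s)) by (apply Rmult_lt_0_compat; auto; lra). cbv beta in Hc2.
      assert (T : forall p q r : R, p - q = r -> 0 < r -> q < p) by (intros; lra). exact (T _ _ _ Hc2 H3). }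
  assert (CX : forall x t, U (x, t) -> continuous (U := RN) (fun x => H (x, t)) x).
  { intros x t Hq. apply (continuous_comp (U := V) (V := VR V) (W := RN) (fun x => (x, t)) H).
    - apply (continuous_pair (V := V) (W := V) (Z := RN)); [apply continuous_id|apply continuous_const].
    - apply (Ck_cont 0 U H _ (Hd 0%nat) Hq). }
  set (r := e / 2).
  assert (X0 : locally x0 (ball x0 e)) by apply locally_ball.
  assert (Sg : forall x t s, locally x (ball x0 e) -> Rabs (t - t0) < e -> Rabs (s - t0) < e -> H (x, t) = 0 ->
     (s < t -> locally x (fun y => H (y, s) < 0)) /\ (t < s -> locally x (fun y => 0 < H (y, s)))).
  { intros x t s Hx Htt Hs HH. split; intros L.
    - apply (CX x s (UE x s Hx Hs) (fun y => y < 0)). apply (open_lt 0).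
      assert (Q := MON x s t Hx Hs Htt L). rewrite HH in Q. exact Q.
    - apply (CX x s (UE x s Hx Hs) (fun y => 0 < y)). apply (open_gt 0).
      assert (Q := MON x t s Hx Htt Hs L). rewrite HH in Q. exact Q. }
  assert (Rr : forall s, (s = t0 - r \/ s = t0 + r) -> Rabs (s - t0) < e).
  { intros s Hs. unfold r in Hs. apply Rabs_def1; destruct Hs; lra. }
  assert (R0 : Rabs (t0 - t0) < e) by (rewrite Rminus_diag, Rabs_R0; lra).
  destruct (Sg x0 t0 (t0 - r) X0 R0 (Rr _ (or_introl eq_refl)) H0) as [S1 _].
  destruct (Sg x0 t0 (t0 + r) X0 R0 (Rr _ (or_intror eq_refl)) H0) as [_ S2].
  specialize (S1 ltac:(unfold r; lra)). specialize (S2 ltac:(unfold r; lra)).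
  set (N := fun x => locally x (fun y => ball x0 e y /\ H (y, t0 - r) < 0 /\ 0 < H (y, t0 + r))).
  assert (ON : open N) by (intros x Hx; apply locally_locally, Hx).
  assert (N0 : N x0) by (apply filter_and; auto; apply filter_and; auto).
  assert (NB : forall x, N x -> locally x (ball x0 e)).
  { intros x Hx. unfold N in Hx. generalize Hx. apply filter_imp. tauto. }
  assert (EX : forall x, exists t, N x -> Rabs (t - t0) < e /\ H (x, t) = 0).
  { intros x. destruct (classic (N x)) as [Hx|]; [|exists 0; tauto].
    unfold N in Hx. destruct (locally_singleton _ _ Hx) as [_ [A B]].
    (* The argument is clamped to [t0 - r, t0 + r] because [IVT_gen] asks for continuity on the
       whole line. *)
    destruct (IVT_gen (fun t => H (x, Rmax (t0 - r) (Rmin (t0 + r) t))) (t0 - r) (t0 + r) 0) as [t [Ht1 Ht2]].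
    - intros t. apply continuity_pt_filterlim.
      apply (continuous_comp (U := R_UniformSpace) (V := R_UniformSpace) (W := RN) (fun t => Rmax (t0 - r) (Rmin (t0 + r) t)) (fun t => H (x, t))).
      + apply continuity_pt_filterlim. intros eps Heps. exists eps. split; auto.
        intros y [_ Hy]. unfold dist in *; simpl in *; unfold R_dist in *. revert Hy.
        unfold Rmax, Rmin, Rabs; repeat destruct Rle_dec; repeat destruct Rcase_abs; lra.
      + apply (continuous_slice (V := V)). apply (Ck_cont 0 U H _ (Hd 0%nat)). apply UE; auto.
        assert (RR : t0 - r <= Rmax (t0 - r) (Rmin (t0 + r) t) <= t0 + r).
        { unfold r. unfold Rmax, Rmin; repeat destruct Rle_dec; lra. }
        unfold r in *. apply Rabs_def1; lra.
    - assert (Z1 : Rmax (t0 - r) (Rmin (t0 + r) (t0 - r)) = t0 - r) by (unfold r, Rmax, Rmin; repeat destruct Rle_dec; lra).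
      assert (Z2 : Rmax (t0 - r) (Rmin (t0 + r) (t0 + r)) = t0 + r) by (unfold r, Rmax, Rmin; repeat destruct Rle_dec; lra).
      rewrite Z1, Z2. rewrite Rmin_left, Rmax_right; [split; left; [exact A|exact B]| |];
        left; apply Rlt_trans with 0; auto.
    - exists (Rmax (t0 - r) (Rmin (t0 + r) t)). intros _. split; auto.
      assert (RR : t0 - r <= Rmax (t0 - r) (Rmin (t0 + r) t) <= t0 + r).
      { unfold r. unfold Rmax, Rmin; repeat destruct Rle_dec; lra. }
      unfold r in *. apply Rabs_def1; lra. }
  apply (choice (fun x t => N x -> Rabs (t - t0) < e /\ H (x, t) = 0)) in EX.
  destruct EX as [tau Htau].
  assert (UN : forall x t, N x -> Rabs (t - t0) < e -> H (x, t) = 0 -> t = tau x).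
  { intros x t Hx Htt HH. destruct (Htau x Hx) as [A B].
    destruct (Rtotal_order t (tau x)) as [L|[L|L]]; auto.
    - assert (Q := MON x t (tau x) (NB x Hx) Htt A L). rewrite HH, B in Q. exfalso. exact (Rlt_irrefl _ Q).
    - assert (Q := MON x (tau x) t (NB x Hx) A Htt L). rewrite HH, B in Q. exfalso. exact (Rlt_irrefl _ Q). }
  assert (UT : forall x, N x -> U (x, tau x)).
  { intros x Hx. apply UE; [apply NB, Hx|apply Htau, Hx]. }
  assert (CT : forall x, N x -> continuous (U := RN) tau x).
  { intros x Hx. apply filterlim_locally. intros eps. destruct (Htau x Hx) as [A B].
    assert (pe' := cond_pos eps).
    assert (L : exists s1 s2, tau x - eps < s1 < tau x /\ tau x < s2 < tau x + eps /\ Rabs (s1 - t0) < e /\ Rabs (s2 - t0) < e).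
    { apply Rabs_def2 in A. destruct A as [Aa Ab]. set (m := Rmin eps (Rmin (tau x - t0 + e) (t0 + e - tau x))).
      assert (0 < m).
      { unfold m; repeat apply Rmin_pos; [exact pe'|lra|lra]. }
      assert (m <= eps) by apply Rmin_l.
      assert (m <= tau x - t0 + e) by (unfold m; eapply Rle_trans; [apply Rmin_r|apply Rmin_l]).
      assert (m <= t0 + e - tau x) by (unfold m; eapply Rle_trans; [apply Rmin_r|apply Rmin_r]).
      exists (tau x - m / 2), (tau x + m / 2). repeat split; try lra; apply Rabs_def1; lra. }
    destruct L as [s1 [s2 [L1 [L2 [L3 L4]]]]].
    destruct (Sg x (tau x) s1 (NB x Hx) A L3 B) as [T1 _].
    destruct (Sg x (tau x) s2 (NB x Hx) A L4 B) as [_ T2].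
    generalize (filter_and _ _ (ON x Hx) (filter_and _ _ (T1 (proj2 L1)) (T2 (proj1 L2)))).
    apply filter_imp. intros y [Hy [Y1 Y2]]. destruct (Htau y Hy) as [A' B'].
    change (Rabs (tau y - tau x) < eps).
    assert (s1 < tau y).
    { apply Rnot_le_lt. intros [L|L].
      - assert (Q := MON y (tau y) s1 (NB y Hy) A' L3 L). rewrite B' in Q. exact (Rlt_asym _ _ Q Y1).
      - rewrite L in B'. rewrite B' in Y1. exact (Rlt_irrefl _ Y1). }
    assert (tau y < s2).
    { apply Rnot_le_lt. intros [L|L].
      - assert (Q := MON y s2 (tau y) (NB y Hy) L4 A' L). rewrite B' in Q. exact (Rlt_asym _ _ Q Y2).
      - rewrite <- L in B'. rewrite B' in Y2. exact (Rlt_irrefl _ Y2). }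
    apply Rabs_def1; lra. }
  assert (HtT : forall x, N x -> 0 < Ht (x, tau x)).
  { intros x Hx. apply Hpos; [apply NB, Hx|apply Htau, Hx]. }
  (* Implicit differentiation: minus the x-derivative of H over its t-derivative. *)
  set (dtau := fun p : V * V => - (dH ((fst p, tau (fst p)), (snd p, 0)) * / Ht (fst p, tau (fst p)))).
  assert (DT : forall x h, N x -> dir_der (W := RN) tau x h (dtau (x, h))).
  { intros x h Hx. unfold dir_der. apply is_derive_Reals. intros eps Heps.
    set (T0 := tau x).
    assert (DX : forall s : R, U (plus x (scal s h), T0) ->
       is_derive (fun s : R => H (plus x (scal s h), T0)) s (dH ((plus x (scal s h), T0), (h, 0)))).
    { intros s Hs. assert (H3 := proj1 (dir_der_first (V := V) H (plus x (scal s h)) h T0 _) (H1 _ (h, 0) Hs)). unfold dir_der in H3.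
      apply (is_derive_ext (fun s' : R => H (plus (plus x (scal s h)) (scal (s' - s) h), T0))).
      { intros s'. f_equal. f_equal. rewrite <- plus_assoc. f_equal.
        transitivity (scal (plus s (s' - s)) h).
        - symmetry. exact (scal_distr_r (s : R_AbsRing) (s' - s) h).
        - f_equal. unfold plus; simpl. assert (Q : forall a b : R, a + (b - a) = b) by (intros; ring). apply Q. }
      evar_last.
      - apply (is_derive_comp (fun s' : R => H (plus (plus x (scal s h)) (scal s' h), T0) : RN) (fun s' : R => s' - s)).
        + assert (Q : forall a : R, a - a = 0) by (intros; ring). rewrite Q. exact H3.
        + auto_derive; auto.
      - exact (scal_one _). }
    (* The difference quotient of [tau] will be this ratio with numerator and denominator taken at
       different intermediate points c and b. Treating c, s and b as independent variables reduces
       the limit to continuity at (0, (0, T0)). *)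
    assert (Cq : continuous (U := RN) (fun q : R * (R * R) => - (dH ((plus x (scal (fst q) h), T0), (h, 0)) * / Ht (plus x (scal (fst (snd q)) h), snd (snd q)))) (0, (0, T0))).
    { apply (sm_cont (V := prod_NormedModule _ RN RR) (W := RN)).
      assert (SL : forall (y : R) , sm (V := RN) (W := V) y (fun s => plus x (scal s h))).
      { intros y. exists (fun _ => True). repeat split; auto; try apply open_true.
        intros k. clear. revert k.
        assert (A0 : forall k, Ck (V := RN) (W := V) k (fun _ => True) (fun s : R => plus x (scal s h))).
        { intros [|k].
          - split; auto. intros s _. apply continuous_line.
          - split. { intros s _. apply continuous_line. }
            exists (fun p : R * R => scal (snd p) h). split.
            + intros s l _. unfold dir_der. simpl.
              apply (is_derive_ext (fun z : R => plus (plus x (scal s h)) (scal z (scal l h)))).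
              * intros z. rewrite <- plus_assoc. f_equal.
                transitivity (plus (scal s h) (scal (z * l) h)).
                -- f_equal. exact (scal_assoc (z : R_AbsRing) l h).
                -- symmetry. exact (scal_distr_r (s : R_AbsRing) (z * l) h).
              * apply is_derive_line.
            + apply (Ck_linear k (V := RR) (W := V)). apply (is_linear_comp (U := RR) (V := RN) (W := V) snd (fun s : R => scal s h)); [apply is_linear_snd|exact (is_linear_scal_l (K := R_AbsRing) h)]. }
        exact A0. }
      apply (sm_opp (V := prod_NormedModule _ RN RR)). apply (sm_mult (V := prod_NormedModule _ RN RR)).
      - apply (sm_comp (V := prod_NormedModule _ RN RR) (W := prod_NormedModule _ (VR V) (VR V)) _ dH).
        + exists (fun q => U (fst q)). repeat split; auto.
          * apply (open_fst (V := VR V) (V' := VR V)), OU.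
          * simpl. rewrite (plus_scal_0 (V := V)). apply UT, Hx.
          * simpl. apply (UT x Hx).
        + apply (sm_pair (V := prod_NormedModule _ RN RR) (W := VR V) (Z := VR V)); [|apply sm_const].
          apply (sm_pair (V := prod_NormedModule _ RN RR) (W := V) (Z := RN)); [|apply (sm_const (W := RN))].
          destruct (SL 0) as [W [OW [W0 HW]]]. exists (fun q => W (fst q)). repeat split; auto.
          * apply (open_fst (V := RN) (V' := RR)), OW.
          * intros k. apply (Ck_comp_linear k (V := prod_NormedModule _ RN RR) (V' := RN) (W := V) W fst (fun s => plus x (scal s h))); auto.
            apply is_linear_fst.
      - apply (sm_inv (V := prod_NormedModule _ RN RR)).
        + simpl. rewrite (plus_scal_0 (V := V)). apply Rgt_not_eq. apply (HtT x Hx).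
        + apply (sm_comp (V := prod_NormedModule _ RN RR) (W := VR V) _ Ht).
          * exists U. repeat split; auto; simpl.
            -- rewrite (plus_scal_0 (V := V)). apply (UT x Hx).
            -- apply (UT x Hx).
          * apply (sm_pair (V := prod_NormedModule _ RN RR) (W := V) (Z := RN)).
            -- destruct (SL 0) as [W [OW [W0 HW]]]. exists (fun q => W (fst (snd q))). repeat split; auto.
               ++ apply (open_comp (T := prod_NormedModule _ RN RR) (U := RR) snd (fun q => W (fst q))).
                  ** intros [p q] _. apply continuous_snd.
                  ** apply (open_fst (V := RN) (V' := RN)), OW.
               ++ intros k. apply (Ck_comp_linear k (V := prod_NormedModule _ RN RR) (V' := RN) (W := V) W (fun q => fst (snd q)) (fun s => plus x (scal s h))); auto.
                  apply (is_linear_comp (U := prod_NormedModule _ RN RR) (V := RR) (W := RN) snd fst); [apply is_linear_snd|apply is_linear_fst].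
            -- apply sm_linear. apply (is_linear_comp (U := prod_NormedModule _ RN RR) (V := RR) (W := RN) snd snd); apply is_linear_snd. }
    assert (E0 : plus x (scal 0 h) = x) by apply plus_scal_0.
    destruct (Cq _ (locally_ball _ (mkposreal eps Heps))) as [d1 Hd1].
    cbn [fst snd] in Hd1. rewrite E0 in Hd1.
    assert (L1 := near_line N x h ON Hx).
    assert (LU : locally (0 : R) (fun s : R => U (plus x (scal s h), T0))).
    { generalize L1. apply filter_imp. intros s Hs. apply UE; [apply NB, Hs|apply (Htau x Hx)]. }
    assert (L2 : locally (0 : R) (fun s : R => Rabs (tau (plus x (scal s h)) - T0) < d1)).
    { assert (C := continuous_comp (fun s : R => plus x (scal s h)) tau 0 (continuous_line x h 0)).
      cbv beta in C. rewrite E0 in C. specialize (C (CT x Hx)).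
      specialize (C (fun y => Rabs (y - T0) < d1)). unfold filtermap in C. apply C. rewrite E0.
      exists d1. intros y Hy. exact Hy. }
    destruct (filter_and _ _ L1 (filter_and _ _ LU L2)) as [d2 Hd2].
    assert (p1 := cond_pos d1). assert (p2 := cond_pos d2).
    exists (mkposreal (Rmin d1 d2) ltac:(apply Rmin_pos; auto)). simpl. intros s Hs0 Hs.
    assert (Hs1 : Rabs s < d1) by (eapply Rlt_le_trans; [exact Hs|apply Rmin_l]).
    assert (Hs2 : Rabs s < d2) by (eapply Rlt_le_trans; [exact Hs|apply Rmin_r]).
    rewrite Rplus_0_l, E0. fold T0.
    assert (BB : forall c, Rabs c < d2 -> N (plus x (scal c h)) /\ U (plus x (scal c h), T0) /\ Rabs (tau (plus x (scal c h)) - T0) < d1).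
    { intros c Hc. apply Hd2. change (Rabs (c - 0) < d2). rewrite Rminus_0_r. exact Hc. }
    assert (BT : forall c, Rmin 0 s <= c <= Rmax 0 s -> Rabs c <= Rabs s).
    { intros c. unfold Rmin, Rmax, Rabs; repeat destruct Rle_dec; repeat destruct Rcase_abs; lra. }
    destruct (MVT_gen (fun c : R => H (plus x (scal c h), T0)) 0 s (fun c => dH ((plus x (scal c h), T0), (h, 0)))) as [c [Hc1 Hc2]].
    { intros c Hc. apply DX. apply (BB c). eapply Rle_lt_trans; [apply BT; lra|auto]. }
    { intros c Hc. apply continuity_pt_filterlim. apply (ex_derive_continuous (fun c : R => H (plus x (scal c h), T0))).
      eexists; apply DX. apply (BB c). eapply Rle_lt_trans; [apply BT; lra|auto]. }
    destruct (BB s Hs2) as [Ns [Us Ts]].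
    set (Ts' := tau (plus x (scal s h))) in *.
    destruct (Htau _ Ns) as [As Bs]. fold Ts' in As, Bs.
    destruct (Htau _ Hx) as [Ax Bx]. fold T0 in Ax, Bx.
    assert (BR : forall c, Rmin T0 Ts' <= c <= Rmax T0 Ts' -> Rabs (c - T0) <= Rabs (Ts' - T0) /\ Rabs (c - t0) < e).
    { intros b. revert As Ax. unfold Rmin, Rmax, Rabs; repeat destruct Rle_dec; repeat destruct Rcase_abs; lra. }
    destruct (MVT_gen (fun c : R => H (plus x (scal s h), c)) T0 Ts' (fun c => Ht (plus x (scal s h), c))) as [b [Hb1 Hb2]].
    { intros b Hb. apply DHt, UE; [apply NB, Ns|apply BR; lra]. }
    { intros b Hb. apply continuity_pt_filterlim. apply (ex_derive_continuous (fun c : R => H (plus x (scal s h), c))).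
      eexists; apply DHt, UE; [apply NB, Ns|apply BR; lra]. }
    assert (Hb3 : 0 - H (plus x (scal s h), T0) = Ht (plus x (scal s h), b) * (Ts' - T0))
      by exact (eq_trans (f_equal (fun r : R => r - H (plus x (scal s h), T0)) (eq_sym Bs)) Hb2).
    cbv beta in Hc2. rewrite E0 in Hc2.
    assert (Hc3 : H (plus x (scal s h), T0) - 0 = dH ((plus x (scal c h), T0), (h, 0)) * (s - 0))
      by exact (eq_trans (f_equal (fun r : R => H (plus x (scal s h), T0) - r) (eq_sym Bx)) Hc2).
    assert (Hp : 0 < Ht (plus x (scal s h), b)) by (apply Hpos; [apply NB, Ns|apply BR; auto]).
    specialize (Hd1 (c, (s, b))).
    assert (QQ : (Ts' - T0) / s = - (dH ((plus x (scal c h), T0), (h, 0)) * / Ht (plus x (scal s h), b))).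
    { assert (T : forall q k d f s' : R, 0 < f -> s' <> 0 -> q - 0 = d * (s' - 0) -> 0 - q = f * k -> k / s' = - (d * / f)).
      { intros q k dd f s' Hf Hs' E1 E2. assert (EE : k = - (dd * / f) * s').
        { apply (Rmult_eq_reg_l f); [|lra]. rewrite <- E2. field_simplify; [|lra]. lra. }
        rewrite EE. field. split; [lra|auto]. }
      exact (T _ _ _ _ _ Hp Hs0 Hc3 Hb3). }
    rewrite QQ. apply Hd1. split; [|split].
    - change (Rabs (c - 0) < d1). rewrite Rminus_0_r. eapply Rle_lt_trans; [apply BT; auto|auto].
    - change (Rabs (s - 0) < d1). rewrite Rminus_0_r. auto.
    - change (Rabs (b - T0) < d1). eapply Rle_lt_trans; [apply BR; auto|auto]. }
  (* Bootstrap: [dtau] is of class k as soon as [tau] is. *)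
  assert (CK : forall k, Ck (W := RN) k N tau).
  { induction k as [|k IH].
    - split; auto.
    - split; auto. exists dtau. split; [exact DT|].
      assert (ON' := open_fst (V' := V) N ON).
      assert (CG : Ck (V := prod_NormedModule _ V V) (W := VR V) k (fun p => N (fst p)) (fun p => (fst p, tau (fst p)))).
      { apply (Ck_pair k (V := prod_NormedModule _ V V) (W := V) (Z := RN)).
        - apply Ck_linear, is_linear_fst.
        - apply (Ck_comp_linear k (V := prod_NormedModule _ V V) N fst tau); auto. apply is_linear_fst. }
      apply (Ck_ext k _ (fun p => (-1) * (dH ((fst p, tau (fst p)), (snd p, 0)) * / Ht (fst p, tau (fst p))))); auto.
      { intros p _. unfold dtau. assert (Q : forall q : R, -1 * q = - q) by (intros; ring). apply Q. }
      apply (Ck_mul k (V := prod_NormedModule _ V V)); auto; [apply (Ck_const k (W := RN))|].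
      apply (Ck_mul k (V := prod_NormedModule _ V V)); auto.
      + apply (Ck_comp k (V := prod_NormedModule _ V V) (W := prod_NormedModule _ (VR V) (VR V)) _ (fun q => U (fst q)) dH); auto.
        * apply (open_fst (V := VR V) (V' := VR V)), OU.
        * intros [x h] Hx. simpl. apply UT, Hx.
        * apply (Ck_pair k (V := prod_NormedModule _ V V) (W := VR V) (Z := VR V)); auto.
          apply (Ck_pair k (V := prod_NormedModule _ V V) (W := V) (Z := RN)).
          -- apply Ck_linear, is_linear_snd.
          -- apply (Ck_const k (W := RN)).
      + apply (Ck_comp k (V := prod_NormedModule _ V V) (W := RN) _ (fun x => x <> 0) Rinv); auto.
        * exact open_neq0.
        * intros [x h] Hx. apply Rgt_not_eq. apply HtT, Hx.
        * apply Ck_inv.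
        * apply (Ck_comp k (V := prod_NormedModule _ V V) (W := VR V) _ U Ht); auto. }
  exists tau. split; [|split; [|split]].
  - exists N. auto.
  - symmetry. apply UN; auto.
  - generalize (ON x0 N0). apply filter_imp. intros x Hx. apply Htau, Hx.
  - assert (L1 := continuous_fst (U := V) (V := RN) x0 t0 N (ON x0 N0)).
    assert (L2 : locally (T := VR V) (x0, t0) (fun q => Rabs (snd q - t0) < e)).
    { exists e. intros [y s] [_ Hs]. exact Hs. }
    unfold filtermap in L1.
    generalize (filter_and _ _ L1 L2). apply filter_imp. intros [x t] [A B] C. simpl in *. apply UN; auto.
Qed.

Lemma implicit_function {V : NM} (x0 : V) (t0 a : R) (H : V * R -> R) :
  sm (V := VR V) (W := RN) (x0, t0) H -> H (x0, t0) = 0 ->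
  is_derive (fun t => H (x0, t)) t0 a -> a <> 0 ->
  exists tau : V -> R, sm (W := RN) x0 tau /\ tau x0 = t0 /\
    locally x0 (fun x => H (x, tau x) = 0) /\
    locally (T := VR V) (x0, t0) (fun q => H q = 0 -> snd q = tau (fst q)).
Proof.
  intros HF H0 Ha pa. destruct (Rdichotomy _ _ pa) as [L|L].
  - destruct (implicit_function_pos x0 t0 (- a) (fun q => - H q)) as [tau [A [B [C D]]]].
    + apply (sm_opp (V := VR V)), HF.
    + rewrite H0. ring.
    + apply (is_derive_opp (K := R_AbsRing) (V := RN) (fun t => H (x0, t))), Ha.
    + lra.
    + exists tau. repeat split; auto.
      * generalize C. apply filter_imp. intros x Hx. lra.
      * generalize D. apply filter_imp. intros x Hx E. apply Hx. rewrite E. ring.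
  - apply (implicit_function_pos x0 t0 a H); auto.
Qed.

Lemma sm_id {V : NM} (x0 : V) : sm x0 (fun x : V => x).
Proof. apply sm_linear, is_linear_id. Qed.

(** Elimination: H2 is solved for t, then H1 for s. As H2 has zero s-derivative at the base point,
    so has its solution t, and the remaining equation keeps the slope [al]. This triangular case
    covers maps tangent to the identity and the equation of [lift_eq], whose linear part at the
    origin is twice the identity. *)
Lemma implicit_function2 {V : NM} (x0 : V) (a0 b0 al be : R) (H1 H2 : (V * R) * R -> R) :
  sm (V := VR (VR V)) (W := RN) ((x0, a0), b0) H1 ->
  sm (V := VR (VR V)) (W := RN) ((x0, a0), b0) H2 ->
  H1 ((x0, a0), b0) = 0 -> H2 ((x0, a0), b0) = 0 ->
  is_derive (fun s => H1 ((x0, s), b0)) a0 al -> al <> 0 ->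
  is_derive (fun s => H2 ((x0, s), b0)) a0 0 ->
  is_derive (fun t => H2 ((x0, a0), t)) b0 be -> be <> 0 ->
  exists s t : V -> R, sm (W := RN) x0 s /\ sm (W := RN) x0 t /\ s x0 = a0 /\ t x0 = b0 /\
    locally x0 (fun x => H1 ((x, s x), t x) = 0 /\ H2 ((x, s x), t x) = 0) /\
    locally (T := VR (VR V)) ((x0, a0), b0) (fun q => H1 q = 0 -> H2 q = 0 ->
      snd (fst q) = s (fst (fst q)) /\ snd q = t (fst (fst q))).
Proof.
  intros S1 S2 E1 E2 D11 Nal D21 D22 Nbe.
  destruct (implicit_function (V := VR V) (x0, a0) b0 be H2 S2 E2 D22 Nbe) as [tau [T1 [T2 [T3 T4]]]].
  assert (SG : forall H, sm (V := VR (VR V)) (W := RN) ((x0, a0), b0) H -> sm2 (a0, b0) (fun p => H ((x0, fst p), snd p))).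
  { intros H S. apply (sm_comp (V := RR) (W := VR (VR V)) (a0, b0) H (fun p => ((x0, fst p), snd p))); auto.
    apply (sm_pair (V := RR) (W := VR V) (Z := RN)); [|apply (sm_snd (V := RN) (W := RN))].
    apply (sm_pair (V := RR) (W := V) (Z := RN)); [apply sm_const|apply (sm_fst (V := RN) (W := RN))]. }
  assert (ST : exists l, is_derive (fun s => tau (x0, s)) a0 l).
  { destruct T1 as [U [OU [U0 HU]]]. destruct (HU 1%nat) as [_ [dT [A _]]].
    exists (dT ((x0, a0), (zero, 1))). apply (dir_der_second (V := V)). apply A, U0. }
  destruct ST as [l Dl].
  assert (CR : forall H, sm (V := VR (VR V)) (W := RN) ((x0, a0), b0) H ->
     is_derive (fun s => H ((x0, s), tau (x0, s))) a0
       (1 * du (fun p => H ((x0, fst p), snd p)) (a0, b0) + l * dv (fun p => H ((x0, fst p), snd p)) (a0, b0))).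
  { intros H S.
    assert (Q := is_derive_curve (fun p => H ((x0, fst p), snd p)) (fun s => s) (fun s => tau (x0, s)) a0 1 l).
    cbv beta in Q. rewrite T2 in Q. cbn [fst snd] in Q. apply Q; auto.
    apply (is_derive_id (K := R_AbsRing)). }
  assert (Du : forall H d, is_derive (fun s => H ((x0, s), b0)) a0 d -> du (fun p => H ((x0, fst p), snd p)) (a0, b0) = d).
  { intros H d Hd. apply is_derive_unique. exact Hd. }
  assert (Dv : forall H d, is_derive (fun s => H ((x0, a0), s)) b0 d -> dv (fun p => H ((x0, fst p), snd p)) (a0, b0) = d).
  { intros H d Hd. apply is_derive_unique. exact Hd. }
  (* [H2 ((x0, s), tau (x0, s))] vanishes for s near a0, and its derivative at a0 is l * be. *)
  assert (l0 : l = 0).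
  { assert (C := CR H2 S2). rewrite (Du _ _ D21), (Dv _ _ D22) in C.
    assert (Z : is_derive (fun s => H2 ((x0, s), tau (x0, s))) a0 0).
    { apply (is_derive_ext_loc (fun _ => 0)); [|apply (is_derive_const (K := R_AbsRing) (V := RN))].
      assert (P : continuous (U := VR V) (fun s : R => (x0, s)) a0).
      { apply (continuous_pair (V := R_UniformSpace) (W := V) (Z := RN)); [apply continuous_const|apply continuous_id]. }
      specialize (P _ T3). unfold filtermap in P. generalize P. apply filter_imp. intros s Hs. symmetry. exact Hs. }
    apply is_derive_unique in C. apply is_derive_unique in Z. rewrite Z in C.
    assert (Q : l * be = 0) by (revert C; intros C; transitivity (1 * 0 + l * be); [ring|symmetry; exact C]).
    apply Rmult_integral in Q. destruct Q; auto. contradiction. }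
  subst l.
  assert (SK : sm (V := VR V) (W := RN) (x0, a0) (fun p => H1 (p, tau p))).
  { apply (sm_comp (V := VR V) (W := VR (VR V)) (x0, a0) H1 (fun p => (p, tau p))).
    - rewrite T2. exact S1.
    - apply (sm_pair (V := VR V) (W := VR V) (Z := RN)); [apply sm_id|exact T1]. }
  destruct (implicit_function (V := V) x0 a0 al (fun p => H1 (p, tau p)) SK) as [sg [G1 [G2 [G3 G4]]]]; auto.
  { rewrite T2. exact E1. }
  { evar_last; [apply (CR H1 S1)|]. rewrite (Du _ _ D11).
    assert (Q : forall r d : R, 1 * r + 0 * d = r) by (intros; ring). apply Q. }
  assert (SP : sm (W := VR V) x0 (fun x => (x, sg x))).
  { apply (sm_pair (V := V) (W := V) (Z := RN)); [apply sm_id|exact G1]. }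
  exists sg, (fun x => tau (x, sg x)). split; [|split; [|split; [|split; [|split]]]]; auto.
  - apply (sm_comp (V := V) (W := VR V) x0 tau (fun x => (x, sg x))); auto. rewrite G2. exact T1.
  - rewrite G2. exact T2.
  - apply filter_and; auto.
    assert (C := sm_cont _ _ SP). cbv beta in C. unfold continuous in C. rewrite G2 in C. apply (C _ T3).
  - assert (C1 := continuous_fst (U := VR V) (V := RN) (x0, a0) b0 _ G4). unfold filtermap in C1.
    generalize (filter_and _ _ C1 T4). apply filter_imp.
    intros [p t] [A B] Z1 Z2. cbn [fst snd] in *. specialize (B Z2).
    assert (Z3 : H1 (p, tau p) = 0) by (rewrite <- B; exact Z1). specialize (A Z3).
    split; auto. rewrite <- A. rewrite <- surjective_pairing. exact B.
Qed.

(** * Map germs *)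

Lemma map_germ_sm phi : map_germ phi <->
  sm2 origin (fun p => fst (phi p)) /\ sm2 origin (fun p => snd (phi p)) /\ phi origin = origin.
Proof. unfold map_germ. rewrite !smooth_sm. tauto. Qed.

Lemma map_germ_pair phi : map_germ phi -> sm (V := RR) (W := RR) origin phi.
Proof.
  intros H. apply map_germ_sm in H. destruct H as [A [B _]].
  apply (sm_ext (V := RR) (W := RR) origin (fun p => (fst (phi p), snd (phi p)))).
  - intros x. symmetry. apply surjective_pairing.
  - apply (sm_pair (V := RR) (W := RN) (Z := RN)); auto.
Qed.

Lemma map_germ_cont phi : map_germ phi -> filterlim phi (locally origin) (locally origin).
Proof.
  intros H. assert (C := sm_cont _ _ (map_germ_pair phi H)). unfold continuous in C.
  destruct H as [_ [_ H]]. rewrite H in C. exact C.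
Qed.

Lemma near0_comp (P : R * R -> Prop) phi : map_germ phi -> near0 P -> near0 (fun p => P (phi p)).
Proof. intros H HP. apply (map_germ_cont phi H P HP). Qed.

Lemma sm_comp_germ (h : R * R -> R) phi : sm2 origin h -> map_germ phi -> sm2 origin (fun p => h (phi p)).
Proof.
  intros Hh Hp. apply (sm_comp (V := RR) (W := RR) origin h phi).
  - destruct Hp as [_ [_ E]]. rewrite E. exact Hh.
  - apply map_germ_pair, Hp.
Qed.

Lemma map_germ_comp phi psi : map_germ phi -> map_germ psi -> map_germ (fun p => phi (psi p)).
Proof.
  intros H1 H2. assert (H2' := H2). apply map_germ_sm in H1. apply map_germ_sm.
  destruct H1 as [A [B C]]. destruct H2' as [_ [_ E]]. repeat split.
  - apply (sm_comp_germ (fun p => fst (phi p))); auto.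
  - apply (sm_comp_germ (fun p => snd (phi p))); auto.
  - rewrite E. exact C.
Qed.

Lemma map_germ_id : map_germ (fun p => p).
Proof.
  apply map_germ_sm. repeat split; [apply (sm_fst (V := RN) (W := RN))|apply (sm_snd (V := RN) (W := RN))].
Qed.

Lemma diffeo_id : diffeo_germ (fun p => p).
Proof.
  split; [apply map_germ_id|]. exists (fun p => p). split; [apply map_germ_id|].
  split; apply filter_forall; auto.
Qed.

Lemma diffeo_comp phi psi : diffeo_germ phi -> diffeo_germ psi -> diffeo_germ (fun p => phi (psi p)).
Proof.
  intros [A [phi' [A1 [A2 A3]]]] [B [psi' [B1 [B2 B3]]]]. split; [apply map_germ_comp; auto|].
  exists (fun p => psi' (phi' p)). split; [apply map_germ_comp; auto|]. split.
  - generalize (filter_and _ _ B2 (near0_comp _ psi B A2)). apply filter_imp.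
    intros p [E1 E2]. rewrite E2. exact E1.
  - generalize (filter_and _ _ A3 (near0_comp _ phi' A1 B3)). apply filter_imp.
    intros p [E1 E2]. rewrite E2. exact E1.
Qed.

Lemma diffeo_inverse phi : diffeo_germ phi -> exists psi, diffeo_germ psi /\
  near0 (fun p => psi (phi p) = p) /\ near0 (fun p => phi (psi p) = p).
Proof.
  intros [A [psi [B [C D]]]]. exists psi. repeat split; auto; try apply B.
  exists phi. auto.
Qed.

Lemma A_equivalent_sym f g : map_germ f -> map_germ g -> A_equivalent f g -> A_equivalent g f.
Proof.
  intros Hf Hg [phi [Phi [H1 [H2 E]]]].
  destruct (diffeo_inverse _ H1) as [phi' [P1 [P2 P3]]].
  destruct (diffeo_inverse _ H2) as [Phi' [Q1 [Q2 Q3]]].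
  exists phi', Phi'. repeat split; try apply P1; try apply Q1.
  assert (P1' : map_germ phi') by apply P1.
  generalize (filter_and _ _ (near0_comp _ phi' P1' E) (filter_and _ _ P3
     (near0_comp _ (fun p => f (phi' p)) (map_germ_comp _ _ Hf P1') Q2))).
  apply filter_imp. intros p [E1 [E2 E3]]. rewrite E2 in E1. rewrite <- E1. exact E3.
Qed.

Lemma A_equivalent_trans f g h : map_germ f -> A_equivalent f g -> A_equivalent g h -> A_equivalent f h.
Proof.
  intros Hf [phi [Phi [H1 [H2 E]]]] [phi' [Phi' [H1' [H2' E']]]].
  exists (fun p => phi' (phi p)), (fun p => Phi' (Phi p)).
  split; [apply diffeo_comp; auto|]. split; [apply diffeo_comp; auto|].
  assert (M : map_germ phi) by apply H1.
  generalize (filter_and _ _ E (near0_comp _ phi M E')). apply filter_imp.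
  intros p [E1 E2]. rewrite E1. exact E2.
Qed.

Lemma A_equivalent_target f Phi : diffeo_germ Phi -> A_equivalent f (fun p => Phi (f p)).
Proof.
  intros H. exists (fun p => p), Phi. split; [apply diffeo_id|]. split; auto. apply filter_forall; auto.
Qed.

Lemma A_equivalent_source f phi : map_germ f -> diffeo_germ phi -> A_equivalent f (fun p => f (phi p)).
Proof.
  intros Hf H. destruct (diffeo_inverse _ H) as [psi [P1 [P2 P3]]].
  exists psi, (fun p => p). split; auto. split; [apply diffeo_id|].
  generalize P3. apply filter_imp. intros p E. rewrite E. reflexivity.
Qed.

(** Solving phi (s, t) = (X, Y) for (s, t): existence gives the right inverse, local uniqueness the
    left one. The identity differential is enough, since linear changes of coordinates are inverted
    by explicit formulas. *)
Lemma inverse_function phi : map_germ phi ->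
  du (fun p => fst (phi p)) origin = 1 -> dv (fun p => fst (phi p)) origin = 0 ->
  du (fun p => snd (phi p)) origin = 0 -> dv (fun p => snd (phi p)) origin = 1 ->
  diffeo_germ phi.
Proof.
  intros Hm D1 D2 D3 D4. split; auto.
  assert (Hm' := Hm). apply map_germ_sm in Hm'. destruct Hm' as [S1 [S2 E0]].
  set (PP := fun q : (R * R * R) * R => (snd (fst q), snd q)).
  assert (SP : sm (V := VR (VR RR)) (W := RR) ((origin, 0), 0) PP).
  { apply (sm_pair (V := VR (VR RR)) (W := RN) (Z := RN)).
    - apply sm_linear. apply (is_linear_comp (U := VR (VR RR)) (V := VR RR) (W := RN) fst snd); [apply is_linear_fst|apply is_linear_snd].
    - apply sm_linear. apply is_linear_snd. }
  assert (SX : sm (V := VR (VR RR)) (W := RN) ((origin, 0), 0) (fun q => fst (fst (fst q)))).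
  { apply sm_linear. apply (is_linear_comp (U := VR (VR RR)) (V := RR) (W := RN) (fun q => fst (fst q)) fst); [|apply is_linear_fst].
    apply (is_linear_comp (U := VR (VR RR)) (V := VR RR) (W := RR) fst fst); apply is_linear_fst. }
  assert (SY : sm (V := VR (VR RR)) (W := RN) ((origin, 0), 0) (fun q => snd (fst (fst q)))).
  { apply sm_linear. apply (is_linear_comp (U := VR (VR RR)) (V := RR) (W := RN) (fun q => fst (fst q)) snd); [|apply is_linear_snd].
    apply (is_linear_comp (U := VR (VR RR)) (V := VR RR) (W := RR) fst fst); apply is_linear_fst. }
  destruct (implicit_function2 (V := RR) origin 0 0 1 1
     (fun q => fst (phi (snd (fst q), snd q)) - fst (fst (fst q)))
     (fun q => snd (phi (snd (fst q), snd q)) - snd (fst (fst q)))) as [s [t [A1 [A2 [A3 [A4 [A5 A6]]]]]]].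
  - apply (sm_minus (V := VR (VR RR))); auto.
    apply (sm_comp (V := VR (VR RR)) (W := RR) _ (fun p => fst (phi p)) PP); auto.
  - apply (sm_minus (V := VR (VR RR))); auto.
    apply (sm_comp (V := VR (VR RR)) (W := RR) _ (fun p => snd (phi p)) PP); auto.
  - cbn [fst snd]. fold origin. rewrite E0. simpl. ring.
  - cbn [fst snd]. fold origin. rewrite E0. simpl. ring.
  - cbn [fst snd]. evar_last.
    + apply (is_derive_minus (K := R_AbsRing) (V := RN) (fun s => fst (phi (s, 0))) (fun _ => fst origin)).
      * apply (du_correct origin (fun p => fst (phi p)) S1).
      * apply (is_derive_const (K := R_AbsRing) (V := RN)).
    + exact (eq_trans (f_equal (fun r => r - 0) D1) (Rminus_0_r 1)).
  - lra.
  - cbn [fst snd]. evar_last.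
    + apply (is_derive_minus (K := R_AbsRing) (V := RN) (fun s => snd (phi (s, 0))) (fun _ => snd origin)).
      * apply (du_correct origin (fun p => snd (phi p)) S2).
      * apply (is_derive_const (K := R_AbsRing) (V := RN)).
    + exact (eq_trans (f_equal (fun r => r - 0) D3) (Rminus_0_r 0)).
  - cbn [fst snd]. evar_last.
    + apply (is_derive_minus (K := R_AbsRing) (V := RN) (fun s => snd (phi (0, s))) (fun _ => snd origin)).
      * apply (dv_correct origin (fun p => snd (phi p)) S2).
      * apply (is_derive_const (K := R_AbsRing) (V := RN)).
    + exact (eq_trans (f_equal (fun r => r - 0) D4) (Rminus_0_r 1)).
  - lra.
  - exists (fun p => (s p, t p)). split; [|split].
    + apply map_germ_sm. split; [exact A1|split; [exact A2|]].
      cbv beta. rewrite A3, A4. reflexivity.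
    + assert (C : continuous (U := VR (VR RR)) (fun p : R * R => ((phi p, fst p), snd p)) origin).
      { apply (sm_cont (V := RR) (W := VR (VR RR))).
        apply (sm_pair (V := RR) (W := VR RR) (Z := RN)); [|apply (sm_snd (V := RN) (W := RN))].
        apply (sm_pair (V := RR) (W := RR) (Z := RN)); [|apply (sm_fst (V := RN) (W := RN))].
        apply map_germ_pair, Hm. }
      unfold continuous in C. cbv beta in C. rewrite E0 in C. cbn [fst snd origin] in C. fold origin in C.
      specialize (C _ A6). unfold near0. unfold filtermap in C. generalize C. apply filter_imp.
      intros [x y] Hq. cbn [fst snd] in Hq. destruct Hq as [Q1 Q2]; [apply Rminus_diag|apply Rminus_diag|].
      rewrite <- Q1, <- Q2. reflexivity.
    + unfold near0. generalize A5. apply filter_imp. intros [X Y] [Q1 Q2]. cbn [fst snd] in *.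
      rewrite (surjective_pairing (phi _)).
      exact (f_equal2 (fun a b : R => (a, b)) (Rminus_diag_uniq _ _ Q1) (Rminus_diag_uniq _ _ Q2)).
Qed.

(** * The ring of smooth germs *)

Definition gs (h : R * R -> R) : Prop := sm2 origin h.

Lemma gs_const c : gs (fun _ => c).
Proof. apply (sm_const (V := RR) (W := RN)). Qed.
Lemma gs_u : gs (fun p => fst p).
Proof. apply (sm_fst (V := RN) (W := RN)). Qed.
Lemma gs_v : gs (fun p => snd p).
Proof. apply (sm_snd (V := RN) (W := RN)). Qed.
Lemma gs_plus a b : gs a -> gs b -> gs (fun p => a p + b p).
Proof. apply (sm_plus (V := RR)). Qed.
Lemma gs_minus a b : gs a -> gs b -> gs (fun p => a p - b p).
Proof. apply (sm_minus (V := RR)). Qed.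
Lemma gs_mult a b : gs a -> gs b -> gs (fun p => a p * b p).
Proof. apply (sm_mult (V := RR)). Qed.
Lemma gs_opp a : gs a -> gs (fun p => - a p).
Proof. apply (sm_opp (V := RR)). Qed.
Lemma gs_pow a n : gs a -> gs (fun p => a p ^ n).
Proof. apply (sm_pow (V := RR)). Qed.
Lemma gs_inv a : a origin <> 0 -> gs a -> gs (fun p => / a p).
Proof. apply (sm_inv (V := RR)). Qed.
Lemma gs_div a b : b origin <> 0 -> gs a -> gs b -> gs (fun p => a p / b p).
Proof. apply (sm_div (V := RR)). Qed.
Lemma gs_sqrt a : 0 < a origin -> gs a -> gs (fun p => sqrt (a p)).
Proof. apply (sm_sqrt (V := RR)). Qed.
Lemma gs_ext a b : near0 (fun p => a p = b p) -> gs a -> gs b.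
Proof. apply (sm_ext_loc (V := RR) (W := RN)). Qed.
Lemma gs_comp h phi : gs h -> map_germ phi -> gs (fun p => h (phi p)).
Proof. apply sm_comp_germ. Qed.
Lemma gs_du h : gs h -> gs (du h).
Proof. apply sm_du. Qed.
Lemma gs_dv h : gs h -> gs (dv h).
Proof. apply sm_dv. Qed.
Lemma gs_near h : gs h -> near0 (fun p => sm2 p h).
Proof. apply (sm_near (V := RR) (W := RN)). Qed.
Lemma gs_smooth h : gs h <-> smooth h.
Proof. symmetry. apply smooth_sm. Qed.
Lemma gs_cont h : gs h -> continuous (T := RR) (U := RN) h origin.
Proof. apply (sm_cont (V := RR) (W := RN)). Qed.

Lemma germ_gs phi : map_germ phi <-> gs (fun p => fst (phi p)) /\ gs (fun p => snd (phi p)) /\ phi origin = origin.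
Proof. apply map_germ_sm. Qed.

Lemma germ_pair a b : gs a -> gs b -> a origin = 0 -> b origin = 0 -> map_germ (fun p => (a p, b p)).
Proof. intros Ha Hb A B. apply germ_gs. cbn [fst snd]. rewrite A, B. auto. Qed.

Lemma gs_pos_near h : gs h -> 0 < h origin -> near0 (fun p => 0 < h p).
Proof. intros Hh H0. apply (gs_cont h Hh (fun y => 0 < y)). apply (open_gt 0), H0. Qed.

Lemma gs_neq_near h : gs h -> h origin <> 0 -> near0 (fun p => h p <> 0).
Proof. intros Hh H0. apply (gs_cont h Hh (fun y => y <> 0)). apply open_neq0, H0. Qed.

Lemma near_all (P : R * R -> Prop) : (forall p, P p) -> near0 P.
Proof. intros H; apply filter_forall; auto. Qed.
Lemma near1 (P Q : R * R -> Prop) : near0 P -> (forall p, P p -> Q p) -> near0 Q.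
Proof. intros H I; unfold near0 in *; generalize H; apply filter_imp; auto. Qed.
Lemma near_and (P Q : R * R -> Prop) : near0 P -> near0 Q -> near0 (fun p => P p /\ Q p).
Proof. intros H I; apply filter_and; auto. Qed.
Lemma near2 (P Q S : R * R -> Prop) : near0 P -> near0 Q -> (forall p, P p -> Q p -> S p) -> near0 S.
Proof. intros H I J; apply (near1 _ _ (near_and _ _ H I)). intros p [A B]; auto. Qed.
Lemma near3 (P Q S T : R * R -> Prop) : near0 P -> near0 Q -> near0 S ->
  (forall p, P p -> Q p -> S p -> T p) -> near0 T.
Proof. intros H I K J; apply (near2 _ _ _ (near_and _ _ H I) K). intros p [A B]; auto. Qed.
Lemma near4 (P Q S T X : R * R -> Prop) : near0 P -> near0 Q -> near0 S -> near0 T ->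
  (forall p, P p -> Q p -> S p -> T p -> X p) -> near0 X.
Proof. intros H I K L J; apply (near3 _ _ _ _ (near_and _ _ H I) K L). intros p [A B]; auto. Qed.
Lemma near_at0 (P : R * R -> Prop) : near0 P -> P origin.
Proof. intros H; apply (locally_singleton (T := RR) origin P H). Qed.
Lemma near_near (P : R * R -> Prop) : near0 P -> near0 (fun p => locally (T := RR) p P).
Proof. intros H. apply (locally_locally (T := RR)), H. Qed.

Create HintDb gsdb.
#[export] Hint Resolve gs_const gs_u gs_v gs_plus gs_minus gs_mult gs_opp gs_pow gs_du gs_dv : gsdb.
Ltac gsm := auto 30 with gsdb.

(** * Hadamard's lemma for germs *)

Lemma hadamard_v h : gs h -> near0 (fun p => h (fst p, 0) = 0) ->
  exists k, gs k /\ near0 (fun p => h p = snd p * k p).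
Proof.
  intros Hh HZ.
  assert (Z : locally (T := RN) 0 (fun x : R => h (x, 0) = 0)).
  { assert (C : filterlim (fun x : R => (x, 0) : RR) (locally (T := RN) 0) (locally (T := RR) origin)).
    { apply (continuous_pair (V := RN) (W := RN) (Z := RN)); [apply continuous_id|apply continuous_const]. }
    apply (C _ HZ). }
  destruct (hadamard_param (V := RN) 0 h Hh Z) as [K [K1 K2]].
  exists K. split; auto.
Qed.

Definition swap (p : R * R) : R * R := (snd p, fst p).

Lemma swap_germ : map_germ swap.
Proof. apply germ_pair; gsm. Qed.

Lemma swap_swap p : swap (swap p) = p.
Proof. destruct p; reflexivity. Qed.

Lemma hadamard_u h : gs h -> near0 (fun p => h (0, snd p) = 0) ->
  exists k, gs k /\ near0 (fun p => h p = fst p * k p).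
Proof.
  intros Hh HZ. destruct (hadamard_v (fun p => h (swap p))) as [k [K1 K2]].
  - apply gs_comp; auto. apply swap_germ.
  - apply (near1 _ _ (near0_comp _ swap swap_germ HZ)). intros p. simpl. auto.
  - exists (fun p => k (swap p)). split; [apply gs_comp; auto; apply swap_germ|].
    apply (near1 _ _ (near0_comp _ swap swap_germ K2)). intros p E. rewrite swap_swap in E. exact E.
Qed.

Lemma hadamard h : gs h -> h origin = 0 ->
  exists a b, gs a /\ gs b /\ near0 (fun p => h p = fst p * a p + snd p * b p).
Proof.
  intros Hh H0.
  assert (G : map_germ (fun p => (fst p, 0))) by (apply germ_pair; gsm).
  assert (Hh' : gs (fun p => h (fst p, 0))) by (apply (gs_comp h _ Hh G)).
  destruct (hadamard_v (fun p => h p - h (fst p, 0))) as [b [B1 B2]]; gsm.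
  { apply near_all. intros p. simpl. ring. }
  destruct (hadamard_u (fun p => h (fst p, 0))) as [a [A1 A2]]; gsm.
  { apply near_all. intros p. exact H0. }
  exists a, b. repeat split; auto. apply (near2 _ _ _ A2 B2). intros p E1 E2. lra.
Qed.

(** Hadamard's lemma for t -> H (psi + t k) with the point p as parameter, followed by the
    substitution t = n p. It shows that changing the argument by multiples of n changes the value by
    a multiple of n. *)
Lemma hadamard_increment H psi k1 k2 n : gs H -> map_germ psi -> gs k1 -> gs k2 -> gs n -> n origin = 0 ->
  exists m, gs m /\ near0 (fun p => H (fst (psi p) + n p * k1 p, snd (psi p) + n p * k2 p) = H (psi p) + n p * m p).
Proof.
  intros HH Hp H1 H2 Hn N0. assert (Hp' := Hp). apply germ_gs in Hp'. destruct Hp' as [P1 [P2 P0]].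
  assert (F1 : forall g, gs g -> sm (V := VR RR) (W := RN) (origin, 0) (fun q => g (fst q))).
  { intros g Hg. apply (sm_comp (V := VR RR) (W := RR) (origin, 0) g fst); auto. apply (sm_fst (V := RR) (W := RN)). }
  assert (T : sm (V := VR RR) (W := RN) (origin, 0) (fun q => snd q)) by apply (sm_snd (V := RR) (W := RN)).
  destruct (hadamard_param (V := RR) origin
    (fun q => H (fst (psi (fst q)) + snd q * k1 (fst q), snd (psi (fst q)) + snd q * k2 (fst q)) - H (psi (fst q)))) as [K [K1 K2]].
  - apply (sm_minus (V := VR RR)).
    + apply (sm_comp (V := VR RR) (W := RR) (origin, 0) H (fun q => (fst (psi (fst q)) + snd q * k1 (fst q), snd (psi (fst q)) + snd q * k2 (fst q)))).
      * cbn [fst snd]. rewrite P0. cbn [fst snd origin].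
        assert (E0 : forall a b : R, (0 + 0 * a, 0 + 0 * b) = origin) by (intros; unfold origin; f_equal; ring).
        exact (eq_ind_r (fun q => sm2 q H) HH (E0 _ _)).
      * apply (sm_pair (V := VR RR) (W := RN) (Z := RN)).
        -- apply (sm_plus (V := VR RR)); [apply (F1 _ P1)|]. apply (sm_mult (V := VR RR)); auto.
        -- apply (sm_plus (V := VR RR)); [apply (F1 _ P2)|]. apply (sm_mult (V := VR RR)); auto.
    + apply (F1 (fun p => H (psi p))). apply gs_comp; auto.
  - apply filter_forall. intros p. cbn [fst snd]. rewrite !Rmult_0_l, !Rplus_0_r, <- surjective_pairing.
    apply Rminus_diag.
  - assert (C : continuous (U := VR RR) (fun p : R * R => (p, n p)) origin).
    { apply (sm_cont (V := RR) (W := VR RR)). apply (sm_pair (V := RR) (W := RR) (Z := RN)); [apply sm_id|exact Hn]. }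
    exists (fun p => K (p, n p)). split.
    + apply (sm_comp (V := RR) (W := VR RR) origin K (fun p => (p, n p))).
      * rewrite N0. exact K1.
      * apply (sm_pair (V := RR) (W := RR) (Z := RN)); [apply sm_id|exact Hn].
    + unfold continuous in C. cbv beta in C. rewrite N0 in C. specialize (C _ K2). unfold filtermap in C.
      apply (near1 _ _ C). intros p E. cbn [fst snd] in E.
      assert (Q : forall a b c : R, a - b = c -> a = b + c) by (intros; lra). exact (Q _ _ _ E).
Qed.

(* [M n] is the n-th power of the maximal ideal of the ring of smooth germs. *)
Fixpoint M (n : nat) (h : R * R -> R) : Prop :=
  match n with
  | O => gs h
  | S m => exists a b, M m a /\ M m b /\ near0 (fun p => h p = fst p * a p + snd p * b p)
  end.

Lemma M_gs n : forall h, M n h -> gs h.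
Proof.
  induction n as [|n IH]; intros h; simpl; auto.
  intros [a [b [Ha [Hb E]]]]. apply (gs_ext (fun p => fst p * a p + snd p * b p)).
  - apply (near1 _ _ E). intros p Ep; rewrite Ep; reflexivity.
  - apply IH in Ha. apply IH in Hb. gsm.
Qed.

Lemma M_ext n h k : near0 (fun p => h p = k p) -> M n h -> M n k.
Proof.
  intros E. destruct n; simpl; [apply gs_ext, E|].
  intros [a [b [Ha [Hb E']]]]. exists a, b. repeat split; auto.
  apply (near2 _ _ _ E E'). intros p E1 E2. congruence.
Qed.

Lemma M_eq n h k : (forall p, h p = k p) -> M n h -> M n k.
Proof. intros E. apply M_ext, near_all, E. Qed.

Lemma M_S n : forall h, M (S n) h -> M n h.
Proof.
  induction n as [|n IH]; intros h Hh.
  - apply (M_gs 1), Hh.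
  - destruct Hh as [a [b [Ha [Hb E]]]]. exists a, b. auto.
Qed.

Lemma M_le n m h : (n <= m)%nat -> M m h -> M n h.
Proof. induction 1; auto. intros H1. apply IHle, M_S, H1. Qed.

Lemma M_0 n : M n (fun _ => 0).
Proof.
  induction n; [apply gs_const|]. exists (fun _ => 0), (fun _ => 0). repeat split; auto.
  apply near_all. intros; ring.
Qed.

Lemma M_plus n : forall h k, M n h -> M n k -> M n (fun p => h p + k p).
Proof.
  induction n as [|n IH]; intros h k; [simpl; gsm|].
  intros [a [b [Ha [Hb E]]]] [a' [b' [Ha' [Hb' E']]]].
  exists (fun p => a p + a' p), (fun p => b p + b' p). repeat split; auto.
  apply (near2 _ _ _ E E'). intros p E1 E2. rewrite E1, E2. ring.
Qed.

Lemma M_mul_gs n : forall h k, M n h -> gs k -> M n (fun p => h p * k p).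
Proof.
  induction n as [|n IH]; intros h k; [simpl; gsm|].
  intros [a [b [Ha [Hb E]]]] Hk.
  exists (fun p => a p * k p), (fun p => b p * k p). repeat split; auto.
  apply (near1 _ _ E). intros p E1. rewrite E1. ring.
Qed.

Lemma M_mult n : forall m h k, M n h -> M m k -> M (n + m) (fun p => h p * k p).
Proof.
  induction n as [|n IH]; intros m h k Hh Hk.
  - apply (M_eq m (fun p => k p * h p)); [intros; ring|]. apply M_mul_gs; auto.
  - destruct Hh as [a [b [Ha [Hb E]]]].
    exists (fun p => a p * k p), (fun p => b p * k p). repeat split; [apply (IH m); auto|apply (IH m); auto|].
    apply (near1 _ _ E). intros p E1. rewrite E1. ring.
Qed.

Lemma M_opp n h : M n h -> M n (fun p => - h p).
Proof.
  intros H. apply (M_eq n (fun p => h p * (-1))); [intros; ring|]. apply M_mul_gs; auto. apply gs_const.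
Qed.

Lemma M_minus n h k : M n h -> M n k -> M n (fun p => h p - k p).
Proof. intros H K. apply M_plus; auto. apply M_opp; auto. Qed.

Lemma M_u : M 1 (fun p => fst p).
Proof. exists (fun _ => 1), (fun _ => 0). repeat split; try apply gs_const. apply near_all; intros; ring. Qed.
Lemma M_v : M 1 (fun p => snd p).
Proof. exists (fun _ => 0), (fun _ => 1). repeat split; try apply gs_const. apply near_all; intros; ring. Qed.

Lemma M_1 h : M 1 h <-> gs h /\ h origin = 0.
Proof.
  split.
  - intros H. split; [apply (M_gs 1), H|]. destruct H as [a [b [_ [_ E]]]].
    apply near_at0 in E. rewrite E. simpl. ring.
  - intros [H H0]. apply hadamard; auto.
Qed.

Lemma M_at0 n h : M (S n) h -> h origin = 0.
Proof. intros H. apply M_1. apply (M_le 1 (S n)); auto. lia. Qed.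

Lemma M_comp n phi : map_germ phi -> forall h, M n h -> M n (fun p => h (phi p)).
Proof.
  intros Hp. assert (Hp' := Hp). apply germ_gs in Hp'. destruct Hp' as [P1 [P2 P0]].
  induction n as [|n IH]; intros h Hh; [apply gs_comp; auto|].
  destruct Hh as [a [b [Ha [Hb E]]]].
  apply (M_ext (S n) (fun p => fst (phi p) * a (phi p) + snd (phi p) * b (phi p))).
  { apply (near1 _ _ (near0_comp _ phi Hp E)). intros p Ep. rewrite Ep. reflexivity. }
  apply M_plus.
  - apply (M_mult 1 n (fun p => fst (phi p)) (fun p => a (phi p))); auto. apply M_1. rewrite P0. auto.
  - apply (M_mult 1 n (fun p => snd (phi p)) (fun p => b (phi p))); auto. apply M_1. rewrite P0. auto.
Qed.

Lemma du_ext h k p : locally (T := RR) p (fun q => h q = k q) -> du h p = du k p.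
Proof.
  intros [d Hd]. unfold du. apply Derive_ext_loc. exists d. intros x Hx.
  apply (Hd (x, snd p)). split; [exact Hx|apply ball_center].
Qed.
Lemma dv_ext h k p : locally (T := RR) p (fun q => h q = k q) -> dv h p = dv k p.
Proof.
  intros [d Hd]. unfold dv. apply Derive_ext_loc. exists d. intros x Hx.
  apply (Hd (fst p, x)). split; [apply ball_center|exact Hx].
Qed.
Lemma du_near h k : near0 (fun q => h q = k q) -> near0 (fun p => du h p = du k p).
Proof. intros H. apply (near1 _ _ (near_near _ H)). intros p; apply du_ext. Qed.
Lemma dv_near h k : near0 (fun q => h q = k q) -> near0 (fun p => dv h p = dv k p).
Proof. intros H. apply (near1 _ _ (near_near _ H)). intros p; apply dv_ext. Qed.

Lemma ex_du h p : sm2 p h -> ex_derive (fun u => h (u, snd p)) (fst p).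
Proof. intros H; eexists; apply du_correct, H. Qed.
Lemma ex_dv h p : sm2 p h -> ex_derive (fun v => h (fst p, v)) (snd p).
Proof. intros H; eexists; apply dv_correct, H. Qed.

Lemma du_plus h k p : sm2 p h -> sm2 p k -> du (fun q => h q + k q) p = du h p + du k p.
Proof. intros; unfold du; apply Derive_plus; apply ex_du; auto. Qed.
Lemma dv_plus h k p : sm2 p h -> sm2 p k -> dv (fun q => h q + k q) p = dv h p + dv k p.
Proof. intros; unfold dv; apply Derive_plus; apply ex_dv; auto. Qed.
Lemma du_mult h k p : sm2 p h -> sm2 p k -> du (fun q => h q * k q) p = du h p * k p + h p * du k p.
Proof.
  intros; unfold du; rewrite (Derive_mult (fun u => h (u, snd p)) (fun u => k (u, snd p))); try apply ex_du; auto.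
  rewrite <- surjective_pairing; reflexivity.
Qed.
Lemma dv_mult h k p : sm2 p h -> sm2 p k -> dv (fun q => h q * k q) p = dv h p * k p + h p * dv k p.
Proof.
  intros; unfold dv; rewrite (Derive_mult (fun v => h (fst p, v)) (fun v => k (fst p, v))); try apply ex_dv; auto.
  rewrite <- surjective_pairing; reflexivity.
Qed.
Lemma du_const c p : du (fun _ => c) p = 0.
Proof. unfold du; apply Derive_const. Qed.
Lemma dv_const c p : dv (fun _ => c) p = 0.
Proof. unfold dv; apply Derive_const. Qed.
Lemma du_u p : du (fun q => fst q) p = 1.
Proof. exact (Derive_id (fst p)). Qed.
Lemma du_v p : du (fun q => snd q) p = 0.
Proof. exact (Derive_const (snd p) (fst p)). Qed.
Lemma dv_u p : dv (fun q => fst q) p = 0.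
Proof. exact (Derive_const (fst p) (snd p)). Qed.
Lemma dv_v p : dv (fun q => snd q) p = 1.
Proof. exact (Derive_id (snd p)). Qed.

Lemma sm2_u p : sm2 p (fun q => fst q).
Proof. apply (sm_fst (V := RN) (W := RN)). Qed.
Lemma sm2_v p : sm2 p (fun q => snd q).
Proof. apply (sm_snd (V := RN) (W := RN)). Qed.

Lemma M_du n : forall h, M (S n) h -> M n (du h).
Proof.
  induction n as [|n IH]; intros h Hh.
  - simpl. apply gs_du. apply (M_gs 1), Hh.
  - destruct Hh as [a [b [Ha [Hb E]]]].
    apply (M_ext (S n) (fun p => (a p + fst p * du a p) + snd p * du b p)).
    + apply (near3 _ _ _ _ (du_near _ _ E) (gs_near a (M_gs _ _ Ha)) (gs_near b (M_gs _ _ Hb))).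
      intros p E1 Sa Sb. rewrite E1.
      rewrite du_plus, !du_mult, du_u, du_v; auto using sm2_u, sm2_v; [ring| |];
        apply (sm_mult (V := RR)); auto using sm2_u, sm2_v.
    + apply M_plus; [apply M_plus; auto|].
      * apply (M_mult 1 n (fun p => fst p) (du a)); auto. apply M_u.
      * apply (M_mult 1 n (fun p => snd p) (du b)); auto. apply M_v.
Qed.

Lemma M_dv n : forall h, M (S n) h -> M n (dv h).
Proof.
  induction n as [|n IH]; intros h Hh.
  - simpl. apply gs_dv. apply (M_gs 1), Hh.
  - destruct Hh as [a [b [Ha [Hb E]]]].
    apply (M_ext (S n) (fun p => (b p + fst p * dv a p) + snd p * dv b p)).
    + apply (near3 _ _ _ _ (dv_near _ _ E) (gs_near a (M_gs _ _ Ha)) (gs_near b (M_gs _ _ Hb))).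
      intros p E1 Sa Sb. rewrite E1.
      rewrite dv_plus, !dv_mult, dv_u, dv_v; auto using sm2_u, sm2_v; [ring| |];
        apply (sm_mult (V := RR)); auto using sm2_u, sm2_v.
    + apply M_plus; [apply M_plus; auto|].
      * apply (M_mult 1 n (fun p => fst p) (dv a)); auto. apply M_u.
      * apply (M_mult 1 n (fun p => snd p) (dv b)); auto. apply M_v.
Qed.

(** * Borel's theorem *)

Notation sm1 := (sm (V := RN) (W := RN)).

(** Closure under both partial derivatives replaces an explicit computation of higher derivatives.
    It is applied to all mixed derivatives of a series and to the functions obtained by substituting
    a square root. *)
Lemma Ck_coind (U : RR -> Prop) (Cl : (R * R -> R) -> Prop) : open U ->
  (forall F, Cl F -> (forall p, U p -> continuous (T := RR) (U := RN) F p) /\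
    exists Fu Fv, Cl Fu /\ Cl Fv /\
      (forall p, U p -> is_derive (fun u => F (u, snd p)) (fst p) (Fu p)) /\
      (forall p, U p -> is_derive (fun v => F (fst p, v)) (snd p) (Fv p))) ->
  forall k F, Cl F -> Ck (V := RR) (W := RN) k U F.
Proof.
  intros HU H. induction k as [|k IH]; intros F HF; destruct (H F HF) as [C [Fu [Fv [Cu [Cv [Du Dv]]]]]].
  - split; auto.
  - split; auto.
    exists (fun q => fst (snd q) * Fu (fst q) + snd (snd q) * Fv (fst q)). split.
    + intros p [a b] Hp. apply dir_der_partials; auto.
      * generalize (HU p Hp). apply filter_imp. intros q Hq. apply Du, Hq.
      * apply (Ck_cont k U); auto.
    + assert (O := open_fst (V := RR) (V' := RR) U HU).
      apply (Ck_add k (V := prod_NormedModule _ RR RR)); auto; apply (Ck_mul k (V := prod_NormedModule _ RR RR)); auto.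
      * apply Ck_linear.
        apply (is_linear_comp (U := prod_NormedModule _ RR RR) (V := RR) (W := RN) snd fst); [apply is_linear_snd|apply is_linear_fst].
      * apply (Ck_comp_linear k (V := prod_NormedModule _ RR RR) (V' := RR) U fst Fu); auto. apply is_linear_fst.
      * apply Ck_linear.
        apply (is_linear_comp (U := prod_NormedModule _ RR RR) (V := RR) (W := RN) snd snd); apply is_linear_snd.
      * apply (Ck_comp_linear k (V := prod_NormedModule _ RR RR) (V' := RR) U fst Fv); auto. apply is_linear_fst.
Qed.

Lemma dir_der_1 (f : R -> R) x l : dir_der (V := RN) (W := RN) f x 1 l <-> is_derive f x l.
Proof.
  unfold dir_der. split; intros D.
  - apply (is_derive_ext (fun z : R => f (x + (z - x) * 1))).
    { intros z. assert (Q : forall a b : R, a + (b - a) * 1 = b) by (intros; ring). rewrite Q. reflexivity. }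
    evar_last.
    + apply (is_derive_comp (fun s : R => f (x + s * 1) : RN) (fun z : R => z - x)).
      * rewrite Rminus_diag. exact D.
      * auto_derive; auto.
    + exact (scal_one _).
  - evar_last.
    + apply (is_derive_comp f (fun s : R => x + s * 1)).
      * assert (Q : forall a : R, a + 0 * 1 = a) by (intros; ring). rewrite Q. exact D.
      * assert (Q : forall a : R, is_derive (fun s : R => a + s * 1) 0 1) by (intros; auto_derive; auto; ring). apply Q.
    + exact (scal_one _).
Qed.

Lemma sm1_Derive x f : sm1 x f -> is_derive f x (Derive f x) /\ sm1 x (Derive f).
Proof.
  intros [U [HU [H0 H]]]. destruct (Ck_all_derivative U f HU H) as [dF [H1 H2]].
  assert (E : forall y, U y -> is_derive f y (dF (y, 1))).
  { intros y Hy. apply dir_der_1. apply H1, Hy. }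
  assert (E' : forall y, U y -> dF (y, 1) = Derive f y).
  { intros y Hy. symmetry. apply is_derive_unique, E, Hy. }
  split.
  - rewrite <- E'; auto.
  - exists U. repeat split; auto. intros k. apply (Ck_ext k _ (fun y => dF (y, 1))); auto.
    apply (Ck_comp k (V := RN) (W := RR) U (fun q => U (fst q)) dF (fun y => (y, 1))); auto.
    + apply (open_fst (V := RN) (V' := RN)), HU.
    + apply (Ck_pair k (V := RN) (W := RN) (Z := RN)); [apply (Ck_linear k U (fun x : RN => x)), is_linear_id|apply (Ck_const k (W := RN))].
Qed.

Lemma sm1_Derive_n x f n : sm1 x f -> sm1 x (Derive_n f n).
Proof. intros H. induction n; simpl; auto. apply (sm1_Derive x (Derive_n f n)), IHn. Qed.

Lemma sm1_ex_derive_n x f n : sm1 x f -> ex_derive_n f n x.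
Proof.
  intros H. destruct n; simpl; auto. eexists. apply (sm1_Derive x (Derive_n f n)), sm1_Derive_n, H.
Qed.

Lemma sm1_cont x f : sm1 x f -> continuous (U := RN) f x.
Proof. apply (sm_cont (V := RN) (W := RN)). Qed.

(** * A flat function and a cutoff *)

Definition expinv (n : nat) (t : R) : R := if Rlt_dec 0 t then (/ t) ^ n * exp (- / t) else 0.

(** The Taylor bound exp (1/t) >= (1/t)^(n+1) / (n+1)! for the exponential. *)
Lemma expinv_bound n t : 0 < t -> 0 <= expinv n t <= INR (fact (S n)) * t.
Proof.
  intros Ht. unfold expinv. destruct (Rlt_dec 0 t) as [_|]; [|lra].
  assert (P : 0 < / t) by (apply Rinv_0_lt_compat, Ht).
  split. { apply Rmult_le_pos; [apply pow_le; lra|left; apply exp_pos]. }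
  assert (E := exp_ge_taylor (/ t) (S n) (Rlt_le _ _ P)).
  assert (F : 0 < INR (fact (S n))) by (apply lt_0_INR, lt_O_fact).
  assert (S0 : (/ t) ^ (S n) / INR (fact (S n)) <= exp (/ t)).
  { eapply Rle_trans; [|exact E]. rewrite tech5.
    assert (0 <= sum_f_R0 (fun k => (/ t) ^ k / INR (fact k)) n).
    { apply cond_pos_sum. intros k. apply Rmult_le_pos; [apply pow_le; lra|left; apply Rinv_0_lt_compat, lt_0_INR, lt_O_fact]. }
    lra. }
  rewrite exp_Ropp. assert (X := exp_pos (/ t)).
  apply Rmult_le_reg_r with (exp (/ t)); auto. rewrite Rmult_assoc, Rinv_l by lra. rewrite Rmult_1_r.
  apply (Rmult_le_compat_l (INR (fact (S n)) * t)) in S0; [|apply Rmult_le_pos; lra].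
  replace (INR (fact (S n)) * t * ((/ t) ^ S n / INR (fact (S n)))) with ((/ t) ^ n) in S0; [exact S0|].
  simpl pow. field. split; lra.
Qed.

(** The factor (1/t)^n makes the family closed under differentiation. At 0 the difference quotient
    is the next member of the family, which [expinv_bound] makes small. *)
Lemma expinv_derive n t : is_derive (expinv n) t (- INR n * expinv (S n) t + expinv (S (S n)) t).
Proof.
  destruct (Rtotal_order t 0) as [L|[L|L]].
  - apply (is_derive_ext_loc (fun _ => 0)).
    + generalize (open_lt 0 t L). apply filter_imp. intros y Hy. unfold expinv. destruct (Rlt_dec 0 y); auto; lra.
    + unfold expinv. destruct (Rlt_dec 0 t); [lra|]. rewrite Rmult_0_r, Rplus_0_r. apply (is_derive_const (K := R_AbsRing) (V := RN)).
  - subst t. unfold expinv at 2 3. destruct (Rlt_dec 0 0); [lra|]. rewrite Rmult_0_r, Rplus_0_r.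
    apply is_derive_Reals. intros eps Heps.
    assert (F : 0 < INR (fact (S (S n)))) by (apply lt_0_INR, lt_O_fact).
    exists (mkposreal (eps / INR (fact (S (S n)))) ltac:(apply Rdiv_lt_0_compat; auto)).
    intros h Hh Hd. change (Rabs h < eps / INR (fact (S (S n)))) in Hd. rewrite Rplus_0_l. unfold expinv at 2. destruct (Rlt_dec 0 0); [lra|].
    rewrite !Rminus_0_r. destruct (Rlt_dec 0 h) as [P|P].
    + assert (E : expinv n h / h = expinv (S n) h).
      { unfold expinv. destruct (Rlt_dec 0 h); [|lra]. simpl pow. field. lra. }
      rewrite E. destruct (expinv_bound (S n) h P) as [B1 B2]. rewrite Rabs_pos_eq by auto.
      rewrite Rabs_pos_eq in Hd by lra.
      apply (Rmult_lt_compat_l (INR (fact (S (S n))))) in Hd; auto.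
      replace (INR (fact (S (S n))) * (eps / INR (fact (S (S n))))) with eps in Hd by (field; lra). exact (Rle_lt_trans _ _ _ B2 Hd).
    + unfold expinv. destruct (Rlt_dec 0 h); [lra|]. unfold Rdiv. rewrite Rmult_0_l, Rabs_R0. auto.
  - apply (is_derive_ext_loc (fun t => (/ t) ^ n * exp (- / t))).
    + generalize (open_gt 0 t L). apply filter_imp. intros y Hy. unfold expinv. destruct (Rlt_dec 0 y) as [|Ny]; [auto|destruct (Ny Hy)].
    + unfold expinv. destruct (Rlt_dec 0 t); [|lra].
      auto_derive; [lra|]. destruct n; [simpl; field; lra|].
      rewrite S_INR. simpl pow. simpl Nat.pred. field. lra.
Qed.

Lemma expinv_Ck k : forall n, Ck (V := RN) (W := RN) k (fun _ => True) (expinv n).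
Proof.
  induction k as [|k IH]; intros n.
  - split; auto. intros x _. apply (ex_derive_continuous (expinv n)). eexists; apply expinv_derive.
  - apply (Ck_real_step k _ _ (fun t => - INR n * expinv (S n) t + expinv (S (S n)) t)).
    + apply open_true.
    + intros x _. apply expinv_derive.
    + apply (Ck_add k (V := RN)); [apply open_true| |apply IH].
      apply (Ck_mul k (V := RN)); [apply open_true|apply (Ck_const k (W := RN))|apply IH].
Qed.

Lemma expinv_sm n x : sm1 x (expinv n).
Proof. exists (fun _ => True). repeat split; auto. apply open_true. intros; apply expinv_Ck. Qed.

Lemma expinv_pos t : 0 < t -> 0 < expinv 0 t.
Proof. intros H. unfold expinv. destruct (Rlt_dec 0 t); [|lra]. simpl. rewrite Rmult_1_l. apply exp_pos. Qed.
Lemma expinv_neg t : t <= 0 -> expinv 0 t = 0.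
Proof. intros H. unfold expinv. destruct (Rlt_dec 0 t); auto; lra. Qed.

(** A cutoff supported in |s| <= sqrt 2. The arguments 2 - s^2 and s^2 - 1 add up to 1, so at least
    one is positive and the denominator never vanishes; s^2 in place of the absolute value keeps it
    smooth at 0. *)
Definition bump (s : R) : R := expinv 0 (2 - s * s) / (expinv 0 (2 - s * s) + expinv 0 (s * s - 1)).

Lemma bump_one s : Rabs s <= 1 -> bump s = 1.
Proof.
  intros H. unfold bump. assert (s * s <= 1).
  { apply Rabs_le_between in H. nra. }
  rewrite (expinv_neg (s * s - 1)) by lra. assert (P := expinv_pos (2 - s * s) ltac:(lra)). field. lra.
Qed.

Lemma bump_zero s : 2 <= Rabs s -> bump s = 0.
Proof.
  intros H. unfold bump. assert (4 <= s * s).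
  { rewrite <- (Rabs_pos_eq (s * s)) by nra. rewrite Rabs_mult. nra. }
  rewrite (expinv_neg (2 - s * s)) by lra. unfold Rdiv; ring.
Qed.

Lemma bump_sm x : sm1 x bump.
Proof.
  assert (A : sm1 x (fun s => expinv 0 (2 - s * s))).
  { apply (sm_comp (V := RN) (W := RN) x (expinv 0) (fun s => 2 - s * s)); [apply expinv_sm|].
    apply (sm_minus (V := RN)); [apply (sm_const (W := RN))|apply (sm_mult (V := RN)); apply sm_id]. }
  apply (sm_div (V := RN)); auto.
  - assert (0 <= expinv 0 (2 - x * x)).
    { destruct (Rlt_dec 0 (2 - x * x)) as [L|L]; [left; apply expinv_pos, L|rewrite expinv_neg; lra]. }
    assert (0 <= expinv 0 (x * x - 1)).
    { destruct (Rlt_dec 0 (x * x - 1)) as [L|L]; [left; apply expinv_pos, L|rewrite expinv_neg; lra]. }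
    destruct (Rlt_dec 0 (2 - x * x)) as [L|L].
    + assert (Q := expinv_pos _ L). lra.
    + assert (Q := expinv_pos (x * x - 1) ltac:(lra)). lra.
  - apply (sm_plus (V := RN)); auto.
    apply (sm_comp (V := RN) (W := RN) x (expinv 0) (fun s => s * s - 1)); [apply expinv_sm|].
    apply (sm_minus (V := RN)); [apply (sm_mult (V := RN)); apply sm_id|apply (sm_const (W := RN))].
Qed.

(** * Series of smooth functions with geometric majorants *)

Lemma geom_half : Rabs (1/2) < 1.
Proof. rewrite Rabs_pos_eq; lra. Qed.

Lemma ex_series_geo K (t : nat -> R) : (forall k, (K <= k)%nat -> Rabs (t k) <= (1/2) ^ k) -> ex_series t.
Proof.
  intros H. apply (ex_series_incr_n t K).
  apply (ex_series_le (V := R_CompleteNormedModule) (fun k => t (K + k)%nat) (fun k => (1/2) ^ (K + k))).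
  - intros n. apply H. lia.
  - apply (ex_series_incr_n (fun k => (1/2) ^ k) K). apply ex_series_geom, geom_half.
Qed.

(** The geometric majorant beyond the index n sums to (1/2)^n. *)
Lemma series_tail K n (t : nat -> R) : (K <= n)%nat -> (forall k, (K <= k)%nat -> Rabs (t k) <= (1/2) ^ k) ->
  Rabs (sum_n t n - Series t) <= (1/2) ^ n.
Proof.
  intros Hn H. assert (E := ex_series_geo K t H).
  rewrite (Series_incr_n t (S n)) by (auto; lia). simpl Init.Nat.pred. rewrite sum_n_Reals.
  replace (sum_f_R0 t n - (sum_f_R0 t n + Series (fun k => t (S n + k)%nat))) with (- Series (fun k => t (S n + k)%nat)) by ring.
  rewrite Rabs_Ropp.
  assert (G : Series (fun k => (1/2) ^ (S n) * (1/2) ^ k) = (1/2) ^ n).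
  { rewrite Series_scal_l, Series_geom by apply geom_half. simpl. field. }
  assert (EG : ex_series (fun k => (1/2) ^ (S n) * (1/2) ^ k)).
  { apply (ex_series_scal_l ((1/2) ^ (S n)) (fun k => (1/2)^k)). apply ex_series_geom, geom_half. }
  assert (B : forall k, 0 <= Rabs (t (S n + k)%nat) <= (1/2) ^ (S n) * (1/2) ^ k).
  { intros k. split; [apply Rabs_pos|]. rewrite <- pow_add. apply H. lia. }
  rewrite <- G. eapply Rle_trans; [apply Series_Rabs|apply Series_le; auto].
  apply (ex_series_le (V := R_CompleteNormedModule) (fun k => Rabs (t (S n + k)%nat)) (fun k => (1/2) ^ (S n) * (1/2) ^ k)); auto.
  intros k. unfold norm; simpl. unfold abs; simpl. rewrite Rabs_Rabsolu. apply B.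
Qed.

Lemma half_pow_small (eps : R) : 0 < eps -> exists n, forall m, (n <= m)%nat -> (1/2) ^ m < eps.
Proof.
  intros He. destruct (pow_lt_1_zero (1/2) geom_half eps He) as [N HN].
  exists N. intros m Hm. specialize (HN m Hm). rewrite Rabs_pos_eq in HN; auto. apply pow_le; lra.
Qed.

Lemma sum_n_cont {X : UniformSpace} (f : nat -> X -> R) x0 n :
  (forall k, continuous (U := R_UniformSpace) (f k) x0) -> continuous (U := R_UniformSpace) (fun x => sum_n (fun k => f k x) n) x0.
Proof.
  intros H. induction n as [|n IH].
  - apply (continuous_ext (f 0%nat)); auto. intros x. rewrite sum_O. reflexivity.
  - apply (continuous_ext (fun x => plus (sum_n (fun k => f k x) n) (f (S n) x))).
    { intros x. rewrite sum_Sn. reflexivity. }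
    apply (continuous_plus (K := R_AbsRing) (V := RN) (fun x => sum_n (fun k => f k x) n) (f (S n))); auto.
Qed.

Lemma Series_cont {X : UniformSpace} (f : nat -> X -> R) x0 K :
  (forall k, continuous (U := R_UniformSpace) (f k) x0) ->
  locally x0 (fun x => forall k, (K <= k)%nat -> Rabs (f k x) <= (1/2) ^ k) ->
  continuous (U := R_UniformSpace) (fun x => Series (fun k => f k x)) x0.
Proof.
  intros Hc Hb. apply filterlim_locally. intros eps.
  assert (pe : 0 < eps / 3) by (destruct eps; simpl; lra).
  destruct (half_pow_small _ pe) as [N HN]. set (n := max N K).
  assert (C := sum_n_cont f x0 n Hc).
  specialize (C _ (locally_ball (sum_n (fun k => f k x0) n) (mkposreal _ pe))). unfold filtermap in C.
  generalize (filter_and _ _ C Hb). apply filter_imp. intros x [A B].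
  assert (T1 := series_tail K n (fun k => f k x) ltac:(lia) B).
  assert (T2 := series_tail K n (fun k => f k x0) ltac:(lia) (locally_singleton _ _ Hb)).
  assert (S0 := HN n ltac:(lia)).
  change (Rabs (Series (fun k => f k x) - Series (fun k => f k x0)) < eps).
  change (Rabs (sum_n (fun k => f k x) n - sum_n (fun k => f k x0) n) < eps / 3) in A.
  cbv beta in T1, T2.
  assert (T : forall a b c d e r : R, Rabs (c - d) < e / 3 -> Rabs (c - a) <= r -> Rabs (d - b) <= r -> r < e / 3 -> Rabs (a - b) < e).
  { intros a b c d e r. unfold Rabs; repeat destruct Rcase_abs; lra. }
  exact (T _ _ _ _ _ _ A T1 T2 S0).
Qed.

Lemma Series_derive (f : nat -> R -> R) (D : R -> Prop) K : open D -> is_connected D ->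
  (forall k x, D x -> sm1 x (f k)) ->
  (forall k x, (K <= k)%nat -> D x -> Rabs (f k x) <= (1/2) ^ k) ->
  (forall k x, (K <= k)%nat -> D x -> Rabs (Derive (f k) x) <= (1/2) ^ k) ->
  forall x, D x -> is_derive (fun x => Series (fun k => f k x)) x (Series (fun k => Derive (f k) x)).
Proof.
  intros OD CD Hs B0 B1.
  assert (U : forall g : nat -> R -> R, (forall k x, (K <= k)%nat -> D x -> Rabs (g k x) <= (1/2) ^ k) ->
    CVU_dom (fun n x => sum_n (fun k => g k x) n) D).
  { intros g Hg eps. destruct (half_pow_small eps (cond_pos eps)) as [N HN]. exists (max N K). intros n Hn x Hx.
    eapply Rle_lt_trans; [apply (series_tail K n (fun k => g k x)); [lia|]|apply HN; lia].
    intros k Hk. apply Hg; auto. }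
  assert (EX : forall k x, D x -> ex_derive (f k) x).
  { intros k x Hx. eexists. apply sm1_Derive, Hs, Hx. }
  assert (ED : forall n x, D x -> Derive (fun y => sum_n (fun k => f k y) n) x = sum_n (fun k => Derive (f k) x) n).
  { intros n x Hx. apply (Derive_sum_n f). intros k _. apply EX, Hx. }
  intros x Hx. unfold Series.
  assert (A := CVU_Derive (fun n x => sum_n (fun k => f k x) n) D OD CD (U f B0)).
  evar_last.
  - apply A; auto.
    + intros n y Hy. apply (ex_derive_sum_n (V := RN) f). intros k _. apply EX, Hy.
    + intros n y Hy. apply continuity_pt_filterlim.
      apply (continuous_ext_loc (T := R_UniformSpace) (U := RN) _ (fun y => sum_n (fun k => Derive (f k) y) n)).
      * generalize (OD y Hy). apply filter_imp. intros z Hz. symmetry. apply ED, Hz.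
      * apply (sum_n_cont (X := R_UniformSpace) (fun k => Derive (f k))). intros k. apply sm1_cont. apply (sm1_Derive y (f k)), Hs, Hy.
    + intros eps. destruct (U (fun k => Derive (f k)) B1 eps) as [N HN]. exists N. intros n Hn y Hy.
      rewrite ED by auto.
      rewrite (Lim_seq_ext _ (fun n => sum_n (fun k => Derive (f k) y) n)) by (intros m; apply ED, Hy).
      apply HN; auto.
  - f_equal. apply Lim_seq_ext. intros n. apply ED, Hx.
Qed.

Lemma sm1_continuity x f : sm1 x f -> continuity_pt f x.
Proof. intros H. apply continuity_pt_filterlim. apply sm1_cont, H. Qed.

Lemma deriv_bound (f : R -> R) a b : a <= b -> (forall x, a <= x <= b -> sm1 x f) ->
  forall n, exists C, 0 <= C /\ forall j x, (j <= n)%nat -> a <= x <= b -> Rabs (Derive_n f j x) <= C.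
Proof.
  intros Hab Hs.
  assert (One : forall j, exists C, 0 <= C /\ forall x, a <= x <= b -> Rabs (Derive_n f j x) <= C).
  { intros j. destruct (continuity_ab_maj (fun x => Rabs (Derive_n f j x)) a b Hab) as [m [H1 H2]].
    - intros c Hc. apply (continuity_pt_comp (Derive_n f j) Rabs).
      + apply sm1_continuity, sm1_Derive_n, Hs, Hc.
      + apply Rcontinuity_abs.
    - exists (Rabs (Derive_n f j m)). split; [apply Rabs_pos|]. intros x Hx. apply H1, Hx. }
  induction n as [|n IH].
  - destruct (One 0%nat) as [C [C0 HC]]. exists C. split; auto. intros j x Hj Hx.
    replace j with 0%nat by lia. auto.
  - destruct IH as [C [C0 HC]]. destruct (One (S n)) as [C' [C0' HC']].
    exists (Rmax C C'). split; [eapply Rle_trans; [exact C0|apply Rmax_l]|].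
    intros j x Hj Hx. destruct (Nat.eq_dec j (S n)) as [->|N].
    + eapply Rle_trans; [apply HC', Hx|apply Rmax_r].
    + eapply Rle_trans; [apply HC; auto; lia|apply Rmax_l].
Qed.

Lemma sm1_pow_bump k b x : sm1 x (fun s => s ^ k * bump (b * s)).
Proof.
  apply (sm_mult (V := RN)); [apply (sm_pow (V := RN)), sm_id|].
  apply (sm_comp (V := RN) (W := RN) x bump (fun s => b * s)); [apply bump_sm|].
  apply (sm_mult (V := RN)); [apply (sm_const (W := RN))|apply sm_id].
Qed.

(** Compactness on [-2, 2]; elsewhere the function vanishes locally. The factor 1 is kept to match
    [bump (b * s)] with b = 1. *)
Lemma pow_bump_bound k n : exists C, 0 <= C /\ forall j x, (j <= n)%nat ->
  Rabs (Derive_n (fun s => s ^ k * bump (1 * s)) j x) <= C.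
Proof.
  destruct (deriv_bound (fun s => s ^ k * bump (1 * s)) (-2) 2 ltac:(lra) (fun x _ => sm1_pow_bump k 1 x) n) as [C [C0 HC]].
  exists C. split; auto. intros j x Hj.
  destruct (Rle_dec (Rabs x) 2) as [L|L].
  - apply HC; auto. apply Rabs_le_between in L. lra.
  - rewrite (Derive_n_ext_loc _ (fun _ => 0)).
    + destruct j; [simpl; rewrite Rabs_R0; auto|]. rewrite Derive_n_const. rewrite Rabs_R0; auto.
    + assert (O : open (fun y : R => 2 < Rabs y)).
      { apply (open_comp (T := R_UniformSpace) (U := R_UniformSpace) Rabs (fun y => 2 < y)); [|apply open_gt].
        intros y _. apply (continuous_Rabs y). }
      generalize (O x ltac:(lra)). apply filter_imp. intros y Hy. rewrite Rmult_1_l, bump_zero by (apply Rlt_le, Hy). apply Rmult_0_r.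
Qed.

(** Rescaling: s^k bump (b s) is b^(-k) times the function of scale 1 taken at b s. The j-th
    derivative thus carries b^(j - k), small for j < k once b is large. *)
Lemma Derive_n_pow_bump k b j x : 0 < b ->
  Derive_n (fun s => s ^ k * bump (b * s)) j x =
  / b ^ k * (b ^ j * Derive_n (fun s => s ^ k * bump (1 * s)) j (b * x)).
Proof.
  intros Hb.
  rewrite (Derive_n_ext _ (fun s => / b ^ k * (fun s => (b * s) ^ k * bump (1 * (b * s))) s)).
  - rewrite Derive_n_scal_l. f_equal.
    apply (Derive_n_comp_scal (fun s => s ^ k * bump (1 * s)) b j x).
    apply filter_forall. intros y i _. apply sm1_ex_derive_n, sm1_pow_bump.
  - intros s. rewrite Rmult_1_l, Rpow_mult_distr. field. apply pow_nonzero. lra.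
Qed.

(** All mixed derivatives are series of the same shape, with the terms differentiated j times in v
    and i times in u. This family is closed under partial derivatives, so [Ck_coind] applies. *)
Lemma separated_series (al ga : nat -> R -> R) (d : R) :
  (forall k v, Rabs v < d -> sm1 v (al k)) -> (forall k x, sm1 x (ga k)) ->
  (forall i j, exists K, forall k x v, (K <= k)%nat -> Rabs v < d ->
     Rabs (Derive_n (al k) j v * Derive_n (ga k) i x) <= (1/2) ^ k) ->
  forall p, Rabs (snd p) < d -> sm2 p (fun p => Series (fun k => al k (snd p) * ga k (fst p))).
Proof.
  intros Ha Hg Hb p Hp.
  set (U := fun p : RR => Rabs (snd p) < d).
  assert (OI : open (fun v : R => Rabs v < d)).
  { assert (O := open_abs 0 d). intros v Hv. specialize (O v). cbv beta in O. rewrite Rminus_0_r in O.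
    generalize (O Hv). apply filter_imp. intros w Hw. rewrite Rminus_0_r in Hw. exact Hw. }
  assert (CI : is_connected (fun v : R => Rabs v < d)).
  { intros a b x A B Hx. apply Rabs_def2 in A. apply Rabs_def2 in B. apply Rabs_def1; lra. }
  assert (OU : open U).
  { intros [x v] Hv. exact (continuous_snd (U := RN) (V := RN) x v (fun w => Rabs w < d) (OI v Hv)). }
  exists U. repeat split; auto. intros k.
  set (F := fun i j (p : R * R) => Series (fun k => Derive_n (al k) j (snd p) * Derive_n (ga k) i (fst p))).
  apply (Ck_coind U (fun G => exists i j, forall p, G p = F i j p)); auto.
  2:{ exists 0%nat, 0%nat. reflexivity. }
  intros G [i [j E]].
  assert (EG : G = F i j) by (apply functional_extensionality; exact E). subst G. clear E. split.
  - intros q Hq. destruct (Hb i j) as [K HK].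
    apply (Series_cont (X := RR) (fun k p => Derive_n (al k) j (snd p) * Derive_n (ga k) i (fst p)) q K).
    + intros m. apply (sm_cont (V := RR) (W := RN)). apply (sm_mult (V := RR)).
      * apply (sm_comp (V := RR) (W := RN) q (Derive_n (al m) j) snd); [apply sm1_Derive_n, Ha, Hq|apply sm2_v].
      * apply (sm_comp (V := RR) (W := RN) q (Derive_n (ga m) i) fst); [apply sm1_Derive_n, Hg|apply sm2_u].
    + generalize (OU q Hq). apply filter_imp. intros r Hr m Hm. apply HK; auto.
  - exists (F (S i) j), (F i (S j)). split; [|split; [|split]]; eauto.
    + intros [x v] Hq. cbn [fst snd]. destruct (Hb i j) as [K HK]. destruct (Hb (S i) j) as [K' HK'].
      assert (DE : forall k y, is_derive (fun y => Derive_n (al k) j v * Derive_n (ga k) i y) y (Derive_n (al k) j v * Derive_n (ga k) (S i) y)).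
      { intros m y. apply (is_derive_scal (Derive_n (ga m) i)). apply (sm1_Derive y (Derive_n (ga m) i)), sm1_Derive_n, Hg. }
      evar_last.
      * apply (Series_derive (fun k y => Derive_n (al k) j v * Derive_n (ga k) i y) (fun _ => True) (max K K')); auto.
        -- apply open_true.
        -- intros ? ? ? _ _ _; auto.
        -- intros m y _. apply (sm_mult (V := RN)); [apply (sm_const (W := RN))|apply sm1_Derive_n, Hg].
        -- intros m y Hm _. apply HK; auto. lia.
        -- intros m y Hm _. eapply Rle_trans; [right; exact (f_equal Rabs (is_derive_unique _ _ _ (DE m y)))|]. apply HK'; auto. lia.
      * apply Series_ext. intros m. apply is_derive_unique, DE.
    + intros [x v] Hq. cbn [fst snd]. destruct (Hb i j) as [K HK]. destruct (Hb i (S j)) as [K' HK'].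
      assert (DE : forall k y, Rabs y < d -> is_derive (fun y => Derive_n (al k) j y * Derive_n (ga k) i x) y (Derive_n (al k) (S j) y * Derive_n (ga k) i x)).
      { intros m y Hy. apply (is_derive_ext (fun y => Derive_n (ga m) i x * Derive_n (al m) j y)).
        { intros t. apply Rmult_comm. }
        evar_last.
        - apply (is_derive_scal (Derive_n (al m) j)).
          apply (sm1_Derive y (Derive_n (al m) j)), sm1_Derive_n, Ha, Hy.
        - apply Rmult_comm. }
      evar_last.
      * apply (Series_derive (fun k y => Derive_n (al k) j y * Derive_n (ga k) i x) (fun v => Rabs v < d) (max K K')); auto.
        -- intros m y Hy. apply (sm_mult (V := RN)); [apply sm1_Derive_n, Ha, Hy|apply (sm_const (W := RN))].
        -- intros m y Hm Hy. apply HK; auto. lia.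
        -- intros m y Hm Hy. eapply Rle_trans; [right; exact (f_equal Rabs (is_derive_unique _ _ _ (DE m y Hy)))|]. apply HK'; auto. lia.
      * apply Series_ext. intros m. apply is_derive_unique, DE, Hq.
Qed.

(* Borel's theorem with a parameter: B 0 has Taylor coefficients a_n(v) in u, and B n is its n-th remainder. *)
Lemma borel_param (a : nat -> R -> R) (d : R) : 0 < d ->
  (forall k v, Rabs v < d -> sm1 v (a k)) ->
  exists B : nat -> R * R -> R, (forall n p, Rabs (snd p) < d / 2 -> sm2 p (B n)) /\
    forall n, exists r, 0 < r /\ forall p, Rabs (fst p) < r -> Rabs (snd p) < d / 2 ->
      B n p = a n (snd p) + fst p * B (S n) p.
Proof.
  intros Hd Ha.
  assert (HA : forall k, exists C, 0 <= C /\ forall j v, (j <= k)%nat -> Rabs v < d / 2 -> Rabs (Derive_n (a k) j v) <= C).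
  { intros k. destruct (deriv_bound (a k) (- (d/2)) (d/2) ltac:(lra)) with (n := k) as [C [C0 HC]].
    - intros x Hx. apply Ha. apply Rabs_def1; lra.
    - exists C. split; auto. intros j v Hj Hv. apply HC; auto. apply Rabs_def2 in Hv. lra. }
  apply choice in HA. destruct HA as [A HA].
  assert (HC := fun k => pow_bump_bound k k). apply choice in HC. destruct HC as [C HC].
  (* Scale of the m-th cutoff. [A m] bounds the derivatives of the m-th coefficient up to order m.
     The sum of [C] covers every exponent k <= m, because the remainder [B n] uses the scale of
     index m = n + k with the exponent k. *)
  set (b := fun m => 1 + 2 ^ m * (A m * sum_f_R0 C m)).
  assert (Cs : forall k m, (k <= m)%nat -> C k <= sum_f_R0 C m).
  { intros k m. induction 1 as [|m Hm IH].
    - destruct k; [simpl; lra|]. simpl. assert (0 <= sum_f_R0 C k) by (apply cond_pos_sum; intros; apply HC). lra.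
    - simpl. assert (Q := proj1 (HC (S m))). lra. }
  assert (C0 : forall m, 0 <= sum_f_R0 C m) by (intros; apply cond_pos_sum; intros; apply HC).
  assert (bp : forall m, 1 <= b m).
  { intros m. unfold b. assert (0 <= 2 ^ m * (A m * sum_f_R0 C m)); [|lra].
    apply Rmult_le_pos; [apply pow_le; lra|]. apply Rmult_le_pos; auto. apply HA. }
  (* Keeping the index n + k of the scale makes u times the k-th term of [B (S n)] exactly the term
     k + 1 of [B n]. *)
  set (ga := fun n k x => x ^ k * bump (b (n + k)%nat * x)).
  assert (SB : forall n i j, exists K, forall k x v, (K <= k)%nat -> Rabs v < d / 2 ->
     Rabs (Derive_n (a (n + k)%nat) j v * Derive_n (ga n k) i x) <= (1/2) ^ k).
  { intros n i j. exists (S (max i j)). intros k x v Hk Hv.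
    assert (Hb := bp (n + k)%nat).
    unfold ga. rewrite Derive_n_pow_bump by lra.
    set (bb := b (n + k)%nat) in *.
    set (X := Derive_n (a (n + k)%nat) j v). set (Y := Derive_n (fun s => s ^ k * bump (1 * s)) i (bb * x)).
    assert (HX : Rabs X <= A (n + k)%nat) by (apply HA; auto; lia).
    assert (HY : Rabs Y <= sum_f_R0 C (n + k)).
    { eapply Rle_trans; [apply (HC k); lia|apply Cs; lia]. }
    assert (P1 : / bb ^ k * bb ^ i <= / bb).
    { replace k with (S (i + (k - S i))) by lia. rewrite <- tech_pow_Rmult, pow_add.
      assert (0 < bb ^ i) by (apply pow_lt; lra).
      assert (1 <= bb ^ (k - S i)) by (apply pow_R1_Rle; lra).
      replace (/ (bb * (bb ^ i * bb ^ (k - S i))) * bb ^ i) with (/ bb * / bb ^ (k - S i)) by (field; lra).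
      rewrite <- (Rmult_1_r (/ bb)) at 2. apply Rmult_le_compat_l; [left; apply Rinv_0_lt_compat; lra|].
      rewrite <- Rinv_1. apply Rinv_le_contravar; lra. }
    assert (P0 : 0 <= / bb ^ k * bb ^ i).
    { apply Rmult_le_pos; [left; apply Rinv_0_lt_compat, pow_lt; lra|apply pow_le; lra]. }
    replace (X * (/ bb ^ k * (bb ^ i * Y))) with ((/ bb ^ k * bb ^ i) * (X * Y)) by ring.
    rewrite Rabs_mult, (Rabs_pos_eq _ P0), Rabs_mult.
    apply Rle_trans with (/ bb * (A (n + k)%nat * sum_f_R0 C (n + k))).
    - apply Rmult_le_compat; auto.
      + apply Rmult_le_pos; apply Rabs_pos.
      + apply Rmult_le_compat; auto; apply Rabs_pos.
    - assert (AC : 0 <= A (n + k)%nat * sum_f_R0 C (n + k)) by (apply Rmult_le_pos; auto; apply HA).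
      assert (Eb : 2 ^ (n + k) * (A (n + k)%nat * sum_f_R0 C (n + k)) <= bb) by (unfold bb, b; lra).
      apply Rmult_le_reg_l with bb; [lra|]. rewrite <- Rmult_assoc, Rinv_r, Rmult_1_l by lra.
      apply Rmult_le_reg_l with (2 ^ k); [apply pow_lt; lra|].
      replace (2 ^ k * (bb * (1/2) ^ k)) with bb.
      2:{ replace (2 ^ k * (bb * (1/2)^k)) with (bb * (2 ^ k * (1/2)^k)) by ring.
          rewrite <- Rpow_mult_distr. replace (2 * (1/2)) with 1 by field. rewrite pow1. ring. }
      eapply Rle_trans; [|exact Eb]. apply Rmult_le_compat_r; auto. apply Rle_pow; [lra|lia]. }
  exists (fun n p => Series (fun k => a (n + k)%nat (snd p) * ga n k (fst p))). split.
  - intros n p Hp. apply (separated_series (fun k => a (n + k)%nat) (ga n) (d / 2)); auto.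
    + intros k v Hv. apply Ha. lra.
    + intros k x. apply sm1_pow_bump.
  (* On this interval the leading cutoff [bump (b n * x)] equals 1, so the term k = 0 is the
     coefficient itself. *)
  - intros n. exists (/ b n). assert (Hb := bp n). split; [apply Rinv_0_lt_compat; lra|].
    intros [x v] Hx Hv. cbn [fst snd] in *.
    rewrite Series_incr_1.
    + f_equal.
      * unfold ga. rewrite Nat.add_0_r. simpl pow.
        rewrite bump_one; [ring|]. rewrite Rabs_mult, (Rabs_pos_eq (b n)) by lra.
        apply Rlt_le. apply (Rmult_lt_compat_l (b n)) in Hx; [|lra]. rewrite Rinv_r in Hx by lra. exact Hx.
      * rewrite <- Series_scal_l. apply Series_ext. intros k. unfold ga. rewrite <- Nat.add_succ_comm. simpl pow. ring.
    + destruct (SB n 0%nat 0%nat) as [K HK]. apply (ex_series_geo K). intros k Hk. apply (HK k x v Hk Hv).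
Qed.

(** * Even functions *)

Lemma cont_zero (f : R -> R) (d : R) : 0 < d -> continuous (U := RN) f 0 ->
  (forall x, x <> 0 -> Rabs x < d -> f x = 0) -> f 0 = 0.
Proof.
  intros Hd Hc H. destruct (Req_dec (f 0) 0) as [|N]; auto. exfalso.
  assert (P : 0 < Rabs (f 0)) by (apply Rabs_pos_lt; auto).
  destruct (Hc _ (locally_ball (f 0) (mkposreal _ P))) as [e He].
  assert (pe := cond_pos e).
  set (x := Rmin d e / 2).
  assert (0 < Rmin d e) by (apply Rmin_pos; auto).
  assert (Rmin d e <= d) by apply Rmin_l. assert (Rmin d e <= e) by apply Rmin_r.
  assert (Ax : Rabs x = x) by (apply Rabs_pos_eq; unfold x; lra).
  assert (B : ball (0 : R) e x).
  { change (Rabs (x - 0) < e). rewrite Rminus_0_r, Ax. unfold x; lra. }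
  specialize (He x B). change (Rabs (f x - f 0) < Rabs (f 0)) in He.
  rewrite (H x) in He; [|unfold x; lra|rewrite Ax; unfold x; lra].
  rewrite Rminus_0_l, Rabs_Ropp in He. lra.
Qed.

Lemma sm2_slice_u (h : R * R -> R) u v : sm2 (u, v) h -> sm1 u (fun x => h (x, v)).
Proof.
  intros H. apply (sm_comp (V := RN) (W := RR) u h (fun x => (x, v))); auto.
  apply (sm_pair (V := RN) (W := RN) (Z := RN)); [apply sm_id|apply (sm_const (W := RN))].
Qed.

Lemma sm2_slice_v (h : R * R -> R) u v : sm2 (u, v) h -> sm1 v (fun y => h (u, y)).
Proof.
  intros H. apply (sm_comp (V := RN) (W := RR) v h (fun y => (u, y))); auto.
  apply (sm_pair (V := RN) (W := RN) (Z := RN)); [apply (sm_const (W := RN))|apply sm_id].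
Qed.

Lemma zero_axis_u (D : R * R -> R) v : sm2 (0, v) D ->
  locally (T := RR) (0, v) (fun q => fst q * D q = 0) -> D (0, v) = 0.
Proof.
  intros HD [e He]. apply (cont_zero (fun x => D (x, v)) e (cond_pos e)).
  - apply sm1_cont, sm2_slice_u, HD.
  - intros x Hx Hd.
    assert (E : fst (x, v) * D (x, v) = 0).
    { apply He. split; [|apply ball_center]. change (Rabs (x - 0) < e). rewrite Rminus_0_r. auto. }
    cbn [fst] in E. apply Rmult_integral in E. tauto.
Qed.

(** An explicit quotient can be iterated and examined near each point of a box, whereas Hadamard's
    lemma by itself only yields a germ. The value on the axis is the only continuous choice. *)
Definition quot (h : R * R -> R) (p : R * R) : R :=
  if Req_dec_T (fst p) 0 then du h p else h p / fst p.

Lemma quot_neq h p : fst p <> 0 -> quot h p = h p / fst p.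
Proof. intros H. unfold quot. destruct (Req_dec_T (fst p) 0); tauto. Qed.

Lemma locally_fst_neq (p : R * R) : fst p <> 0 -> locally (T := RR) p (fun q => fst q <> 0).
Proof.
  destruct p as [u v]. intros H. exact (continuous_fst (U := RN) (V := RN) u v (fun x => x <> 0) (open_neq0 u H)).
Qed.

(** At a point of the axis Hadamard's lemma gives a smooth quotient, which agrees with [quot]
    because its values on the axis are the u-derivative of h. Elsewhere [quot] is a plain
    division. *)
Lemma quot_local h p : sm2 p h -> (fst p = 0 -> locally (T := RR) p (fun q => fst q = 0 -> h q = 0)) ->
  sm2 p (quot h) /\ h p = fst p * quot h p.
Proof.
  intros Hh HZ. destruct (Req_dec (fst p) 0) as [E|N].
  - destruct p as [u v]. cbn [fst] in E. subst u. specialize (HZ eq_refl).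
    assert (SL : forall q : R * R, is_linear (K := R_AbsRing) (U := RR) (V := RR) swap).
    { intros _. apply (is_linear_prod (T := RR) (U := RN) (V := RN) snd fst); [apply is_linear_snd|apply is_linear_fst]. }
    destruct (hadamard_param (V := RN) v (fun q => h (swap q))) as [K [K1 K2]].
    + apply (sm_comp (V := RR) (W := RR) (v, 0) h swap); auto. apply sm_linear, SL, (0,0).
    + assert (C : filterlim (fun x : R => (0, x) : RR) (locally (T := RN) v) (locally (T := RR) (0, v))).
      { apply (continuous_pair (V := RN) (W := RN) (Z := RN)); [apply continuous_const|apply continuous_id]. }
      specialize (C _ HZ). unfold filtermap in C. generalize C. apply filter_imp. intros x Hx. apply Hx. reflexivity.
    + assert (KS : sm2 (0, v) (fun q => K (swap q))).
      { apply (sm_comp (V := RR) (W := RR) (0, v) K swap); auto. apply sm_linear, SL, (0,0). }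
      assert (E1 : locally (T := RR) (0, v) (fun q => h q = fst q * K (swap q))).
      { assert (C : continuous (T := RR) (U := RR) swap (0, v)).
        { apply (continuous_pair (V := RR) (W := RN) (Z := RN)); [apply continuous_snd|apply continuous_fst]. }
        specialize (C _ K2). unfold filtermap in C. generalize C. apply filter_imp. intros q Hq.
        rewrite swap_swap in Hq. exact Hq. }
      assert (E2 : locally (T := RR) (0, v) (fun q => K (swap q) = quot h q)).
      { generalize (filter_and _ _ (locally_locally (T := RR) _ _ E1) (sm_near _ _ KS)). apply filter_imp.
        intros q [A B]. unfold quot. assert (A0 := locally_singleton (T := RR) _ _ A). cbv beta in A0.
        destruct (Req_dec_T _ _) as [Z|Z].
        - rewrite (du_ext h _ q A), du_mult, du_u; auto using sm2_u.
          assert (T : forall a b c : R, c = 0 -> a = 1 * a + c * b) by (intros; subst; ring). exact (T _ _ _ Z).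
        - rewrite A0. assert (T : forall a c : R, c <> 0 -> a = c * a / c) by (intros; field; auto). exact (T _ _ Z). }
      split.
      * apply (sm_ext_loc (V := RR) (W := RN) (0, v) _ _ E2). exact KS.
      * assert (Q1 := locally_singleton (T := RR) _ _ E1). assert (Q2 := locally_singleton (T := RR) _ _ E2).
        cbv beta in Q1, Q2. exact (eq_trans Q1 (f_equal (fun r : R => 0 * r) Q2)).
  - split.
    + apply (sm_ext_loc (V := RR) (W := RN) p (fun q => h q / fst q)).
      * generalize (locally_fst_neq p N). apply filter_imp. intros q Hq. symmetry. apply quot_neq, Hq.
      * apply (sm_div (V := RR)); auto using sm2_u.
    + rewrite quot_neq by auto. assert (T : forall a c : R, c <> 0 -> a = c * (a / c)) by (intros; field; auto). exact (T _ _ N).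
Qed.

Section Even.

Variables (d1 d2 : R).
Hypotheses (pd1 : 0 < d1) (pd2 : 0 < d2).

Definition box (p : R * R) : Prop := Rabs (fst p) < d1 /\ Rabs (snd p) < d2.

Lemma box_open : open (T := RR) box.
Proof.
  intros [u v] [Hu Hv]. cbn [fst snd] in *.
  assert (O : forall d x, Rabs x < d -> locally (x : R) (fun y : R => Rabs y < d)).
  { intros d x Hx. assert (Q := open_abs 0 d x). cbv beta in Q. rewrite Rminus_0_r in Q.
    generalize (Q Hx). apply filter_imp. intros y. rewrite Rminus_0_r; auto. }
  apply filter_and.
  - exact (continuous_fst (U := RN) (V := RN) u v (fun x => Rabs x < d1) (O _ _ Hu)).
  - exact (continuous_snd (U := RN) (V := RN) u v (fun x => Rabs x < d2) (O _ _ Hv)).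
Qed.

Definition sbox (h : R * R -> R) : Prop := forall p, box p -> sm2 p h.
Definition even (h : R * R -> R) : Prop := forall u v, box (u, v) -> h (- u, v) = h (u, v).
Definition odd (h : R * R -> R) : Prop := forall u v, box (u, v) -> h (- u, v) = - h (u, v).

Lemma box_neg u v : box (u, v) -> box (- u, v).
Proof. unfold box; cbn [fst snd]. rewrite Rabs_Ropp. auto. Qed.

Lemma box_0 u v : box (u, v) -> box (0, v).
Proof. unfold box; cbn [fst snd]. rewrite Rabs_R0. intuition. Qed.

Lemma odd_zero h : odd h -> forall p, box p -> fst p = 0 -> h p = 0.
Proof.
  intros Ho [u v] Hp E. cbn [fst] in E. subst u. specialize (Ho 0 v Hp). rewrite Ropp_0 in Ho. lra.
Qed.

Lemma quot_odd h : sbox h -> odd h -> sbox (quot h) /\ even (quot h) /\ (forall p, box p -> h p = fst p * quot h p).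
Proof.
  intros Hs Ho.
  assert (L : forall p, box p -> sm2 p (quot h) /\ h p = fst p * quot h p).
  { intros p Hp. apply quot_local; auto. intros _. generalize (box_open p Hp). apply filter_imp.
    intros q Hq. apply odd_zero; auto. }
  repeat split; try (intros p Hp; apply L, Hp).
  intros u v Hp. destruct (Req_dec u 0) as [->|N]; [rewrite Ropp_0; auto|].
  rewrite !quot_neq by (cbn [fst]; lra). cbn [fst]. rewrite Ho by auto. field. auto.
Qed.

Lemma even_du h : sbox h -> even h -> odd (du h).
Proof.
  intros Hs He u v Hp.
  assert (E : du h (u, v) = - du h (- u, v)); [|rewrite E; ring].
  unfold du. cbn [fst snd].
  rewrite (Derive_ext_loc (fun u => h (u, v)) (fun u => h (- u, v))).
  - rewrite (Derive_comp (fun x => h (x, v)) (fun x => - x)).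
    + assert (E : Derive (fun x : R => - x) u = -1).
      { apply is_derive_unique. auto_derive; auto. }
      rewrite E. ring.
    + apply (ex_du h (- u, v)). apply Hs, box_neg, Hp.
    + auto_derive; auto.
  - assert (Q := open_abs 0 d1 u). cbv beta in Q. rewrite Rminus_0_r in Q.
    generalize (Q (proj1 Hp)). apply filter_imp. intros y Hy. rewrite Rminus_0_r in Hy.
    symmetry. apply He. split; [exact Hy|apply Hp].
Qed.

Lemma even_dv h : even h -> even (dv h).
Proof.
  intros He u v Hp. unfold dv. cbn [fst snd]. apply Derive_ext_loc.
  assert (Q := open_abs 0 d2 v). cbv beta in Q. rewrite Rminus_0_r in Q.
  generalize (Q (proj2 Hp)). apply filter_imp. intros y Hy. rewrite Rminus_0_r in Hy.
  apply He. split; [apply Hp|exact Hy].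
Qed.

Lemma sbox_du h : sbox h -> sbox (du h).
Proof. intros H p Hp. apply sm_du, H, Hp. Qed.
Lemma sbox_dv h : sbox h -> sbox (dv h).
Proof. intros H p Hp. apply sm_dv, H, Hp. Qed.

Definition taylor_step (h : R * R -> R) : R * R -> R := quot (quot (fun p => h p - h (0, snd p))).

(** The first quotient by u of the even function h - h (0, v) is odd, off the axis by computation
    and on it by continuity. It therefore vanishes at u = 0, and u divides once more. *)
Lemma taylor_step_spec h : sbox h -> even h ->
  sbox (taylor_step h) /\ even (taylor_step h) /\
  forall p, box p -> h p = h (0, snd p) + (fst p) ^ 2 * taylor_step h p.
Proof.
  intros Hs He. set (g := fun p : R * R => h p - h (0, snd p)).
  assert (Sg : sbox g).
  { intros [u v] Hp. apply (sm_minus (V := RR)); [apply Hs, Hp|].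
    apply (sm_comp (V := RR) (W := RR) (u, v) h (fun q => (0, snd q))).
    - apply Hs. apply (box_0 u v Hp).
    - apply (sm_pair (V := RR) (W := RN) (Z := RN)); [apply (sm_const (W := RN))|apply sm2_v]. }
  assert (L : forall p, box p -> sm2 p (quot g) /\ g p = fst p * quot g p).
  { intros p Hp. apply quot_local; auto. intros _. apply filter_forall. intros [u v] E. cbn [fst] in E. subst u.
    exact (Rminus_diag (h (0, v))). }
  assert (O : odd (quot g)).
  { assert (O1 : forall u v, u <> 0 -> box (u, v) -> quot g (- u, v) = - quot g (u, v)).
    { intros u v N Hp. rewrite !quot_neq by (cbn [fst]; lra). unfold g. cbn [fst snd]. rewrite He by auto. field. auto. }
    intros u v Hp. destruct (Req_dec u 0) as [->|N]; [|auto].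
    rewrite Ropp_0. assert (Z : quot g (0, v) + quot g (0, v) = 0); [|lra].
    assert (C := cont_zero (fun x => quot g (x, v) + quot g (- x, v)) d1 pd1). cbv beta in C. rewrite Ropp_0 in C.
    apply C.
    - apply (sm_cont (V := RN) (W := RN)). apply (sm_plus (V := RN)).
      + apply sm2_slice_u, L, Hp.
      + apply (sm_comp (V := RN) (W := RN) 0 (fun x => quot g (x, v)) (fun x => - x)).
        * rewrite Ropp_0. apply sm2_slice_u, L, Hp.
        * apply (sm_opp (V := RN)), sm_id.
    - intros x N Hx. rewrite O1; auto; [ring|]. split; [exact Hx|apply Hp]. }
  destruct (quot_odd (quot g)) as [A [B C]]; auto.
  { intros p Hp. apply L, Hp. }
  repeat split; auto. intros p Hp. unfold taylor_step. fold g.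
  assert (E1 := proj2 (L p Hp)). assert (E2 := C p Hp). rewrite E2 in E1. unfold g at 1 in E1. simpl pow.
  transitivity (h (0, snd p) + (h p - h (0, snd p))); [ring|]. rewrite E1. ring.
Qed.

(** Vanishing to infinite order along u = 0, expressed by local divisibility by all powers of u, a
    form which partial derivatives inherit directly. *)
Definition flat (h : R * R -> R) : Prop := forall n v, Rabs v < d2 ->
  exists g, sm2 (0, v) g /\ locally (T := RR) (0, v) (fun q => h q = fst q ^ n * g q).

Lemma flat_du h : flat h -> flat (du h).
Proof.
  intros Hf n v Hv. destruct (Hf (S n) v Hv) as [g [G E]].
  exists (fun q => INR (S n) * g q + fst q * du g q). split.
  - apply (sm_plus (V := RR)); apply (sm_mult (V := RR)); auto using sm2_u, sm_du. apply (sm_const (V := RR) (W := RN)).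
  - generalize (filter_and _ _ (locally_locally (T := RR) _ _ E) (sm_near _ _ G)). apply filter_imp.
    intros q [A B].
    transitivity (du (fun q : R * R => fst q ^ S n) q * g q + fst q ^ S n * du g q).
    + refine (eq_trans (du_ext h _ q A) (du_mult _ g q _ B)). apply (sm_pow (V := RR)), sm2_u.
    + assert (D : du (fun q => fst q ^ S n) q = INR (S n) * fst q ^ n).
      { apply is_derive_unique. cbn [fst].
        assert (Q : forall x : R, is_derive (fun u : R => u ^ S n) x (INR (S n) * x ^ n)).
        { intros x. auto_derive; auto. simpl Nat.pred. apply Rmult_1_l. }
        apply Q. }
      rewrite D. rewrite <- tech_pow_Rmult.
      assert (T : forall a b c e f : R, a * b * c + e * b * f = b * (a * c + e * f)) by (intros; ring). apply T.
Qed.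

Lemma flat_dv h : flat h -> flat (dv h).
Proof.
  intros Hf n v Hv. destruct (Hf n v Hv) as [g [G E]].
  exists (dv g). split; [apply sm_dv, G|].
  generalize (filter_and _ _ (locally_locally (T := RR) _ _ E) (sm_near _ _ G)). apply filter_imp.
  intros q [A B].
  transitivity (dv (fun q : R * R => fst q ^ n) q * g q + fst q ^ n * dv g q).
  - refine (eq_trans (dv_ext h _ q A) (dv_mult _ g q _ B)). apply (sm_pow (V := RR)), sm2_u.
  - assert (D : dv (fun q => fst q ^ n) q = 0) by exact (Derive_const (fst q ^ n) (snd q)).
    rewrite D.
    assert (T : forall a b c : R, 0 * a + b * c = b * c) by (intros; ring). apply T.
Qed.

Lemma cancel_u (A B : R * R -> R) v : sm2 (0, v) A -> sm2 (0, v) B ->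
  locally (T := RR) (0, v) (fun q => fst q * A q = fst q * B q) ->
  locally (T := RR) (0, v) (fun q => A q = B q).
Proof.
  intros SA SB E.
  generalize (filter_and _ _ (locally_locally (T := RR) _ _ E) (filter_and _ _ (sm_near _ _ SA) (sm_near _ _ SB))).
  apply filter_imp. intros [x y] [H [S1 S2]].
  destruct (Req_dec x 0) as [->|N].
  - apply Rminus_diag_uniq.
    apply (zero_axis_u (fun q => A q - B q)).
    + apply (sm_minus (V := RR)); auto.
    + generalize H. apply filter_imp. intros q Hq. rewrite Rmult_minus_distr_l, Hq. apply Rminus_diag.
  - assert (Q := locally_singleton (T := RR) _ _ H). cbn [fst] in Q. apply Rmult_eq_reg_l in Q; auto.
Qed.

(** The u-derivative of h divided by 2 u: at u = sqrt x this is the derivative of h (sqrt x, v) in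
    x. *)
Definition half_quot (h : R * R -> R) (p : R * R) : R := / 2 * quot (du h) p.

Lemma half_quot_spec h : sbox h -> even h -> flat h ->
  sbox (half_quot h) /\ even (half_quot h) /\ flat (half_quot h).
Proof.
  intros Hs He Hf. destruct (quot_odd (du h)) as [A [B C]]; auto using sbox_du, even_du.
  repeat split.
  - intros p Hp. apply (sm_mult (V := RR)); [apply (sm_const (V := RR) (W := RN))|apply A, Hp].
  - intros u v Hp. unfold half_quot. rewrite B; auto.
  - intros n v Hv. destruct (flat_du h Hf (S n) v Hv) as [g [G E]].
    assert (H0 : box (0, v)) by (split; cbn [fst snd]; [rewrite Rabs_R0|]; auto).
    exists (fun q => / 2 * g q). split; [apply (sm_mult (V := RR)); auto; apply (sm_const (V := RR) (W := RN))|].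
    assert (Q : locally (T := RR) (0, v) (fun q => quot (du h) q = fst q ^ n * g q)).
    { apply cancel_u; [apply A, H0| |].
      - apply (sm_mult (V := RR)); auto. apply (sm_pow (V := RR)), sm2_u.
      - generalize (filter_and _ _ E (box_open _ H0)). apply filter_imp. intros q [E1 Bq].
        transitivity (du h q); [symmetry; apply C, Bq|]. rewrite E1. destruct q as [x y]. cbn [fst]. simpl pow. ring. }
    generalize Q. apply filter_imp. intros [x y] Hq. unfold half_quot. cbn [fst] in *. rewrite Hq. ring.
Qed.

Definition root_ext (h : R * R -> R) (p : R * R) : R :=
  if Rlt_dec 0 (fst p) then h (sqrt (fst p), snd p) else 0.

Definition ubox (p : R * R) : Prop := fst p < d1 * d1 /\ Rabs (snd p) < d2.

Lemma ubox_sqrt x v : 0 < x -> ubox (x, v) -> box (sqrt x, v).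
Proof.
  intros Hx [A B]. cbn [fst snd] in *. split; cbn [fst snd]; auto.
  rewrite Rabs_pos_eq by apply sqrt_pos. rewrite <- (sqrt_square d1) by lra. apply sqrt_lt_1; lra.
Qed.

(** Order 2 n of vanishing in u is order n in x = u^2, so flatness survives the square root. *)
Lemma root_ext_small h v n : flat h -> Rabs v < d2 ->
  exists C e, 0 < C /\ 0 < e /\ forall q : R * R, Rabs (fst q) < e -> Rabs (snd q - v) < e -> Rabs (root_ext h q) <= C * Rabs (fst q) ^ n.
Proof.
  intros Hf Hv. destruct (Hf (2 * n)%nat v Hv) as [g [G E]].
  assert (Cg := sm_cont (V := RR) (W := RN) _ _ G).
  destruct (Cg _ (locally_ball (g (0, v)) (mkposreal 1 Rlt_0_1))) as [e1 H1].
  destruct E as [e2 H2]. assert (p1 := cond_pos e1). assert (p2 := cond_pos e2).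
  set (m := Rmin 1 (Rmin e1 e2)).
  assert (pm : 0 < m) by (unfold m; repeat apply Rmin_pos; lra).
  assert (m1 : m <= 1) by apply Rmin_l.
  assert (me1 : m <= e1) by (unfold m; eapply Rle_trans; [apply Rmin_r|apply Rmin_l]).
  assert (me2 : m <= e2) by (unfold m; eapply Rle_trans; [apply Rmin_r|apply Rmin_r]).
  exists (Rabs (g (0, v)) + 1), (m * m). assert (Q0 := Rabs_pos (g (0, v))).
  split; [lra|]. split; [nra|]. intros [x w] Hx Hw. cbn [fst snd] in *. unfold root_ext. cbn [fst snd].
  destruct (Rlt_dec 0 x) as [L|L].
  2:{ rewrite Rabs_R0. apply Rmult_le_pos; [lra|apply pow_le, Rabs_pos]. }
  rewrite (Rabs_pos_eq x) in Hx by lra. rewrite (Rabs_pos_eq x) by lra.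
  assert (Sq : 0 <= sqrt x) by apply sqrt_pos.
  assert (Sm : sqrt x < m).
  { rewrite <- (sqrt_square m) by lra. apply sqrt_lt_1; lra. }
  assert (Bw : Rabs (w - v) < m) by nra.
  rewrite (H2 (sqrt x, w)).
  2:{ split; [change (Rabs (sqrt x - 0) < e2); rewrite Rminus_0_r, Rabs_pos_eq by auto|change (Rabs (w - v) < e2)]; lra. }
  specialize (H1 (sqrt x, w)). lapply H1.
  2:{ split; [change (Rabs (sqrt x - 0) < e1); rewrite Rminus_0_r, Rabs_pos_eq by auto|change (Rabs (w - v) < e1)]; lra. }
  clear H1. intros H1. change (Rabs (g (sqrt x, w) - g (0, v)) < 1) in H1.
  cbn [fst]. rewrite pow_mult. replace (sqrt x ^ 2) with x by (simpl; rewrite Rmult_1_r, sqrt_sqrt; lra).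
  rewrite Rabs_mult, (Rabs_pos_eq (x ^ n)) by (apply pow_le; lra). rewrite Rmult_comm.
  apply Rmult_le_compat_r; [apply pow_le; lra|].
  assert (T : forall a b : R, Rabs (a - b) < 1 -> Rabs a <= Rabs b + 1).
  { intros a b. unfold Rabs; repeat destruct Rcase_abs; lra. }
  exact (T _ _ H1).
Qed.

(** The functions [root_ext h] with h smooth, even and flat are closed under partial derivatives:
    the x-derivative is [root_ext (half_quot h)], the v-derivative [root_ext (dv h)]. At x = 0,
    continuity and the zero derivative come from the bounds of order 1 and 2. *)
Lemma root_ext_Ck h k : sbox h -> even h -> flat h ->
  Ck (V := RR) (W := RN) k ubox (root_ext h).
Proof.
  intros Hs0 He0 Hf0.
  assert (OU : open (T := RR) ubox).
  { intros [u v] [Hu Hv]. apply filter_and.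
    - exact (continuous_fst (U := RN) (V := RN) u v (fun x => x < d1 * d1) (open_lt _ u Hu)).
    - assert (Q := open_abs 0 d2 v). cbv beta in Q. rewrite Rminus_0_r in Q.
      assert (Q' := continuous_snd (U := RN) (V := RN) u v (fun x => Rabs (x - 0) < d2) (Q Hv)).
      unfold filtermap in Q'. generalize Q'. apply filter_imp. intros q. rewrite Rminus_0_r; auto. }
  apply (Ck_coind ubox (fun F => exists h, sbox h /\ even h /\ flat h /\ F = root_ext h)); auto.
  2:{ exists h; auto. }
  clear h Hs0 He0 Hf0. intros F [h [Hs [He [Hf ->]]]].
  assert (Pos : forall x v, 0 < x -> locally (T := RR) (x, v) (fun q => h (sqrt (fst q), snd q) = root_ext h q)).
  { intros x v Hx. assert (Q := continuous_fst (U := RN) (V := RN) x v (fun y => 0 < y) (open_gt 0 x Hx)).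
    unfold filtermap in Q. generalize Q. apply filter_imp. intros [qx qy] Hq. unfold root_ext. cbn [fst snd] in *. destruct (Rlt_dec 0 qx) as [|Nq]; [reflexivity|destruct (Nq Hq)]. }
  assert (Neg : forall x v, x < 0 -> locally (T := RR) (x, v) (fun q => 0 = root_ext h q)).
  { intros x v Hx. assert (Q := continuous_fst (U := RN) (V := RN) x v (fun y => y < 0) (open_lt 0 x Hx)).
    unfold filtermap in Q. generalize Q. apply filter_imp. intros [qx qy] Hq. unfold root_ext. cbn [fst snd] in *.
    destruct (Rlt_dec 0 qx) as [Hq'|]; auto. exfalso. exact (Rlt_asym _ _ Hq Hq'). }
  assert (SmP : forall x v, 0 < x -> ubox (x, v) -> sm2 (x, v) (root_ext h)).
  { intros x v Hx Hb. apply (sm_ext_loc (V := RR) (W := RN) _ _ _ (Pos x v Hx)).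
    apply (sm_comp (V := RR) (W := RR) (x, v) h (fun q => (sqrt (fst q), snd q))).
    - apply Hs, ubox_sqrt; auto.
    - apply (sm_pair (V := RR) (W := RN) (Z := RN)); [apply (sm_sqrt (V := RR)); auto using sm2_u|apply sm2_v]. }
  split.
  - intros [x v] Hb. destruct (Rtotal_order x 0) as [L|[L|L]].
    + apply (sm_cont (V := RR) (W := RN)). apply (sm_ext_loc (V := RR) (W := RN) _ _ _ (Neg x v L)). apply (sm_const (V := RR) (W := RN)).
    + subst x. destruct (root_ext_small h v 1 Hf (proj2 Hb)) as [C [e [pC [pe HC]]]].
      apply filterlim_locally. intros eps. assert (E0 : root_ext h (0, v) = 0).
      { unfold root_ext. cbn [fst]. destruct (Rlt_dec 0 0); auto; lra. }
      assert (pp := cond_pos eps).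
      assert (pm : 0 < Rmin e (eps / C)) by (apply Rmin_pos; auto; apply Rdiv_lt_0_compat; auto).
      exists (mkposreal _ pm). intros [y w] [Hy Hw].
      change (Rabs (y - 0) < Rmin e (eps / C)) in Hy. change (Rabs (w - v) < Rmin e (eps / C)) in Hw.
      rewrite Rminus_0_r in Hy.
      assert (M1 : Rmin e (eps / C) <= e) by apply Rmin_l. assert (M2 : Rmin e (eps / C) <= eps / C) by apply Rmin_r.
      change (Rabs (root_ext h (y, w) - root_ext h (0, v)) < eps). rewrite E0, Rminus_0_r.
      eapply Rle_lt_trans; [apply HC; cbn [fst snd]; lra|]. cbn [fst]. rewrite pow_1.
      apply Rlt_le_trans with (C * (eps / C)); [apply Rmult_lt_compat_l; lra|]. right; field; lra.
    + apply (sm_cont (V := RR) (W := RN)). auto.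
  - destruct (half_quot_spec h Hs He Hf) as [Hs' [He' Hf']].
    exists (root_ext (half_quot h)), (root_ext (dv h)). split; [eauto|]. split.
    { exists (dv h). repeat split; auto using sbox_dv, even_dv, flat_dv. }
    split.
    + intros [x v] Hb. cbn [fst snd]. unfold root_ext at 2. cbn [fst snd]. destruct (Rlt_dec 0 x) as [L|L].
      * apply (is_derive_ext_loc (fun x => h (sqrt x, v))).
        { generalize (open_gt 0 x L). apply filter_imp. intros y Hy. unfold root_ext. cbn [fst snd]. destruct (Rlt_dec 0 y) as [|Ny]; [reflexivity|destruct (Ny Hy)]. }
        assert (Bx := ubox_sqrt x v L Hb).
        assert (Sp : 0 < sqrt x) by (apply sqrt_lt_R0; auto).
        evar_last.
        -- apply (is_derive_comp (fun y => h (y, v)) sqrt).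
           ++ apply (du_correct (sqrt x, v) h). apply Hs, Bx.
           ++ auto_derive; auto.
        -- unfold half_quot. rewrite quot_neq by (cbn [fst]; lra). cbn [fst snd].
           assert (T : forall a s : R, 0 < s -> 1 * / (2 * s) * a = / 2 * (a / s)) by (intros; field; lra).
           exact (T _ _ Sp).
      * destruct (Rle_lt_or_eq_dec x 0) as [L'|L']; [lra| |].
        -- apply (is_derive_ext_loc (fun _ => 0)).
           { generalize (open_lt 0 x L'). apply filter_imp. intros y Hy. unfold root_ext. cbn [fst snd].
             destruct (Rlt_dec 0 y) as [Hy'|]; auto. exfalso. exact (Rlt_asym _ _ Hy Hy'). }
           apply (is_derive_const (K := R_AbsRing) (V := RN)).
        -- subst x. destruct (root_ext_small h v 2 Hf (proj2 Hb)) as [C [e [pC [pe HC]]]].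
           apply is_derive_Reals. intros eps Heps.
           assert (pm : 0 < Rmin e (eps / C)) by (apply Rmin_pos; auto; apply Rdiv_lt_0_compat; auto).
           exists (mkposreal _ pm). intros s Hs0 Hs1. change (Rabs s < Rmin e (eps / C)) in Hs1.
           assert (M1 : Rmin e (eps / C) <= e) by apply Rmin_l. assert (M2 : Rmin e (eps / C) <= eps / C) by apply Rmin_r.
           rewrite Rplus_0_l. assert (E0 : root_ext h (0, v) = 0).
           { unfold root_ext. cbn [fst]. destruct (Rlt_dec 0 0); auto; lra. }
           change (Rabs ((root_ext h (s, v) - root_ext h (0, v)) / s - 0) < eps).
           rewrite E0, !Rminus_0_r. unfold Rdiv. rewrite Rabs_mult, Rabs_inv.
           assert (As := Rabs_pos_lt s Hs0).
           assert (B : Rabs (root_ext h (s, v)) <= C * Rabs s ^ 2).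
           { apply (HC (s, v)); cbn [fst snd]; [lra|]. rewrite Rminus_diag, Rabs_R0. exact pe. }
           apply Rle_lt_trans with (C * Rabs s ^ 2 * / Rabs s).
           { apply Rmult_le_compat_r; auto. left; apply Rinv_0_lt_compat; auto. }
           replace (C * Rabs s ^ 2 * / Rabs s) with (C * Rabs s) by (field; lra).
           apply Rlt_le_trans with (C * (eps / C)); [apply Rmult_lt_compat_l; lra|]. right; field; lra.
    + intros [x v] Hb. cbn [fst snd]. unfold root_ext. cbn [fst snd]. destruct (Rlt_dec 0 x) as [L|L].
      * apply (dv_correct (sqrt x, v) h). apply Hs, ubox_sqrt; auto.
      * apply (is_derive_const (K := R_AbsRing) (V := RN)).
Qed.

End Even.

Lemma gs_box h : gs h -> exists d, 0 < d /\ forall p, Rabs (fst p) < d -> Rabs (snd p) < d -> sm2 p h.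
Proof.
  intros Hh. destruct (gs_near h Hh) as [d Hd]. exists d. split; [apply cond_pos|].
  intros [u v] Hu Hv. apply Hd. split; [change (Rabs (u - 0) < d)|change (Rabs (v - 0) < d)]; rewrite Rminus_0_r; auto.
Qed.

Lemma near_box (P : R * R -> Prop) : near0 P <-> exists d, 0 < d /\ forall p, Rabs (fst p) < d -> Rabs (snd p) < d -> P p.
Proof.
  split.
  - intros [d Hd]. exists d. split; [apply cond_pos|].
    intros [u v] Hu Hv. apply Hd. split; [change (Rabs (u - 0) < d)|change (Rabs (v - 0) < d)]; rewrite Rminus_0_r; auto.
  - intros [d [pd Hd]]. exists (mkposreal d pd). intros [u v] [Hu Hv].
    change (Rabs (u - 0) < d) in Hu. change (Rabs (v - 0) < d) in Hv. rewrite Rminus_0_r in *. apply Hd; auto.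
Qed.

(* Whitney: subtracting a Borel sum in u^2 leaves a function flat along u = 0, whose composition
   with sqrt u extends smoothly by 0. *)
Lemma whitney_even h : gs h -> near0 (fun p => h (- fst p, snd p) = h p) ->
  exists k, gs k /\ near0 (fun p => h p = k ((fst p) ^ 2, snd p)).
Proof.
  intros Hh He. apply near_box in He. destruct He as [e1 [pe1 He]].
  destruct (gs_box h Hh) as [e2 [pe2 Hs]].
  set (d := Rmin e1 e2). assert (pd : 0 < d) by (apply Rmin_pos; auto).
  assert (de1 : d <= e1) by apply Rmin_l. assert (de2 : d <= e2) by apply Rmin_r.
  set (hs := fun n => Nat.iter n taylor_step h).
  assert (HS : forall n, sbox d d (hs n) /\ even d d (hs n)).
  { induction n as [|n [A B]].
    - split.
      + intros p [A B]. apply Hs; lra.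
      + intros u v [A B]. apply (He (u, v)); cbn [fst snd] in *; lra.
    - destruct (taylor_step_spec d d pd (hs n) A B) as [C [D _]]. split; auto. }
  assert (HT : forall n p, box d d p -> hs n p = hs n (0, snd p) + fst p ^ 2 * hs (S n) p).
  { intros n. destruct (HS n) as [A B]. apply (taylor_step_spec d d pd (hs n) A B). }
  destruct (borel_param (fun n v => hs n (0, v)) d pd) as [B [B1 B2]].
  { intros k v Hv. apply sm2_slice_v. apply HS. split; cbn [fst snd]; [rewrite Rabs_R0|]; auto. }
  (* The iterated remainders of h and those of its Borel sum in u^2 obey the same recursion with the
     same coefficients, so the differences satisfy Rm n = u^2 Rm (n + 1), which yields flatness. *)
  set (Rm := fun n (p : R * R) => hs n p - B n (fst p ^ 2, snd p)).
  assert (p2 : 0 < d / 2) by lra.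
  assert (RS : forall n, sbox d (d / 2) (Rm n)).
  { intros n [u v] [Hu Hv]. cbn [fst snd] in *. apply (sm_minus (V := RR)).
    - apply HS. split; cbn [fst snd]; lra.
    - apply (sm_comp (V := RR) (W := RR) (u, v) (B n) (fun p => (fst p ^ 2, snd p))).
      + apply B1. exact Hv.
      + apply (sm_pair (V := RR) (W := RN) (Z := RN)); [apply (sm_pow (V := RR)), sm2_u|apply sm2_v]. }
  assert (RE : forall n, even d (d / 2) (Rm n)).
  { intros n u v [Hu Hv]. unfold Rm. cbn [fst snd] in *. rewrite (proj2 (HS n)) by (split; cbn [fst snd]; lra).
    f_equal. f_equal. f_equal. ring. }
  assert (RR1 : forall n v, Rabs v < d / 2 -> locally (T := RR) (0, v) (fun q => Rm n q = fst q ^ 2 * Rm (S n) q)).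
  { intros n v Hv. destruct (B2 n) as [r [pr Hr]].
    set (m := Rmin 1 (Rmin r d)). assert (pm : 0 < m) by (repeat apply Rmin_pos; lra).
    assert (m1 : m <= 1) by apply Rmin_l.
    assert (m2 : m <= r) by (unfold m; eapply Rle_trans; [apply Rmin_r|apply Rmin_l]).
    assert (m3 : m <= d) by (unfold m; eapply Rle_trans; [apply Rmin_r|apply Rmin_r]).
    assert (Hb : box m (d / 2) (0, v)) by (split; cbn [fst snd]; [rewrite Rabs_R0|]; auto).
    assert (HR : forall x w : R, Rabs x < m -> Rabs w < d / 2 -> Rm n (x, w) = x ^ 2 * Rm (S n) (x, w)).
    { intros x w Hx Hw. unfold Rm. cbn [fst snd].
      assert (E1 := HT n (x, w)). cbn [fst snd] in E1. rewrite E1 by (split; cbn [fst snd]; lra).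
      assert (E2 := Hr (x ^ 2, w)). cbn [fst snd] in E2. rewrite E2; [ring| |lra].
      simpl. rewrite Rmult_1_r, Rabs_mult. assert (Q := Rabs_pos x). nra. }
    generalize (box_open m (d / 2) _ Hb). apply filter_imp. intros [x w] [Hx Hw]. exact (HR x w Hx Hw). }
  assert (RF : flat (d / 2) (Rm 0%nat)).
  { assert (G : forall n j v, Rabs v < d / 2 -> locally (T := RR) (0, v) (fun q => Rm j q = (fst q ^ 2) ^ n * Rm (n + j)%nat q)).
    { induction n as [|n IH]; intros j v Hv.
      - apply filter_forall. intros q. simpl. ring.
      - generalize (filter_and _ _ (RR1 j v Hv) (IH (S j) v Hv)). apply filter_imp. intros q [E1 E2].
        replace (n + S j)%nat with (S n + j)%nat in E2 by lia.
        assert (T : forall a b c e : R, a = b * c -> c = b ^ n * e -> a = b ^ S n * e).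
        { intros a b c e -> ->. rewrite <- tech_pow_Rmult. ring. }
        exact (T _ _ _ _ E1 E2). }
    intros n v Hv. exists (fun q => fst q ^ n * Rm n q). split.
    - apply (sm_mult (V := RR)); [apply (sm_pow (V := RR)), sm2_u|]. apply RS. split; cbn [fst snd]; [rewrite Rabs_R0|]; auto.
    - generalize (G n 0%nat v Hv). apply filter_imp. intros q E. rewrite Nat.add_0_r in E.
      assert (T : forall a b e : R, a = (b ^ 2) ^ n * e -> a = b ^ n * (b ^ n * e)).
      { intros a b e ->. rewrite <- pow_mult. replace (2 * n)%nat with (n + n)%nat by lia. rewrite pow_add. ring. }
      exact (T _ _ _ E). }
  exists (fun p => B 0%nat p + root_ext (Rm 0%nat) p). split.
  - apply gs_plus.
    + apply B1. simpl. rewrite Rabs_R0. lra.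
    + exists (ubox d (d / 2)). split; [|split].
      * intros [u v] [Hu Hv]. apply filter_and.
        -- exact (continuous_fst (U := RN) (V := RN) u v (fun x => x < d * d) (open_lt _ u Hu)).
        -- assert (Q := open_abs 0 (d / 2) v). cbv beta in Q. rewrite Rminus_0_r in Q.
           assert (Q' := continuous_snd (U := RN) (V := RN) u v (fun x => Rabs (x - 0) < d / 2) (Q Hv)).
           unfold filtermap in Q'. generalize Q'. apply filter_imp. intros q. rewrite Rminus_0_r; auto.
      * split; simpl; [nra|]. rewrite Rabs_R0. lra.
      * intros k. apply root_ext_Ck; auto.
  - apply near_box. exists (d / 2). split; auto. intros [u v] Hu Hv. cbn [fst snd] in *.
    assert (E : root_ext (Rm 0%nat) (u ^ 2, v) = Rm 0%nat (u, v)).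
    { unfold root_ext. cbn [fst snd]. destruct (Rlt_dec 0 (u ^ 2)) as [L|L].
      (* The square root of u^2 is the absolute value of u; evenness of the remainder handles
         negative u. *)
      - replace (sqrt (u ^ 2)) with (Rabs u) by (rewrite <- sqrt_Rsqr_abs; f_equal; unfold Rsqr; ring).
        unfold Rabs. destruct (Rcase_abs u); auto. apply RE. split; cbn [fst snd]; lra.
      - assert (u = 0) by nra. subst u. symmetry.
        destruct (RF 1%nat v Hv) as [g [_ Eg]]. assert (Q := locally_singleton (T := RR) _ _ Eg). cbv beta in Q.
        rewrite Q. cbn [fst]. ring. }
    rewrite E. unfold Rm. cbn [fst snd]. unfold hs. simpl Nat.iter. ring.
Qed.

(** * Split-complex and complex coordinates *)

(* The algebra R[j]/(j^2 = e) on pairs: split-complex for e = 1, complex for e = -1. *)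
Definition dadd (a b : R * R) : R * R := (fst a + fst b, snd a + snd b).
Definition dsub (a b : R * R) : R * R := (fst a - fst b, snd a - snd b).
Definition dopp (a : R * R) : R * R := (- fst a, - snd a).
Definition dmul (e : R) (a b : R * R) : R * R := (fst a * fst b + e * (snd a * snd b), fst a * snd b + snd a * fst b).
Definition dconj (a : R * R) : R * R := (fst a, - snd a).
Definition dre (r : R) : R * R := (r, 0).
Definition dnorm (e : R) (a : R * R) : R := fst a * fst a - e * (snd a * snd a).
Definition dinv (e : R) (a : R * R) : R * R := (fst a / dnorm e a, - snd a / dnorm e a).

Lemma deq (a b : R * R) : fst a = fst b -> snd a = snd b -> a = b.
Proof. destruct a, b; simpl; intros; subst; auto. Qed.

Ltac dred := cbn [dadd dsub dopp dmul dconj dre dinv fst snd]; unfold dnorm; cbn [dadd dsub dopp dmul dconj dre dinv fst snd].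
Ltac dring := intros; apply deq; dred; ring.

Definition dsm (W : R * R -> R * R) : Prop := gs (fun p => fst (W p)) /\ gs (fun p => snd (W p)).
Definition dM (n : nat) (W : R * R -> R * R) : Prop := M n (fun p => fst (W p)) /\ M n (fun p => snd (W p)).

Lemma gs_eq a b : (forall p, a p = b p) -> gs a -> gs b.
Proof. intros E. apply gs_ext, near_all, E. Qed.

Lemma dsm_near W V : near0 (fun p => W p = V p) -> dsm W -> dsm V.
Proof.
  intros E [A B]. split.
  - apply (gs_ext (fun p => fst (W p))); auto. apply (near1 _ _ E). intros p ->; auto.
  - apply (gs_ext (fun p => snd (W p))); auto. apply (near1 _ _ E). intros p ->; auto.
Qed.

Lemma dM_near n W V : near0 (fun p => W p = V p) -> dM n W -> dM n V.
Proof.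
  intros E [A B]. split.
  - apply (M_ext n (fun p => fst (W p))); auto. apply (near1 _ _ E). intros p ->; auto.
  - apply (M_ext n (fun p => snd (W p))); auto. apply (near1 _ _ E). intros p ->; auto.
Qed.

Lemma dM_dsm n W : dM n W -> dsm W.
Proof. intros [A B]; split; eapply M_gs; eauto. Qed.
Lemma dM_le n m W : (n <= m)%nat -> dM m W -> dM n W.
Proof. intros H [A B]; split; eapply M_le; eauto. Qed.
Lemma dsm_const c : dsm (fun _ => c).
Proof. split; [exact (gs_const (fst c))|exact (gs_const (snd c))]. Qed.
Lemma dsm_p : dsm (fun p => p).
Proof. split; [apply gs_u|apply gs_v]. Qed.
Lemma dsm_pair a b : gs a -> gs b -> dsm (fun p => (a p, b p)).
Proof. split; auto. Qed.
Lemma dsm_re a : gs a -> dsm (fun p => dre (a p)).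
Proof. split; auto. exact (gs_const 0). Qed.
Lemma dM_p : dM 1 (fun p => p).
Proof. split; [apply M_u|apply M_v]. Qed.
Lemma dM_add n A B : dM n A -> dM n B -> dM n (fun p => dadd (A p) (B p)).
Proof. intros [A1 A2] [B1 B2]; split; apply M_plus; auto. Qed.
Lemma dM_sub n A B : dM n A -> dM n B -> dM n (fun p => dsub (A p) (B p)).
Proof. intros [A1 A2] [B1 B2]; split; apply M_minus; auto. Qed.
Lemma dM_opp n A : dM n A -> dM n (fun p => dopp (A p)).
Proof. intros [A1 A2]; split; apply M_opp; auto. Qed.
Lemma dM_conj n A : dM n A -> dM n (fun p => dconj (A p)).
Proof. intros [A1 A2]; split; auto; apply M_opp; auto. Qed.
Lemma dM_mul e n m A B : dM n A -> dM m B -> dM (n + m) (fun p => dmul e (A p) (B p)).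
Proof.
  intros [A1 A2] [B1 B2]; split; cbn [dmul fst snd].
  - apply M_plus; [apply (M_mult n m (fun p => fst (A p)) (fun p => fst (B p))); auto|].
    apply (M_eq _ (fun p => snd (A p) * snd (B p) * e)); [intros; ring|].
    apply M_mul_gs; [|apply gs_const]. apply (M_mult n m (fun p => snd (A p)) (fun p => snd (B p))); auto.
  - apply M_plus; [apply (M_mult n m (fun p => fst (A p)) (fun p => snd (B p)))|apply (M_mult n m (fun p => snd (A p)) (fun p => fst (B p)))]; auto.
Qed.
Lemma dsm_add A B : dsm A -> dsm B -> dsm (fun p => dadd (A p) (B p)).
Proof. apply (dM_add 0). Qed.
Lemma dsm_sub A B : dsm A -> dsm B -> dsm (fun p => dsub (A p) (B p)).
Proof. apply (dM_sub 0). Qed.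
Lemma dsm_opp A : dsm A -> dsm (fun p => dopp (A p)).
Proof. apply (dM_opp 0). Qed.
Lemma dsm_conj A : dsm A -> dsm (fun p => dconj (A p)).
Proof. apply (dM_conj 0). Qed.
Lemma dsm_mul e A B : dsm A -> dsm B -> dsm (fun p => dmul e (A p) (B p)).
Proof. apply (dM_mul e 0 0). Qed.
Lemma dsm_norm e A : dsm A -> gs (fun p => dnorm e (A p)).
Proof. intros [A1 A2]. unfold dnorm. gsm. Qed.
Lemma dsm_inv e A : dnorm e (A origin) <> 0 -> dsm A -> dsm (fun p => dinv e (A p)).
Proof.
  intros H HA. assert (Hn := dsm_norm e A HA). destruct HA as [A1 A2]. split; cbn [dinv fst snd].
  - apply gs_div; auto.
  - apply gs_div; auto. apply gs_opp; auto.
Qed.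
Lemma dsm_comp A phi : dsm A -> map_germ phi -> dsm (fun p => A (phi p)).
Proof.
  intros [A1 A2] H. split; [apply (gs_comp (fun p => fst (A p)))|apply (gs_comp (fun p => snd (A p)))]; auto.
Qed.
Lemma dM_comp n A phi : dM n A -> map_germ phi -> dM n (fun p => A (phi p)).
Proof.
  intros [A1 A2] H. split; [apply (M_comp n phi H (fun p => fst (A p)))|apply (M_comp n phi H (fun p => snd (A p)))]; auto.
Qed.
Lemma germ_dsm phi : map_germ phi <-> dsm phi /\ phi origin = origin.
Proof. rewrite germ_gs. unfold dsm. tauto. Qed.
Lemma dM_germ n phi : dM (S n) phi -> map_germ phi.
Proof.
  intros H. apply germ_dsm. split; [apply (dM_dsm (S n)), H|].
  destruct H as [A B]. apply deq; [apply (M_at0 n (fun p => fst (phi p)) A)|apply (M_at0 n (fun p => snd (phi p)) B)].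
Qed.
Lemma dM_at0 n A : dM (S n) A -> A origin = (0, 0).
Proof. intros H. apply dM_germ in H. apply H. Qed.
Lemma dM_1 A : dM 1 A <-> dsm A /\ A origin = (0, 0).
Proof.
  split.
  - intros H. split; [apply (dM_dsm 1), H|apply (dM_at0 0), H].
  - intros [[A1 A2] E]. split; apply M_1; rewrite E; auto.
Qed.

Create HintDb ddb.
#[export] Hint Resolve dsm_const dsm_p dsm_add dsm_sub dsm_opp dsm_conj dsm_mul dsm_comp : ddb.
Ltac dsmt := auto 40 with ddb.

Lemma M_const_linear a b : M 2 (fun p => fst p * a + snd p * b) -> a = 0 /\ b = 0.
Proof.
  intros H. split.
  - assert (H1 := M_at0 0 _ (M_du 1 _ H)). cbv beta in H1.
    rewrite du_plus, !du_mult, du_u, du_v, !du_const in H1; auto using sm2_u, sm2_v;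
      try (apply (sm_const (V := RR) (W := RN))); try (apply (sm_mult (V := RR)); auto using sm2_u, sm2_v; apply (sm_const (V := RR) (W := RN))).
    cbn [origin fst snd] in H1. lra.
  - assert (H1 := M_at0 0 _ (M_dv 1 _ H)). cbv beta in H1.
    rewrite dv_plus, !dv_mult, dv_u, dv_v, !dv_const in H1; auto using sm2_u, sm2_v;
      try (apply (sm_const (V := RR) (W := RN))); try (apply (sm_mult (V := RR)); auto using sm2_u, sm2_v; apply (sm_const (V := RR) (W := RN))).
    cbn [origin fst snd] in H1. lra.
Qed.

Lemma cancel_u_germ A B : gs A -> gs B -> near0 (fun p => fst p * A p = fst p * B p) -> near0 (fun p => A p = B p).
Proof. intros HA HB H. apply (cancel_u A B 0 HA HB H). Qed.

Lemma cancel_v_germ A B : gs A -> gs B -> near0 (fun p => snd p * A p = snd p * B p) -> near0 (fun p => A p = B p).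
Proof.
  intros HA HB H.
  assert (C := cancel_u_germ (fun p => A (swap p)) (fun p => B (swap p))
    (gs_comp _ _ HA swap_germ) (gs_comp _ _ HB swap_germ) (near0_comp _ swap swap_germ H)).
  apply (near1 _ _ (near0_comp _ swap swap_germ C)). intros p. rewrite swap_swap. auto.
Qed.

(** Setting v = 0 kills the right side, and u can be cancelled, so a vanishes on the axis v = 0 and
    v divides it. Cancelling v gives the other half. *)
Lemma coprime_uv a b : gs a -> gs b -> near0 (fun p => fst p * a p = snd p * b p) ->
  exists c, gs c /\ near0 (fun p => a p = snd p * c p /\ b p = fst p * c p).
Proof.
  intros Ha Hb H.
  assert (G : map_germ (fun p => (fst p, 0))) by (apply germ_pair; gsm).
  assert (Z : near0 (fun p => a (fst p, 0) = 0)).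
  { apply (cancel_u_germ (fun p => a (fst p, 0)) (fun _ => 0)); gsm.
    - apply (gs_comp a _ Ha G).
    - apply (near1 _ _ (near0_comp _ _ G H)). intros p E. cbn [fst snd] in E. rewrite E. ring. }
  destruct (hadamard_v a Ha Z) as [c [Hc E]]. exists c. split; auto.
  apply near_and; auto.
  apply (cancel_v_germ b (fun p => fst p * c p)); gsm.
  apply (near2 _ _ _ H E). intros p E1 E2. rewrite <- E1, E2. ring.
Qed.

Lemma unit_cases e : e * e = 1 -> e = 1 \/ e = -1.
Proof.
  intros H. assert (Q : (e - 1) * (e + 1) = 0) by (ring_simplify; lra).
  apply Rmult_integral in Q. destruct Q; [left|right]; lra.
Qed.

(** [field] cannot use e * e = 1, so both values of e are substituted first. *)
Ltac efield e He := let H := fresh in destruct (unit_cases e He) as [H|H]; rewrite !H; field.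

Section D.

Variable e : R.
Hypothesis He : e * e = 1.

Notation "a +' b" := (dadd a b) (at level 50, left associativity).
Notation "a -' b" := (dsub a b) (at level 50, left associativity).
Notation "a *' b" := (dmul e a b) (at level 40, left associativity).

(** Substitute u = (z + zbar) / 2 and v = e j (z - zbar) / 2 in W = u a + v b: the coefficients are
    (a + e j b) / 2 and (a - e j b) / 2. *)
Lemma dM_split n W : dM (S n) W -> exists A B, dM n A /\ dM n B /\
  near0 (fun p => W p = p *' A p +' dconj p *' B p).
Proof.
  intros [[a1 [b1 [A1 [B1 E1]]]] [a2 [b2 [A2 [B2 E2]]]]].
  assert (Q : forall a b r, M n a -> M n b -> M n (fun p => (a p + r * b p) / 2)).
  { intros a b r Ha Hb. apply (M_eq n (fun p => a p * / 2 + b p * (r / 2))); [intros; field|].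
    apply M_plus; apply M_mul_gs; auto using gs_const. }
  exists (fun p => ((a1 p + 1 * b2 p) / 2, (a2 p + e * b1 p) / 2)), (fun p => ((a1 p + (-1) * b2 p) / 2, (a2 p + (- e) * b1 p) / 2)).
  split; [split; apply Q; auto|]. split; [split; apply Q; auto|].
  apply (near2 _ _ _ E1 E2). intros p F1 F2. apply deq; dred.
  - rewrite F1. field_simplify. replace (e ^ 2) with 1 by (rewrite <- He; ring). field.
  - rewrite F2. field.
Qed.

(* Congruence modulo the ideal generated by zbar, that is, by [dconj]; z is the identity map. *)
Definition cz (W V : R * R -> R * R) : Prop :=
  exists k, dsm k /\ near0 (fun p => W p = V p +' dconj p *' k p).

Lemma cz_near W V : near0 (fun p => W p = V p) -> cz W V.
Proof.
  intros E. exists (fun _ => (0, 0)). split; [apply dsm_const|]. apply (near1 _ _ E). intros p ->. dring.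
Qed.
Lemma cz_eq W V : (forall p, W p = V p) -> cz W V.
Proof. intros E. apply cz_near, near_all, E. Qed.
Lemma cz_refl W : cz W W.
Proof. apply cz_eq; auto. Qed.
Lemma cz_sym W V : cz W V -> cz V W.
Proof.
  intros [k [Hk E]]. exists (fun p => dopp (k p)). split; [dsmt|].
  apply (near1 _ _ E). intros p ->. dring.
Qed.
Lemma cz_trans W V X : cz W V -> cz V X -> cz W X.
Proof.
  intros [k [Hk E]] [l [Hl F]]. exists (fun p => k p +' l p). split; [dsmt|].
  apply (near2 _ _ _ E F). intros p -> ->. dring.
Qed.
Lemma cz_add W V W' V' : cz W V -> cz W' V' -> cz (fun p => W p +' W' p) (fun p => V p +' V' p).
Proof.
  intros [k [Hk E]] [l [Hl F]]. exists (fun p => k p +' l p). split; [dsmt|].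
  apply (near2 _ _ _ E F). intros p -> ->. dring.
Qed.
Lemma cz_sub W V W' V' : cz W V -> cz W' V' -> cz (fun p => W p -' W' p) (fun p => V p -' V' p).
Proof.
  intros [k [Hk E]] [l [Hl F]]. exists (fun p => k p -' l p). split; [dsmt|].
  apply (near2 _ _ _ E F). intros p -> ->. dring.
Qed.
Lemma cz_opp W V : cz W V -> cz (fun p => dopp (W p)) (fun p => dopp (V p)).
Proof.
  intros [k [Hk E]]. exists (fun p => dopp (k p)). split; [dsmt|].
  apply (near1 _ _ E). intros p ->. dring.
Qed.
Lemma cz_mul W V W' V' : dsm V -> dsm W' -> cz W V -> cz W' V' -> cz (fun p => W p *' W' p) (fun p => V p *' V' p).
Proof.
  intros HV HW [k [Hk E]] [l [Hl F]]. exists (fun p => k p *' W' p +' V p *' l p). split; [dsmt|].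
  apply (near2 _ _ _ E F). intros p E1 E2. rewrite E1.
  transitivity (V p *' W' p +' dconj p *' (k p *' W' p)); [dring|].
  transitivity (V p *' (V' p +' dconj p *' l p) +' dconj p *' (k p *' W' p)); [rewrite <- E2; reflexivity|]. dring.
Qed.
Lemma cz_zbar A : dsm A -> cz (fun p => dconj p *' A p) (fun _ => (0, 0)).
Proof. intros H. exists A. split; auto. apply near_all. dring. Qed.

(** Repeated splitting: each time the zbar part is discarded and a factor z comes out. *)
Lemma cz_dM n W : dM n W -> exists h, dsm h /\ cz W (fun p => Nat.iter n (dmul e p) (h p)).
Proof.
  revert W. induction n as [|n IH]; intros W HW.
  - exists W. split; [exact HW|apply cz_refl].
  - destruct (dM_split n W HW) as [A [B [HA [HB E]]]].
    destruct (IH A HA) as [h [Hh Eh]]. exists h. split; auto.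
    apply (cz_trans _ (fun p => p *' A p)).
    + exists B. split; [apply (dM_dsm n), HB|exact E].
    + simpl. apply cz_mul; auto using cz_refl, dsm_p. apply (dM_dsm n), HA.
Qed.

(** In the split case the algebra has zero divisors, so the coprimality of z and zbar is read off
    the two real components, where it becomes that of u and v. *)
Lemma coprime_z h k : dsm h -> dsm k -> near0 (fun p => p *' h p = dconj p *' k p) ->
  exists c, dsm c /\ near0 (fun p => h p = dconj p *' c p /\ k p = p *' c p).
Proof.
  intros [H1 H2] [K1 K2] E.
  (* u (h - k) = v (- j (h + k)) *)
  destruct (coprime_uv (fun p => fst (h p) - fst (k p)) (fun p => - (e * (snd (h p) + snd (k p))))) as [c1 [C1 F1]]; gsm.
  { apply (near1 _ _ E). intros p Ep. apply (f_equal fst) in Ep. revert Ep. dred. intros Ep. lra. }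
  destruct (coprime_uv (fun p => snd (h p) - snd (k p)) (fun p => - (fst (h p) + fst (k p)))) as [c2 [C2 F2]]; gsm.
  { apply (near1 _ _ E). intros p Ep. apply (f_equal snd) in Ep. revert Ep. dred. intros Ep. lra. }
  exists (fun p => (- c2 p / 2, - e * c1 p / 2)). split.
  - split; cbn [fst snd]; unfold Rdiv; gsm.
  - assert (T : forall x y u v a b c1 c2 : R, x - a = v * c1 -> - (e * (y + b)) = u * c1 -> y - b = v * c2 -> - (x + a) = u * c2 ->
       x = u * (- c2 / 2) + e * (- v * (- e * c1 / 2)) /\ y = u * (- e * c1 / 2) + - v * (- c2 / 2) /\
       a = u * (- c2 / 2) + e * (v * (- e * c1 / 2)) /\ b = u * (- e * c1 / 2) + v * (- c2 / 2)).
    { intros x y u v a b d1 d2 E1 E2 E3 E4.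
      assert (E2' : y + b = - e * (u * d1)).
      { rewrite <- E2. transitivity (e * e * (y + b)); [rewrite He; ring|ring]. }
      assert (EE : forall r, e * (e * r) = r) by (intros r; rewrite <- Rmult_assoc, He; ring).
      replace (e * (- v * (- e * d1 / 2))) with (e * (e * (v * d1 / 2))) by field.
      replace (e * (v * (- e * d1 / 2))) with (e * (e * (- v * d1 / 2))) by field.
      rewrite !EE. repeat split; lra. }
    apply (near2 _ _ _ F1 F2). intros p [E1 E2] [E3 E4].
    destruct (T _ _ _ _ _ _ _ _ E1 E2 E3 E4) as [Q1 [Q2 [Q3 Q4]]].
    split; apply deq; dred; auto.
Qed.

Lemma cz_cancel h : dsm h -> cz (fun p => p *' h p) (fun _ => (0, 0)) -> cz h (fun _ => (0, 0)).
Proof.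
  intros Hh [k [Hk E]]. destruct (coprime_z h k Hh Hk) as [c [Hc F]].
  - apply (near1 _ _ E). intros p ->. dring.
  - exists c. split; auto. apply (near1 _ _ F). intros p [-> _]. dring.
Qed.

(** Conjugating the second congruence shows that z divides k as well as zbar, and coprimality then
    puts k in the ideal of N = z zbar. *)
Lemma cz_both k : dsm k -> cz k (fun _ => (0, 0)) -> cz (fun p => dconj (k p)) (fun _ => (0, 0)) ->
  exists m, dsm m /\ near0 (fun p => k p = dre (dnorm e p) *' m p).
Proof.
  intros Hk [a [Ha E]] [b [Hb F]].
  destruct (coprime_z (fun p => dconj (b p)) a) as [c [Hc Q]]; auto; [dsmt| |].
  - apply (near2 _ _ _ E F). intros p E1 F1.
    transitivity (dconj (dconj (k p))).
    + rewrite F1. dring.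
    + transitivity (k p); [dring|]. rewrite E1. dring.
  - exists c. split; auto. apply (near2 _ _ _ E Q). intros p -> [_ ->]. dring.
Qed.

(** A form z a1 + zbar k0 with constant coefficients that lies in the second power of the maximal
    ideal is zero. Hence constant and linear coefficients modulo zbar are well defined. *)
Lemma cz_const_linear a0 a1 k H : dsm k -> dM 2 H ->
  near0 (fun p => a0 +' p *' a1 +' dconj p *' k p +' H p = (0, 0)) -> a0 = (0, 0) /\ a1 = (0, 0).
Proof.
  intros Hk HH E.
  assert (A0 : a0 = (0, 0)).
  { assert (Q := near_at0 _ E). cbv beta in Q. rewrite (dM_at0 1 H HH) in Q.
    assert (Q1 := f_equal fst Q). assert (Q2 := f_equal snd Q). revert Q1 Q2. unfold origin. dred. intros Q1 Q2.
    apply deq; cbn [fst snd]; lra. }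
  split; auto. subst a0.
  set (k0 := k origin).
  assert (L : dM 2 (fun p => p *' a1 +' dconj p *' k0)).
  { apply (dM_near 2 (fun p => dopp (H p) -' dconj p *' (k p -' k0))).
    - apply (near1 _ _ E). intros p Ep.
      transitivity (p *' a1 +' dconj p *' k0 -' ((0,0) +' p *' a1 +' dconj p *' k p +' H p)); [dring|]. rewrite Ep. dring.
    - apply dM_sub; [apply dM_opp, HH|]. apply (dM_mul e 1 1); [apply dM_conj, dM_p|].
      apply dM_1. split; [dsmt|]. unfold k0. dring. }
  destruct L as [L1 L2].
  destruct (M_const_linear (fst a1 + fst k0) (e * (snd a1 - snd k0))) as [Q1 Q2].
  { apply (M_eq 2 (fun p => fst (p *' a1 +' dconj p *' k0))); auto. intros p. dred. ring. }
  destruct (M_const_linear (snd a1 + snd k0) (fst a1 - fst k0)) as [Q3 Q4].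
  { apply (M_eq 2 (fun p => snd (p *' a1 +' dconj p *' k0))); auto. intros p. dred. ring. }
  assert (Q2' : snd a1 - snd k0 = 0).
  { transitivity (e * (e * (snd a1 - snd k0))); [rewrite <- Rmult_assoc, He; ring|]. rewrite Q2. ring. }
  apply deq; cbn [fst snd]; lra.
Qed.

End D.

(** * Extending functions over the normal form *)

Lemma even_odd_u h : gs h -> exists A B, gs A /\ gs B /\
  near0 (fun p => h p = A (fst p ^ 2, snd p) + fst p * B (fst p ^ 2, snd p)).
Proof.
  intros Hh.
  set (r := fun p : R * R => (- fst p, snd p)).
  assert (Gr : map_germ r) by (apply germ_pair; gsm; simpl; ring).
  assert (rr : forall p, r (r p) = p) by (intros [x y]; unfold r; cbn [fst snd]; f_equal; ring).
  assert (Hr : gs (fun p => h (r p))) by (apply gs_comp; auto).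
  destruct (whitney_even (fun p => / 2 * (h p + h (r p)))) as [A [HA EA]]; gsm.
  { apply near_all. intros p. fold (r p). rewrite rr. ring. }
  destruct (hadamard_u (fun p => / 2 * (h p - h (r p)))) as [q [Hq Eq]]; gsm.
  { apply near_all. intros p. unfold r. cbn [fst snd]. rewrite Ropp_0. ring. }
  assert (Hqr : gs (fun p => q (r p))) by (apply gs_comp; auto).
  assert (Ev : near0 (fun p => q (r p) = q p)).
  { apply cancel_u_germ; auto. apply (near2 _ _ _ Eq (near0_comp _ r Gr Eq)).
    intros p E1 E2. rewrite rr in E2. unfold r at 2 in E2. cbn [fst] in E2. lra. }
  destruct (whitney_even q Hq) as [B [HB EB]].
  { apply (near1 _ _ Ev). intros p Ep. exact Ep. }
  exists A, B. repeat split; auto. apply (near3 _ _ _ _ EA Eq EB). intros p E1 E2 E3.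
  rewrite <- E1, <- E3. lra.
Qed.

Lemma even_odd_v h : gs h -> exists A B, gs A /\ gs B /\
  near0 (fun p => h p = A (fst p, snd p ^ 2) + snd p * B (fst p, snd p ^ 2)).
Proof.
  intros Hh. destruct (even_odd_u (fun p => h (swap p))) as [A [B [HA [HB E]]]].
  { apply gs_comp; auto using swap_germ. }
  exists (fun p => A (swap p)), (fun p => B (swap p)). repeat split; try (apply gs_comp; auto using swap_germ).
  apply (near1 _ _ (near0_comp _ swap swap_germ E)). intros p Ep. rewrite swap_swap in Ep. exact Ep.
Qed.

(** Whitney's theorem in u, then in v for both coefficients: 1, u, v and u v generate all germs over
    the germs of functions of u^2 and v^2. *)
Lemma whitney_uv h : gs h -> exists k0 k1 k2 k3, gs k0 /\ gs k1 /\ gs k2 /\ gs k3 /\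
  near0 (fun p => let q := (fst p ^ 2, snd p ^ 2) in
    h p = k0 q + fst p * k1 q + snd p * k2 q + fst p * snd p * k3 q).
Proof.
  intros Hh. destruct (even_odd_u h Hh) as [A [B [HA [HB E]]]].
  destruct (even_odd_v A HA) as [k0 [k2 [H0 [H2 EA]]]].
  destruct (even_odd_v B HB) as [k1 [k3 [H1 [H3 EB]]]].
  exists k0, k1, k2, k3. repeat split; auto.
  assert (G : map_germ (fun p => (fst p ^ 2, snd p))) by (apply germ_pair; gsm; simpl; ring).
  apply (near3 _ _ _ _ E (near0_comp _ _ G EA) (near0_comp _ _ G EB)).
  intros p E1 E2 E3. cbn [fst snd] in *. rewrite E1, E2, E3. ring.
Qed.

Section Ext.

Variable e : R.
Hypothesis He : e * e = 1.

Notation "a +' b" := (dadd a b) (at level 50, left associativity).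
Notation "a -' b" := (dsub a b) (at level 50, left associativity).
Notation "a *' b" := (dmul e a b) (at level 40, left associativity).
Notation cz := (cz e).

Definition re_sq (p : R * R) : R := fst p ^ 2 + e * snd p ^ 2.

(** With a = [re_sq], u^2 = (a + N) / 2 and v^2 = e (a - N) / 2. As N is a multiple of zbar, the
    coefficients of [whitney_uv] become functions of a alone, and modulo zbar the factors u, v and u
    v are constant multiples of z, z and a. Functions of one variable are encoded as germs on the
    plane taken at second coordinate 0. *)
Lemma split_mod_zbar_real h : gs h -> exists k l, dsm k /\ dsm l /\
  cz (fun p => dre (h p)) (fun p => k (re_sq p, 0) +' p *' l (re_sq p, 0)).
Proof.
  intros Hh. destruct (whitney_uv h Hh) as [k0 [k1 [k2 [k3 [H0 [H1 [H2 [H3 E]]]]]]]].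
  set (psi := fun p : R * R => (/ 2 * fst p, e / 2 * fst p)).
  assert (Gpsi : map_germ psi) by (apply germ_pair; gsm; simpl; ring).
  assert (Ga : gs re_sq) by (unfold re_sq; gsm).
  assert (GA : map_germ (fun p => (re_sq p, 0))) by (apply germ_pair; gsm; unfold re_sq; simpl; ring).
  assert (Gpa : map_germ (fun p => psi (re_sq p, 0))) by (apply (map_germ_comp psi _ Gpsi GA)).
  assert (HN : gs (fun p => dnorm e p)) by (unfold dnorm; gsm).
  assert (INC : forall k, gs k -> exists m, gs m /\ near0 (fun p => k (fst p ^ 2, snd p ^ 2) = k (psi (re_sq p, 0)) + dnorm e p * m p)).
  { intros k Hk. destruct (hadamard_increment k (fun p => psi (re_sq p, 0)) (fun _ => / 2) (fun _ => - e / 2) (fun p => dnorm e p)) as [m [Hm Em]]; gsm.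
    { unfold dnorm; simpl; ring. }
    exists m. split; auto. apply (near1 _ _ Em). intros p Ep. rewrite <- Ep. f_equal.
    unfold psi, re_sq, dnorm. cbn [fst snd]. f_equal; [field|]. efield e He. }
  destruct (INC k0 H0) as [m0 [M0 E0]]. destruct (INC k1 H1) as [m1 [M1' E1]].
  destruct (INC k2 H2) as [m2 [M2' E2]]. destruct (INC k3 H3) as [m3 [M3 E3]].
  exists (fun p => (k0 (psi p), e / 2 * fst p * k3 (psi p))), (fun p => (/ 2 * k1 (psi p), e / 2 * k2 (psi p))).
  assert (Q0 := gs_comp _ _ H0 Gpsi). assert (Q1 := gs_comp _ _ H1 Gpsi).
  assert (Q2 := gs_comp _ _ H2 Gpsi). assert (Q3 := gs_comp _ _ H3 Gpsi).
  split; [split; cbn [fst snd]; gsm|].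
  split; [split; cbn [fst snd]; gsm|].
  assert (S : forall k, gs k -> gs (fun p => k (psi (re_sq p, 0)))) by (intros; apply gs_comp; auto).
  set (mm := fun p => m0 p + fst p * m1 p + snd p * m2 p + fst p * snd p * m3 p).
  assert (Smm : gs mm) by (unfold mm; gsm).
  (* u = z/2 + zbar/2, v = e j (z - zbar)/2, u v = e j (a - zbar^2)/2 *)
  exists (fun p => (p *' dre (mm p)) +' (/ 2 * k1 (psi (re_sq p, 0)), - e / 2 * k2 (psi (re_sq p, 0)))
     +' dconj p *' (0, - e / 2 * k3 (psi (re_sq p, 0)))).
  split.
  { apply dsm_add; [apply dsm_add|].
    - apply dsm_mul; [apply dsm_p|apply dsm_re, Smm].
    - split; cbn [fst snd]; gsm.
    - apply dsm_mul; [apply dsm_conj, dsm_p|]. split; cbn [fst snd]; gsm. }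
  apply (near2 _ _ _ (near_and _ _ E (near_and _ _ E0 E1)) (near_and _ _ E2 E3)).
  intros p [F [F0 F1]] [F2 F3]. cbv zeta in F.
  rewrite F0, F1, F2, F3 in F.
  apply deq; dred; unfold mm.
  - rewrite F. unfold dnorm, re_sq.
    generalize (k0 (psi (fst p ^ 2 + e * snd p ^ 2, 0))) (k1 (psi (fst p ^ 2 + e * snd p ^ 2, 0)))
      (k2 (psi (fst p ^ 2 + e * snd p ^ 2, 0))) (k3 (psi (fst p ^ 2 + e * snd p ^ 2, 0))).
    intros a b c d. efield e He.
  - unfold dnorm, re_sq.
    generalize (k0 (psi (fst p ^ 2 + e * snd p ^ 2, 0))) (k1 (psi (fst p ^ 2 + e * snd p ^ 2, 0)))
      (k2 (psi (fst p ^ 2 + e * snd p ^ 2, 0))) (k3 (psi (fst p ^ 2 + e * snd p ^ 2, 0))).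
    intros a b c d. efield e He.
Qed.

Lemma split_mod_zbar H : dsm H -> exists k l, dsm k /\ dsm l /\
  cz H (fun p => k (re_sq p, 0) +' p *' l (re_sq p, 0)).
Proof.
  intros [H1 H2].
  destruct (split_mod_zbar_real _ H1) as [k1 [l1 [K1 [L1 E1]]]].
  destruct (split_mod_zbar_real _ H2) as [k2 [l2 [K2 [L2 E2]]]].
  exists (fun p => k1 p +' (0, 1) *' k2 p), (fun p => l1 p +' (0, 1) *' l2 p).
  split; [dsmt|]. split; [dsmt|].
  assert (GA : map_germ (fun p => (re_sq p, 0))) by (apply germ_pair; unfold re_sq; gsm; simpl; ring).
  apply (cz_trans _ _ (fun p => dre (fst (H p)) +' (0, 1) *' dre (snd (H p)))).
  { apply cz_eq. intros p. dring. }
  apply (cz_trans _ _ (fun p => (k1 (re_sq p, 0) +' p *' l1 (re_sq p, 0)) +' (0, 1) *' (k2 (re_sq p, 0) +' p *' l2 (re_sq p, 0)))).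
  { apply cz_add; [exact E1|]. apply cz_mul; auto using cz_refl, dsm_const, dsm_re. }
  apply cz_eq. intros p. dring.
Qed.

(* z^2 + z^3 - zbar^3; that its real part is Re z^2 makes functions of it easy to find modulo zbar. *)
Definition nform (p : R * R) : R * R :=
  p *' p +' p *' p *' p -' dconj p *' dconj p *' dconj p.

Lemma nform_germ : map_germ nform.
Proof. apply germ_dsm. split; [unfold nform; dsmt|]. unfold nform, origin. dring. Qed.

Lemma fst_nform p : fst (nform p) = re_sq p.
Proof. unfold nform, re_sq. dred. ring. Qed.

(** Write H as k (a) + z l (a) modulo zbar, where a is the first component of G. The absence of a
    linear term forces l (0) = 0, so l (a) = a l' (a), and modulo zbar z a is -1/2 times the
    conjugate of G. *)
Lemma extend_over_nform H H' : dsm H -> dsm H' ->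
  cz H (fun p => H origin +' p *' (p *' H' p)) ->
  exists A, dsm A /\ cz (fun p => A (nform p)) H.
Proof.
  intros HH HH' E. destruct (split_mod_zbar H HH) as [k [l [Hk [Hl F]]]].
  assert (GA : map_germ (fun p => (re_sq p, 0))) by (apply germ_pair; unfold re_sq; gsm; simpl; ring).
  assert (GF : map_germ (fun p => (fst p, 0))) by (apply germ_pair; gsm).
  assert (G0 : forall p q : R * R, fst p = fst q -> (fst p, 0) = (fst q, 0)) by (intros ? ? ->; auto).
  assert (RS : dM 2 (fun p => (re_sq p, 0))).
  { split; cbn [fst snd]; [|exact (M_0 2)]. unfold re_sq.
    apply (M_eq 2 (fun p => fst p * fst p + snd p * snd p * e)); [intros; ring|].
    apply M_plus; [apply (M_mult 1 1 (fun p => fst p) (fun p => fst p)); apply M_u|].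
    apply M_mul_gs; [apply (M_mult 1 1 (fun p => snd p) (fun p => snd p)); apply M_v|apply gs_const]. }
  assert (HADD : forall g, dsm g -> exists g1 : R * R -> R * R, dsm g1 /\ near0 (fun p => g (re_sq p, 0) = g origin +' dre (re_sq p) *' g1 (re_sq p, 0))).
  { intros g [Hg1 Hg2].
    assert (One : forall g, gs g -> exists g1, gs g1 /\ near0 (fun p => g (fst p, 0) = g origin + fst p * g1 (fst p, 0))).
    { intros f Hf. destruct (hadamard_u (fun p => f (fst p, 0) - f origin)) as [f1 [Hf1 Ef]].
      - apply gs_minus; [apply (gs_comp f _ Hf GF)|gsm].
      - apply near_all. intros p. unfold origin. cbn [fst]. ring.
      - exists f1. split; auto. apply (near1 _ _ (near0_comp _ _ GF Ef)). intros p Ep. cbn [fst] in Ep. lra. }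
    destruct (One _ Hg1) as [a [Ha Ea]]. destruct (One _ Hg2) as [b [Hb Eb]].
    exists (fun p => (a p, b p)). split; [split; auto|].
    apply (near2 _ _ _ (near0_comp _ _ GA Ea) (near0_comp _ _ GA Eb)). intros p E1 E2. cbn [fst] in E1, E2.
    apply deq; dred; [rewrite E1|rewrite E2]; ring. }
  destruct (HADD k Hk) as [k' [Hk' Ek]]. destruct (HADD l Hl) as [l' [Hl' El]].
  assert (DRS : dM 2 (fun p => dre (re_sq p))) by exact RS.
  assert (L0 : l origin = (0, 0)).
  { destruct (cz_trans _ _ _ _ (cz_sym _ _ _ E) F) as [c [Hc Ec]].
    apply (proj2 (cz_const_linear e He (k origin -' H origin) (l origin) c
      (fun p => dre (re_sq p) *' k' (re_sq p, 0) +' p *' (dre (re_sq p) *' l' (re_sq p, 0)) -' p *' (p *' H' p)) Hc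
      ltac:(apply dM_sub; [apply dM_add|]; [apply (dM_mul e 2 0); auto; apply dsm_comp; auto| |apply (dM_mul e 1 1); [apply dM_p|apply (dM_mul e 1 0); [apply dM_p|exact HH']]];
        apply (dM_le 2 3); [lia|]; apply (dM_mul e 1 2); [apply dM_p|]; apply (dM_mul e 2 0); auto; apply dsm_comp; auto)
      ltac:(apply (near3 _ _ _ _ Ec Ek El); intros p E1 E2 E3; rewrite E2, E3 in E1;
        transitivity ((k origin +' dre (re_sq p) *' k' (re_sq p, 0)
           +' p *' (l origin +' dre (re_sq p) *' l' (re_sq p, 0)) +' dconj p *' c p)
           -' (H origin +' p *' (p *' H' p))); [dring|rewrite <- E1; dring]))). }
  exists (fun p => k (fst p, 0) -' dre (/ 2) *' dconj p *' l' (fst p, 0)). split.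
  { apply dsm_sub; [apply (dsm_comp k _ Hk GF)|]. apply dsm_mul; [dsmt|apply (dsm_comp l' _ Hl' GF)]. }
  apply (cz_trans _ _ (fun p => k (re_sq p, 0) +' p *' l (re_sq p, 0))); [|apply cz_sym, F].
  (* z a = (z^3 + z zbar^2)/2, and zbar-bar of the normal form is zbar^2 + zbar^3 - z^3 *)
  exists (fun p => dopp (dre (/ 2) *' (dconj p +' dconj p *' dconj p +' p *' dconj p) *' l' (re_sq p, 0))).
  split.
  { apply dsm_opp, dsm_mul; [dsmt|apply (dsm_comp l' _ Hl' GA)]. }
  apply (near1 _ _ El). intros p E3. rewrite fst_nform, E3, L0.
  generalize (l' (re_sq p, 0)) (k (re_sq p, 0)). intros a b. unfold nform, re_sq.
  apply deq; dred; field.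
Qed.

End Ext.

(** * Maps congruent to the normal form modulo z zbar *)

Lemma du_M2_origin h : M 2 h -> du h origin = 0.
Proof. intros H. apply (M_at0 0), (M_du 1), H. Qed.
Lemma dv_M2_origin h : M 2 h -> dv h origin = 0.
Proof. intros H. apply (M_at0 0), (M_dv 1), H. Qed.

Lemma diffeo_perturb phi q : dM 2 q -> near0 (fun p => phi p = dadd p (q p)) -> diffeo_germ phi.
Proof.
  intros [Q1 Q2] E.
  assert (S1 : sm2 origin (fun p => fst (q p))) by apply (M_gs 2 _ Q1).
  assert (S2 : sm2 origin (fun p => snd (q p))) by apply (M_gs 2 _ Q2).
  assert (G : map_germ phi).
  { apply germ_dsm. split.
    - apply (dsm_near (fun p => dadd p (q p))); [apply (near1 _ _ E); intros p ->; auto|].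
      apply dsm_add; [apply dsm_p|]. split; auto.
    - rewrite (near_at0 _ E). rewrite (dM_at0 1 q (conj Q1 Q2)). unfold origin. dring. }
  assert (E1 : near0 (fun p => fst (phi p) = fst p + fst (q p))) by (apply (near1 _ _ E); intros p ->; auto).
  assert (E2 : near0 (fun p => snd (phi p) = snd p + snd (q p))) by (apply (near1 _ _ E); intros p ->; auto).
  apply inverse_function; auto.
  - refine (eq_trans (du_ext (fun p => fst (phi p)) (fun p => fst p + fst (q p)) origin E1) _).
    refine (eq_trans (du_plus (fun p => fst p) (fun p => fst (q p)) origin (sm2_u origin) S1) _).
    refine (eq_trans (f_equal2 Rplus (du_u origin) (du_M2_origin _ Q1)) _). ring.
  - refine (eq_trans (dv_ext (fun p => fst (phi p)) (fun p => fst p + fst (q p)) origin E1) _).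
    refine (eq_trans (dv_plus (fun p => fst p) (fun p => fst (q p)) origin (sm2_u origin) S1) _).
    refine (eq_trans (f_equal2 Rplus (dv_u origin) (dv_M2_origin _ Q1)) _). ring.
  - refine (eq_trans (du_ext (fun p => snd (phi p)) (fun p => snd p + snd (q p)) origin E2) _).
    refine (eq_trans (du_plus (fun p => snd p) (fun p => snd (q p)) origin (sm2_v origin) S2) _).
    refine (eq_trans (f_equal2 Rplus (du_v origin) (du_M2_origin _ Q2)) _). ring.
  - refine (eq_trans (dv_ext (fun p => snd (phi p)) (fun p => snd p + snd (q p)) origin E2) _).
    refine (eq_trans (dv_plus (fun p => snd p) (fun p => snd (q p)) origin (sm2_v origin) S2) _).
    refine (eq_trans (f_equal2 Rplus (dv_v origin) (dv_M2_origin _ Q2)) _). ring.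
Qed.

(** From phi (psi p) = p the deviation of psi from the identity is -q (psi p), again of order
    two. *)
Lemma inverse_perturb phi q : dM 2 q -> near0 (fun p => phi p = dadd p (q p)) ->
  exists psi r, diffeo_germ psi /\ dM 2 r /\ (forall p, psi p = dadd p (r p)) /\
    near0 (fun p => psi (phi p) = p) /\ near0 (fun p => phi (psi p) = p).
Proof.
  intros Q E. destruct (diffeo_inverse phi (diffeo_perturb phi q Q E)) as [psi [P1 [P2 P3]]].
  assert (G : map_germ psi) by apply P1.
  exists psi, (fun p => dsub (psi p) p). split; auto. split; [|split; [|split]]; auto.
  - apply (dM_near 2 (fun p => dopp (q (psi p)))).
    + apply (near2 _ _ _ P3 (near0_comp _ psi G E)). intros p E1 E2. rewrite E1 in E2.
      transitivity (dsub (psi p) (dadd (psi p) (q (psi p)))); [dring|]. rewrite <- E2. reflexivity.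
    + apply dM_opp, dM_comp; auto.
  - dring.
Qed.

Lemma det_jac_near f g : near0 (fun p => f p = g p) -> near0 (fun p => det_jac f p = det_jac g p).
Proof.
  intros E.
  assert (E1 : near0 (fun p => fst (f p) = fst (g p))) by (apply (near1 _ _ E); intros p ->; auto).
  assert (E2 : near0 (fun p => snd (f p) = snd (g p))) by (apply (near1 _ _ E); intros p ->; auto).
  apply (near4 _ _ _ _ _ (du_near _ _ E1) (dv_near _ _ E1) (du_near _ _ E2) (dv_near _ _ E2)).
  intros p A B C D. unfold det_jac. rewrite A, B, C, D. reflexivity.
Qed.

Lemma det_jac_comp f phi : map_germ f -> map_germ phi ->
  near0 (fun p => det_jac (fun q => f (phi q)) p = det_jac f (phi p) * det_jac phi p).
Proof.
  intros Hf Hp. assert (Hf' := Hf). assert (Hp' := Hp). apply germ_gs in Hf'. apply germ_gs in Hp'.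
  destruct Hf' as [F1 [F2 _]]. destruct Hp' as [P1 [P2 _]].
  apply (near4 _ _ _ _ _ (near0_comp _ phi Hp (gs_near _ F1)) (near0_comp _ phi Hp (gs_near _ F2)) (gs_near _ P1) (gs_near _ P2)).
  intros p A B C D. unfold det_jac.
  assert (X : forall h, sm2 (phi p) h -> du (fun q => h (phi q)) p = du h (phi p) * du (fun q => fst (phi q)) p + dv h (phi p) * du (fun q => snd (phi q)) p /\
     dv (fun q => h (phi q)) p = du h (phi p) * dv (fun q => fst (phi q)) p + dv h (phi p) * dv (fun q => snd (phi q)) p).
  { intros h Hh.
    assert (Eh : (fun q => h (phi q)) = (fun q => h (fst (phi q), snd (phi q)))).
    { apply functional_extensionality. intros q. rewrite <- surjective_pairing. reflexivity. }
    rewrite Eh. rewrite (surjective_pairing (phi p)) in Hh.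
    assert (Q1 := du_comp h (fun q => fst (phi q)) (fun q => snd (phi q)) p Hh C D).
    assert (Q2 := dv_comp h (fun q => fst (phi q)) (fun q => snd (phi q)) p Hh C D).
    cbv beta in Q1, Q2. rewrite <- (surjective_pairing (phi p)) in Q1, Q2. auto. }
  destruct (X (fun q => fst (f q)) A) as [X1 X2]. destruct (X (fun q => snd (f q)) B) as [X3 X4].
  assert (T : forall a b c d a1 b1 c1 d1 x y z w : R, a = a1 * x + b1 * z -> b = a1 * y + b1 * w -> c = c1 * x + d1 * z -> d = c1 * y + d1 * w ->
    a * d - b * c = (a1 * d1 - b1 * c1) * (x * w - y * z)) by (intros; subst; ring).
  exact (T _ _ _ _ _ _ _ _ _ _ _ _ X1 X2 X3 X4).
Qed.

Lemma det_jac_gs f : dsm f -> gs (det_jac f).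
Proof. intros [A B]. unfold det_jac. gsm. Qed.

Definition dsm_at {V : NM} (x0 : V) (W : V -> R * R) : Prop :=
  sm (W := RN) x0 (fun x => fst (W x)) /\ sm (W := RN) x0 (fun x => snd (W x)).

Lemma dsm_at_add {V : NM} (x0 : V) A B : dsm_at x0 A -> dsm_at x0 B -> dsm_at x0 (fun x => dadd (A x) (B x)).
Proof. intros [A1 A2] [B1 B2]; split; apply (sm_plus (V := V)); auto. Qed.
Lemma dsm_at_sub {V : NM} (x0 : V) A B : dsm_at x0 A -> dsm_at x0 B -> dsm_at x0 (fun x => dsub (A x) (B x)).
Proof. intros [A1 A2] [B1 B2]; split; apply (sm_minus (V := V)); auto. Qed.
Lemma dsm_at_conj {V : NM} (x0 : V) A : dsm_at x0 A -> dsm_at x0 (fun x => dconj (A x)).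
Proof. intros [A1 A2]; split; auto; apply (sm_opp (V := V)); auto. Qed.
Lemma dsm_at_mul {V : NM} (x0 : V) e A B : dsm_at x0 A -> dsm_at x0 B -> dsm_at x0 (fun x => dmul e (A x) (B x)).
Proof.
  intros [A1 A2] [B1 B2]; split; apply (sm_plus (V := V)); try apply (sm_mult (V := V)); auto;
    try apply (sm_mult (V := V)); auto. apply (sm_const (W := RN)).
Qed.
Lemma dsm_at_const {V : NM} (x0 : V) c : dsm_at x0 (fun _ : V => c).
Proof. split; apply (sm_const (W := RN)). Qed.
#[export] Hint Resolve @dsm_at_add @dsm_at_sub @dsm_at_conj @dsm_at_mul @dsm_at_const : ddb.

Section Lift.

Variable e : R.
Hypothesis He : e * e = 1.

Notation "a +' b" := (dadd a b) (at level 50, left associativity).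
Notation "a -' b" := (dsub a b) (at level 50, left associativity).
Notation "a *' b" := (dmul e a b) (at level 40, left associativity).
Notation cz := (cz e).
Notation nform := (nform e).

(** The coefficient of N^2 in G (z + N s) for s = sg + zbar r, once the part linear in sg has been
    separated as in [lift_identity]. The factor zbar in front of r lets r enter at order N^2,
    because z zbar = N. *)
Definition lift_eq (sg : R * R) (p r : R * R) : R * R :=
  let s := sg +' dconj p *' r in
  (dre 2 +' dre 3 *' p) *' r -' dre 3 *' dconj p *' dconj r +' (dre 1 +' dre 3 *' p) *' (s *' s)
  -' dre 3 *' dconj p *' (dconj s *' dconj s) +' dre (dnorm e p) *' (s *' s *' s -' dconj s *' dconj s *' dconj s).

Lemma lift_eq_origin sg r : lift_eq sg origin r = dre 2 *' r +' sg *' sg.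
Proof. unfold lift_eq, origin. dring. Qed.

Lemma nform_increment p w : nform (p +' w) = nform p +' (dre 2 *' p +' dre 3 *' (p *' p)) *' w
  +' (dre 1 +' dre 3 *' p) *' (w *' w) +' w *' w *' w -' dre 3 *' (dconj p *' dconj p) *' dconj w
  -' dre 3 *' dconj p *' (dconj w *' dconj w) -' dconj w *' dconj w *' dconj w.
Proof. unfold nform. dring. Qed.

Lemma lift_identity p sg r : let s := sg +' dconj p *' r in
  nform (p +' dre (dnorm e p) *' s) = nform p
   +' dre (dnorm e p) *' ((dre 2 +' dre 3 *' p) *' (p *' sg) -' dre 3 *' (dconj p *' dconj p) *' dconj sg)
   +' dre (dnorm e p * dnorm e p) *' lift_eq sg p r.
Proof.
  intros s. rewrite nform_increment.
  assert (Hs : sg = s -' dconj p *' r) by (unfold s; dring).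
  unfold lift_eq. cbv zeta. fold s. rewrite Hs at 1 2. clearbody s. dring.
Qed.

(** At the origin the equation reads 2 r + sg^2 = 0, with invertible linear part in r, so the
    implicit function theorem applies. *)
Lemma lift_solve sg : dsm sg -> exists r, dsm r /\ near0 (fun p => lift_eq (sg p) p (r p) = (0, 0)).
Proof.
  intros Hs.
  set (s0 := sg origin *' sg origin).
  set (a0 := - fst s0 / 2). set (b0 := - snd s0 / 2).
  set (base := ((origin, a0), b0) : VR (VR RR)).
  set (LE := fun q : (R * R * R) * R => lift_eq (sg (fst (fst q))) (fst (fst q)) (snd (fst q), snd q)).
  assert (VP : dsm_at (V := VR (VR RR)) base (fun q => fst (fst q))).
  { assert (L : is_linear (K := R_AbsRing) (U := VR (VR RR)) (V := RR) (fun q => fst (fst q))).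
    { apply (is_linear_comp (U := VR (VR RR)) (V := VR RR) (W := RR) fst fst); apply is_linear_fst. }
    split; apply sm_linear.
    - apply (is_linear_comp (U := VR (VR RR)) (V := RR) (W := RN) (fun q => fst (fst q)) fst); auto. apply is_linear_fst.
    - apply (is_linear_comp (U := VR (VR RR)) (V := RR) (W := RN) (fun q => fst (fst q)) snd); auto. apply is_linear_snd. }
  assert (VF : sm (V := VR (VR RR)) (W := RR) base (fun q => fst (fst q))).
  { apply sm_linear. apply (is_linear_comp (U := VR (VR RR)) (V := VR RR) (W := RR) fst fst); apply is_linear_fst. }
  assert (VS : dsm_at (V := VR (VR RR)) base (fun q => sg (fst (fst q)))).
  { destruct Hs as [S1 S2]. split.
    - apply (sm_comp (V := VR (VR RR)) (W := RR) base (fun p => fst (sg p)) (fun q => fst (fst q))); auto.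
    - apply (sm_comp (V := VR (VR RR)) (W := RR) base (fun p => snd (sg p)) (fun q => fst (fst q))); auto. }
  assert (VR2 : dsm_at (V := VR (VR RR)) base (fun q => (snd (fst q), snd q))).
  { split; apply sm_linear; cbn [fst snd].
    - apply (is_linear_comp (U := VR (VR RR)) (V := VR RR) (W := RN) fst snd); [apply is_linear_fst|apply is_linear_snd].
    - apply (is_linear_snd (U := VR RR) (V := RN)). }
  assert (VN : dsm_at (V := VR (VR RR)) base (fun q => dre (dnorm e (fst (fst q))))).
  { destruct VP as [P1 P2]. split; [|exact (sm_const (V := VR (VR RR)) (W := RN) base 0)]. cbn [dre fst]. unfold dnorm.
    apply (sm_minus (V := VR (VR RR))); apply (sm_mult (V := VR (VR RR))); auto; [apply (sm_const (W := RN))|].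
    apply (sm_mult (V := VR (VR RR))); auto. }
  assert (VL : dsm_at (V := VR (VR RR)) base LE).
  { unfold LE, lift_eq. cbv zeta.
    assert (VT : dsm_at (V := VR (VR RR)) base (fun q => sg (fst (fst q)) +' dconj (fst (fst q)) *' (snd (fst q), snd q))).
    { apply dsm_at_add; auto. apply dsm_at_mul; auto. apply dsm_at_conj; auto. }
    repeat first [apply VT | apply VN | apply VR2 | apply VP | apply dsm_at_const | apply dsm_at_add | apply dsm_at_sub | apply dsm_at_mul | apply dsm_at_conj]. }
  assert (LO : forall a b : R, LE ((origin, a), b) = (2 * a + fst s0, 2 * b + snd s0)).
  { intros a b. unfold LE. cbn [fst snd]. rewrite lift_eq_origin. fold s0. apply deq; dred; ring. }
  destruct (implicit_function2 (V := RR) origin a0 b0 2 2 (fun q => fst (LE q)) (fun q => snd (LE q))) as [s [t [A1 [A2 [_ [_ [A5 _]]]]]]].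
  - apply VL.
  - apply VL.
  - rewrite LO. cbn [fst]. unfold a0. field.
  - rewrite LO. cbn [snd]. unfold b0. field.
  - apply (is_derive_ext (fun x : R => 2 * x + fst s0)); [intros x; rewrite LO; reflexivity|]. auto_derive; auto; ring.
  - lra.
  - apply (is_derive_ext (fun x : R => 2 * b0 + snd s0)); [intros x; rewrite LO; reflexivity|]. apply (is_derive_const (K := R_AbsRing) (V := RN)).
  - apply (is_derive_ext (fun x : R => 2 * x + snd s0)); [intros x; rewrite LO; reflexivity|]. auto_derive; auto; ring.
  - lra.
  - exists (fun p => (s p, t p)). split; [split; auto|].
    unfold near0. generalize A5. apply filter_imp. intros p [B1 B2]. apply deq; [exact B1|exact B2].
Qed.

(* The source change is id + N s, where N = z zbar. The hypothesis on the Jacobian determinant is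
   what solves the equation for s modulo zbar; [lift_solve] then gives the correction. *)
Lemma lift_nform f k q : dsm k -> gs q ->
  near0 (fun p => f p = nform p +' dre (dnorm e p) *' k p) ->
  near0 (fun p => det_jac f p = dnorm e p * q p) ->
  exists phi, diffeo_germ phi /\ near0 (fun p => f p = nform (phi p)).
Proof.
  intros Hk Hq Ef EJ. assert (Hk' := Hk). destruct Hk' as [K1 K2].
  set (f1 := fun p : R * R => (fst p * fst p + e * (snd p * snd p)) + (fst p * fst p - e * (snd p * snd p)) * fst (k p)).
  set (f2 := fun p : R * R => (2 * (fst p * snd p) + 6 * (fst p * fst p * snd p) + 2 * e * (snd p * snd p * snd p)) + (fst p * fst p - e * (snd p * snd p)) * snd (k p)).
  assert (Ef' : near0 (fun p => f p = (f1 p, f2 p))).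
  { apply (near1 _ _ Ef). intros p ->. unfold f1, f2, nform. apply deq; dred; ring. }
  (* Modulo zbar the Jacobian determinant |f_z|^2 - |f_zbar|^2 of G + N k is z^2 h: there f_z is 2 z
     + 3 z^2, f_zbar is z k, and their conjugates are z conj k and -3 z^2. As N divides the
     determinant, zbar divides h. *)
  set (h := fun p => (dre 2 +' dre 3 *' p) *' dconj (k p) +' dre 3 *' p *' k p).
  assert (Sh : dsm h) by (unfold h; dsmt).
  assert (C0 : cz h (fun _ => (0, 0))).
  { apply (cz_cancel e He); auto. apply (cz_cancel e He); [dsmt|].
    (* The terms of the Jacobian determinant that contain derivatives of k; all of them carry a
       factor N. *)
    set (t := fun p : R * R => let u := fst p in let v := snd p in let N := dnorm e p in
       let a := du (fun q => fst (k q)) p in let b := dv (fun q => fst (k q)) p in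
       let c := du (fun q => snd (k q)) p in let d := dv (fun q => snd (k q)) p in
       a * (2 * u + 6 * u * u + 6 * e * v * v - 2 * e * v * snd (k p) + N * d) + (2 * u + 2 * u * fst (k p)) * d
       - b * (2 * v + 12 * u * v + 2 * u * snd (k p) + N * c) - (2 * e * v - 2 * e * v * fst (k p)) * c).
    assert (St : gs t) by (unfold t, dnorm; cbv zeta; gsm).
    assert (T : forall (K : R -> R) dK x (F : R -> R) dF (G : R -> R) dG l, is_derive K x dK -> is_derive F x dF -> is_derive G x dG ->
      dF + dG * K x + G x * dK = l -> is_derive (fun y => F y + G y * K y) x l).
    { intros K dK x F dF G dG l HK HF HG E.
      assert (Q := is_derive_plus F _ x _ _ HF (is_derive_mult G K x dG dK HG HK Rmult_comm)).
      rewrite <- E. rewrite Rplus_assoc. exact Q. }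
    assert (DJ : near0 (fun p => det_jac f p =
       (2 * fst p + 2 * fst p * fst (k p)) * (2 * fst p + 6 * fst p * fst p + 6 * e * snd p * snd p - 2 * e * snd p * snd (k p))
       - (2 * e * snd p - 2 * e * snd p * fst (k p)) * (2 * snd p + 12 * fst p * snd p + 2 * fst p * snd (k p)) + dnorm e p * t p)).
    { apply (near3 _ _ _ _ (det_jac_near _ _ Ef') (gs_near _ K1) (gs_near _ K2)). intros p -> S1 S2.
      assert (D1 := du_correct p _ S1). assert (D2 := dv_correct p _ S1).
      assert (D3 := du_correct p _ S2). assert (D4 := dv_correct p _ S2).
      destruct p as [u v]. cbn [fst snd] in *.
      assert (A1 : is_derive (fun x => f1 (x, v)) u (2 * u + 2 * u * fst (k (u, v)) + dnorm e (u, v) * du (fun q => fst (k q)) (u, v))).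
      { refine (T (fun x => fst (k (x, v))) _ u (fun x => x * x + e * (v * v)) _ (fun x => x * x - e * (v * v)) _ _ D1 _ _ _);
          [auto_derive; auto; reflexivity|auto_derive; auto; reflexivity|unfold dnorm; cbn [fst snd]; ring]. }
      assert (A2 : is_derive (fun x => f1 (u, x)) v (2 * e * v - 2 * e * v * fst (k (u, v)) + dnorm e (u, v) * dv (fun q => fst (k q)) (u, v))).
      { refine (T (fun x => fst (k (u, x))) _ v (fun x => u * u + e * (x * x)) _ (fun x => u * u - e * (x * x)) _ _ D2 _ _ _);
          [auto_derive; auto; reflexivity|auto_derive; auto; reflexivity|unfold dnorm; cbn [fst snd]; ring]. }
      assert (A3 : is_derive (fun x => f2 (x, v)) u (2 * v + 12 * u * v + 2 * u * snd (k (u, v)) + dnorm e (u, v) * du (fun q => snd (k q)) (u, v))).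
      { refine (T (fun x => snd (k (x, v))) _ u (fun x => 2 * (x * v) + 6 * (x * x * v) + 2 * e * (v * v * v)) _ (fun x => x * x - e * (v * v)) _ _ D3 _ _ _);
          [auto_derive; auto; reflexivity|auto_derive; auto; reflexivity|unfold dnorm; cbn [fst snd]; ring]. }
      assert (A4 : is_derive (fun x => f2 (u, x)) v (2 * u + 6 * u * u + 6 * e * v * v - 2 * e * v * snd (k (u, v)) + dnorm e (u, v) * dv (fun q => snd (k q)) (u, v))).
      { refine (T (fun x => snd (k (u, x))) _ v (fun x => 2 * (u * x) + 6 * (u * u * x) + 2 * e * (x * x * x)) _ (fun x => u * u - e * (x * x)) _ _ D4 _ _ _);
          [auto_derive; auto; reflexivity|auto_derive; auto; reflexivity|unfold dnorm; cbn [fst snd]; ring]. }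
      transitivity ((2 * u + 2 * u * fst (k (u, v)) + dnorm e (u, v) * du (fun q => fst (k q)) (u, v)) *
          (2 * u + 6 * u * u + 6 * e * v * v - 2 * e * v * snd (k (u, v)) + dnorm e (u, v) * dv (fun q => snd (k q)) (u, v)) -
          (2 * e * v - 2 * e * v * fst (k (u, v)) + dnorm e (u, v) * dv (fun q => fst (k q)) (u, v)) *
          (2 * v + 12 * u * v + 2 * u * snd (k (u, v)) + dnorm e (u, v) * du (fun q => snd (k q)) (u, v))).
      { exact (f_equal2 Rminus (f_equal2 Rmult (is_derive_unique _ _ _ A1) (is_derive_unique _ _ _ A4))
          (f_equal2 Rmult (is_derive_unique _ _ _ A2) (is_derive_unique _ _ _ A3))). }
      unfold t. cbv zeta. cbn [fst snd]. ring. }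
    exists (fun p => p *' dre (q p - t p)
       -' ((dre 2 *' p +' dre 3 *' p *' p) *' (dre 2 +' dre 3 *' dconj p) +' k p *' (dre 2 *' dconj p +' dre 3 *' dconj p *' dconj p +' p *' dconj (k p)))
       +' (dre 9 *' dconj p *' p *' p -' dre 3 *' dconj p *' dconj p *' dconj (k p) +' p *' k p *' dconj (k p))).
    split; [dsmt|].
    { apply dsm_add; [apply dsm_sub|]; try dsmt. apply dsm_mul; [apply dsm_p|apply dsm_re; gsm]. }
    apply (near2 _ _ _ EJ DJ). intros p E1 E2. rewrite E1 in E2.
    assert (E3 : dnorm e p * (q p - t p) = (2 * fst p + 2 * fst p * fst (k p)) * (2 * fst p + 6 * fst p * fst p + 6 * e * snd p * snd p - 2 * e * snd p * snd (k p))
       - (2 * e * snd p - 2 * e * snd p * fst (k p)) * (2 * snd p + 12 * fst p * snd p + 2 * fst p * snd (k p))) by lra.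
    unfold h. clear E1 E2. revert E3. generalize (q p - t p). intros w E3.
    transitivity (dre (dnorm e p * w)
       -' dconj p *' ((dre 2 *' p +' dre 3 *' p *' p) *' (dre 2 +' dre 3 *' dconj p) +' k p *' (dre 2 *' dconj p +' dre 3 *' dconj p *' dconj p +' p *' dconj (k p)))
       +' dconj p *' (dre 9 *' dconj p *' p *' p -' dre 3 *' dconj p *' dconj p *' dconj (k p) +' p *' k p *' dconj (k p))).
    - rewrite E3. apply deq; dred; ring.
    - apply deq; dred; ring. }
  destruct C0 as [c [Hc Ec]].
  (* Determinant of the system that expresses h and its conjugate through k and its conjugate; it is
     4 at the origin. With h = zbar c, the solution k has exactly the shape of the part of G (z + N
     s) linear in s, for sg = conj c / Dn. *)
  set (Dn := fun p => dnorm e (dre 2 +' dre 3 *' p) - 9 * dnorm e p).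
  assert (SD : gs Dn).
  { unfold Dn. apply gs_minus; [apply (dsm_norm e (fun p => dre 2 +' dre 3 *' p)); dsmt|].
    apply gs_mult; [apply gs_const|apply (dsm_norm e (fun p => p)), dsm_p]. }
  assert (D0 : Dn origin <> 0) by (unfold Dn, origin; dred; lra).
  set (sg := fun p => dre (/ Dn p) *' dconj (c p)).
  assert (Ssg : dsm sg).
  { unfold sg. apply dsm_mul; [apply dsm_re, gs_inv; auto|dsmt]. }
  assert (Ek : near0 (fun p => k p = (dre 2 +' dre 3 *' p) *' (p *' sg p) -' dre 3 *' (dconj p *' dconj p) *' dconj (sg p))).
  { apply (near2 _ _ _ Ec (gs_neq_near _ SD D0)). intros p E1 Dp.
    assert (E2 : h p = dconj p *' c p) by (rewrite E1; dring).
    transitivity (dre (/ Dn p) *' ((dre 2 +' dre 3 *' p) *' dconj (h p) -' dre 3 *' dconj p *' h p)).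
    - transitivity (dre (/ Dn p) *' (dre (Dn p) *' k p)).
      + apply deq; dred; field; auto.
      + f_equal. unfold Dn, h. dring.
    - rewrite E2. unfold sg. dring. }
  destruct (lift_solve sg Ssg) as [r [Hr Er]].
  set (s := fun p => sg p +' dconj p *' r p).
  assert (Ss : dsm s) by (unfold s; dsmt).
  exists (fun p => p +' dre (dnorm e p) *' s p). split.
  - apply (diffeo_perturb _ (fun p => dre (dnorm e p) *' s p)).
    + apply (dM_mul e 2 0); auto.
      apply (dM_near 2 (fun p => p *' dconj p)); [apply near_all; dring|].
      apply (dM_mul e 1 1); [apply dM_p|apply dM_conj, dM_p].
    + apply near_all; auto.
  - apply (near3 _ _ _ _ Ef Ek Er). intros p E1 E2 E3. rewrite E1, E2.
    assert (I := lift_identity p (sg p) (r p)). cbv zeta in I. unfold s. rewrite I, E3. dring.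
Qed.

End Lift.

(** * Reduction to the normal form *)

Lemma D_ring e : ring_theory (0, 0) (1, 0) dadd (dmul e) dsub dopp eq.
Proof. split; try dring; intros [x y]; apply deq; dred; ring. Qed.

Section Normal.

Variable e : R.
Hypothesis He : e * e = 1.

Notation "a +' b" := (dadd a b) (at level 50, left associativity).
Notation "a -' b" := (dsub a b) (at level 50, left associativity).
Notation "a *' b" := (dmul e a b) (at level 40, left associativity).
Notation cz := (cz e).
Notation nform := (nform e).

Lemma M3_split h : M 3 h -> exists a b c, M 1 a /\ M 1 b /\ M 1 c /\
  near0 (fun p => h p = fst p * fst p * a p + fst p * snd p * b p + snd p * snd p * c p).
Proof.
  intros [a [b [[a1 [a2 [A1 [A2 EA]]]] [[b1 [b2 [B1 [B2 EB]]]] E]]]].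
  exists a1, (fun p => a2 p + b1 p), b2. repeat split; auto.
  - apply (M_plus 1); auto.
  - apply (near3 _ _ _ _ EA EB E). intros p E1 E2 ->. rewrite E1, E2. ring.
Qed.

Lemma det_jac_square W r : dM 3 r -> near0 (fun p => W p = p *' p +' r p) ->
  exists h, M 3 h /\ near0 (fun p => det_jac W p = 4 * dnorm e p + h p).
Proof.
  intros [R1 R2] E.
  assert (E1 : near0 (fun p => fst (W p) = fst p * fst p + e * (snd p * snd p) + fst (r p))) by (apply (near1 _ _ E); intros p ->; auto).
  assert (E2 : near0 (fun p => snd (W p) = (fst p * snd p + snd p * fst p) + snd (r p))) by (apply (near1 _ _ E); intros p ->; auto).
  set (a := du (fun p => fst (r p))). set (b := dv (fun p => fst (r p))).
  set (c := du (fun p => snd (r p))). set (d := dv (fun p => snd (r p))).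
  assert (Ma : M 2 a) by (apply (M_du 2); auto). assert (Mb : M 2 b) by (apply (M_dv 2); auto).
  assert (Mc : M 2 c) by (apply (M_du 2); auto). assert (Md : M 2 d) by (apply (M_dv 2); auto).
  exists (fun p => fst p * (2 * a p) + fst p * (2 * d p) + fst p * 0 + a p * d p - (snd p * (2 * e * c p) + snd p * (2 * b p) + b p * c p)).
  split.
  - assert (K : forall x k, M 2 x -> M 2 (fun p => k * x p)).
    { intros x k Hx. apply (M_eq 2 (fun p => x p * k)); [intros; ring|]. apply M_mul_gs; auto using gs_const. }
    assert (K2 : forall x y, M 2 x -> M 2 y -> M 3 (fun p => x p * y p)).
    { intros x y Hx Hy. apply (M_le 3 4); auto. apply (M_mult 2 2); auto. }
    apply M_minus; repeat apply M_plus; auto; try (apply (M_mult 1 2); auto using M_u, M_v, M_0).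
  - assert (S1 := M_gs 3 _ R1). assert (S2 := M_gs 3 _ R2).
    apply (near4 _ _ _ _ _ (near_and _ _ (du_near _ _ E1) (dv_near _ _ E1)) (near_and _ _ (du_near _ _ E2) (dv_near _ _ E2)) (gs_near _ S1) (gs_near _ S2)).
    intros p [A1 A2] [A3 A4] T1 T2.
    assert (P1 : sm2 p (fun q => fst q * fst q + e * (snd q * snd q))).
    { apply (sm_plus (V := RR)); [|apply (sm_mult (V := RR)); [apply (sm_const (W := RN))|]]; apply (sm_mult (V := RR)); auto using sm2_u, sm2_v. }
    assert (P2 : sm2 p (fun q => fst q * snd q + snd q * fst q)).
    { apply (sm_plus (V := RR)); apply (sm_mult (V := RR)); auto using sm2_u, sm2_v. }
    assert (B1 := eq_trans A1 (du_plus _ _ p P1 T1)). assert (B2 := eq_trans A2 (dv_plus _ _ p P1 T1)).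
    assert (B3 := eq_trans A3 (du_plus _ _ p P2 T2)). assert (B4 := eq_trans A4 (dv_plus _ _ p P2 T2)).
    assert (C1 : du (fun q => fst q * fst q + e * (snd q * snd q)) p = 2 * fst p).
    { unfold du. apply is_derive_unique. cbn [fst snd]. auto_derive; auto. ring. }
    assert (C2 : dv (fun q => fst q * fst q + e * (snd q * snd q)) p = 2 * e * snd p).
    { unfold dv. apply is_derive_unique. cbn [fst snd]. auto_derive; auto. ring. }
    assert (C3 : du (fun q => fst q * snd q + snd q * fst q) p = 2 * snd p).
    { unfold du. apply is_derive_unique. cbn [fst snd]. auto_derive; auto. ring. }
    assert (C4 : dv (fun q => fst q * snd q + snd q * fst q) p = 2 * fst p).
    { unfold dv. apply is_derive_unique. cbn [fst snd]. auto_derive; auto. ring. }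
    assert (T : forall A B C D A' B' C' D' a b c d u v : R, A = A' + a -> B = B' + b -> C = C' + c -> D = D' + d ->
      A' = 2 * u -> B' = 2 * e * v -> C' = 2 * v -> D' = 2 * u ->
      A * D - B * C = 4 * (u * u - e * (v * v)) + (u * (2 * a) + u * (2 * d) + u * 0 + a * d - (v * (2 * e * c) + v * (2 * b) + b * c)))
      by (intros; subst; ring).
    exact (T _ _ _ _ _ _ _ _ _ _ _ _ _ _ B1 B2 B3 B4 C1 C2 C3 C4).
Qed.

(** Completing the square in A u^2 + 2 B u v + C v^2, where the functions A, B, C take the values 4,
    0, -4 e at the origin: the form is A ((u + v B / A)^2 - e X v^2), and X, which is 1 at the
    origin, has a smooth square root. *)
Lemma morse_norm J h : M 3 h -> near0 (fun p => J p = 4 * dnorm e p + h p) ->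
  exists A q, gs A /\ dM 2 q /\ near0 (fun p => J p = A p * dnorm e (p +' q p)).
Proof.
  intros Hh E. destruct (M3_split h Hh) as [a [b [c [Ha [Hb [Hc Eh]]]]]].
  set (A := fun p => 4 + a p). set (B := fun p => b p * / 2). set (C := fun p => - (4 * e) + c p).
  assert (Ga := M_gs 1 _ Ha). assert (Gb := M_gs 1 _ Hb). assert (Gc := M_gs 1 _ Hc).
  assert (a0 := M_at0 0 _ Ha). assert (b0 := M_at0 0 _ Hb). assert (c0 := M_at0 0 _ Hc).
  assert (GA : gs A) by (unfold A; gsm). assert (GB : gs B) by (unfold B; gsm). assert (GC : gs C) by (unfold C; gsm).
  assert (A0 : A origin = 4) by (unfold A; rewrite a0; ring).
  assert (B0 : B origin = 0) by (unfold B; rewrite b0; ring).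
  assert (C0 : C origin = - (4 * e)) by (unfold C; rewrite c0; ring).
  set (X := fun p => e * (B p * B p - A p * C p) / (A p * A p)).
  assert (X0 : X origin = 1). { unfold X. rewrite A0, B0, C0. replace (e * (0 * 0 - 4 * - (4 * e))) with (16 * (e * e)) by ring. rewrite He. field. }
  assert (GX : gs X). { unfold X. apply gs_div; gsm. rewrite A0. lra. }
  assert (GT : gs (fun p => sqrt (X p))) by (apply gs_sqrt; auto; rewrite X0; lra).
  exists A, (fun p => (snd p * (B p / A p), snd p * (sqrt (X p) - 1))). split; auto. split.
  - split; cbn [fst snd]; apply (M_mult 1 1); auto using M_v; apply M_1; split; gsm.
    + apply gs_div; auto. rewrite A0; lra.
    + rewrite B0. unfold Rdiv. ring.
    + rewrite X0, sqrt_1. ring.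
  - assert (NA : near0 (fun p => A p <> 0)) by (apply gs_neq_near; auto; rewrite A0; lra).
    assert (PX : near0 (fun p => 0 < X p)) by (apply gs_pos_near; auto; rewrite X0; lra).
    apply (near4 _ _ _ _ _ E Eh NA PX). intros p E1 E2 N1 N2. rewrite E1, E2. clear E1 E2.
    assert (S := sqrt_sqrt (X p) (Rlt_le _ _ N2)). revert S. generalize (sqrt (X p)). intros s S.
    unfold dnorm. cbn [dadd fst snd].
    replace (snd p + snd p * (s - 1)) with (snd p * s) by ring.
    replace (snd p * s * (snd p * s)) with (snd p * snd p * (s * s)) by ring. rewrite S. unfold X.
    transitivity (A p * (fst p * fst p) + 2 * B p * (fst p * snd p) + C p * (snd p * snd p)).
    + unfold A, B, C. field.
    + efield e He; auto.
Qed.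

(* Only the coefficient of zbar^3 in the cubic part is invariant under source changes id + M 2. *)
Definition cubic_form (c : R * R) (W : R * R -> R * R) : Prop :=
  exists r m, dM 2 r /\ dM 4 m /\
    near0 (fun p => W p = p *' p +' p *' r p +' c *' (dconj p *' dconj p *' dconj p) +' m p).

Lemma cubic_form_germ c W : cubic_form c W -> map_germ W.
Proof.
  intros [r [m [Hr [Hm E]]]]. apply (dM_germ 0). apply (dM_near 1 (fun p => p *' p +' p *' r p +' c *' (dconj p *' dconj p *' dconj p) +' m p)).
  - apply (near1 _ _ E). auto.
  - assert (P := dM_p). assert (Pc := dM_conj 1 _ P). repeat apply dM_add.
    + apply (dM_le 1 2); auto. apply (dM_mul e 1 1); auto.
    + apply (dM_le 1 3); auto. apply (dM_mul e 1 2); auto.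
    + apply (dM_le 1 3); auto. apply (dM_mul e 0 3); [apply dsm_const|]. apply (dM_mul e 2 1); auto. apply (dM_mul e 1 1); auto.
    + apply (dM_le 1 4); auto.
Qed.

(** Replacing z by z + q adds 2 z q + q^2 to z^2: the first term joins z r, the second has order
    four, and so has the change in zbar^3. *)
Lemma cubic_form_comp c W psi q : dM 2 q -> (forall p, psi p = p +' q p) -> cubic_form c W ->
  cubic_form c (fun p => W (psi p)).
Proof.
  intros Hq Ep [r [m [Hr [Hm E]]]].
  assert (P := dM_p). assert (Pc := dM_conj 1 _ P). assert (Qc := dM_conj 2 _ Hq).
  assert (G : map_germ psi).
  { apply (dM_germ 0), (dM_near 1 (fun p => p +' q p)); [apply near_all; auto|].
    apply dM_add; auto. apply (dM_le 1 2); auto. }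
  exists (fun p => q p +' q p +' r (psi p)),
    (fun p => q p *' q p +' q p *' r (psi p) +' c *' (dconj (q p) *' (dconj p *' dconj p +' dconj p *' dconj (psi p) +' dconj (psi p) *' dconj (psi p))) +' m (psi p)).
  assert (Sp : dM 1 psi) by (apply dM_1, germ_dsm, G). assert (Spc := dM_conj 1 _ Sp).
  assert (Hr' := dM_comp 2 _ _ Hr G).
  split; [|split].
  - repeat apply dM_add; auto.
  - repeat apply dM_add.
    + apply (dM_mul e 2 2); auto.
    + apply (dM_mul e 2 2); auto.
    + apply (dM_mul e 0 4); [apply dsm_const|]. apply (dM_mul e 2 2); auto. repeat apply dM_add; apply (dM_mul e 1 1); auto.
    + apply dM_comp; auto.
  - apply (near1 _ _ (near0_comp _ psi G E)). intros p ->. generalize (r (psi p)), (m (psi p)). intros x y. rewrite Ep. dring.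
Qed.

Definition norm_jac (W : R * R -> R * R) : Prop := exists q, gs q /\ near0 (fun p => det_jac W p = dnorm e p * q p).

(** By the Morse lemma the Jacobian determinant is a multiple of N in the coordinate z + q;
    composing with the inverse change restores N in z itself. *)
Lemma normalize_jac c W : cubic_form c W -> exists psi, diffeo_germ psi /\
  cubic_form c (fun p => W (psi p)) /\ norm_jac (fun p => W (psi p)).
Proof.
  intros HW. assert (GW := cubic_form_germ c W HW). assert (HW' := HW). destruct HW' as [r [m [Hr [Hm E]]]].
  destruct (det_jac_square W (fun p => p *' r p +' c *' (dconj p *' dconj p *' dconj p) +' m p)) as [h [Hh EJ]].
  { assert (P := dM_p). assert (Pc := dM_conj 1 _ P). repeat apply dM_add.
    - apply (dM_mul e 1 2); auto.
    - apply (dM_mul e 0 3); [apply dsm_const|]. apply (dM_mul e 2 1); auto. apply (dM_mul e 1 1); auto.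
    - apply (dM_le 3 4); auto. }
  { apply (near1 _ _ E). intros p ->. dring. }
  destruct (morse_norm _ _ Hh EJ) as [A [q [GA [Hq EA]]]].
  destruct (inverse_perturb (fun p => p +' q p) q Hq) as [psi [s [P1 [P2 [P3 [P4 P5]]]]]].
  { apply near_all; auto. }
  exists psi. split; auto. split; [apply (cubic_form_comp c W psi s); auto|].
  assert (Gp : map_germ psi) by apply P1.
  exists (fun p => A (psi p) * det_jac psi p). split.
  - apply gs_mult; [apply gs_comp; auto|]. apply det_jac_gs, germ_dsm, Gp.
  - apply (near3 _ _ _ _ (det_jac_comp W psi GW Gp) (near0_comp _ psi Gp EA) P5). intros p -> -> E3.
    cbv beta in E3. rewrite E3. ring.
Qed.

(** A change psi = z t multiplies zbar by conj t, so it preserves the ideal of zbar. *)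
Lemma cz_comp V V' psi t : map_germ psi -> dsm t -> near0 (fun p => psi p = p *' t p) -> cz V V' ->
  cz (fun p => V (psi p)) (fun p => V' (psi p)).
Proof.
  intros G Ht E [k [Hk F]]. exists (fun p => dconj (t p) *' k (psi p)). split; [dsmt|].
  apply (near2 _ _ _ E (near0_comp _ psi G F)). intros p E1 ->.
  transitivity (V' (psi p) +' dconj (p *' t p) *' k (psi p)); [rewrite <- E1; reflexivity|]. dring.
Qed.

Lemma norm_jac_comp W psi t : map_germ W -> map_germ psi -> dsm t -> near0 (fun p => psi p = p *' t p) ->
  norm_jac W -> norm_jac (fun p => W (psi p)).
Proof.
  intros GW G Ht E [q [Hq F]].
  exists (fun p => dnorm e (t p) * q (psi p) * det_jac psi p). split.
  - apply gs_mult; [apply gs_mult; [apply (dsm_norm e), Ht|apply gs_comp; auto]|apply det_jac_gs, germ_dsm, G].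
  - apply (near3 _ _ _ _ (det_jac_comp W psi GW G) (near0_comp _ psi G F) E). intros p -> -> E1.
    assert (N : dnorm e (psi p) = dnorm e p * dnorm e (t p)) by (rewrite E1; dred; ring).
    rewrite N. ring.
Qed.

(** The usual formula for the complex square root of x + j y: first component a = sqrt ((x + |X|) /
    2), second y / (2 a), where |X| is the square root of [dnorm]. Near 1 it is smooth and valid for
    both values of e. *)
Lemma dsqrt X : dsm X -> X origin = (1, 0) ->
  exists T, dsm T /\ T origin = (1, 0) /\ near0 (fun p => T p *' T p = X p).
Proof.
  intros [X1 X2] X0.
  set (n := fun p => dnorm e (X p)).
  assert (Gn : gs n) by (apply (dsm_norm e); split; auto).
  assert (n0 : n origin = 1) by (unfold n; rewrite X0; dred; ring).
  set (b := fun p => (fst (X p) + sqrt (n p)) * / 2).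
  assert (Gb : gs b). { unfold b. assert (gs (fun p => sqrt (n p))) by (apply gs_sqrt; auto; rewrite n0; lra). gsm. }
  assert (b0 : b origin = 1) by (unfold b; rewrite X0, n0, sqrt_1; cbn [fst]; field).
  set (a := fun p => sqrt (b p)).
  assert (Ga : gs a) by (unfold a; apply gs_sqrt; auto; rewrite b0; lra).
  assert (a0 : a origin = 1) by (unfold a; rewrite b0; apply sqrt_1).
  exists (fun p => (a p, snd (X p) / (2 * a p))). split; [|split].
  - split; cbn [fst snd]; auto. apply gs_div; gsm. rewrite a0; lra.
  - rewrite a0, X0. cbn [snd]. f_equal. field.
  - apply (near3 _ _ _ _ (gs_pos_near n Gn ltac:(rewrite n0; lra)) (gs_pos_near b Gb ltac:(rewrite b0; lra)) (gs_pos_near a Ga ltac:(rewrite a0; lra))).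
    intros p N1 N2 N3.
    assert (S1 := sqrt_sqrt (n p) (Rlt_le _ _ N1)). assert (S2 := sqrt_sqrt (b p) (Rlt_le _ _ N2)). fold (a p) in S2.
    unfold b in S2. unfold n at 3 in S1. revert S1 S2. unfold dnorm. generalize (sqrt (n p)). clear N1 N2. revert N3. generalize (a p).
    destruct (X p) as [x y]. cbn [fst snd]. intros s S0 w S1 S2.
    apply deq; cbn [dmul fst snd]; [|field; lra].
    apply (Rmult_eq_reg_r (4 * (s * s))); [|nra].
    transitivity (4 * (s * s) * (s * s) + e * (y * y)); [field; lra|].
    rewrite S2. nra.
Qed.

Add Ring D_ring_e : (D_ring e).

(** W and its conjugate modulo zbar, in the combinations that give z^2 and z^3 for G; [eps] measures
    the deviation left in the second. *)
Definition adapted (W eps : R * R -> R * R) : Prop :=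
  cz (fun p => W p +' dconj (W p)) (fun p => p *' p) /\ cz (fun p => dopp (dconj (W p))) (fun p => p *' p *' p *' eps p).

Lemma dM_iter4 m : dM 4 m -> exists h, dsm h /\ cz m (fun p => p *' p *' p *' p *' h p).
Proof.
  intros H. destruct (cz_dM e He 4 m H) as [h [Hh E]]. exists h. split; auto.
  apply (cz_trans e _ _ _ E). apply cz_eq. intros p. simpl. ring.
Qed.

Lemma dM_iter2 m : dM 2 m -> exists h, dsm h /\ cz m (fun p => p *' p *' h p).
Proof.
  intros H. destruct (cz_dM e He 2 m H) as [h [Hh E]]. exists h. split; auto.
  apply (cz_trans e _ _ _ E). apply cz_eq. intros p. simpl. ring.
Qed.

(** Modulo zbar the sum of W and its conjugate is z^2 X with X = 1 at the origin, so the new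
    coordinate z sqrt X turns it into z^2. The coefficient -1 of zbar^3 makes -conj W start with
    z^3. *)
Lemma adapt_square W : cubic_form (-1, 0) W -> norm_jac W -> exists psi eps, diffeo_germ psi /\
  dsm eps /\ eps origin = (1, 0) /\ norm_jac (fun p => W (psi p)) /\ adapted (fun p => W (psi p)) eps.
Proof.
  intros HW HJ. assert (GW := cubic_form_germ _ W HW). destruct HW as [r [m [Hr [Hm E]]]].
  destruct (dM_iter2 r Hr) as [r' [Sr' Er]].
  destruct (dM_iter4 (fun p => m p +' dconj (m p))) as [m1 [Sm1 Em1]]; [apply dM_add; auto; apply dM_conj; auto|].
  destruct (dM_iter4 (fun p => dconj (m p))) as [m2 [Sm2 Em2]]; [apply dM_conj; auto|].
  assert (Sr := dM_dsm 2 _ Hr). assert (Sm := dM_dsm 4 _ Hm).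
  (* Chosen so that z^2 (1 + z g) collects z r = z^3 r', the conjugate -z^3 of the cubic term, and
     z^4 m1 from the terms of order four. *)
  set (g := fun p => r' p -' (1, 0) +' p *' m1 p).
  assert (Sg : dsm g) by (unfold g; dsmt).
  set (X := fun p => (1, 0) +' p *' g p).
  assert (SX : dsm X) by (unfold X; dsmt).
  destruct (dsqrt X SX) as [T [ST [T0 ET]]]; [unfold X, origin; dring|].
  set (s := fun p => p *' T p).
  assert (Hq : dM 2 (fun p => p *' (T p -' (1, 0)))).
  { apply (dM_mul e 1 1); [apply dM_p|]. apply dM_1. split; [dsmt|]. rewrite T0. dring. }
  destruct (inverse_perturb s _ Hq) as [psi [q [P1 [P2 [P3 [P4 P5]]]]]].
  { apply near_all. intros p. unfold s. ring. }
  assert (Gp : map_germ psi) by apply P1.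
  assert (STp : dsm (fun p => T (psi p))) by dsmt.
  assert (N0 : dnorm e (T (psi origin)) <> 0).
  { replace (psi origin) with origin by (symmetry; apply Gp). rewrite T0. dred. lra. }
  (* The inverse change is z times the unit 1 / T (psi), the shape that [cz_comp] and
     [norm_jac_comp] require. *)
  set (t := fun p => dinv e (T (psi p))).
  assert (St : dsm t) by (apply (dsm_inv e (fun p => T (psi p))); auto).
  assert (Et : near0 (fun p => psi p = p *' t p)).
  { apply (near2 _ _ _ P5 (gs_neq_near _ (dsm_norm e _ STp) N0)). intros p E1 N1. unfold t.
    unfold s in E1. rewrite <- E1 at 2. revert N1. generalize (T (psi p)), (psi p). unfold dnorm. intros x y N1.
    apply deq; dred; field; auto. }
  assert (t0 : t origin = (1, 0)).
  { unfold t. replace (psi origin) with origin by (symmetry; apply Gp). rewrite T0. apply deq; dred; field; lra. }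
  set (eps0 := fun p => (1, 0) -' p *' m2 p).
  exists psi, (fun p => t p *' t p *' t p *' eps0 (psi p)). split; auto.
  assert (S0 : dsm eps0) by (unfold eps0; dsmt).
  assert (S1 : dsm (fun p => eps0 (psi p))) by (apply dsm_comp; auto).
  split; [dsmt|]. split.
  { unfold eps0. replace (psi origin) with origin by (symmetry; apply Gp). rewrite t0. unfold origin. dring. }
  split; [apply (norm_jac_comp W psi t); auto|].
  assert (Zb : forall A, dsm A -> cz (fun p => dconj p *' A p) (fun _ => (0, 0))) by apply cz_zbar.
  split.
  - apply (cz_trans e _ (fun p => psi p *' psi p *' X (psi p))).
    + apply (cz_comp (fun p => W p +' dconj (W p)) (fun p => p *' p *' X p) psi t); auto.
      apply (cz_trans e _ (fun p => (p *' p +' p *' r p +' (-1, 0) *' (p *' p *' p) +' (m p +' dconj (m p)))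
        +' dconj p *' (dconj p +' dconj (r p) +' (-1, 0) *' (dconj p *' dconj p)))).
      { apply cz_near. apply (near1 _ _ E). intros p ->. dring. }
      apply (cz_trans e _ (fun p => (p *' p +' p *' (p *' p *' r' p) +' (-1, 0) *' (p *' p *' p) +' p *' p *' p *' p *' m1 p) +' (0, 0))).
      { apply cz_add; [|apply Zb; dsmt]. apply cz_add; auto. apply cz_add; [|apply cz_refl].
        apply cz_add; [apply cz_refl|]. apply cz_mul; auto using dsm_p, cz_refl. }
      apply cz_eq. intros p. unfold X, g. replace (-1, 0) with (dopp (1, 0)) by dring. ring.
    + apply cz_near. apply (near2 _ _ _ P5 (near0_comp _ psi Gp ET)). intros p E1 E2. cbv beta in E2. rewrite <- E2.
      unfold s in E1. rewrite <- E1 at 5 6. ring.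
  - apply (cz_trans e _ (fun p => psi p *' psi p *' psi p *' eps0 (psi p))).
    + apply (cz_comp (fun p => dopp (dconj (W p))) (fun p => p *' p *' p *' eps0 p) psi t); auto.
      apply (cz_trans e _ (fun p => p *' p *' p -' dconj (m p)
        -' dconj p *' (dconj p +' dconj (r p)))).
      { apply cz_near. apply (near1 _ _ E). intros p ->. dring. }
      apply (cz_trans e _ (fun p => p *' p *' p -' p *' p *' p *' p *' m2 p -' (0, 0))).
      { apply cz_sub; [|apply Zb; dsmt]. apply cz_sub; auto using cz_refl. }
      apply cz_eq. intros p. unfold eps0. ring.
    + apply cz_near. apply (near1 _ _ Et). intros p E1. generalize (eps0 (psi p)). intros x. rewrite E1. ring.
Qed.

End Normal.

Section Chain.

Variable e : R.
Hypothesis He : e * e = 1.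

Notation "a +' b" := (dadd a b) (at level 50, left associativity).
Notation "a -' b" := (dsub a b) (at level 50, left associativity).
Notation "a *' b" := (dmul e a b) (at level 40, left associativity).
Notation cz := (cz e).
Notation nform := (nform e).
Notation norm_jac := (norm_jac e).
Notation adapted := (adapted e).

Add Ring D_ring_e2 : (D_ring e).

Lemma z_expand h : dsm h -> exists h', dsm h' /\ cz h (fun p => h origin +' p *' h' p).
Proof.
  intros Hh. destruct (cz_dM e He 1 (fun p => h p -' h origin)) as [h' [S E]].
  { apply dM_1. split; [dsmt|]. dring. }
  exists h'. split; auto. apply (cz_trans e _ (fun p => h origin +' (h p -' h origin))).
  - apply cz_eq. intros; ring.
  - apply cz_add; auto using cz_refl.
Qed.

Lemma cz_pmul p_ A B : dsm p_ -> dsm A -> cz A B -> cz (fun p => p_ p *' A p) (fun p => p_ p *' B p).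
Proof. intros. apply cz_mul; auto using cz_refl. Qed.

(* The source change z (1 + b z^2 + 2 b z^3) with 3 b = 2 e1 - e2 makes both quartic corrections
   start with a multiple of 1 + 2 z, as [adapted_nform] needs. *)
Lemma adapt_quartic W eps : map_germ W -> dsm eps -> eps origin = (1, 0) -> norm_jac W -> adapted W eps ->
  exists psi c1 c2 h1 h2, diffeo_germ psi /\ dsm h1 /\ dsm h2 /\ norm_jac (fun p => W (psi p)) /\
    cz (fun p => W (psi p) +' dconj (W (psi p)))
       (fun p => p *' p *' ((1, 0) +' p *' p *' (c1 *' ((1, 0) +' p +' p) +' p *' p *' h1 p))) /\
    cz (fun p => dopp (dconj (W (psi p))))
       (fun p => p *' p *' (p +' p *' p *' (c2 *' ((1, 0) +' p +' p) +' p *' p *' h2 p))).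
Proof.
  intros GW He0 E0 HJ [HP HQ].
  destruct (z_expand eps He0) as [f1 [F1 X1]]. destruct (z_expand f1 F1) as [f2 [F2 X2]]. destruct (z_expand f2 F2) as [w [Hw X3]].
  set (e1 := f1 origin) in *. set (e2 := f2 origin) in *. rewrite E0 in X1.
  assert (Xe : cz eps (fun p => (1, 0) +' p *' (e1 +' p *' (e2 +' p *' w p)))).
  { apply (cz_trans e _ _ _ X1). apply cz_add; [apply cz_refl|]. apply cz_pmul; auto using dsm_p.
    apply (cz_trans e _ _ _ X2). apply cz_add; [apply cz_refl|]. apply cz_pmul; auto using dsm_p. }
  (* Cubing 1 + b z^2 adds 3 b to the coefficient e2 of z^2 in [eps], and the shape e1 (1 + 2 z)
     requires e2 + 3 b = 2 e1. *)
  set (b := dre (/ 3) *' (e1 +' e1 -' e2)).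
  assert (Eb : e2 = e1 +' e1 -' (b +' b +' b)) by (unfold b; apply deq; dred; field).
  set (s := fun p : R * R => b +' b *' p +' b *' p).
  assert (Ss : dsm s) by (unfold s; dsmt).
  set (t := fun p => (1, 0) +' p *' p *' s p).
  assert (St : dsm t) by (unfold t; dsmt).
  set (psi := fun p => p *' t p).
  assert (Dp : diffeo_germ psi).
  { apply (diffeo_perturb psi (fun p => p *' (p *' p *' s p))).
    - apply (dM_le 2 3); auto. assert (P := dM_p). apply (dM_mul e 1 2); auto. apply (dM_mul e 2 0); auto. apply (dM_mul e 1 1); auto.
    - apply near_all. intros p. unfold psi, t. ring. }
  assert (Gp : map_germ psi) by apply Dp.
  assert (Ep : near0 (fun p => psi p = p *' t p)) by (apply near_all; auto).
  assert (Swp : dsm (fun p => w (psi p))) by (apply dsm_comp; auto).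
  exists psi, (b +' b), e1,
    (fun p => s p *' s p),
    (fun p => (b +' b +' b) *' ((1, 0) +' (1, 0)) +' (s p *' s p *' p +' s p *' s p *' p +' s p *' s p *' p +' p *' p *' p *' s p *' s p *' s p)
       +' e1 *' (s p *' (t p +' (1, 0)) *' (t p *' t p +' (1, 0)))
       +' p *' e2 *' (s p *' ((1, 0) +' t p +' t p *' t p +' t p *' t p *' t p +' t p *' t p *' t p *' t p))
       +' t p *' t p *' t p *' t p *' t p *' t p *' w (psi p)).
  split; auto. split; [dsmt|]. split; [dsmt|]. split; [apply (norm_jac_comp e W psi t); auto|]. split.
  - apply (cz_trans e _ (fun p => psi p *' psi p)).
    + apply (cz_comp e (fun p => W p +' dconj (W p)) (fun p => p *' p) psi t); auto.
    + apply cz_eq. intros p. unfold psi, t, s. ring.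
  - apply (cz_trans e _ (fun p => psi p *' psi p *' psi p *' eps (psi p))).
    + apply (cz_comp e (fun p => dopp (dconj (W p))) (fun p => p *' p *' p *' eps p) psi t); auto.
    + apply (cz_trans e _ (fun p => psi p *' psi p *' psi p *' ((1, 0) +' psi p *' (e1 +' psi p *' (e2 +' psi p *' w (psi p)))))).
      * apply (cz_comp e (fun p => p *' p *' p *' eps p) (fun p => p *' p *' p *' ((1, 0) +' p *' (e1 +' p *' (e2 +' p *' w p)))) psi t); auto.
        apply cz_pmul; auto. dsmt.
      * apply cz_eq. intros p. generalize (w (psi p)). intros x. rewrite Eb. unfold psi, t, s. ring.
Qed.

(* Modulo zbar, D vanishes on the normal form and D' = conj D equals z^4 (1 + 2 z) there, so the
   target change w + D' A(w) + D conj B(w) corrects w by A and conj w by B independently. *)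
Lemma adapted_nform W c1 c2 h1 h2 : map_germ W -> dsm h1 -> dsm h2 -> norm_jac W ->
  cz (fun p => W p +' dconj (W p))
     (fun p => p *' p *' ((1, 0) +' p *' p *' (c1 *' ((1, 0) +' p +' p) +' p *' p *' h1 p))) ->
  cz (fun p => dopp (dconj (W p)))
     (fun p => p *' p *' (p +' p *' p *' (c2 *' ((1, 0) +' p +' p) +' p *' p *' h2 p))) ->
  A_equivalent W nform.
Proof.
  intros GW S1 S2 [q [Hq EJ]] HP HQ.
  assert (GG := nform_germ e). assert (SG : dsm nform) by apply germ_dsm, GG. assert (SW : dsm W) by apply germ_dsm, GW.
  set (l := fun p : R * R => (1, 0) +' p +' p). assert (Sl : dsm l) by (unfold l; dsmt).
  assert (l0 : dnorm e (l origin) <> 0).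
  { replace (dnorm e (l origin)) with 1 by (unfold l, origin; dred; ring). lra. }
  set (i := fun p => dinv e (l p)).
  assert (Si : dsm i) by (exact (dsm_inv e l l0 Sl)).
  assert (Ei : near0 (fun p => l p *' i p = (1, 0))).
  { apply (near1 _ _ (gs_neq_near _ (dsm_norm e _ Sl) l0)). intros p. unfold i. generalize (l p).
    intros x N. apply deq; revert N; dred; intros N; field; auto. }
  assert (EX : forall c h, dsm h -> exists A, dsm A /\ cz (fun p => A (nform p)) (fun p => c +' p *' (p *' (h p *' i p)))).
  { intros c h Sh. apply (extend_over_nform e He _ (fun p => h p *' i p)); try dsmt. apply cz_eq. intros p. unfold origin. ring. }
  (* After division by z^4 (1 + 2 z), matching W asks for c1 + c2 + z^2 (h1 + h2) / (1 + 2 z), and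
     matching its conjugate for -c2 - z^2 h2 / (1 + 2 z). Neither has a linear term, so modulo zbar
     both are functions of G. *)
  destruct (EX (c1 +' c2) (fun p => h1 p +' h2 p)) as [A [SA EA]]; [dsmt|].
  destruct (EX (dopp c2) (fun p => dopp (h2 p))) as [B [SB EB]]; [dsmt|]. clear EX.
  (* Modulo zbar, conj G = -z^3 and G + conj G = z^2 satisfy the cusp equation y^2 = x^3, which is D
     = 0. With G in place of conj G the expression gives (z^2 + z^3)^2 - z^6 = z^4 + 2 z^5. *)
  set (D := fun w : R * R => dconj w *' dconj w -' (w +' dconj w) *' (w +' dconj w) *' (w +' dconj w)).
  set (D' := fun w : R * R => w *' w -' (w +' dconj w) *' (w +' dconj w) *' (w +' dconj w)).
  assert (cD : forall w, dconj (D w) = D' w) by (unfold D, D'; dring).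
  assert (cD' : forall w, dconj (D' w) = D w) by (unfold D, D'; dring).
  set (E := fun w => D' w *' A w +' D w *' dconj (B w)).
  assert (HE : dM 2 E).
  { assert (P := dM_p). assert (Pc := dM_conj 1 _ P).
    assert (P3 : dM 2 (fun w : R * R => (w +' dconj w) *' (w +' dconj w) *' (w +' dconj w))).
    { apply (dM_le 2 3); auto. apply (dM_mul e 2 1); [apply (dM_mul e 1 1)|]; apply dM_add; auto. }
    apply dM_add; apply (dM_mul e 2 0); try exact SA; try (apply dsm_conj; exact SB);
      apply dM_sub; auto; apply (dM_mul e 1 1); auto. }
  set (Psi := fun w => w +' E w).
  destruct (inverse_perturb Psi E HE) as [Xi [r [X1 [X2 [X3 [X4 X5]]]]]]; [apply near_all; auto|].
  assert (DPsi : diffeo_germ Psi) by (apply (diffeo_perturb Psi E HE), near_all; auto).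
  assert (GP : map_germ Psi) by apply DPsi. assert (GX : map_germ Xi) by apply X1.
  assert (GPG : map_germ (fun p => Psi (nform p))) by (apply map_germ_comp; auto).
  assert (Zb : forall A, dsm A -> cz (fun p => dconj p *' A p) (fun _ => (0, 0))) by apply cz_zbar.
  assert (Z1 : cz (fun p => nform p +' dconj (nform p)) (fun p => p *' p)).
  { apply (cz_trans e _ (fun p => p *' p +' dconj p *' dconj p)); [apply cz_eq; unfold nform; dring|].
    apply (cz_trans e _ (fun p => p *' p +' (0, 0))); [|apply cz_eq; intros; ring].
    apply cz_add; [apply cz_refl|]. apply Zb; dsmt. }
  assert (Z2 : cz (fun p => dconj (nform p)) (fun p => dopp (p *' p *' p))).
  { apply (cz_trans e _ (fun p => dopp (p *' p *' p) +' dconj p *' (dconj p +' dconj p *' dconj p))); [apply cz_eq; unfold nform; dring|].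
    apply (cz_trans e _ (fun p => dopp (p *' p *' p) +' (0, 0))); [|apply cz_eq; intros; ring].
    apply cz_add; [apply cz_refl|]. apply Zb; dsmt. }
  assert (Z3 : cz nform (fun p => p *' p +' p *' p *' p)).
  { apply (cz_trans e _ (fun p => (nform p +' dconj (nform p)) -' dconj (nform p))); [apply cz_eq; intros; ring|].
    apply (cz_trans e _ (fun p => p *' p -' dopp (p *' p *' p))); [apply cz_sub; auto|apply cz_eq; intros; ring]. }
  assert (Z4 : cz (fun p => (nform p +' dconj (nform p)) *' (nform p +' dconj (nform p)) *' (nform p +' dconj (nform p))) (fun p => (p *' p) *' (p *' p) *' (p *' p))).
  { apply cz_mul; auto; try dsmt. apply cz_mul; auto; dsmt. }
  assert (Z5 : cz (fun p => D (nform p)) (fun p => (0, 0))).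
  { apply (cz_trans e _ (fun p => dopp (p *' p *' p) *' dopp (p *' p *' p) -' (p *' p) *' (p *' p) *' (p *' p))).
    - apply cz_sub; auto. apply cz_mul; auto; dsmt.
    - apply cz_eq; intros; ring. }
  assert (Z6 : cz (fun p => D' (nform p)) (fun p => p *' p *' (p *' p *' l p))).
  { apply (cz_trans e _ (fun p => (p *' p +' p *' p *' p) *' (p *' p +' p *' p *' p) -' (p *' p) *' (p *' p) *' (p *' p))).
    - apply cz_sub; auto. apply cz_mul; auto; dsmt.
    - apply cz_eq; intros; unfold l; ring. }
  assert (SAG : dsm (fun p => A (nform p))) by (apply dsm_comp; auto).
  assert (SBG : dsm (fun p => B (nform p))) by (apply dsm_comp; auto).
  assert (Q1 : cz W (fun p => Psi (nform p))).
  { apply (cz_trans e _ (fun p => (W p +' dconj (W p)) +' dopp (dconj (W p)))); [apply cz_eq; intros; ring|].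
    apply (cz_trans e _ _ _ (cz_add e _ _ _ _ HP HQ)). apply cz_sym.
    apply (cz_trans e _ (fun p => (p *' p +' p *' p *' p) +' (p *' p *' (p *' p *' l p) *' (c1 +' c2 +' p *' (p *' ((h1 p +' h2 p) *' i p))) +' (0, 0) *' dconj (B (nform p))))).
    - apply cz_add; auto. apply cz_add; [|apply cz_mul; auto using cz_refl; dsmt]. apply cz_mul; auto; dsmt.
    - apply cz_near. apply (near1 _ _ Ei). intros p Ep.
      transitivity ((p *' p +' p *' p *' p) +' p *' p *' (p *' p *' (l p *' (c1 +' c2) +' p *' p *' ((h1 p +' h2 p) *' (l p *' i p))))); [ring|].
      rewrite Ep. unfold l. ring. }
  assert (Q2 : cz (fun p => dconj (W p)) (fun p => dconj (Psi (nform p)))).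
  { apply (cz_trans e _ (fun p => dopp (dopp (dconj (W p))))); [apply cz_eq; intros; ring|].
    apply (cz_trans e _ _ _ (cz_opp e _ _ HQ)). apply cz_sym.
    apply (cz_trans e _ (fun p => dconj (nform p) +' (D (nform p) *' dconj (A (nform p)) +' D' (nform p) *' B (nform p)))).
    { apply cz_eq. intros p. unfold Psi, E. rewrite <- (cD (nform p)), <- (cD' (nform p)). generalize (D (nform p)), (D' (nform p)), (A (nform p)), (B (nform p)). dring. }
    apply (cz_trans e _ (fun p => dopp (p *' p *' p) +' ((0, 0) *' dconj (A (nform p)) +' p *' p *' (p *' p *' l p) *' (dopp c2 +' p *' (p *' (dopp (h2 p) *' i p)))))).
    - apply cz_add; auto. apply cz_add; [apply cz_mul; auto using cz_refl; dsmt|]. apply cz_mul; auto; dsmt.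
    - apply cz_near. apply (near1 _ _ Ei). intros p Ep.
      transitivity (dopp (p *' p *' p) -' p *' p *' (p *' p *' (l p *' c2 +' p *' p *' (h2 p *' (l p *' i p))))); [ring|].
      rewrite Ep. unfold l. ring. }
  assert (SPG : dsm (fun p => Psi (nform p))) by apply germ_dsm, GPG.
  (* W and [Psi (nform p)] agree modulo zbar and modulo z, hence modulo N. *)
  destruct (cz_both e He (fun p => W p -' Psi (nform p))) as [k [Sk Ek]].
  { dsmt. }
  { apply (cz_trans e _ (fun p => Psi (nform p) -' Psi (nform p))); [apply cz_sub; auto using cz_refl|apply cz_eq; intros; ring]. }
  { apply (cz_trans e _ (fun p => dconj (W p) -' dconj (Psi (nform p)))); [apply cz_eq; dring|].
    apply (cz_trans e _ (fun p => dconj (Psi (nform p)) -' dconj (Psi (nform p)))); [apply cz_sub; auto using cz_refl|apply cz_eq; intros; ring]. }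
  assert (GXs : dsm Xi) by apply germ_dsm, GX.
  assert (Sn : gs (fun p => dnorm e p)) by (apply (dsm_norm e), dsm_p).
  assert (n0 : dnorm e origin = 0) by (unfold origin; dred; ring).
  (* Applied to Psi (G) + N k, the inverse [Xi] of [Psi] gives G plus a multiple of N, the shape
     that [lift_nform] handles. *)
  destruct (hadamard_increment (fun p => fst (Xi p)) _ _ _ _ (proj1 GXs) GPG (proj1 Sk) (proj2 Sk) Sn n0) as [m1 [M1 F1]].
  destruct (hadamard_increment (fun p => snd (Xi p)) _ _ _ _ (proj2 GXs) GPG (proj1 Sk) (proj2 Sk) Sn n0) as [m2 [M2 F2]].
  destruct (lift_nform e He (fun p => Xi (W p)) (fun p => (m1 p, m2 p)) (fun p => det_jac Xi (W p) * q p)) as [phi [Hphi Ephi]].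
  - apply dsm_pair; auto.
  - apply gs_mult; auto. apply gs_comp; auto. apply det_jac_gs; auto.
  - apply (near4 _ _ _ _ _ Ek F1 F2 (near0_comp _ nform GG X4)). intros p T1 T2 T3 T4.
    assert (WW : W p = (fst (Psi (nform p)) + dnorm e p * fst (k p), snd (Psi (nform p)) + dnorm e p * snd (k p))).
    { transitivity (Psi (nform p) +' (W p -' Psi (nform p))); [ring|]. rewrite T1. apply deq; dred; ring. }
    rewrite WW. rewrite T4 in T2, T3. apply deq.
    + refine (eq_trans T2 _). dred. ring.
    + refine (eq_trans T3 _). dred. ring.
  - apply (near2 _ _ _ (det_jac_comp Xi W GX GW) EJ). intros p -> ->. ring.
  - exists phi, Xi. auto.
Qed.

Lemma cubic_form_nform W : cubic_form e (-1, 0) W -> A_equivalent W nform.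
Proof.
  intros HW. assert (GW := cubic_form_germ e _ W HW).
  destruct (normalize_jac e He _ W HW) as [f1 [F1 [A1 B1]]].
  destruct (adapt_square e He _ A1 B1) as [f2 [eps [F2 [Se [E0 [B2 A2]]]]]].
  assert (G1 : map_germ (fun p => W (f1 p))) by (apply map_germ_comp; auto; apply F1).
  assert (G2 : map_germ (fun p => W (f1 (f2 p)))) by (apply (map_germ_comp (fun p => W (f1 p))); auto; apply F2).
  destruct (adapt_quartic _ eps G2 Se E0 B2 A2) as [f3 [c1 [c2 [h1 [h2 [F3 [S1 [S2 [B3 [Z1 Z2]]]]]]]]]].
  assert (G3 : map_germ (fun p => W (f1 (f2 (f3 p))))) by (apply (map_germ_comp (fun p => W (f1 (f2 p)))); auto; apply F3).
  apply (A_equivalent_trans _ (fun p => W (f1 p))); auto; [apply A_equivalent_source; auto|].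
  apply (A_equivalent_trans _ (fun p => W (f1 (f2 p)))); auto; [apply (A_equivalent_source (fun p => W (f1 p))); auto|].
  apply (A_equivalent_trans _ (fun p => W (f1 (f2 (f3 p))))); auto; [apply (A_equivalent_source (fun p => W (f1 (f2 p)))); auto|].
  apply (adapted_nform _ c1 c2 h1 h2); auto.
Qed.

End Chain.

(** * Jets *)

(* Cubic polynomials in one piece, since they are closed under both partial derivatives. *)
Definition pol (k l m a b c x0 x1 x2 x3 : R) (p : R * R) : R :=
  let (u, v) := p in
  k + (l * u + m * v) + (a * (u * u) + b * (u * v) + c * (v * v)) +
  (x0 * (u * u * u) + x1 * (u * u * v) + x2 * (u * v * v) + x3 * (v * v * v)).

Lemma du_pol k l m a b c x0 x1 x2 x3 p :
  du (pol k l m a b c x0 x1 x2 x3) p = pol l (2 * a) b (3 * x0) (2 * x1) x2 0 0 0 0 p.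
Proof. destruct p as [u v]. unfold du, pol. cbn [fst snd]. apply is_derive_unique. auto_derive; auto. ring. Qed.

Lemma dv_pol k l m a b c x0 x1 x2 x3 p :
  dv (pol k l m a b c x0 x1 x2 x3) p = pol m b (2 * c) x1 (2 * x2) (3 * x3) 0 0 0 0 p.
Proof. destruct p as [u v]. unfold dv, pol. cbn [fst snd]. apply is_derive_unique. auto_derive; auto. ring. Qed.

Lemma pol_gs k l m a b c x0 x1 x2 x3 : gs (pol k l m a b c x0 x1 x2 x3).
Proof.
  apply (gs_eq (fun p => k + (l * fst p + m * snd p) + (a * (fst p * fst p) + b * (fst p * snd p) + c * (snd p * snd p)) +
    (x0 * (fst p * fst p * fst p) + x1 * (fst p * fst p * snd p) + x2 * (fst p * snd p * snd p) + x3 * (snd p * snd p * snd p)))).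
  - intros [u v]. reflexivity.
  - gsm.
Qed.

Lemma sm2_pol k l m a b c x0 x1 x2 x3 p : sm2 p (pol k l m a b c x0 x1 x2 x3).
Proof.
  unfold pol.
  assert (E : forall h k : R * R -> R, (forall q, h q = k q) -> sm2 p h -> sm2 p k).
  { intros h k' E. replace k' with h; auto. apply functional_extensionality; auto. }
  apply (E (fun p => k + (l * fst p + m * snd p) + (a * (fst p * fst p) + b * (fst p * snd p) + c * (snd p * snd p)) +
    (x0 * (fst p * fst p * fst p) + x1 * (fst p * fst p * snd p) + x2 * (fst p * snd p * snd p) + x3 * (snd p * snd p * snd p)))).
  - intros [u v]. reflexivity.
  - repeat first [apply (sm_plus (V := RR)) | apply (sm_mult (V := RR)) | apply (sm_const (V := RR) (W := RN)) | apply sm2_u | apply sm2_v].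
Qed.

Lemma du_jet n h r k l m a b c x0 x1 x2 x3 : M (S n) r ->
  near0 (fun p => h p = pol k l m a b c x0 x1 x2 x3 p + r p) ->
  exists r', M n r' /\ near0 (fun p => du h p = pol l (2 * a) b (3 * x0) (2 * x1) x2 0 0 0 0 p + r' p).
Proof.
  intros Hr E. exists (du r). split; [apply M_du; auto|].
  apply (near2 _ _ _ (du_near _ _ E) (gs_near _ (M_gs _ _ Hr))). intros p E1 S.
  refine (eq_trans E1 (eq_trans (du_plus _ _ p (sm2_pol _ _ _ _ _ _ _ _ _ _ p) S) _)).
  rewrite du_pol. reflexivity.
Qed.

Lemma dv_jet n h r k l m a b c x0 x1 x2 x3 : M (S n) r ->
  near0 (fun p => h p = pol k l m a b c x0 x1 x2 x3 p + r p) ->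
  exists r', M n r' /\ near0 (fun p => dv h p = pol m b (2 * c) x1 (2 * x2) (3 * x3) 0 0 0 0 p + r' p).
Proof.
  intros Hr E. exists (dv r). split; [apply M_dv; auto|].
  apply (near2 _ _ _ (dv_near _ _ E) (gs_near _ (M_gs _ _ Hr))). intros p E1 S.
  refine (eq_trans E1 (eq_trans (dv_plus _ _ p (sm2_pol _ _ _ _ _ _ _ _ _ _ p) S) _)).
  rewrite dv_pol. reflexivity.
Qed.

Lemma pol_M1 k l m a b c x0 x1 x2 x3 : M 1 (pol k l m a b c x0 x1 x2 x3) -> k = 0.
Proof. intros H. assert (E := M_at0 0 _ H). unfold pol, origin in E. lra. Qed.

Lemma pol_M2 k l m a b c x0 x1 x2 x3 : M 2 (pol k l m a b c x0 x1 x2 x3) -> k = 0 /\ l = 0 /\ m = 0.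
Proof.
  intros H. split; [|split].
  - apply (pol_M1 _ _ _ _ _ _ _ _ _ _ (M_S 1 _ H)).
  - apply (pol_M1 l (2 * a) b (3 * x0) (2 * x1) x2 0 0 0 0). apply (M_eq 1 _ _ (du_pol k l m a b c x0 x1 x2 x3)), M_du, H.
  - apply (pol_M1 m b (2 * c) x1 (2 * x2) (3 * x3) 0 0 0 0). apply (M_eq 1 _ _ (dv_pol k l m a b c x0 x1 x2 x3)), M_dv, H.
Qed.

Lemma pol_M3 k l m a b c x0 x1 x2 x3 : M 3 (pol k l m a b c x0 x1 x2 x3) ->
  k = 0 /\ l = 0 /\ m = 0 /\ a = 0 /\ b = 0 /\ c = 0.
Proof.
  intros H. destruct (pol_M2 _ _ _ _ _ _ _ _ _ _ (M_S 2 _ H)) as [A [B C]].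
  destruct (pol_M2 l (2 * a) b (3 * x0) (2 * x1) x2 0 0 0 0) as [A1 [B1 C1]].
  { apply (M_eq 2 _ _ (du_pol k l m a b c x0 x1 x2 x3)), M_du, H. }
  destruct (pol_M2 m b (2 * c) x1 (2 * x2) (3 * x3) 0 0 0 0) as [A2 [B2 C2]].
  { apply (M_eq 2 _ _ (dv_pol k l m a b c x0 x1 x2 x3)), M_dv, H. }
  repeat split; lra.
Qed.

Lemma pol_M4 k l m a b c x0 x1 x2 x3 : M 4 (pol k l m a b c x0 x1 x2 x3) ->
  k = 0 /\ l = 0 /\ m = 0 /\ a = 0 /\ b = 0 /\ c = 0 /\ x0 = 0 /\ x1 = 0 /\ x2 = 0 /\ x3 = 0.
Proof.
  intros H. destruct (pol_M3 _ _ _ _ _ _ _ _ _ _ (M_S 3 _ H)) as [A [B [C [D [E F]]]]].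
  destruct (pol_M3 l (2 * a) b (3 * x0) (2 * x1) x2 0 0 0 0) as [_ [_ [_ [A1 [B1 C1]]]]].
  { apply (M_eq 3 _ _ (du_pol k l m a b c x0 x1 x2 x3)), M_du, H. }
  destruct (pol_M3 m b (2 * c) x1 (2 * x2) (3 * x3) 0 0 0 0) as [_ [_ [_ [A2 [B2 C2]]]]].
  { apply (M_eq 3 _ _ (dv_pol k l m a b c x0 x1 x2 x3)), M_dv, H. }
  repeat split; lra.
Qed.

Lemma M_expand0 h : gs h -> exists k r, M 1 r /\ near0 (fun p => h p = k + r p).
Proof.
  intros H. exists (h origin), (fun p => h p - h origin). split; [|apply near_all; intros; ring].
  apply M_1. split; [gsm|ring].
Qed.

Lemma M_cons n a b : M n a -> M n b -> M (S n) (fun p => fst p * a p + snd p * b p).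
Proof. intros Ha Hb. exists a, b. repeat split; auto. apply near_all; auto. Qed.

Lemma M_expand1 h : M 1 h -> exists l m r, M 2 r /\ near0 (fun p => h p = l * fst p + m * snd p + r p).
Proof.
  intros [a [b [Ha [Hb E]]]].
  destruct (M_expand0 a Ha) as [l [r [Hr Er]]]. destruct (M_expand0 b Hb) as [m [s [Hs Es]]].
  exists l, m, (fun p => fst p * r p + snd p * s p). split; [apply M_cons; auto|].
  apply (near3 _ _ _ _ E Er Es). intros p -> -> ->. ring.
Qed.

Lemma M_expand2 h : M 2 h -> exists a b c r, M 3 r /\
  near0 (fun p => h p = a * (fst p * fst p) + b * (fst p * snd p) + c * (snd p * snd p) + r p).
Proof.
  intros [a [b [Ha [Hb E]]]].
  destruct (M_expand1 a Ha) as [l [m [r [Hr Er]]]]. destruct (M_expand1 b Hb) as [l' [m' [s [Hs Es]]]].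
  exists l, (m + l'), m', (fun p => fst p * r p + snd p * s p). split; [apply M_cons; auto|].
  apply (near3 _ _ _ _ E Er Es). intros p -> -> ->. ring.
Qed.

Lemma M_expand3 h : M 3 h -> exists x0 x1 x2 x3 r, M 4 r /\
  near0 (fun p => h p = x0 * (fst p * fst p * fst p) + x1 * (fst p * fst p * snd p)
    + x2 * (fst p * snd p * snd p) + x3 * (snd p * snd p * snd p) + r p).
Proof.
  intros [a [b [Ha [Hb E]]]].
  destruct (M_expand2 a Ha) as [x [y [z [r [Hr Er]]]]]. destruct (M_expand2 b Hb) as [x' [y' [z' [s [Hs Es]]]]].
  exists x, (y + x'), (z + y'), z', (fun p => fst p * r p + snd p * s p). split; [apply M_cons; auto|].
  apply (near3 _ _ _ _ E Er Es). intros p -> -> ->. ring.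
Qed.

Definition jet (h : R * R -> R) (a b c x0 x1 x2 x3 : R) : Prop :=
  exists r, M 4 r /\ near0 (fun p => h p = pol 0 0 0 a b c x0 x1 x2 x3 p + r p).

Lemma jet_of_M2 h : M 2 h -> exists a b c x0 x1 x2 x3, jet h a b c x0 x1 x2 x3.
Proof.
  intros H. destruct (M_expand2 h H) as [a [b [c [r [Hr E]]]]].
  destruct (M_expand3 r Hr) as [x0 [x1 [x2 [x3 [s [Hs F]]]]]].
  exists a, b, c, x0, x1, x2, x3, s. split; auto.
  apply (near2 _ _ _ E F). intros [u v] -> ->. unfold pol. cbn [fst snd]. ring.
Qed.

Lemma M_2_critical h : gs h -> h origin = 0 -> du h origin = 0 -> dv h origin = 0 -> M 2 h.
Proof.
  intros Hh H0 Hu Hv.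
  destruct (M_expand1 h (proj2 (M_1 h) (conj Hh H0))) as [l [m [r [Hr E]]]].
  assert (E' : near0 (fun p => h p = pol 0 l m 0 0 0 0 0 0 0 p + r p)).
  { apply (near1 _ _ E). intros [u v] ->. unfold pol. cbn [fst snd]. ring. }
  destruct (du_jet 1 _ _ _ _ _ _ _ _ _ _ _ _ Hr E') as [r1 [R1 E1]].
  destruct (dv_jet 1 _ _ _ _ _ _ _ _ _ _ _ _ Hr E') as [r2 [R2 E2]].
  apply near_at0 in E1, E2. rewrite Hu, (M_at0 0 _ R1) in E1. rewrite Hv, (M_at0 0 _ R2) in E2.
  unfold pol, origin in E1, E2.
  apply (M_ext 2 r); auto. apply (near1 _ _ E). intros p ->.
  replace l with 0 by lra. replace m with 0 by lra. ring.
Qed.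

Lemma hess_quad h a b c r : M 3 r -> near0 (fun p => h p = pol 0 0 0 a b c 0 0 0 0 p + r p) ->
  h_uu h = 2 * a /\ h_uv h = b /\ h_vv h = 2 * c.
Proof.
  intros Hr E.
  destruct (du_jet 2 _ _ _ _ _ _ _ _ _ _ _ _ Hr E) as [r1 [R1 E1]].
  destruct (dv_jet 2 _ _ _ _ _ _ _ _ _ _ _ _ Hr E) as [r2 [R2 E2]].
  destruct (du_jet 1 _ _ _ _ _ _ _ _ _ _ _ _ R1 E1) as [r3 [R3 E3]].
  destruct (dv_jet 1 _ _ _ _ _ _ _ _ _ _ _ _ R1 E1) as [r4 [R4 E4]].
  destruct (dv_jet 1 _ _ _ _ _ _ _ _ _ _ _ _ R2 E2) as [r5 [R5 E5]].
  apply near_at0 in E3, E4, E5. rewrite (M_at0 0 _ R3) in E3. rewrite (M_at0 0 _ R4) in E4. rewrite (M_at0 0 _ R5) in E5.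
  unfold h_uu, h_uv, h_vv. rewrite E3, E4, E5. unfold pol, origin. repeat split; ring.
Qed.

Lemma det_jac_jet f a1 b1 c1 x0 x1 x2 x3 a2 b2 c2 y0 y1 y2 y3 :
  jet (fun p => fst (f p)) a1 b1 c1 x0 x1 x2 x3 -> jet (fun p => snd (f p)) a2 b2 c2 y0 y1 y2 y3 ->
  exists r, M 3 r /\ near0 (fun p => det_jac f p =
    pol 0 0 0 (2 * (a1 * b2 - a2 * b1)) (4 * (a1 * c2 - a2 * c1)) (2 * (b1 * c2 - b2 * c1)) 0 0 0 0 p + r p).
Proof.
  intros [r1 [R1 E1]] [r2 [R2 E2]].
  destruct (du_jet 3 _ _ _ _ _ _ _ _ _ _ _ _ R1 E1) as [s1 [S1 F1]].
  destruct (dv_jet 3 _ _ _ _ _ _ _ _ _ _ _ _ R1 E1) as [s2 [S2 F2]].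
  destruct (du_jet 3 _ _ _ _ _ _ _ _ _ _ _ _ R2 E2) as [s3 [S3 F3]].
  destruct (dv_jet 3 _ _ _ _ _ _ _ _ _ _ _ _ R2 E2) as [s4 [S4 F4]].
  assert (Q : forall a b c r, M 3 r -> M 2 (fun p => (a * (fst p * fst p) + b * (fst p * snd p) + c * (snd p * snd p)) + r p)).
  { intros a b c r Hr.
    assert (K : forall k h, M 2 h -> M 2 (fun p => k * h p)).
    { intros k h Hh. apply (M_eq 2 (fun p => h p * k)); [intros; ring|]. apply M_mul_gs; auto using gs_const. }
    apply M_plus; [|apply M_S; auto]. repeat apply M_plus; apply K; apply (M_mult 1 1); auto using M_u, M_v. }
  assert (L : forall l m, M 1 (fun p => l * fst p + m * snd p)).
  { intros l m. apply M_plus.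
    - apply (M_eq 1 (fun p => fst p * l)); [intros; ring|]. apply M_mul_gs; auto using gs_const, M_u.
    - apply (M_eq 1 (fun p => snd p * m)); [intros; ring|]. apply M_mul_gs; auto using gs_const, M_v. }
  set (q1 := fun p => (3 * x0 * (fst p * fst p) + 2 * x1 * (fst p * snd p) + x2 * (snd p * snd p)) + s1 p).
  set (q2 := fun p => (x1 * (fst p * fst p) + 2 * x2 * (fst p * snd p) + 3 * x3 * (snd p * snd p)) + s2 p).
  set (q3 := fun p => (3 * y0 * (fst p * fst p) + 2 * y1 * (fst p * snd p) + y2 * (snd p * snd p)) + s3 p).
  set (q4 := fun p => (y1 * (fst p * fst p) + 2 * y2 * (fst p * snd p) + 3 * y3 * (snd p * snd p)) + s4 p).
  assert (Q1 : M 2 q1) by (apply Q; auto). assert (Q2 : M 2 q2) by (apply Q; auto).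
  assert (Q3 : M 2 q3) by (apply Q; auto). assert (Q4 : M 2 q4) by (apply Q; auto).
  exists (fun p => (2 * a1 * fst p + b1 * snd p) * q4 p + q1 p * (b2 * fst p + 2 * c2 * snd p) + q1 p * q4 p
     - ((b1 * fst p + 2 * c1 * snd p) * q3 p + q2 p * (2 * a2 * fst p + b2 * snd p) + q2 p * q3 p)).
  split.
  - apply M_minus; repeat apply M_plus; first [solve [apply (M_mult 1 2); auto] | solve [apply (M_mult 2 1); auto] | apply M_S, (M_mult 2 2); auto].
  - apply (near4 _ _ _ _ _ F1 F2 F3 F4). intros [u v] T1 T2 T3 T4. unfold det_jac. rewrite T1, T2, T3, T4.
    unfold q1, q2, q3, q4, pol. cbn [fst snd]. ring.
Qed.

(** * Arithmetic of 3-jets *)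

Definition jet1 (h : R * R -> R) (l m a b c x0 x1 x2 x3 : R) : Prop :=
  exists r, M 4 r /\ near0 (fun p => h p = pol 0 l m a b c x0 x1 x2 x3 p + r p).

Lemma M_scal n k h : M n h -> M n (fun p => k * h p).
Proof. intros Hh. apply (M_eq n (fun p => h p * k)); [intros; ring|]. apply M_mul_gs; auto using gs_const. Qed.

Lemma jet1_near h h' l m a b c x0 x1 x2 x3 : near0 (fun p => h p = h' p) ->
  jet1 h l m a b c x0 x1 x2 x3 -> jet1 h' l m a b c x0 x1 x2 x3.
Proof. intros E [r [Hr F]]. exists r. split; auto. apply (near2 _ _ _ E F). intros p <-. auto. Qed.

Lemma jet1_add h h' l m a b c x0 x1 x2 x3 l' m' a' b' c' x0' x1' x2' x3' :
  jet1 h l m a b c x0 x1 x2 x3 -> jet1 h' l' m' a' b' c' x0' x1' x2' x3' ->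
  jet1 (fun p => h p + h' p) (l + l') (m + m') (a + a') (b + b') (c + c') (x0 + x0') (x1 + x1') (x2 + x2') (x3 + x3').
Proof.
  intros [r [Hr F]] [s [Hs G]]. exists (fun p => r p + s p). split; [apply M_plus; auto|].
  apply (near2 _ _ _ F G). intros [u v] -> ->. unfold pol. ring.
Qed.

Lemma jet1_scal k h l m a b c x0 x1 x2 x3 : jet1 h l m a b c x0 x1 x2 x3 ->
  jet1 (fun p => k * h p) (k * l) (k * m) (k * a) (k * b) (k * c) (k * x0) (k * x1) (k * x2) (k * x3).
Proof.
  intros [r [Hr F]]. exists (fun p => k * r p). split; [apply M_scal; auto|].
  apply (near1 _ _ F). intros [u v] ->. unfold pol. ring.
Qed.

Lemma M_lin l m : M 1 (fun p => l * fst p + m * snd p).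
Proof. apply M_plus; apply M_scal; auto using M_u, M_v. Qed.
Lemma M_quad a b c : M 2 (fun p => a * (fst p * fst p) + b * (fst p * snd p) + c * (snd p * snd p)).
Proof. repeat apply M_plus; apply M_scal; apply (M_mult 1 1); auto using M_u, M_v. Qed.
Lemma M_cub x0 x1 x2 x3 : M 3 (fun p => x0 * (fst p * fst p * fst p) + x1 * (fst p * fst p * snd p) + x2 * (fst p * snd p * snd p) + x3 * (snd p * snd p * snd p)).
Proof.
  repeat apply M_plus; apply M_scal; [apply (M_mult 2 1 (fun p => fst p * fst p))|apply (M_mult 2 1 (fun p => fst p * fst p))
    |apply (M_mult 2 1 (fun p => fst p * snd p))|apply (M_mult 2 1 (fun p => snd p * snd p))]; try apply (M_mult 1 1); auto using M_u, M_v.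
Qed.

Lemma jet1_mul h h' l m a b c x0 x1 x2 x3 l' m' a' b' c' x0' x1' x2' x3' :
  jet1 h l m a b c x0 x1 x2 x3 -> jet1 h' l' m' a' b' c' x0' x1' x2' x3' ->
  jet1 (fun p => h p * h' p) 0 0 (l * l') (l * m' + m * l') (m * m')
    (l * a' + a * l') (l * b' + m * a' + a * m' + b * l') (l * c' + m * b' + b * m' + c * l') (m * c' + c * m').
Proof.
  intros [r [Hr F]] [s [Hs G]].
  set (h1 := fun p : R * R => l * fst p + m * snd p).
  set (h2 := fun p : R * R => a * (fst p * fst p) + b * (fst p * snd p) + c * (snd p * snd p)).
  set (h3 := fun p : R * R => x0 * (fst p * fst p * fst p) + x1 * (fst p * fst p * snd p) + x2 * (fst p * snd p * snd p) + x3 * (snd p * snd p * snd p)).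
  set (k1 := fun p : R * R => l' * fst p + m' * snd p).
  set (k2 := fun p : R * R => a' * (fst p * fst p) + b' * (fst p * snd p) + c' * (snd p * snd p)).
  set (k3 := fun p : R * R => x0' * (fst p * fst p * fst p) + x1' * (fst p * fst p * snd p) + x2' * (fst p * snd p * snd p) + x3' * (snd p * snd p * snd p)).
  assert (H1 : M 1 h1) by apply M_lin. assert (H2 : M 2 h2) by apply M_quad. assert (H3 : M 3 h3) by apply M_cub.
  assert (K1 : M 1 k1) by apply M_lin. assert (K2 : M 2 k2) by apply M_quad. assert (K3 : M 3 k3) by apply M_cub.
  exists (fun p => h1 p * k3 p + h2 p * k2 p + h3 p * k1 p + h3 p * (k2 p + k3 p + s p) + h2 p * (k3 p + s p) + r p * (k1 p + k2 p + k3 p + s p) + s p * h1 p). split.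
  - assert (Gs := M_gs _ _ Hs). assert (Gk1 := M_gs _ _ K1). assert (Gk2 := M_gs _ _ K2). assert (Gk3 := M_gs _ _ K3). assert (Gh1 := M_gs _ _ H1).
    repeat apply M_plus; try (solve [apply M_mul_gs; auto; gsm]).
    + apply (M_mult 1 3); auto.
    + apply (M_mult 2 2); auto.
    + apply (M_mult 3 1); auto.
    + apply (M_mult 3 1); auto. apply M_plus; [apply M_plus; [apply (M_le 1 2)|apply (M_le 1 3)]|apply (M_le 1 4)]; auto; lia.
    + apply (M_mult 2 2); auto. apply M_plus; [apply (M_le 2 3)|apply (M_le 2 4)]; auto; lia.
  - apply (near2 _ _ _ F G). intros [u v] -> ->. unfold h1, h2, h3, k1, k2, k3, pol. cbn [fst snd]. ring.
Qed.

Lemma jet1_M4 h : M 4 h -> jet1 h 0 0 0 0 0 0 0 0 0.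
Proof. intros H. exists h. split; auto. apply near_all. intros [u v]. unfold pol. ring. Qed.

Lemma jet1_unique h l m a b c x0 x1 x2 x3 l' m' a' b' c' x0' x1' x2' x3' :
  jet1 h l m a b c x0 x1 x2 x3 -> jet1 h l' m' a' b' c' x0' x1' x2' x3' ->
  l = l' /\ m = m' /\ a = a' /\ b = b' /\ c = c' /\ x0 = x0' /\ x1 = x1' /\ x2 = x2' /\ x3 = x3'.
Proof.
  intros [r [Hr F]] [s [Hs G]].
  destruct (pol_M4 0 (l - l') (m - m') (a - a') (b - b') (c - c') (x0 - x0') (x1 - x1') (x2 - x2') (x3 - x3')) as [_ [? [? [? [? [? [? [? [? ?]]]]]]]]].
  { apply (M_ext 4 (fun p => s p - r p)); [|apply M_minus; auto].
    apply (near2 _ _ _ F G). intros [u v] E1 E2. rewrite E1 in E2. revert E2. unfold pol. lra. }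
  repeat split; lra.
Qed.

Lemma germ_jet1 h : gs h -> h origin = 0 -> exists l m a b c x0 x1 x2 x3, jet1 h l m a b c x0 x1 x2 x3.
Proof.
  intros Hh H0. destruct (M_expand1 h (proj2 (M_1 h) (conj Hh H0))) as [l [m [r [Hr E]]]].
  destruct (jet_of_M2 r Hr) as [a [b [c [x0 [x1 [x2 [x3 [s [Hs F]]]]]]]]].
  exists l, m, a, b, c, x0, x1, x2, x3, s. split; auto.
  apply (near2 _ _ _ E F). intros [u v] -> ->. unfold pol. cbn [fst snd]. ring.
Qed.

Lemma jet1_eq h l m a b c x0 x1 x2 x3 l' m' a' b' c' x0' x1' x2' x3' :
  jet1 h l m a b c x0 x1 x2 x3 ->
  l = l' -> m = m' -> a = a' -> b = b' -> c = c' -> x0 = x0' -> x1 = x1' -> x2 = x2' -> x3 = x3' ->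
  jet1 h l' m' a' b' c' x0' x1' x2' x3'.
Proof. intros; subst; auto. Qed.

(** The terms of order three are the cubic part of h at the linear part of phi, plus twice the polar
    form of the quadratic part between the linear and the second-order part of phi. As h has no
    linear term, the third-order part of phi only acts beyond order three. *)
Lemma jet1_source h a b c x0 x1 x2 x3 phi l m p0 p1 p2 y0 y1 y2 y3 l' m' q0 q1 q2 z0 z1 z2 z3 :
  map_germ phi -> jet1 h 0 0 a b c x0 x1 x2 x3 ->
  jet1 (fun p => fst (phi p)) l m p0 p1 p2 y0 y1 y2 y3 -> jet1 (fun p => snd (phi p)) l' m' q0 q1 q2 z0 z1 z2 z3 ->
  jet1 (fun p => h (phi p)) 0 0
    (a * (l * l) + b * (l * l') + c * (l' * l')) (2 * a * (l * m) + b * (l * m' + m * l') + 2 * c * (l' * m'))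
    (a * (m * m) + b * (m * m') + c * (m' * m'))
    (2 * a * (l * p0) + b * (l * q0 + l' * p0) + 2 * c * (l' * q0)
      + (x0 * (l * l * l) + x1 * (l * l * l') + x2 * (l * l' * l') + x3 * (l' * l' * l')))
    (2 * a * (l * p1 + m * p0) + b * (l * q1 + m * q0 + l' * p1 + m' * p0) + 2 * c * (l' * q1 + m' * q0)
      + (3 * x0 * (l * l * m) + x1 * (l * l * m' + 2 * (l * m * l')) + x2 * (m * l' * l' + 2 * (l * l' * m')) + 3 * x3 * (l' * l' * m')))
    (2 * a * (l * p2 + m * p1) + b * (l * q2 + m * q1 + l' * p2 + m' * p1) + 2 * c * (l' * q2 + m' * q1)
      + (3 * x0 * (l * m * m) + x1 * (m * m * l' + 2 * (l * m * m')) + x2 * (l * m' * m' + 2 * (m * l' * m')) + 3 * x3 * (l' * m' * m')))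
    (2 * a * (m * p2) + b * (m * q2 + m' * p2) + 2 * c * (m' * q2)
      + (x0 * (m * m * m) + x1 * (m * m * m') + x2 * (m * m' * m') + x3 * (m' * m' * m'))).
Proof.
  intros Gp [r [Hr E]] J1 J2.
  assert (S := jet1_M4 _ (M_comp 4 phi Gp r Hr)).
  assert (J11 := jet1_mul _ _ _ _ _ _ _ _ _ _ _ _ _ _ _ _ _ _ _ _ J1 J1).
  assert (J12 := jet1_mul _ _ _ _ _ _ _ _ _ _ _ _ _ _ _ _ _ _ _ _ J1 J2).
  assert (J22 := jet1_mul _ _ _ _ _ _ _ _ _ _ _ _ _ _ _ _ _ _ _ _ J2 J2).
  assert (J111 := jet1_mul _ _ _ _ _ _ _ _ _ _ _ _ _ _ _ _ _ _ _ _ J11 J1).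
  assert (J112 := jet1_mul _ _ _ _ _ _ _ _ _ _ _ _ _ _ _ _ _ _ _ _ J11 J2).
  assert (J122 := jet1_mul _ _ _ _ _ _ _ _ _ _ _ _ _ _ _ _ _ _ _ _ J12 J2).
  assert (J222 := jet1_mul _ _ _ _ _ _ _ _ _ _ _ _ _ _ _ _ _ _ _ _ J22 J2).
  assert (T := jet1_add _ _ _ _ _ _ _ _ _ _ _ _ _ _ _ _ _ _ _ _
    (jet1_add _ _ _ _ _ _ _ _ _ _ _ _ _ _ _ _ _ _ _ _ (jet1_add _ _ _ _ _ _ _ _ _ _ _ _ _ _ _ _ _ _ _ _ (jet1_scal a _ _ _ _ _ _ _ _ _ _ J11) (jet1_scal b _ _ _ _ _ _ _ _ _ _ J12)) (jet1_scal c _ _ _ _ _ _ _ _ _ _ J22))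
    (jet1_add _ _ _ _ _ _ _ _ _ _ _ _ _ _ _ _ _ _ _ _ (jet1_add _ _ _ _ _ _ _ _ _ _ _ _ _ _ _ _ _ _ _ _ (jet1_scal x0 _ _ _ _ _ _ _ _ _ _ J111) (jet1_scal x1 _ _ _ _ _ _ _ _ _ _ J112))
      (jet1_add _ _ _ _ _ _ _ _ _ _ _ _ _ _ _ _ _ _ _ _ (jet1_scal x2 _ _ _ _ _ _ _ _ _ _ J122) (jet1_add _ _ _ _ _ _ _ _ _ _ _ _ _ _ _ _ _ _ _ _ (jet1_scal x3 _ _ _ _ _ _ _ _ _ _ J222) S)))).
  apply (jet1_near _ (fun p => h (phi p))) in T.
  - refine (jet1_eq _ _ _ _ _ _ _ _ _ _ _ _ _ _ _ _ _ _ _ T _ _ _ _ _ _ _ _ _); ring.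
  - apply (near1 _ _ (near0_comp _ phi Gp E)). intros p ->. unfold pol. destruct (phi p) as [u v]. cbn [fst snd]. ring.
Qed.

(** f starts at order two, so products of its components have order four and only the linear part of
    H acts on the 3-jet. *)
Lemma jet1_target H f a b c x0 x1 x2 x3 a' b' c' x0' x1' x2' x3' l m p0 p1 p2 y0 y1 y2 y3 :
  map_germ f -> jet1 (fun p => fst (f p)) 0 0 a b c x0 x1 x2 x3 -> jet1 (fun p => snd (f p)) 0 0 a' b' c' x0' x1' x2' x3' ->
  jet1 H l m p0 p1 p2 y0 y1 y2 y3 ->
  jet1 (fun p => H (f p)) 0 0 (l * a + m * a') (l * b + m * b') (l * c + m * c')
    (l * x0 + m * x0') (l * x1 + m * x1') (l * x2 + m * x2') (l * x3 + m * x3').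
Proof.
  intros Gf J1 J2 [r [Hr E]].
  assert (S := jet1_M4 _ (M_comp 4 f Gf r Hr)).
  assert (J11 := jet1_mul _ _ _ _ _ _ _ _ _ _ _ _ _ _ _ _ _ _ _ _ J1 J1).
  assert (J12 := jet1_mul _ _ _ _ _ _ _ _ _ _ _ _ _ _ _ _ _ _ _ _ J1 J2).
  assert (J22 := jet1_mul _ _ _ _ _ _ _ _ _ _ _ _ _ _ _ _ _ _ _ _ J2 J2).
  assert (J111 := jet1_mul _ _ _ _ _ _ _ _ _ _ _ _ _ _ _ _ _ _ _ _ J11 J1).
  assert (J112 := jet1_mul _ _ _ _ _ _ _ _ _ _ _ _ _ _ _ _ _ _ _ _ J11 J2).
  assert (J122 := jet1_mul _ _ _ _ _ _ _ _ _ _ _ _ _ _ _ _ _ _ _ _ J12 J2).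
  assert (J222 := jet1_mul _ _ _ _ _ _ _ _ _ _ _ _ _ _ _ _ _ _ _ _ J22 J2).
  assert (T0 := jet1_add _ _ _ _ _ _ _ _ _ _ _ _ _ _ _ _ _ _ _ _ (jet1_scal l _ _ _ _ _ _ _ _ _ _ J1) (jet1_scal m _ _ _ _ _ _ _ _ _ _ J2)).
  assert (T := jet1_add _ _ _ _ _ _ _ _ _ _ _ _ _ _ _ _ _ _ _ _
    (jet1_add _ _ _ _ _ _ _ _ _ _ _ _ _ _ _ _ _ _ _ _ (jet1_add _ _ _ _ _ _ _ _ _ _ _ _ _ _ _ _ _ _ _ _ (jet1_scal p0 _ _ _ _ _ _ _ _ _ _ J11) (jet1_scal p1 _ _ _ _ _ _ _ _ _ _ J12)) (jet1_scal p2 _ _ _ _ _ _ _ _ _ _ J22))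
    (jet1_add _ _ _ _ _ _ _ _ _ _ _ _ _ _ _ _ _ _ _ _ (jet1_add _ _ _ _ _ _ _ _ _ _ _ _ _ _ _ _ _ _ _ _ (jet1_scal y0 _ _ _ _ _ _ _ _ _ _ J111) (jet1_scal y1 _ _ _ _ _ _ _ _ _ _ J112))
      (jet1_add _ _ _ _ _ _ _ _ _ _ _ _ _ _ _ _ _ _ _ _ (jet1_scal y2 _ _ _ _ _ _ _ _ _ _ J122) (jet1_add _ _ _ _ _ _ _ _ _ _ _ _ _ _ _ _ _ _ _ _ (jet1_scal y3 _ _ _ _ _ _ _ _ _ _ J222) S)))).
  assert (T1 := jet1_add _ _ _ _ _ _ _ _ _ _ _ _ _ _ _ _ _ _ _ _ T0 T).
  apply (jet1_near _ (fun p => H (f p))) in T1.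
  - refine (jet1_eq _ _ _ _ _ _ _ _ _ _ _ _ _ _ _ _ _ _ _ T1 _ _ _ _ _ _ _ _ _); ring.
  - apply (near1 _ _ (near0_comp _ f Gf E)). intros p ->. unfold pol. destruct (f p) as [u v]. cbn [fst snd]. ring.
Qed.

(** The linear parts of phi and of its inverse multiply to the identity matrix, so their
    determinants multiply to 1. *)
Lemma diffeo_linear phi l m a b c x0 x1 x2 x3 l' m' a' b' c' x0' x1' x2' x3' : diffeo_germ phi ->
  jet1 (fun p => fst (phi p)) l m a b c x0 x1 x2 x3 -> jet1 (fun p => snd (phi p)) l' m' a' b' c' x0' x1' x2' x3' ->
  l * m' - m * l' <> 0.
Proof.
  intros [Gp [psi [Gq [E _]]]] [r [Hr E1]] [s [Hs E2]] Z.
  assert (Gq' := Gq). apply germ_gs in Gq'. destruct Gq' as [G1 [G2 G0]].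
  destruct (germ_jet1 _ G1 (f_equal fst G0)) as [k [n [? [? [? [? [? [? [? [r1 [R1 F1]]]]]]]]]]].
  destruct (germ_jet1 _ G2 (f_equal snd G0)) as [k' [n' [? [? [? [? [? [? [? [r2 [R2 F2]]]]]]]]]]].
  assert (C1 := near0_comp _ phi Gp F1). assert (C2 := near0_comp _ phi Gp F2).
  assert (Gp' := Gp). apply germ_gs in Gp'. destruct Gp' as [P1 [P2 P0]].
  assert (Q : forall h i j a b c x0 x1 x2 x3 ri, M 4 ri ->
    near0 (fun p => h p = pol 0 i j a b c x0 x1 x2 x3 (phi p) + ri (phi p)) ->
    forall d d', near0 (fun p => h p = d * fst p + d' * snd p) -> i * l + j * l' = d /\ i * m + j * m' = d').
  { intros h i j ai bi ci y0 y1 y2 y3 ri Hri Eh d d' Ed.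
    assert (M1 : M 1 (fun p => fst (phi p))) by (apply M_1; split; auto; rewrite P0; reflexivity).
    assert (M2 : M 1 (fun p => snd (phi p))) by (apply M_1; split; auto; rewrite P0; reflexivity).
    assert (MM : M 2 (fun p => i * (pol 0 0 0 a b c x0 x1 x2 x3 p + r p) + j * (pol 0 0 0 a' b' c' x0' x1' x2' x3' p + s p) +
      (ai * (fst (phi p) * fst (phi p)) + bi * (fst (phi p) * snd (phi p)) + ci * (snd (phi p) * snd (phi p)) +
      (y0 * (fst (phi p) * fst (phi p) * fst (phi p)) + y1 * (fst (phi p) * fst (phi p) * snd (phi p)) + y2 * (fst (phi p) * snd (phi p) * snd (phi p)) + y3 * (snd (phi p) * snd (phi p) * snd (phi p)))) + ri (phi p))).
    { assert (PM : forall a b c x0 x1 x2 x3, M 2 (pol 0 0 0 a b c x0 x1 x2 x3)).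
      { intros a0 b0 c0 z0 z1 z2 z3. apply (M_eq 2 (fun p => (a0 * (fst p * fst p) + b0 * (fst p * snd p) + c0 * (snd p * snd p)) + (z0 * (fst p * fst p * fst p) + z1 * (fst p * fst p * snd p) + z2 * (fst p * snd p * snd p) + z3 * (snd p * snd p * snd p)))).
        - intros [u v]. unfold pol. cbn [fst snd]. ring.
        - apply M_plus; [apply M_quad|apply (M_le 2 3), M_cub; lia]. }
      assert (PP := M_comp 2 phi Gp _ (PM ai bi ci y0 y1 y2 y3)).
      apply M_plus; [apply M_plus; [apply M_plus; apply M_scal; apply M_plus; auto|]|].
      - apply (M_le 2 4); auto.
      - apply (M_le 2 4); auto.
      - apply (M_eq 2 (fun p => pol 0 0 0 ai bi ci y0 y1 y2 y3 (phi p))); auto.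
        intros p. unfold pol. destruct (phi p). cbn [fst snd]. ring.
      - apply (M_le 2 4); [lia|]. apply M_comp; auto. }
    destruct (pol_M2 0 (i * l + j * l' - d) (i * m + j * m' - d') 0 0 0 0 0 0 0) as [_ [A B]].
    { refine (M_ext 2 _ _ _ (M_opp 2 _ MM)). apply (near4 _ _ _ _ _ Eh Ed E1 E2). intros [u v] H1 H2 H3 H4.
      rewrite H1 in H2. clear H1. revert H2 H3 H4. generalize (r (u, v)), (s (u, v)), (ri (phi (u, v))). destruct (phi (u, v)) as [f1 f2]. unfold pol. cbn [fst snd].
      intros t1 t2 t3 H2 H3 H4. apply (f_equal (Rmult i)) in H3. apply (f_equal (Rmult j)) in H4. lra. }
    split; lra. }
  assert (D1 : near0 (fun p => fst p = fst (psi (phi p)))) by (apply (near1 _ _ E); intros p ->; auto).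
  assert (D2 : near0 (fun p => snd p = snd (psi (phi p)))) by (apply (near1 _ _ E); intros p ->; auto).
  destruct (Q (fun p => fst p) _ _ _ _ _ _ _ _ _ _ R1 (near2 _ _ _ D1 C1 (fun p X Y => eq_trans X Y)) 1 0) as [A1 A2].
  { apply near_all; intros; ring. }
  destruct (Q (fun p => snd p) _ _ _ _ _ _ _ _ _ _ R2 (near2 _ _ _ D2 C2 (fun p X Y => eq_trans X Y)) 0 1) as [A3 A4].
  { apply near_all; intros; ring. }
  assert (X : (k * n' - n * k') * (l * m' - m * l') = 1).
  { transitivity ((k * l + n * l') * (k' * m + n' * m') - (k * m + n * m') * (k' * l + n' * l')); [ring|].
    rewrite A1, A2, A3, A4. ring. }
  rewrite Z in X. lra.
Qed.

(** * Invariance of the determinant conditions *)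

Record cub := Cub { qa : R; qb : R; qc : R; k0 : R; k1 : R; k2 : R; k3 : R }.

Definition has_jet (f : R * R -> R * R) (F G : cub) : Prop :=
  jet1 (fun p => fst (f p)) 0 0 (qa F) (qb F) (qc F) (k0 F) (k1 F) (k2 F) (k3 F) /\
  jet1 (fun p => snd (f p)) 0 0 (qa G) (qb G) (qc G) (k0 G) (k1 G) (k2 G) (k3 G).

(** The Jacobian determinant of the two quadratic parts is 2 (jA u^2 + 2 jB u v + jC v^2); [jdisc]
    is the determinant of this form without the factor 2. *)
Definition jA (F G : cub) : R := qa F * qb G - qa G * qb F.
Definition jB (F G : cub) : R := qa F * qc G - qa G * qc F.
Definition jC (F G : cub) : R := qb F * qc G - qb G * qc F.
Definition jdisc (F G : cub) : R := jA F G * jC F G - jB F G * jB F G.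

Open Scope C_scope.

Definition quad (F : cub) (x y : C) : C := qa F * (x * x) + qb F * (x * y) + qc F * (y * y).
Definition cubic (F : cub) (x y : C) : C := k0 F * (x * x * x) + k1 F * (x * x * y) + k2 F * (x * y * y) + k3 F * (y * y * y).
Definition jform (F G : cub) (x y : C) : C := jA F G * (x * x) + 2 * jB F G * (x * y) + jC F G * (y * y).
Definition qk_det (F G : cub) (x y : C) : C := quad F x y * cubic G x y - quad G x y * cubic F x y.

(* Quantifying over all complex solutions makes the two determinant conditions invariant without
   matching the vector fields. *)
Definition cubic_generic (F G : cub) : Prop :=
  forall x y : C, ~ (x = 0 /\ y = 0) -> jform F G x y = 0 -> qk_det F G x y <> 0.

Ltac rtoc H := apply (f_equal RtoC) in H; rewrite ?RtoC_plus, ?RtoC_minus, ?RtoC_mult, ?RtoC_plus, ?RtoC_mult in H.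

Lemma Ceq_0 (a b : C) : a - b = 0 -> a = b.
Proof. intros H. transitivity (a - b + b); [ring|]. rewrite H. ring. Qed.
Lemma Csub_0 (a b : C) : a = b -> a - b = 0.
Proof. intros ->. ring. Qed.

Lemma quad_source (l1 l2 a1 b1 c1 a2 b2 c2 A B C_ l m l' m' : R) (x y : C) :
  (l1 * a1 + l2 * a2 = A * (l * l) + B * (l * l') + C_ * (l' * l'))%R ->
  (l1 * b1 + l2 * b2 = 2 * A * (l * m) + B * (l * m' + m * l') + 2 * C_ * (l' * m'))%R ->
  (l1 * c1 + l2 * c2 = A * (m * m) + B * (m * m') + C_ * (m' * m'))%R ->
  l1 * (a1 * (x * x) + b1 * (x * y) + c1 * (y * y)) + l2 * (a2 * (x * x) + b2 * (x * y) + c2 * (y * y)) =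
  A * ((l * x + m * y) * (l * x + m * y)) + B * ((l * x + m * y) * (l' * x + m' * y)) + C_ * ((l' * x + m' * y) * (l' * x + m' * y)).
Proof.
  intros E1 E2 E3. rtoc E1. rtoc E2. rtoc E3.
  apply Ceq_0. apply Csub_0 in E1, E2, E3.
  transitivity (0 * (x * x) + 0 * (x * y) + 0 * (y * y)); [|ring].
  rewrite <- E1 at 1. rewrite <- E2 at 1. rewrite <- E3 at 1. ring.
Qed.

(** The comparison of cubic coefficients in Phi f = g phi, evaluated at a complex vector. The last
    bracket is the polar term with the second-order part (p, q) of phi. *)
Lemma cubic_source (l1 l2 x0 x1 x2 x3 y0 y1 y2 y3 A B C_ X0 X1 X2 X3 l m l' m' p0 p1 p2 q0 q1 q2 : R) (x y : C) :
  (l1 * x0 + l2 * y0 = 2 * A * (l * p0) + B * (l * q0 + l' * p0) + 2 * C_ * (l' * q0)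
      + (X0 * (l * l * l) + X1 * (l * l * l') + X2 * (l * l' * l') + X3 * (l' * l' * l')))%R ->
  (l1 * x1 + l2 * y1 = 2 * A * (l * p1 + m * p0) + B * (l * q1 + m * q0 + l' * p1 + m' * p0) + 2 * C_ * (l' * q1 + m' * q0)
      + (3 * X0 * (l * l * m) + X1 * (l * l * m' + 2 * (l * m * l')) + X2 * (m * l' * l' + 2 * (l * l' * m')) + 3 * X3 * (l' * l' * m')))%R ->
  (l1 * x2 + l2 * y2 = 2 * A * (l * p2 + m * p1) + B * (l * q2 + m * q1 + l' * p2 + m' * p1) + 2 * C_ * (l' * q2 + m' * q1)
      + (3 * X0 * (l * m * m) + X1 * (m * m * l' + 2 * (l * m * m')) + X2 * (l * m' * m' + 2 * (m * l' * m')) + 3 * X3 * (l' * m' * m')))%R ->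
  (l1 * x3 + l2 * y3 = 2 * A * (m * p2) + B * (m * q2 + m' * p2) + 2 * C_ * (m' * q2)
      + (X0 * (m * m * m) + X1 * (m * m * m') + X2 * (m * m' * m') + X3 * (m' * m' * m')))%R ->
  let u := l * x + m * y in let v := l' * x + m' * y in
  let p := p0 * (x * x) + p1 * (x * y) + p2 * (y * y) in let q := q0 * (x * x) + q1 * (x * y) + q2 * (y * y) in
  l1 * (x0 * (x * x * x) + x1 * (x * x * y) + x2 * (x * y * y) + x3 * (y * y * y)) +
  l2 * (y0 * (x * x * x) + y1 * (x * x * y) + y2 * (x * y * y) + y3 * (y * y * y)) =
  X0 * (u * u * u) + X1 * (u * u * v) + X2 * (u * v * v) + X3 * (v * v * v) +
  (2 * A * u * p + B * (u * q + v * p) + 2 * C_ * v * q).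
Proof.
  intros E1 E2 E3 E4 u v p q. rtoc E1. rtoc E2. rtoc E3. rtoc E4.
  apply Ceq_0. apply Csub_0 in E1, E2, E3, E4.
  transitivity (0 * (x * x * x) + 0 * (x * x * y) + 0 * (x * y * y) + 0 * (y * y * y)); [|ring].
  rewrite <- E1 at 1. rewrite <- E2 at 1. rewrite <- E3 at 1. rewrite <- E4 at 1. unfold u, v, p, q. ring.
Qed.

(* det(M w, M p) = det M det(w, p), where M = B(w, -) and det M is a multiple of the Jacobian form at w. *)
Lemma polar_det (a1 b1 c1 a2 b2 c2 u v p q : C) :
  (a1 * b2 - a2 * b1) * (u * u) + 2 * (a1 * c2 - a2 * c1) * (u * v) + (b1 * c2 - b2 * c1) * (v * v) = 0 ->
  (a1 * (u * u) + b1 * (u * v) + c1 * (v * v)) * (2 * a2 * u * p + b2 * (u * q + v * p) + 2 * c2 * v * q) =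
  (a2 * (u * u) + b2 * (u * v) + c2 * (v * v)) * (2 * a1 * u * p + b1 * (u * q + v * p) + 2 * c1 * v * q).
Proof.
  intros H. apply Ceq_0.
  transitivity (((a1 * b2 - a2 * b1) * (u * u) + 2 * (a1 * c2 - a2 * c1) * (u * v) + (b1 * c2 - b2 * c1) * (v * v)) * (u * q - v * p)); [ring|].
  rewrite H. ring.
Qed.

(** With L and T the linear parts of phi and Phi, the quadratic parts satisfy T Q_f = Q_g L. So the
    discriminants differ by the positive factor det(L)^4 / det(T)^2, and zeros of the Jacobian form
    go to zeros. In the cubic part the second-order part of phi adds a polar term, which by
    [polar_det] is parallel to Q_g at such zeros and drops out of the determinant. *)
Lemma A_equivalent_jet f g F1 F2 G1 G2 : map_germ f -> map_germ g -> has_jet f F1 F2 -> has_jet g G1 G2 ->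
  A_equivalent f g -> (0 < jdisc F1 F2 * jdisc G1 G2 \/ (jdisc F1 F2 = 0 /\ jdisc G1 G2 = 0))%R /\ (cubic_generic G1 G2 -> cubic_generic F1 F2).
Proof.
  intros Gf Gg [JF1 JF2] [JG1 JG2] [phi [Phi [Hphi [HPhi E]]]].
  assert (Gphi : map_germ phi) by apply Hphi. assert (GPhi : map_germ Phi) by apply HPhi.
  assert (Gphi' := Gphi). apply germ_gs in Gphi'. destruct Gphi' as [S1 [S2 S0]].
  assert (GPhi' := GPhi). apply germ_gs in GPhi'. destruct GPhi' as [T1 [T2 T0]].
  destruct (germ_jet1 _ S1 (f_equal fst S0)) as [l [m [p0 [p1 [p2 [t1 [t2 [t3 [t4 J1]]]]]]]]].
  destruct (germ_jet1 _ S2 (f_equal snd S0)) as [l' [m' [q0 [q1 [q2 [t5 [t6 [t7 [t8 J2]]]]]]]]].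
  destruct (germ_jet1 _ T1 (f_equal fst T0)) as [r1 [r2 [t9 [t10 [t11 [t12 [t13 [t14 [t15 J3]]]]]]]]].
  destruct (germ_jet1 _ T2 (f_equal snd T0)) as [s1 [s2 [t16 [t17 [t18 [t19 [t20 [t21 [t22 J4]]]]]]]]].
  assert (DL := diffeo_linear _ _ _ _ _ _ _ _ _ _ _ _ _ _ _ _ _ _ _ Hphi J1 J2).
  assert (DR := diffeo_linear _ _ _ _ _ _ _ _ _ _ _ _ _ _ _ _ _ _ _ HPhi J3 J4).
  assert (E1 : near0 (fun p => fst (g (phi p)) = fst (Phi (f p)))) by (apply (near1 _ _ E); intros p ->; auto).
  assert (E2 : near0 (fun p => snd (g (phi p)) = snd (Phi (f p)))) by (apply (near1 _ _ E); intros p ->; auto).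
  assert (A1 := jet1_near _ _ _ _ _ _ _ _ _ _ _ E1 (jet1_source _ _ _ _ _ _ _ _ _ _ _ _ _ _ _ _ _ _ _ _ _ _ _ _ _ _ _ Gphi JG1 J1 J2)).
  assert (A2 := jet1_near _ _ _ _ _ _ _ _ _ _ _ E2 (jet1_source _ _ _ _ _ _ _ _ _ _ _ _ _ _ _ _ _ _ _ _ _ _ _ _ _ _ _ Gphi JG2 J1 J2)).
  assert (B1 := jet1_target _ _ _ _ _ _ _ _ _ _ _ _ _ _ _ _ _ _ _ _ _ _ _ _ _ Gf JF1 JF2 J3).
  assert (B2 := jet1_target _ _ _ _ _ _ _ _ _ _ _ _ _ _ _ _ _ _ _ _ _ _ _ _ _ Gf JF1 JF2 J4).
  destruct (jet1_unique _ _ _ _ _ _ _ _ _ _ _ _ _ _ _ _ _ _ _ B1 A1) as [_ [_ [X1 [X2 [X3 [X4 [X5 [X6 X7]]]]]]]].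
  destruct (jet1_unique _ _ _ _ _ _ _ _ _ _ _ _ _ _ _ _ _ _ _ B2 A2) as [_ [_ [Y1 [Y2 [Y3 [Y4 [Y5 [Y6 Y7]]]]]]]].
  clear A1 A2 B1 B2 J1 J2 J3 J4 E E1 E2 JF1 JF2 JG1 JG2.
  split.
  - clear X4 X5 X6 X7 Y4 Y5 Y6 Y7.
    set (d := (l * m' - m * l')%R) in *. set (d' := (r1 * s2 - r2 * s1)%R) in *.
    assert (Z : (d' * d' * jdisc F1 F2 = d * d * d * d * jdisc G1 G2)%R).
    { transitivity ((((r1 * qa F1 + r2 * qa F2) * (s1 * qb F1 + s2 * qb F2) - (s1 * qa F1 + s2 * qa F2) * (r1 * qb F1 + r2 * qb F2))
       * ((r1 * qb F1 + r2 * qb F2) * (s1 * qc F1 + s2 * qc F2) - (s1 * qb F1 + s2 * qb F2) * (r1 * qc F1 + r2 * qc F2))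
       - ((r1 * qa F1 + r2 * qa F2) * (s1 * qc F1 + s2 * qc F2) - (s1 * qa F1 + s2 * qa F2) * (r1 * qc F1 + r2 * qc F2))
       * ((r1 * qa F1 + r2 * qa F2) * (s1 * qc F1 + s2 * qc F2) - (s1 * qa F1 + s2 * qa F2) * (r1 * qc F1 + r2 * qc F2)))%R).
      - unfold jdisc, jA, jB, jC, d'. ring.
      - rewrite X1, X2, X3, Y1, Y2, Y3. unfold jdisc, jA, jB, jC, d. ring. }
    assert (P1 : (0 < d' * d')%R) by (apply Rlt_0_sqr; auto).
    assert (P2 : (0 < d * d)%R) by (apply Rlt_0_sqr; auto).
    destruct (Req_dec (jdisc G1 G2) 0) as [N|N].
    + right. split; auto. rewrite N, Rmult_0_r in Z. apply Rmult_integral in Z. destruct Z; lra.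
    + left. assert (Q := Rlt_0_sqr _ N). unfold Rsqr in Q.
      apply (Rmult_lt_reg_l (d' * d')%R); auto.
      replace (d' * d' * (jdisc F1 F2 * jdisc G1 G2))%R with ((d * d) * (d * d) * (jdisc G1 G2 * jdisc G1 G2))%R.
      2: { transitivity ((d' * d' * jdisc F1 F2) * jdisc G1 G2)%R; [rewrite Z|]; ring. }
      rewrite Rmult_0_r. apply Rmult_lt_0_compat; [apply Rmult_lt_0_compat|]; auto.
  - intros HG x y Nxy HJ HD.
    set (u := l * x + m * y). set (v := l' * x + m' * y).
    assert (U1 := quad_source _ _ _ _ _ _ _ _ _ _ _ _ _ _ _ x y X1 X2 X3).
    assert (U2 := quad_source _ _ _ _ _ _ _ _ _ _ _ _ _ _ _ x y Y1 Y2 Y3).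
    assert (V1 := cubic_source _ _ _ _ _ _ _ _ _ _ _ _ _ _ _ _ _ _ _ _ _ _ _ _ _ _ _ x y X4 X5 X6 X7).
    assert (V2 := cubic_source _ _ _ _ _ _ _ _ _ _ _ _ _ _ _ _ _ _ _ _ _ _ _ _ _ _ _ x y Y4 Y5 Y6 Y7).
    cbv zeta in V1, V2. fold u v in U1, U2, V1, V2.
    fold (quad F1 x y) (quad F2 x y) (quad G1 u v) in U1. fold (quad F1 x y) (quad F2 x y) (quad G2 u v) in U2.
    fold (cubic F1 x y) (cubic F2 x y) (cubic G1 u v) in V1. fold (cubic F1 x y) (cubic F2 x y) (cubic G2 u v) in V2.
    revert V1 V2. generalize (p0 * (x * x) + p1 * (x * y) + p2 * (y * y)), (q0 * (x * x) + q1 * (x * y) + q2 * (y * y)). intros p q V1 V2.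
    assert (DLc : l * m' - m * l' <> 0).
    { rewrite <- !RtoC_mult, <- RtoC_minus. intros Q. apply RtoC_inj in Q. auto. }
    assert (N' : ~ (u = 0 /\ v = 0)).
    { intros [Q1 Q2]. apply Nxy. split.
      - assert (Q : (l * m' - m * l') * x = 0) by (transitivity (m' * u - m * v); [unfold u, v; ring|rewrite Q1, Q2; ring]).
        destruct (Ceq_dec x 0) as [|Nx]; auto. exfalso. apply (Cmult_neq_0 _ _ DLc Nx Q).
      - assert (Q : (l * m' - m * l') * y = 0) by (transitivity (l * v - l' * u); [unfold u, v; ring|rewrite Q1, Q2; ring]).
        destruct (Ceq_dec y 0) as [|Ny]; auto. exfalso. apply (Cmult_neq_0 _ _ DLc Ny Q). }
    assert (JG : jform G1 G2 u v = 0).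
    { assert (Q : (l * m' - m * l') * jform G1 G2 u v = (r1 * s2 - r2 * s1) * jform F1 F2 x y).
      { clear V1 V2 X4 X5 X6 X7 Y4 Y5 Y6 Y7 HG HD HJ.
        rtoc X1. rtoc X2. rtoc X3. rtoc Y1. rtoc Y2. rtoc Y3.
        transitivity (((r1 * qa F1 + r2 * qa F2) * (s1 * qb F1 + s2 * qb F2) - (s1 * qa F1 + s2 * qa F2) * (r1 * qb F1 + r2 * qb F2)) * (x * x)
          + 2 * ((r1 * qa F1 + r2 * qa F2) * (s1 * qc F1 + s2 * qc F2) - (s1 * qa F1 + s2 * qa F2) * (r1 * qc F1 + r2 * qc F2)) * (x * y)
          + ((r1 * qb F1 + r2 * qb F2) * (s1 * qc F1 + s2 * qc F2) - (s1 * qb F1 + s2 * qb F2) * (r1 * qc F1 + r2 * qc F2)) * (y * y)).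
        - rewrite X1, X2, X3, Y1, Y2, Y3. unfold jform, jA, jB, jC, u, v. rewrite !RtoC_minus, !RtoC_mult. ring.
        - unfold jform, jA, jB, jC. rewrite !RtoC_minus, !RtoC_mult. ring. }
      rewrite HJ in Q. destruct (Ceq_dec (jform G1 G2 u v) 0) as [|Nj]; auto. exfalso. apply (Cmult_neq_0 _ _ DLc Nj). rewrite Q. ring. }
    apply (HG u v N' JG).
    assert (PD := polar_det (qa G1) (qb G1) (qc G1) (qa G2) (qb G2) (qc G2) u v p q).
    fold (quad G1 u v) (quad G2 u v) in PD.
    assert (PD' : quad G1 u v * (2 * qa G2 * u * p + qb G2 * (u * q + v * p) + 2 * qc G2 * v * q) = quad G2 u v * (2 * qa G1 * u * p + qb G1 * (u * q + v * p) + 2 * qc G1 * v * q)).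
    { apply PD. rewrite <- JG. unfold jform, jA, jB, jC. rewrite !RtoC_minus, !RtoC_mult. ring. }
    clear PD.
    transitivity ((r1 * s2 - r2 * s1) * qk_det F1 F2 x y); [|rewrite HD; ring].
    transitivity ((r1 * quad F1 x y + r2 * quad F2 x y) * (s1 * cubic F1 x y + s2 * cubic F2 x y)
      - (s1 * quad F1 x y + s2 * quad F2 x y) * (r1 * cubic F1 x y + r2 * cubic F2 x y)); [|unfold qk_det; ring].
    rewrite U1, U2, V1, V2. unfold qk_det.
    transitivity (quad G1 u v * cubic G2 u v - quad G2 u v * cubic G1 u v + (quad G1 u v * (2 * qa G2 * u * p + qb G2 * (u * q + v * p) + 2 * qc G2 * v * q) - quad G2 u v * (2 * qa G1 * u * p + qb G1 * (u * q + v * p) + 2 * qc G1 * v * q))).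
    + rewrite PD'. ring.
    + ring.
Qed.

Open Scope R_scope.

(** * Linear normalization *)

Definition lin (a b c d : R) (p : R * R) : R * R := (a * fst p + b * snd p, c * fst p + d * snd p).

Lemma lin_germ a b c d : map_germ (lin a b c d).
Proof. apply germ_pair; gsm; unfold origin; cbn [fst snd]; ring. Qed.

Lemma lin_diffeo a b c d : a * d - b * c <> 0 -> diffeo_germ (lin a b c d).
Proof.
  intros D. split; [apply lin_germ|].
  exists (lin (d / (a * d - b * c)) (- b / (a * d - b * c)) (- c / (a * d - b * c)) (a / (a * d - b * c))).
  split; [apply lin_germ|].
  split; apply near_all; intros [x y]; unfold lin; cbn [fst snd]; f_equal; field; auto.
Qed.

Lemma lin_jet1 a b : jet1 (fun p => a * fst p + b * snd p) a b 0 0 0 0 0 0 0.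
Proof. exists (fun _ => 0). split; [apply M_0|]. apply near_all. intros [u v]. unfold pol. cbn [fst snd]. ring. Qed.

Lemma quadratic_direction A B C : A * C - B * B <> 0 -> exists s t, A * (s * s) + 2 * B * (s * t) + C * (t * t) <> 0.
Proof.
  intros D. destruct (Req_dec A 0) as [A0|A0].
  - destruct (Req_dec C 0) as [C0|C0].
    + exists 1, 1. subst. intros Q. apply D. replace B with 0 by lra. ring.
    + exists 0, 1. intros Q. apply C0. lra.
  - exists 1, 0. intros Q. apply A0. lra.
Qed.

(** The vectors (s, t) and (s', t') are orthogonal for the Jacobian form, the second rescaled to
    make the form a multiple of u^2 - e v^2. Then jB = 0 and jC = -e jA, and the identity qb jB - qa
    jC = qc jA, valid for each of the two quadratic parts, gives qc = e qa. *)
Lemma diagonalize_source e f F G : e * e = 1 -> map_germ f -> has_jet f F G -> 0 < - e * jdisc F G ->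
  exists f1 F1 G1, map_germ f1 /\ A_equivalent f f1 /\ has_jet f1 F1 G1 /\
    jA F1 G1 <> 0 /\ qc F1 = e * qa F1 /\ qc G1 = e * qa G1.
Proof.
  intros He Gf [J1 J2] Hd.
  set (A := jA F G). set (B := jB F G). set (C := jC F G).
  assert (D : A * C - B * B = jdisc F G) by reflexivity.
  destruct (quadratic_direction A B C) as [s [t Hk]].
  { rewrite D. intros Q. rewrite Q in Hd. lra. }
  set (k := A * (s * s) + 2 * B * (s * t) + C * (t * t)) in *.
  set (d := jdisc F G) in *.
  (* Normalization w^2 jdisc = -e: the form takes the value w^2 k jdisc at (s', t'), and -e k is
     wanted. *)
  set (w := / sqrt (- e * d)).
  assert (Hw : w <> 0). { unfold w. apply Rinv_neq_0_compat. assert (P := sqrt_lt_R0 _ Hd). lra. }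
  assert (Hw2 : w * w * d = - e).
  { assert (S := sqrt_sqrt _ (Rlt_le _ _ Hd)). assert (P := sqrt_lt_R0 _ Hd). unfold w.
    replace (/ sqrt (- e * d) * / sqrt (- e * d)) with (/ (- e * d)).
    - apply (Rmult_eq_reg_l (- e * d)); [|lra]. rewrite <- Rmult_assoc, Rinv_r by lra. rewrite Rmult_1_l.
      transitivity (e * e * d); [rewrite He|]; ring.
    - rewrite <- S at 1. field. lra. }
  set (s' := - w * (B * s + C * t)). set (t' := w * (A * s + B * t)).
  assert (DL : s * t' - s' * t = w * k) by (unfold s', t', k; ring).
  assert (DL0 : s * t' - s' * t <> 0) by (rewrite DL; apply Rmult_integral_contrapositive; auto).
  assert (HL := lin_diffeo s s' t t' DL0).
  set (qL := fun H : cub => Cub (qa H * (s * s) + qb H * (s * t) + qc H * (t * t))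
     (2 * qa H * (s * s') + qb H * (s * t' + s' * t) + 2 * qc H * (t * t')) (qa H * (s' * s') + qb H * (s' * t') + qc H * (t' * t'))
     (k0 H * (s * s * s) + k1 H * (s * s * t) + k2 H * (s * t * t) + k3 H * (t * t * t))
     (3 * k0 H * (s * s * s') + k1 H * (s * s * t' + 2 * (s * s' * t)) + k2 H * (s' * t * t + 2 * (s * t * t')) + 3 * k3 H * (t * t * t'))
     (3 * k0 H * (s * s' * s') + k1 H * (s' * s' * t + 2 * (s * s' * t')) + k2 H * (s * t' * t' + 2 * (s' * t * t')) + 3 * k3 H * (t * t' * t'))
     (k0 H * (s' * s' * s') + k1 H * (s' * s' * t') + k2 H * (s' * t' * t') + k3 H * (t' * t' * t'))).
  exists (fun p => f (lin s s' t t' p)), (qL F), (qL G).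
  split; [apply map_germ_comp; auto; apply HL|]. split; [apply A_equivalent_source; auto|].
  split.
  { split.
    - refine (jet1_eq _ _ _ _ _ _ _ _ _ _ _ _ _ _ _ _ _ _ _ (jet1_source _ _ _ _ _ _ _ _ (lin s s' t t') _ _ _ _ _ _ _ _ _ _ _ _ _ _ _ _ _ _ (proj1 HL) J1 (lin_jet1 s s') (lin_jet1 t t')) _ _ _ _ _ _ _ _ _); cbn [qL qa qb qc k0 k1 k2 k3]; ring.
    - refine (jet1_eq _ _ _ _ _ _ _ _ _ _ _ _ _ _ _ _ _ _ _ (jet1_source _ _ _ _ _ _ _ _ (lin s s' t t') _ _ _ _ _ _ _ _ _ _ _ _ _ _ _ _ _ _ (proj1 HL) J2 (lin_jet1 s s') (lin_jet1 t t')) _ _ _ _ _ _ _ _ _); cbn [qL qa qb qc k0 k1 k2 k3]; ring. }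
  set (D' := s * t' - s' * t) in *.
  assert (EA : jA (qL F) (qL G) = D' * k).
  { unfold k, A, B, C, jA, jB, jC, D', qL. cbn [qa qb qc]. ring. }
  assert (EB : jB (qL F) (qL G) = D' * (A * (s * s') + B * (s * t' + s' * t) + C * (t * t'))).
  { unfold A, B, C, jA, jB, jC, D', qL. cbn [qa qb qc]. ring. }
  assert (EC : jC (qL F) (qL G) = D' * (A * (s' * s') + 2 * B * (s' * t') + C * (t' * t'))).
  { unfold A, B, C, jA, jB, jC, D', qL. cbn [qa qb qc]. ring. }
  assert (Z0 : A * (s * s') + B * (s * t' + s' * t) + C * (t * t') = 0) by (unfold s', t'; ring).
  assert (Z1 : A * (s' * s') + 2 * B * (s' * t') + C * (t' * t') = - e * k).
  { rewrite <- Hw2, <- D. unfold s', t', k. ring. }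
  rewrite Z0, Rmult_0_r in EB. rewrite Z1 in EC.
  assert (NA : jA (qL F) (qL G) <> 0) by (rewrite EA; apply Rmult_integral_contrapositive; auto).
  assert (EC' : jC (qL F) (qL G) = - e * jA (qL F) (qL G)) by (rewrite EC, EA; ring).
  split; auto. clear EA EC Z0 Z1. revert NA EB EC'. generalize (qL F), (qL G). clear - He.
  intros F1 G1. unfold jA, jB, jC. destruct F1 as [a b c ? ? ? ?], G1 as [a2 b2 c2 ? ? ? ?]. cbn [qa qb qc]. intros NA EB EC.
  split; apply (Rmult_eq_reg_l (a * b2 - a2 * b)); auto.
  - transitivity (b * (a * c2 - a2 * c) - a * (b * c2 - b2 * c)); [ring|]. rewrite EB, EC. ring.
  - transitivity (b2 * (a * c2 - a2 * c) - a2 * (b * c2 - b2 * c)); [ring|]. rewrite EB, EC. ring.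
Qed.

(** The quadratic parts now span the plane of u^2 + e v^2 and u v, so a linear target change takes
    them to the components u^2 + e v^2 and 2 u v of z^2. *)
Lemma normalize_target e f F G : map_germ f -> has_jet f F G ->
  jA F G <> 0 -> qc F = e * qa F -> qc G = e * qa G ->
  exists W x0 x1 x2 x3 y0 y1 y2 y3, map_germ W /\ A_equivalent f W /\
    has_jet W (Cub 1 0 e x0 x1 x2 x3) (Cub 0 2 0 y0 y1 y2 y3).
Proof.
  intros Gf [J1 J2] HA E1 E2. unfold jA in HA.
  set (d := qa F * qb G - qa G * qb F) in *.
  assert (HL : diffeo_germ (lin (qb G / d) (- qb F / d) (-2 * qa G / d) (2 * qa F / d))).
  { apply lin_diffeo. intros Q. apply HA.
    assert (X : 2 = d * (qb G / d * (2 * qa F / d) - - qb F / d * (-2 * qa G / d))).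
    { replace (qb G / d * (2 * qa F / d) - - qb F / d * (-2 * qa G / d)) with (2 * (qa F * qb G - qa G * qb F) / (d * d)) by (field; auto).
      fold d. field. auto. }
    rewrite Q in X. lra. }
  exists (fun p => lin (qb G / d) (- qb F / d) (-2 * qa G / d) (2 * qa F / d) (f p)).
  do 8 eexists. split; [apply map_germ_comp; auto; apply HL|]. split; [apply A_equivalent_target; auto|].
  split.
  - refine (jet1_eq _ _ _ _ _ _ _ _ _ _ _ _ _ _ _ _ _ _ _ (jet1_target _ f _ _ _ _ _ _ _ _ _ _ _ _ _ _ _ _ _ _ _ _ _ _ _ Gf J1 J2 (lin_jet1 (qb G / d) (- qb F / d))) _ _ _ _ _ _ _ _ _); cbn [qa qb qc k0 k1 k2 k3]; try reflexivity.
    + unfold d. field. auto.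
    + field. auto.
    + rewrite E1, E2. unfold d. field. auto.
  - refine (jet1_eq _ _ _ _ _ _ _ _ _ _ _ _ _ _ _ _ _ _ _ (jet1_target _ f _ _ _ _ _ _ _ _ _ _ _ _ _ _ _ _ _ _ _ _ _ _ _ Gf J1 J2 (lin_jet1 (-2 * qa G / d) (2 * qa F / d))) _ _ _ _ _ _ _ _ _); cbn [qa qb qc k0 k1 k2 k3]; try reflexivity.
    + field. auto.
    + unfold d. field. auto.
    + rewrite E1, E2. field. auto.
Qed.

(* 8 times the coefficient of zbar^3 when u = (z + zbar)/2 and v = e j (z - zbar)/2. *)
Definition zbar3 (e : R) (F G : cub) : R * R :=
  (k0 F - k1 G + e * k2 F - e * k3 G, k0 G - e * k1 F + e * k2 G - k3 F).

(** For the quadratic part z^2 the zeros of the Jacobian form are the multiples of (1, r) with r^2 =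
    e, real or complex. There the determinant is 2 (Y - r X); the product over both roots is 4 (Y^2
    - e X^2), which is -4 e times the norm of (X, Y). *)
Lemma zbar3_unit e x0 x1 x2 x3 y0 y1 y2 y3 : e * e = 1 ->
  cubic_generic (Cub 1 0 e x0 x1 x2 x3) (Cub 0 2 0 y0 y1 y2 y3) ->
  dnorm e (zbar3 e (Cub 1 0 e x0 x1 x2 x3) (Cub 0 2 0 y0 y1 y2 y3)) <> 0.
Proof.
  intros He HG. set (F := Cub 1 0 e x0 x1 x2 x3) in *. set (G := Cub 0 2 0 y0 y1 y2 y3) in *.
  destruct (zbar3 e F G) as [X Y] eqn:EZ. unfold zbar3, F, G in EZ. cbn [k0 k1 k2 k3] in EZ. injection EZ as EX EY.
  assert (Hec : Cmult (RtoC e) (RtoC e) = RtoC 1) by (rewrite <- RtoC_mult, He; reflexivity).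
  assert (T : exists t : C, Cmult t t = RtoC e).
  { destruct (unit_cases e He) as [->| ->]; [exists (RtoC 1)|exists Ci]; apply injective_projections; cbn; ring. }
  destruct T as [t Ht].
  assert (K : forall r : C, Cmult r r = RtoC e -> qk_det F G (RtoC 1) r = Cmult (RtoC 2) (Cminus (RtoC Y) (Cmult r (RtoC X))) /\ qk_det F G (RtoC 1) r <> RtoC 0).
  { intros r Hr. split.
    - rewrite <- EX, <- EY. unfold qk_det, quad, cubic, F, G. cbn [qa qb qc k0 k1 k2 k3].
      assert (Q2 : Cplus (Cplus (Cmult (RtoC 1) (Cmult (RtoC 1) (RtoC 1))) (Cmult (RtoC 0) (Cmult (RtoC 1) r))) (Cmult (RtoC e) (Cmult r r)) = RtoC 2).
      { rewrite Hr, Hec. apply injective_projections; cbn; ring. }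
      rewrite Q2. rewrite !RtoC_minus, !RtoC_plus, !RtoC_minus, !RtoC_mult.
      (* The added terms are multiples of e - r^2 and 1 - r^4, hence zero; they turn the claim into
         a polynomial identity. *)
      match goal with |- ?L = _ => transitivity (L + 2 * RtoC y2 * (RtoC e - r * r) + 2 * RtoC y3 * r * (RtoC e - r * r) - 2 * RtoC x1 * (RtoC e - r * r) - 2 * RtoC x2 * r * (RtoC e - r * r) - 2 * RtoC x3 * (RtoC 1 - r * r * (r * r)))%C end.
      + rewrite Hr, Hec. ring.
      + ring.
    - apply HG.
      + intros [Q _]. apply RtoC_inj in Q. lra.
      + unfold jform, jA, jB, jC, F, G. cbn [qa qb qc]. rewrite Hr, !RtoC_minus, !RtoC_mult.
        transitivity (2 - 2 * (RtoC e * RtoC e))%C; [ring|]. rewrite Hec. ring. }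
  intros Z.
  destruct (K t Ht) as [K1 K2]. destruct (K (- t)%C) as [K3 K4]; [rewrite <- Ht; ring|].
  rewrite K1 in K2. rewrite K3 in K4. apply (Cmult_neq_0 _ _ K2 K4).
  transitivity (4 * (RtoC Y * RtoC Y - (t * t) * (RtoC X * RtoC X)))%C; [ring|].
  rewrite Ht, <- !RtoC_mult, <- RtoC_minus.
  replace (Y * Y - e * (X * X)) with 0; [ring|].
  transitivity (- e * dnorm e (X, Y)); [rewrite Z; ring|]. unfold dnorm. cbn [fst snd].
  transitivity ((e * e) * (Y * Y) - e * (X * X)); [ring|]. rewrite He. ring.
Qed.

Section Scaling.

Variable e : R.
Hypothesis He : e * e = 1.

Notation "a +' b" := (dadd a b) (at level 50, left associativity).
Notation "a -' b" := (dsub a b) (at level 50, left associativity).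
Notation "a *' b" := (dmul e a b) (at level 40, left associativity).

Add Ring D_ring_e3 : (D_ring e).

Lemma cubic_form_of_jet W x0 x1 x2 x3 y0 y1 y2 y3 :
  has_jet W (Cub 1 0 e x0 x1 x2 x3) (Cub 0 2 0 y0 y1 y2 y3) ->
  cubic_form e (dre (/ 8) *' zbar3 e (Cub 1 0 e x0 x1 x2 x3) (Cub 0 2 0 y0 y1 y2 y3)) W.
Proof.
  intros [[r [Hr E]] [s [Hs F]]]. cbn [qa qb qc k0 k1 k2 k3] in E, F.
  (* Coefficients of z^3, z^2 zbar and z zbar^2 in the cubic part. *)
  set (a0 := (/ 8 * (x0 + y1 + e * x2 + e * y3), / 8 * (y0 + e * x1 + e * y2 + x3))).
  set (a1 := (/ 8 * (3 * x0 + y1 - e * x2 - 3 * e * y3), / 8 * (3 * y0 + e * x1 - e * y2 - 3 * x3))).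
  set (a2 := (/ 8 * (3 * x0 - y1 - e * x2 + 3 * e * y3), / 8 * (3 * y0 - e * x1 - e * y2 + 3 * x3))).
  exists (fun p => a0 *' (p *' p) +' a1 *' (p *' dconj p) +' a2 *' (dconj p *' dconj p)), (fun p => (r p, s p)).
  assert (P := dM_p). assert (Pc := dM_conj 1 _ P).
  split; [|split].
  - repeat apply dM_add; apply (dM_mul e 0 2); try apply dsm_const; apply (dM_mul e 1 1); auto.
  - split; auto.
  - apply (near2 _ _ _ E F). intros [u v] E1 E2. apply deq.
    + rewrite E1. unfold pol, a0, a1, a2, zbar3. cbn [k0 k1 k2 k3]. dred. efield e He.
    + rewrite E2. unfold pol, a0, a1, a2, zbar3. cbn [k0 k1 k2 k3]. dred. efield e He.
Qed.

Lemma dmul_diffeo a : dnorm e a <> 0 -> diffeo_germ (fun p => a *' p).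
Proof.
  intros N. refine (eq_ind (lin (fst a) (e * snd a) (snd a) (fst a)) diffeo_germ _ _ _).
  - apply lin_diffeo. revert N. unfold dnorm. intros N Q. apply N. rewrite <- Q. ring.
  - apply functional_extensionality. intros p. apply deq; unfold lin; dred; ring.
Qed.

(** The map a^(-2) W (a z) keeps z^2 and multiplies the coefficient c by a^(-2) conj(a)^3; the
    equation for a makes the result -1. *)
Lemma cubic_form_scale c a W : dnorm e a <> 0 -> a *' a = dopp c *' (dconj a *' dconj a *' dconj a) ->
  cubic_form e c W -> exists W', A_equivalent W W' /\ cubic_form e (-1, 0) W'.
Proof.
  intros N Ea HW. assert (GW := cubic_form_germ e c W HW). destruct HW as [r [m [Hr [Hm E]]]].
  set (b := dinv e a).
  assert (Eb : b *' a = (1, 0)) by (revert N; unfold b; dred; intros N; apply deq; dred; field; auto).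
  assert (Nb : dnorm e b <> 0).
  { intros Q. assert (X : dnorm e (b *' a) = 1) by (rewrite Eb; dred; ring).
    assert (Y : dnorm e (b *' a) = dnorm e b * dnorm e a) by (dred; ring). rewrite Y, Q in X. lra. }
  assert (Da := dmul_diffeo a N).
  assert (Nbb : dnorm e (b *' b) <> 0).
  { replace (dnorm e (b *' b)) with (dnorm e b * dnorm e b) by (dred; ring). apply Rmult_integral_contrapositive; auto. }
  assert (Db := dmul_diffeo (b *' b) Nbb).
  assert (Ga : map_germ (fun p => a *' p)) by apply Da.
  exists (fun p => (b *' b) *' W (a *' p)). split.
  - apply (A_equivalent_trans _ (fun p => W (a *' p))); auto; [apply (A_equivalent_source W (fun p => a *' p)); auto|].
    apply (A_equivalent_target (fun p => W (a *' p)) (fun w => (b *' b) *' w)); auto.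
  - exists (fun p => b *' r (a *' p)), (fun p => (b *' b) *' m (a *' p)). split; [|split].
    + apply (dM_mul e 0 2); [apply dsm_const|]. apply (dM_comp 2 r (fun p => a *' p)); auto.
    + apply (dM_mul e 0 4); [apply dsm_const|]. apply (dM_comp 4 m (fun p => a *' p)); auto.
    + apply (near1 _ _ (near0_comp _ _ Ga E)). intros p ->. generalize (r (a *' p)), (m (a *' p)). intros x y.
      transitivity ((b *' a) *' (b *' a) *' (p *' p) +' (b *' a) *' (p *' (b *' x)) +' (b *' b *' (c *' (dconj a *' dconj a *' dconj a))) *' (dconj p *' dconj p *' dconj p) +' (b *' b) *' y).
      { replace (dconj (a *' p)) with (dconj a *' dconj p) by dring. ring. }
      replace (c *' (dconj a *' dconj a *' dconj a)) with (dopp (a *' a)) by (rewrite Ea; ring).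
      replace (b *' b *' dopp (a *' a)) with (dopp ((b *' a) *' (b *' a))) by ring. rewrite Eb.
      replace (-1, 0) with (dopp (1, 0)) by dring. ring.
Qed.

End Scaling.

(* In the coordinates x + y, x - y the equation reads p^2 = s q^3, q^2 = t p^3. *)
Lemma scale_split c : dnorm 1 c <> 0 -> exists a, dnorm 1 a <> 0 /\ dmul 1 a a = dmul 1 (dopp c) (dmul 1 (dmul 1 (dconj a) (dconj a)) (dconj a)).
Proof.
  intros N.
  set (s := - (fst c + snd c)). set (t := - (fst c - snd c)).
  assert (Nst : s * t <> 0). { intros Q. apply N. unfold dnorm. rewrite <- Q. unfold s, t. ring. }
  assert (Ns : s <> 0) by (intros Q; apply Nst; rewrite Q; ring).
  assert (Nt : t <> 0) by (intros Q; apply Nst; rewrite Q; ring).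
  assert (SG : forall x, x <> 0 -> exists g, g * g = 1 /\ g * Rabs x = x).
  { intros x Hx. destruct (Rcase_abs x).
    - exists (-1). rewrite Rabs_left; auto. split; ring.
    - exists 1. rewrite Rabs_right; auto. split; ring. }
  destruct (SG s Ns) as [g [g2 gs]]. destruct (SG t Nt) as [h [h2 ht]].
  set (S := ln (Rabs s)). set (T := ln (Rabs t)).
  assert (ES : exp S = Rabs s) by (apply exp_ln, Rabs_pos_lt; auto).
  assert (ET : exp T = Rabs t) by (apply exp_ln, Rabs_pos_lt; auto).
  (* In logarithms the equations for the absolute values read 2 p = S + 3 q and 2 q = T + 3 p,
     solved by p = -(2 S + 3 T) / 5 and q = -(2 T + 3 S) / 5. Squares being positive, x takes the
     sign of t and y that of s. *)
  set (P := exp (- (2 * S + 3 * T) / 5)). set (Q := exp (- (2 * T + 3 * S) / 5)).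
  assert (E1 : P * P = Rabs s * (Q * Q * Q)).
  { unfold P, Q. rewrite <- ES, <- !exp_plus. f_equal. field. }
  assert (E2 : Q * Q = Rabs t * (P * P * P)).
  { unfold P, Q. rewrite <- ET, <- !exp_plus. f_equal. field. }
  set (x := h * P). set (y := g * Q).
  assert (F1 : x * x = s * (y * y * y)).
  { unfold x, y. transitivity ((h * h) * (P * P)); [ring|]. rewrite h2, E1.
    transitivity ((g * g) * (g * g) * (Rabs s * (Q * Q * Q))); [rewrite g2; ring|].
    transitivity ((g * Rabs s) * (g * Q * (g * Q) * (g * Q))); [ring|rewrite gs; reflexivity]. }
  assert (F2 : y * y = t * (x * x * x)).
  { unfold x, y. transitivity ((g * g) * (Q * Q)); [ring|]. rewrite g2, E2.
    transitivity ((h * h) * (h * h) * (Rabs t * (P * P * P))); [rewrite h2; ring|].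
    transitivity ((h * Rabs t) * (h * P * (h * P) * (h * P))); [ring|rewrite ht; reflexivity]. }
  exists ((x + y) / 2, (x - y) / 2). split.
  - assert (PP : 0 < P) by apply exp_pos. assert (QP : 0 < Q) by apply exp_pos.
    replace (dnorm 1 ((x + y) / 2, (x - y) / 2)) with ((h * g) * (P * Q)) by (unfold dnorm, x, y; cbn [fst snd]; field).
    assert (G0 : g <> 0) by (intros Z; rewrite Z in g2; lra). assert (H0 : h <> 0) by (intros Z; rewrite Z in h2; lra).
    repeat apply Rmult_integral_contrapositive_currified; auto; lra.
  - apply deq; dred.
    + transitivity ((s * (y * y * y) + t * (x * x * x)) / 2); [rewrite <- F1, <- F2|unfold s, t]; field.
    + transitivity ((s * (y * y * y) - t * (x * x * x)) / 2); [rewrite <- F1, <- F2|unfold s, t]; field.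
Qed.

Lemma unit_circle_angle x y : x * x + y * y = 1 -> exists t, x = cos t /\ y = sin t.
Proof.
  intros H. assert (B : -1 <= x <= 1) by (split; nra).
  assert (S : sin (acos x) * sin (acos x) = y * y).
  { assert (Q := sin2_cos2 (acos x)). unfold Rsqr in Q. rewrite cos_acos in Q; lra. }
  assert (Q : (sin (acos x) - y) * (sin (acos x) + y) = 0) by (ring_simplify; lra).
  apply Rmult_integral in Q. destruct Q.
  - exists (acos x). rewrite cos_acos; auto. split; lra.
  - exists (- acos x). rewrite cos_neg, sin_neg, cos_acos; auto. split; lra.
Qed.

(** In polar form -c has modulus m and angle t. Then a has modulus 1 / m, and its angle w satisfies
    2 w = t - 3 w, that is w = t / 5. *)
Lemma scale_complex c : dnorm (-1) c <> 0 -> exists a, dnorm (-1) a <> 0 /\ dmul (-1) a a = dmul (-1) (dopp c) (dmul (-1) (dmul (-1) (dconj a) (dconj a)) (dconj a)).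
Proof.
  intros N.
  assert (N0 : 0 < dnorm (-1) c). { revert N. unfold dnorm. destruct c as [x y]. cbn [fst snd]. intros N. nra. }
  set (m := sqrt (dnorm (-1) c)).
  assert (Hm : 0 < m) by (apply sqrt_lt_R0; auto).
  assert (Hm2 : m * m = dnorm (-1) c) by (apply sqrt_sqrt; lra).
  destruct (unit_circle_angle (- fst c / m) (- snd c / m)) as [t [E1 E2]].
  { transitivity (dnorm (-1) c / (m * m)); [unfold dnorm; field; lra|]. rewrite Hm2. field. lra. }
  set (w := t / 5).
  assert (Et : t = w + w + w + w + w) by (unfold w; field).
  assert (C1 : - fst c = m * cos t) by (rewrite <- E1; field; lra).
  assert (C2 : - snd c = m * sin t) by (rewrite <- E2; field; lra).
  assert (CM : forall a b, dmul (-1) (cos a, sin a) (cos b, sin b) = (cos (a + b), sin (a + b))).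
  { intros a b. rewrite cos_plus, sin_plus. apply deq; dred; ring. }
  assert (CC : forall a, dconj (cos a, sin a) = (cos (- a), sin (- a))).
  { intros a. rewrite cos_neg, sin_neg. reflexivity. }
  exists (dmul (-1) (dre (/ m)) (cos w, sin w)). split.
  - replace (dnorm (-1) (dmul (-1) (dre (/ m)) (cos w, sin w))) with (/ m * / m).
    + apply Rmult_integral_contrapositive; split; apply Rinv_neq_0_compat; lra.
    + transitivity (/ m * / m * (Rsqr (sin w) + Rsqr (cos w))); [rewrite sin2_cos2; ring|]. unfold Rsqr. dred. ring.
  - assert (Ec : dopp c = dmul (-1) (dre m) (cos t, sin t)) by (apply deq; dred; rewrite ?C1, ?C2; ring).
    rewrite Ec.
    transitivity (dmul (-1) (dre (/ m * / m)) (dmul (-1) (cos w, sin w) (cos w, sin w))); [dring|].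
    transitivity (dmul (-1) (dre (m * (/ m * / m * / m))) (dmul (-1) (cos t, sin t) (dmul (-1) (dmul (-1) (dconj (cos w, sin w)) (dconj (cos w, sin w))) (dconj (cos w, sin w))))); [|dring].
    rewrite CC, !CM. f_equal; [f_equal; field; lra|]. rewrite Et. f_equal; f_equal; ring.
Qed.

Lemma nform_sufficient e f F G : e * e = 1 -> map_germ f -> has_jet f F G -> 0 < - e * jdisc F G ->
  cubic_generic F G -> A_equivalent f (nform e).
Proof.
  intros He Gf J Hd HG.
  destruct (diagonalize_source e f F G He Gf J Hd) as [f1 [F1 [G1 [Gf1 [Q1 [J1 [N1 [E1 E2]]]]]]]].
  destruct (normalize_target e f1 F1 G1 Gf1 J1 N1 E1 E2) as [W [x0 [x1 [x2 [x3 [y0 [y1 [y2 [y3 [GW [Q2 JW]]]]]]]]]]].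
  assert (Q : A_equivalent f W) by (apply (A_equivalent_trans f f1 W); auto).
  (* Genericity is carried from f to W along the inverse equivalence. *)
  destruct (A_equivalent_jet W f _ _ _ _ GW Gf JW J (A_equivalent_sym f W Gf GW Q)) as [_ HGW].
  assert (Nz := zbar3_unit e x0 x1 x2 x3 y0 y1 y2 y3 He (HGW HG)).
  assert (CF := cubic_form_of_jet e He W _ _ _ _ _ _ _ _ JW). revert Nz CF.
  generalize (zbar3 e (Cub 1 0 e x0 x1 x2 x3) (Cub 0 2 0 y0 y1 y2 y3)). intros c Nz CF.
  set (c8 := dmul e (dre (/ 8)) c) in *.
  assert (N8 : dnorm e c8 <> 0).
  { replace (dnorm e c8) with (/ 64 * dnorm e c) by (unfold c8; dred; field). apply Rmult_integral_contrapositive; split; auto; lra. }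
  assert (SC : exists a, dnorm e a <> 0 /\ dmul e a a = dmul e (dopp c8) (dmul e (dmul e (dconj a) (dconj a)) (dconj a))).
  { destruct (unit_cases e He) as [Ee|Ee]; rewrite Ee in *; [apply scale_split|apply scale_complex]; auto. }
  destruct SC as [a [Na Ea]].
  destruct (cubic_form_scale e c8 a W Na Ea CF) as [W' [Q3 CF']].
  apply (A_equivalent_trans f W); auto. apply (A_equivalent_trans W W'); auto.
  apply (cubic_form_nform e He W' CF').
Qed.

(** * The criterion *)

(** The Jacobian form is y^2 - e x^2, so a non-zero solution has both coordinates non-zero, while
    the determinant is x^4 y. *)
Lemma normal_form_generic e : e * e = 1 -> cubic_generic (Cub 0 1 0 0 0 0 0) (Cub e 0 1 1 0 0 0).
Proof.
  intros He x y N HJ HD.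
  assert (Z : (x * x * (x * x) * y)%C = RtoC 0).
  { rewrite <- HD. unfold qk_det, quad, cubic. cbn [qa qb qc k0 k1 k2 k3]. ring. }
  assert (Hec : Cmult (RtoC e) (RtoC e) = RtoC 1) by (rewrite <- RtoC_mult, He; reflexivity).
  assert (J : (y * y)%C = (RtoC e * (x * x))%C).
  { apply Ceq_0. rewrite <- HJ. unfold jform, jA, jB, jC. cbn [qa qb qc]. rewrite !RtoC_minus, !RtoC_mult. ring. }
  assert (SQ : forall a : C, (a * a)%C = RtoC 0 -> a = RtoC 0).
  { intros a Ha. destruct (Ceq_dec a 0) as [|Na]; auto. exfalso. apply (Cmult_neq_0 _ _ Na Na Ha). }
  assert (X0 : x = RtoC 0).
  { apply SQ. apply SQ. destruct (Ceq_dec y 0) as [Y0|Ny].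
    - transitivity (RtoC e * RtoC e * (x * x) * (x * x))%C; [rewrite Hec; ring|].
      transitivity (RtoC e * (x * x) * (RtoC e * (x * x)))%C; [ring|]. rewrite <- J, Y0. ring.
    - destruct (Ceq_dec (x * x * (x * x))%C 0) as [|Nx]; auto. exfalso. apply (Cmult_neq_0 _ _ Nx Ny Z). }
  apply N. split; auto. apply SQ. rewrite J, X0. ring.
Qed.

(** The model g meets the same sufficient conditions as f, so both are equivalent to [nform e] and
    hence to each other. For necessity f is compared with g, whose discriminant is -e. *)
Lemma normal_form_iff e g f F G : e * e = 1 -> map_germ g -> has_jet g (Cub 0 1 0 0 0 0 0) (Cub e 0 1 1 0 0 0) ->
  map_germ f -> has_jet f F G ->
  (A_equivalent f g <-> 0 < - e * jdisc F G /\ cubic_generic F G).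
Proof.
  intros He Gg Jg Gf Jf.
  assert (Hg := normal_form_generic e He).
  assert (Dg : jdisc (Cub 0 1 0 0 0 0 0) (Cub e 0 1 1 0 0 0) = - e).
  { unfold jdisc, jA, jB, jC. cbn [qa qb qc]. ring. }
  split.
  - intros H. destruct (A_equivalent_jet f g _ _ _ _ Gf Gg Jf Jg H) as [D T]. split; auto.
    rewrite Dg in D. destruct D as [D|[_ D]]; [lra|]. exfalso. assert (e = 0) by lra. subst e. lra.
  - intros [D T]. assert (E1 := nform_sufficient e f F G He Gf Jf D T).
    assert (E2 := nform_sufficient e g _ _ He Gg Jg ltac:(rewrite Dg; lra) Hg).
    apply (A_equivalent_trans f (nform e)); auto. apply A_equivalent_sym; auto. apply nform_germ.
Qed.

Lemma has_jet_germ g F G : jet1 (fun p => fst (g p)) 0 0 (qa F) (qb F) (qc F) (k0 F) (k1 F) (k2 F) (k3 F) ->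
  jet1 (fun p => snd (g p)) 0 0 (qa G) (qb G) (qc G) (k0 G) (k1 G) (k2 G) (k3 G) -> map_germ g /\ has_jet g F G.
Proof.
  intros J1 J2. split; [|split; auto].
  assert (T : forall h a b c x0 x1 x2 x3, jet1 h 0 0 a b c x0 x1 x2 x3 -> gs h /\ h origin = 0).
  { intros h a b c x0 x1 x2 x3 [r [Hr E]]. split.
    - apply (gs_ext (fun p => pol 0 0 0 a b c x0 x1 x2 x3 p + r p)); [apply (near1 _ _ E); auto|].
      apply gs_plus; [apply pol_gs|apply (M_gs _ _ Hr)].
    - rewrite (near_at0 _ E), (M_at0 _ _ Hr). unfold pol, origin. ring. }
  destruct (T _ _ _ _ _ _ _ _ J1). destruct (T _ _ _ _ _ _ _ _ J2).
  apply germ_gs. split; [|split]; auto. apply deq; auto.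
Qed.

Lemma pol_jet1 h l m a b c x0 x1 x2 x3 : (forall p, h p = pol 0 l m a b c x0 x1 x2 x3 p) -> jet1 h l m a b c x0 x1 x2 x3.
Proof. intros E. exists (fun _ => 0). split; [apply M_0|]. apply near_all. intros p. rewrite E. ring. Qed.

Lemma rank_zero_jet f : map_germ f -> has_rank (differential f origin) 0 -> exists F G, has_jet f F G.
Proof.
  intros Gf [b [Lb [_ Hb]]]. destruct b; [|discriminate].
  assert (Z : forall x, differential f origin x = origin).
  { intros x. destruct (proj1 (Hb _) (ex_intro _ x eq_refl)) as [c [_ E]].
    rewrite <- E. destruct c; reflexivity. }
  apply germ_gs in Gf. destruct Gf as [G1 [G2 G0]].
  assert (Z1 := Z (1, 0)). assert (Z2 := Z (0, 1)). unfold differential in Z1, Z2. cbn [fst snd] in Z1, Z2.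
  unfold origin at 5 in Z1. unfold origin at 5 in Z2. injection Z1 as A1 A2. injection Z2 as A3 A4.
  assert (M1 : M 2 (fun p => fst (f p))).
  { apply M_2_critical; auto; [rewrite G0; reflexivity| |].
    - refine (eq_trans _ A1). ring.
    - refine (eq_trans _ A3). ring. }
  assert (M2 : M 2 (fun p => snd (f p))).
  { apply M_2_critical; auto; [rewrite G0; reflexivity| |].
    - refine (eq_trans _ A2). ring.
    - refine (eq_trans _ A4). ring. }
  destruct (jet_of_M2 _ M1) as [a [b [c [x0 [x1 [x2 [x3 J1]]]]]]].
  destruct (jet_of_M2 _ M2) as [a' [b' [c' [y0 [y1 [y2 [y3 J2]]]]]]].
  exists (Cub a b c x0 x1 x2 x3), (Cub a' b' c' y0 y1 y2 y3). split; auto.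
Qed.

(** The Jacobian determinant vanishes to second order, so the factor g contributes only its value at
    the origin to the Hesse matrix. *)
Lemma identifier_hessian f F G lambda : has_jet f F G -> identifier f lambda -> exists r, r <> 0 /\
  h_uu lambda = 4 * r * jA F G /\ h_uv lambda = 4 * r * jB F G /\ h_vv lambda = 4 * r * jC F G.
Proof.
  intros [J1 J2] [g [Hg [Ng E]]]. apply gs_smooth in Hg.
  destruct (det_jac_jet f _ _ _ _ _ _ _ _ _ _ _ _ _ _ J1 J2) as [r [Hr EJ]].
  fold (jA F G) (jB F G) (jC F G) in EJ.
  exists (g origin). split; [apply (near_at0 _ Ng)|].
  destruct (M_expand0 g Hg) as [k [s [Hs Es]]].
  assert (Ek : g origin = k) by (rewrite (near_at0 _ Es), (M_at0 0 _ Hs); ring). rewrite Ek.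
  set (q := fun p => 2 * jA F G * (fst p * fst p) + 4 * jB F G * (fst p * snd p) + 2 * jC F G * (snd p * snd p)).
  destruct (hess_quad lambda (k * (2 * jA F G)) (k * (4 * jB F G)) (k * (2 * jC F G)) (fun p => s p * q p + r p * g p)) as [A [B C]].
  - apply M_plus; [apply (M_mult 1 2); auto; apply M_quad|apply M_mul_gs; auto].
  - apply (near3 _ _ _ _ E EJ Es). intros [u v] -> -> Es'. rewrite Es'. unfold q, pol. cbn [fst snd]. ring.
  - rewrite A, B, C. repeat split; ring.
Qed.

(** The order n of the remainder is tracked because each derivation along a field lowers it by one;
    three derivations of a 3-jet end with the value at the origin. *)
Definition rjet (n : nat) (h : R * R -> R) (k l m a b c : R) : Prop :=
  exists r, M n r /\ near0 (fun p => h p = pol k l m a b c 0 0 0 0 p + r p).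

Lemma rjet_eq n h k l m a b c k' l' m' a' b' c' : rjet n h k l m a b c ->
  k = k' -> l = l' -> m = m' -> a = a' -> b = b' -> c = c' -> rjet n h k' l' m' a' b' c'.
Proof. intros; subst; auto. Qed.

Lemma rjet_add n h h' k l m a b c k' l' m' a' b' c' : rjet n h k l m a b c -> rjet n h' k' l' m' a' b' c' ->
  rjet n (fun p => h p + h' p) (k + k') (l + l') (m + m') (a + a') (b + b') (c + c').
Proof.
  intros [r [Hr E]] [s [Hs F]]. exists (fun p => r p + s p). split; [apply M_plus; auto|].
  apply (near2 _ _ _ E F). intros [u v] -> ->. unfold pol. ring.
Qed.

Lemma rjet_sub n h h' k l m a b c k' l' m' a' b' c' : rjet n h k l m a b c -> rjet n h' k' l' m' a' b' c' ->
  rjet n (fun p => h p - h' p) (k - k') (l - l') (m - m') (a - a') (b - b') (c - c').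
Proof.
  intros [r [Hr E]] [s [Hs F]]. exists (fun p => r p - s p). split; [apply M_minus; auto|].
  apply (near2 _ _ _ E F). intros [u v] -> ->. unfold pol. ring.
Qed.

Lemma rjet_mul2 h h' k l m k' l' m' : rjet 2 h k l m 0 0 0 -> rjet 2 h' k' l' m' 0 0 0 ->
  rjet 2 (fun p => h p * h' p) (k * k') (k * l' + l * k') (k * m' + m * k') 0 0 0.
Proof.
  intros [r [Hr E]] [s [Hs F]]. assert (Gr := M_gs _ _ Hr). assert (Gs := M_gs _ _ Hs).
  exists (fun p => r p * (k' + l' * fst p + m' * snd p + s p) + s p * (k + l * fst p + m * snd p)
    + (l * fst p + m * snd p) * (l' * fst p + m' * snd p)). split.
  - apply M_plus; [apply M_plus; apply M_mul_gs; auto; gsm|]. apply (M_mult 1 1); apply M_lin.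
  - apply (near2 _ _ _ E F). intros [u v] -> ->. unfold pol. cbn [fst snd]. ring.
Qed.

Lemma rjet_mul3 h h' k l m l' m' a' b' c' : rjet 2 h k l m 0 0 0 -> rjet 3 h' 0 l' m' a' b' c' ->
  rjet 3 (fun p => h p * h' p) 0 (k * l') (k * m') (k * a' + l * l') (k * b' + l * m' + m * l') (k * c' + m * m').
Proof.
  intros [r [Hr E]] [s [Hs F]]. assert (Gr := M_gs _ _ Hr). assert (Gs := M_gs _ _ Hs).
  set (q1 := fun p => l' * fst p + m' * snd p).
  set (q2 := fun p => a' * (fst p * fst p) + b' * (fst p * snd p) + c' * (snd p * snd p)).
  assert (M1 : M 1 q1) by apply M_lin. assert (M2 : M 2 q2) by apply M_quad.
  exists (fun p => s p * (k + l * fst p + m * snd p + r p) + r p * q1 p + r p * q2 p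
    + (l * fst p + m * snd p) * q2 p). split.
  - apply M_plus; [apply M_plus; [apply M_plus|]|].
    + apply M_mul_gs; auto; gsm.
    + apply (M_mult 2 1); auto.
    + apply M_S, (M_mult 2 2); auto.
    + apply (M_mult 1 2); auto. apply M_lin.
  - apply (near2 _ _ _ E F). intros [u v] -> ->. unfold q1, q2, pol. cbn [fst snd]. ring.
Qed.

Lemma rjet_du n h k l m a b c : rjet (S n) h k l m a b c -> rjet n (du h) l (2 * a) b 0 0 0.
Proof.
  intros [r [Hr E]]. destruct (du_jet n _ _ _ _ _ _ _ _ _ _ _ _ Hr E) as [s [Hs F]]. exists s. split; auto.
  apply (near1 _ _ F). intros [u v] ->. unfold pol. ring.
Qed.
Lemma rjet_dv n h k l m a b c : rjet (S n) h k l m a b c -> rjet n (dv h) m b (2 * c) 0 0 0.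
Proof.
  intros [r [Hr E]]. destruct (dv_jet n _ _ _ _ _ _ _ _ _ _ _ _ Hr E) as [s [Hs F]]. exists s. split; auto.
  apply (near1 _ _ F). intros [u v] ->. unfold pol. ring.
Qed.

Lemma rjet_at0 n h k l m a b c : rjet (S n) h k l m a b c -> h origin = k.
Proof. intros [r [Hr E]]. rewrite (near_at0 _ E), (M_at0 _ _ Hr). unfold pol, origin. ring. Qed.

Definition cjet (n : nat) (h : R * R -> C) (k l m a b c : C) : Prop :=
  rjet n (fun p => Re (h p)) (Re k) (Re l) (Re m) (Re a) (Re b) (Re c) /\
  rjet n (fun p => Im (h p)) (Im k) (Im l) (Im m) (Im a) (Im b) (Im c).

Open Scope C_scope.

Lemma cjet_add n h h' k l m a b c k' l' m' a' b' c' : cjet n h k l m a b c -> cjet n h' k' l' m' a' b' c' ->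
  cjet n (fun p => h p + h' p) (k + k') (l + l') (m + m') (a + a') (b + b') (c + c').
Proof. intros [A B] [A' B']. split; [apply (rjet_add n (fun p => Re (h p)) (fun p => Re (h' p)))|apply (rjet_add n (fun p => Im (h p)) (fun p => Im (h' p)))]; auto. Qed.

Lemma cjet_mul2 h h' k l m k' l' m' : cjet 2 h k l m 0 0 0 -> cjet 2 h' k' l' m' 0 0 0 ->
  cjet 2 (fun p => h p * h' p) (k * k') (k * l' + l * k') (k * m' + m * k') 0 0 0.
Proof.
  intros [A B] [A' B']. split.
  - refine (rjet_eq _ _ _ _ _ _ _ _ _ _ _ _ _ _ (rjet_sub 2 _ _ _ _ _ _ _ _ _ _ _ _ _ _ (rjet_mul2 _ _ _ _ _ _ _ _ A A') (rjet_mul2 _ _ _ _ _ _ _ _ B B')) _ _ _ _ _ _); unfold Re, Im; cbn; ring.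
  - refine (rjet_eq _ _ _ _ _ _ _ _ _ _ _ _ _ _ (rjet_add 2 _ _ _ _ _ _ _ _ _ _ _ _ _ _ (rjet_mul2 _ _ _ _ _ _ _ _ A B') (rjet_mul2 _ _ _ _ _ _ _ _ B A')) _ _ _ _ _ _); unfold Re, Im; cbn; ring.
Qed.

Lemma cjet_mul3 h h' k l m l' m' a' b' c' : cjet 2 h k l m 0 0 0 -> cjet 3 h' 0 l' m' a' b' c' ->
  cjet 3 (fun p => h p * h' p) 0 (k * l') (k * m') (k * a' + l * l') (k * b' + l * m' + m * l') (k * c' + m * m').
Proof.
  intros [A B] [A' B']. split.
  - refine (rjet_eq _ _ _ _ _ _ _ _ _ _ _ _ _ _ (rjet_sub 3 _ _ _ _ _ _ _ _ _ _ _ _ _ _ (rjet_mul3 _ _ _ _ _ _ _ _ _ _ A A') (rjet_mul3 _ _ _ _ _ _ _ _ _ _ B B')) _ _ _ _ _ _); unfold Re, Im; cbn; ring.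
  - refine (rjet_eq _ _ _ _ _ _ _ _ _ _ _ _ _ _ (rjet_add 3 _ _ _ _ _ _ _ _ _ _ _ _ _ _ (rjet_mul3 _ _ _ _ _ _ _ _ _ _ A B') (rjet_mul3 _ _ _ _ _ _ _ _ _ _ B A')) _ _ _ _ _ _); unfold Re, Im; cbn; ring.
Qed.

Lemma cjet_du n h k l m a b c : cjet (S n) h k l m a b c -> cjet n (cdu h) l (2 * a) b 0 0 0.
Proof.
  intros [A B]. split.
  - refine (rjet_eq _ _ _ _ _ _ _ _ _ _ _ _ _ _ (rjet_du n _ _ _ _ _ _ _ A) _ _ _ _ _ _); unfold Re, Im; cbn; ring.
  - refine (rjet_eq _ _ _ _ _ _ _ _ _ _ _ _ _ _ (rjet_du n _ _ _ _ _ _ _ B) _ _ _ _ _ _); unfold Re, Im; cbn; ring.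
Qed.
Lemma cjet_dv n h k l m a b c : cjet (S n) h k l m a b c -> cjet n (cdv h) m b (2 * c) 0 0 0.
Proof.
  intros [A B]. split.
  - refine (rjet_eq _ _ _ _ _ _ _ _ _ _ _ _ _ _ (rjet_dv n _ _ _ _ _ _ _ A) _ _ _ _ _ _); unfold Re, Im; cbn; ring.
  - refine (rjet_eq _ _ _ _ _ _ _ _ _ _ _ _ _ _ (rjet_dv n _ _ _ _ _ _ _ B) _ _ _ _ _ _); unfold Re, Im; cbn; ring.
Qed.

Lemma cjet_at0 n h k l m a b c : cjet (S n) h k l m a b c -> h origin = k.
Proof. intros [A B]. apply injective_projections; [apply (rjet_at0 _ _ _ _ _ _ _ _ A)|apply (rjet_at0 _ _ _ _ _ _ _ _ B)]. Qed.

Lemma cjet_smooth xi : csmooth xi -> exists a b, cjet 2 xi (xi origin) a b 0 0 0.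
Proof.
  intros [S1 S2]. apply gs_smooth in S1, S2.
  assert (T : forall h, gs h -> exists l m, rjet 2 h (h origin) l m 0 0 0).
  { intros h Hh. destruct (M_expand1 (fun p => h p - h origin)%R) as [l [m [r [Hr E]]]].
    { apply M_1. split; [gsm|ring]. }
    exists l, m, r. split; auto. apply (near1 _ _ E). intros [u v] H. unfold pol. cbn [fst snd] in H. lra. }
  destruct (T _ S1) as [l [m A]]. destruct (T _ S2) as [l' [m' B]].
  exists (l, l'), (m, m'). split; auto.
Qed.

Lemma jet1_cdu h a b c x0 x1 x2 x3 : jet1 h 0 0 a b c x0 x1 x2 x3 ->
  cjet 3 (cdu (fun p => RtoC (h p))) 0 (RtoC (2 * a)) (RtoC b) (RtoC (3 * x0)) (RtoC (2 * x1)) (RtoC x2) /\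
  cjet 3 (cdv (fun p => RtoC (h p))) 0 (RtoC b) (RtoC (2 * c)) (RtoC x1) (RtoC (2 * x2)) (RtoC (3 * x3)).
Proof.
  intros [r [Hr E]].
  destruct (du_jet 3 _ _ _ _ _ _ _ _ _ _ _ _ Hr E) as [r1 [R1 E1]].
  destruct (dv_jet 3 _ _ _ _ _ _ _ _ _ _ _ _ Hr E) as [r2 [R2 E2]].
  assert (Z1 : forall p, du (fun _ => 0%R) p = 0%R) by (intros p; apply (Derive_const 0 (fst p))).
  assert (Z2 : forall p, dv (fun _ => 0%R) p = 0%R) by (intros p; apply (Derive_const 0 (snd p))).
  split; split.
  - exists r1. split; auto.
  - exists (fun _ => 0%R). split; [apply M_0|]. apply near_all. intros p. refine (eq_trans (Z1 p) _). destruct p. unfold pol; cbn. ring.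
  - exists r2. split; auto.
  - exists (fun _ => 0%R). split; [apply M_0|]. apply near_all. intros p. refine (eq_trans (Z2 p) _). destruct p. unfold pol; cbn. ring.
Qed.

(* z is the second derivative of an integral curve of (xi1, xi2) at the origin. *)
Lemma iterated_derivatives xi1 xi2 : csmooth xi1 -> csmooth xi2 ->
  let x := xi1 origin in let y := xi2 origin in
  let d (h : R * R -> C) := fun p => xi1 p * cdu h p + xi2 p * cdv h p in
  exists z1 z2, forall h H, jet1 h 0 0 (qa H) (qb H) (qc H) (k0 H) (k1 H) (k2 H) (k3 H) ->
    d (d (fun p => RtoC (h p))) origin = 2 * quad H x y /\
    d (d (d (fun p => RtoC (h p)))) origin = 6 * cubic H x y
      + 3 * (2 * qa H * x * z1 + qb H * (x * z2 + y * z1) + 2 * qc H * y * z2).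
Proof.
  intros S1 S2 x y d.
  destruct (cjet_smooth xi1 S1) as [a1 [b1 J1]]. destruct (cjet_smooth xi2 S2) as [a2 [b2 J2]].
  fold x in J1. fold y in J2.
  exists (x * a1 + y * b1), (x * a2 + y * b2). intros h H Jh.
  destruct (jet1_cdu _ _ _ _ _ _ _ _ Jh) as [U V].
  assert (D1 := cjet_add _ _ _ _ _ _ _ _ _ _ _ _ _ _ _ (cjet_mul3 _ _ _ _ _ _ _ _ _ _ J1 U) (cjet_mul3 _ _ _ _ _ _ _ _ _ _ J2 V)).
  assert (D1u := cjet_du 2 _ _ _ _ _ _ _ D1). assert (D1v := cjet_dv 2 _ _ _ _ _ _ _ D1).
  assert (D2 := cjet_add _ _ _ _ _ _ _ _ _ _ _ _ _ _ _ (cjet_mul2 _ _ _ _ _ _ _ _ J1 D1u) (cjet_mul2 _ _ _ _ _ _ _ _ J2 D1v)).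
  assert (D2u := cjet_du 1 _ _ _ _ _ _ _ D2). assert (D2v := cjet_dv 1 _ _ _ _ _ _ _ D2).
  split.
  - refine (eq_trans (cjet_at0 1 _ _ _ _ _ _ _ D2) _). rewrite !RtoC_mult. unfold quad. ring.
  - unfold d at 1. fold x y.
    refine (eq_trans (f_equal2 Cplus (f_equal (Cmult x) (cjet_at0 0 _ _ _ _ _ _ _ D2u)) (f_equal (Cmult y) (cjet_at0 0 _ _ _ _ _ _ _ D2v))) _).
    rewrite !RtoC_mult. unfold cubic. ring.
Qed.

(** The second derivative of f is 2 Q (w), the third is 6 K (w) plus 3 times a polar term of Q
    containing the derivatives of the field. At a zero w of the Jacobian form [polar_det] removes
    that term, so only the value of the field at the origin matters. *)
Lemma det23_qk_det f F G eta : has_jet f F G -> vector_field eta ->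
  jform F G (fst (eta origin)) (snd (eta origin)) = 0 ->
  det23 f eta = 12 * qk_det F G (fst (eta origin)) (snd (eta origin)).
Proof.
  intros [J1 J2] [S1 S2] HJ.
  destruct (iterated_derivatives _ _ S1 S2) as [z1 [z2 T]].
  destruct (T _ _ J1) as [A1 A2]. destruct (T _ _ J2) as [B1 B2]. clear T.
  set (x := fst (eta origin)) in *. set (y := snd (eta origin)) in *.
  assert (PD := polar_det (qa F) (qb F) (qc F) (qa G) (qb G) (qc G) x y z1 z2).
  fold (quad F x y) (quad G x y) in PD.
  assert (PD' : quad F x y * (2 * qa G * x * z1 + qb G * (x * z2 + y * z1) + 2 * qc G * y * z2) = quad G x y * (2 * qa F * x * z1 + qb F * (x * z2 + y * z1) + 2 * qc F * y * z2)).
  { apply PD. rewrite <- HJ. unfold jform, jA, jB, jC. rewrite !RtoC_minus, !RtoC_mult. ring. }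
  unfold det23, cdet.
  refine (eq_trans (f_equal2 Cminus (f_equal2 Cmult A1 B2) (f_equal2 Cmult B1 A2)) _).
  transitivity (12 * (quad F x y * cubic G x y - quad G x y * cubic F x y) + 6 * (quad F x y * (2 * qa G * x * z1 + qb G * (x * z2 + y * z1) + 2 * qc G * y * z2) - quad G x y * (2 * qa F * x * z1 + qb F * (x * z2 + y * z1) + 2 * qc F * y * z2))).
  - ring.
  - rewrite PD'. unfold qk_det. ring.
Qed.

(** If the determinant vanished, (y2, -y1) and (-x2, x1) would be coefficients of linear relations,
    so all entries would be zero; then (1, 0) would be a relation too. *)
Lemma lin_indep_det (a b : C * C) : lin_indep (K := C_Ring) [a; b] -> fst a * snd b - fst b * snd a <> 0.
Proof.
  destruct a as [x1 y1], b as [x2 y2]. cbn [fst snd]. intros H D.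
  assert (T : forall s t : C, s * x1 + t * x2 = 0 -> s * y1 + t * y2 = 0 -> s = 0 /\ t = 0).
  { intros s t E1 E2. assert (Q := H [s; t] eq_refl).
    assert (Z : lin_comb (K := C_Ring) [s; t] [(x1, y1); (x2, y2)] = zero).
    { unfold lin_comb. cbn [combine map fold_right fst snd].
      change ((s * x1 + (t * x2 + 0), s * y1 + (t * y2 + 0)) = (RtoC 0, RtoC 0)). f_equal.
      - transitivity (s * x1 + t * x2); [ring|exact E1].
      - transitivity (s * y1 + t * y2); [ring|exact E2]. }
    specialize (Q Z). inversion Q as [|? ? Hs Q1]. inversion Q1 as [|? ? Ht Q2]. subst. split; reflexivity. }
  destruct (T y2 (- y1)) as [Y2 Y1]; [refine (eq_trans _ D); ring|ring|].
  destruct (T (- x2) x1) as [X2 X1]; [ring|refine (eq_trans _ D); ring|].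
  destruct (T 1 0) as [Q _].
  - rewrite X1. ring.
  - transitivity (- (- y1)); [ring|]. rewrite Y1. ring.
  - apply RtoC_inj in Q. lra.
Qed.

(** In the basis of the two given solutions the form is 2 s t b, where b is non-zero by the Gram
    identity b^2 = -jdisc D^2. Every solution is thus a multiple of one of the two, and the
    determinant is homogeneous of degree five. *)
Lemma cubic_generic_pair F G x1 y1 x2 y2 : jdisc F G <> 0%R -> x1 * y2 - x2 * y1 <> 0 ->
  jform F G x1 y1 = 0 -> jform F G x2 y2 = 0 ->
  qk_det F G x1 y1 <> 0 -> qk_det F G x2 y2 <> 0 -> cubic_generic F G.
Proof.
  intros Hd HD H1 H2 Q1 Q2 x y N HJ.
  set (D := x1 * y2 - x2 * y1) in *.
  set (s := (x * y2 - x2 * y) / D). set (t := (x1 * y - x * y1) / D).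
  assert (Ex : x = s * x1 + t * x2) by (unfold s, t, D; field; auto).
  assert (Ey : y = s * y1 + t * y2) by (unfold s, t, D; field; auto).
  clearbody s t. subst x y.
  set (b := jA F G * (x1 * x2) + jB F G * (x1 * y2 + x2 * y1) + jC F G * (y1 * y2)).
  assert (Eb : b * b = jform F G x1 y1 * jform F G x2 y2 - jdisc F G * (D * D)).
  { unfold b, D, jform, jdisc. rewrite RtoC_minus, !RtoC_mult. ring. }
  assert (Nb : b <> 0).
  { intros Z. rewrite Z, H1 in Eb.
    assert (Hdc : RtoC (jdisc F G) <> 0) by (intros Q; apply RtoC_inj in Q; auto).
    apply (Cmult_neq_0 _ _ Hdc (Cmult_neq_0 _ _ HD HD)).
    transitivity (0 * jform F G x2 y2 - (0 * jform F G x2 y2 - jdisc F G * (D * D))); [ring|]. rewrite <- Eb. ring. }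
  assert (ST : s * t = 0).
  { destruct (Ceq_dec (s * t) 0) as [|Nst]; auto. exfalso. apply (Cmult_neq_0 _ _ Nst Nb).
    transitivity ((jform F G (s * x1 + t * x2) (s * y1 + t * y2) - s * s * jform F G x1 y1 - t * t * jform F G x2 y2) / 2).
    - unfold b, jform. field.
    - rewrite HJ, H1, H2. field. }
  destruct (Ceq_dec s 0) as [S0|Ns].
  - subst s. assert (Nt : t <> 0) by (intros Z; apply N; subst t; split; ring).
    replace (qk_det F G (0 * x1 + t * x2) (0 * y1 + t * y2)) with (t * t * t * t * t * qk_det F G x2 y2) by (unfold qk_det, quad, cubic; ring).
    repeat apply Cmult_neq_0; auto.
  - assert (T0 : t = 0).
    { destruct (Ceq_dec t 0) as [|Nt]; auto. exfalso. apply (Cmult_neq_0 _ _ Ns Nt ST). }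
    subst t.
    replace (qk_det F G (s * x1 + 0 * x2) (s * y1 + 0 * y2)) with (s * s * s * s * s * qk_det F G x1 y1) by (unfold qk_det, quad, cubic; ring).
    repeat apply Cmult_neq_0; auto.
Qed.

Open Scope R_scope.

Theorem theorem1 (f : R * R -> R * R) (lambda : R * R -> R)
    (eta1 eta2 : R * R -> C * C)
    (Hf : map_germ f)
    (Hrank : has_rank (differential f origin) 0)
    (Hlambda : identifier f lambda)
    (Hcrit : nondegenerate_critical lambda)
    (Heta : hesse_fields lambda eta1 eta2) :
  (sharksfin f <->
     det_hess lambda < 0 /\ det23 f eta1 <> RtoC 0 /\ det23 f eta2 <> RtoC 0) /\
  (deltoid f <->
     det_hess lambda > 0 /\ det23 f eta1 <> RtoC 0 /\ det23 f eta2 <> RtoC 0).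
Proof.
  destruct (rank_zero_jet f Hf Hrank) as [F [G J]].
  destruct (identifier_hessian f F G lambda J Hlambda) as [r [Hr [Euu [Euv Evv]]]].
  destruct Hcrit as [_ [_ Hdet]]. destruct Heta as [E1 [E2 [S1 [S2 LI]]]].
  assert (ED : det_hess lambda = 16 * (r * r) * jdisc F G).
  { unfold det_hess, jdisc. rewrite Euu, Euv, Evv. ring. }
  assert (Hrr : 0 < r * r) by (apply Rlt_0_sqr; auto).
  (* Non-degeneracy leaves two possible signs of the Hesse determinant, and [hesse_fields] provides
     smoothness for each. *)
  assert (V : vector_field eta1 /\ vector_field eta2).
  { destruct (Rtotal_order (det_hess lambda) 0) as [L|[L|L]].
    - destruct (E1 L) as [[A _] [B _]]. auto.
    - contradiction.
    - apply E2, L. }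
  destruct V as [V1 V2].
  (* The Hesse quadric is 4 r times the Jacobian form. *)
  assert (HS : forall w, hesse_solution lambda w -> ~ (fst w = RtoC 0 /\ snd w = RtoC 0) /\ jform F G (fst w) (snd w) = RtoC 0).
  { intros [x y] [N H]. cbn [fst snd]. split.
    - intros [-> ->]. apply N. reflexivity.
    - rewrite Euu, Euv, Evv, !RtoC_mult in H.
      assert (Hrc : RtoC r <> RtoC 0) by (intros Q; apply RtoC_inj in Q; auto).
      assert (H4 : RtoC 4 <> RtoC 0) by (intros Q; apply RtoC_inj in Q; lra).
      destruct (Ceq_dec (jform F G x y) 0) as [|Nj]; auto. exfalso.
      apply (Cmult_neq_0 _ _ (Cmult_neq_0 _ _ H4 Hrc) Nj). rewrite <- H. unfold jform. ring. }
  destruct (HS _ S1) as [N1 J1]. destruct (HS _ S2) as [N2 J2].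
  assert (GEN : cubic_generic F G <-> det23 f eta1 <> RtoC 0 /\ det23 f eta2 <> RtoC 0).
  { rewrite (det23_qk_det f F G eta1 J V1 J1), (det23_qk_det f F G eta2 J V2 J2).
    assert (H12 : RtoC 12 <> RtoC 0) by (intros Q; apply RtoC_inj in Q; lra).
    split.
    - intros HG. split; apply Cmult_neq_0; auto.
    - intros [Q1 Q2]. apply (cubic_generic_pair F G _ _ _ _) with (3 := J1) (4 := J2).
      + intros Z. apply Hdet. rewrite ED, Z. ring.
      + apply lin_indep_det, LI.
      + intros Z. apply Q1. rewrite Z. ring.
      + intros Z. apply Q2. rewrite Z. ring. }
  rewrite <- GEN. unfold sharksfin, deltoid. split.
  - destruct (has_jet_germ (fun p => let (u, v) := p in (u * v, u ^ 2 + v ^ 2 + u ^ 3)) (Cub 0 1 0 0 0 0 0) (Cub 1 0 1 1 0 0 0)) as [Gg Jg].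
    { apply pol_jet1. intros [u v]. unfold pol. cbn. ring. }
    { apply pol_jet1. intros [u v]. unfold pol. cbn. ring. }
    rewrite (normal_form_iff 1 _ f F G ltac:(ring) Gg Jg Hf J).
    (* [det_hess] is the positive multiple 16 r^2 of [jdisc], so the two have the same sign. *)
    assert (0 < - (1) * jdisc F G <-> det_hess lambda < 0) by (rewrite ED; split; intros; nra). tauto.
  - destruct (has_jet_germ (fun p => let (u, v) := p in (u * v, - (u ^ 2) + v ^ 2 + u ^ 3)) (Cub 0 1 0 0 0 0 0) (Cub (-1) 0 1 1 0 0 0)) as [Gg Jg].
    { apply pol_jet1. intros [u v]. unfold pol. cbn. ring. }
    { apply pol_jet1. intros [u v]. unfold pol. cbn. ring. }
    rewrite (normal_form_iff (-1) _ f F G ltac:(ring) Gg Jg Hf J).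
    assert (0 < - (-1) * jdisc F G <-> det_hess lambda > 0) by (rewrite ED; split; intros; nra). tauto.
Qed.
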